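(* Let $(X,\mathcal{X},\nu,\mathbf{d},\gamma)$, the Poisson random measure $N$ on $(\Omega,\mathcal{A},\mathbb{P})$, the gradient $\flat$ with values in $L^2(R,\mathcal{R},\rho)$, the marked random measure $N\odot\rho$, the map $\varepsilon^+$, the up-structure $(\Omega,\mathcal{A},\mathbb{P},\mathbb{D},\Gamma)$ with its gradient $\sharp$, and the space $\underline{\mathbb{D}}$ be as defined in the context. Let $L^2_0(\mathbb{P}_N\times\rho)$ be the closed subspace of $L^2(\mathbb{P}_N\times\rho)$ of the elements $K$ with $\int K(\omega,x,r)\,\rho(dr)=0$ for $\mathbb{P}_N$-a.e. $(\omega,x)$. Then for every $F\in\mathbb{D}$ the formula $$F^\sharp=\int(\varepsilon^+F)^\flat\,d(N\odot\rho)$$ holds, and it decomposes as $$F\in\mathbb{D}\ \stackrel{\varepsilon^+}{\longmapsto}\ \varepsilon^+F\in\underline{\mathbb{D}}\ \stackrel{\flat}{\longmapsto}\ (\varepsilon^+F)^\flat\in L^2_0(\mathbb{P}_N\times\rho)\ \stackrel{d(N\odot\rho)}{\longmapsto}\ F^\sharp\in L^2(\mathbb{P}\times\hat{\mathbb{P}}),$$ where each operator is continuous on the range of the preceding one. Moreover, for every $F\in\mathbb{D}$, $$\Gamma[F]=\hat{\mathbb{E}}|F^\sharp|^2=\int\gamma[\varepsilon^+F]\,dN\qquad\mathbb{P}\text{-a.s.}$$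
   Context: **Bottom space.** $(X,\mathcal{X},\nu,\mathbf{d},\gamma)$ is a local Dirichlet structure with carré du champ: $(X,\mathcal{X},\nu)$ is a $\sigma$-finite measured space, singletons belong to $\mathcal{X}$, $\nu$ is diffuse, $\mathbf{d}\subset L^2(\nu)$ is the domain of a local Dirichlet form $\epsilon[u]=\frac12\int\gamma[u]\,d\nu$ with carré du champ operator $\gamma$ (write $\gamma[u,v]$ for the associated bilinear map and $\gamma[u]=\gamma[u,u]$), and $(a,\mathcal{D}(a))$ is its generator in $L^2(\nu)$. Assume $\mathbf{d}$ is separable, $1\in\mathbf{d}_{loc}$ and $\gamma[1]=0$. $(R,\mathcal{R},\rho)$ is a probability space and $\flat$ is a gradient for this structure with values in $L^2(R,\mathcal{R},\rho)$: a linear map $u\mapsto u^\flat$ from $\mathbf{d}$ to $L^2(\nu\times\rho)$ satisfying the chain rule, $\gamma[u]=\int(u^\flat)^2d\rho$, $\int u^\flat d\rho=0$ $\nu$-a.e. for all $u\in\mathbf{d}$, and $1^\flat=0$. All these objects are extended to complex-valued functions ($\flat$ complex linear, $\gamma$ hermitian, $\gamma[u]=\int|u^\flat|^2d\rho$). **Up-space.** $\Omega$ is the configuration space of countable sums of Dirac masses on $X$, $N$ is the Poisson random measure on $X$ with intensity $\nu$, $\mathcal{A}$ is the $\sigma$-field generated by $N$ and $\mathbb{P}$ its law on $\Omega$. $N(f)=\int f\,dN$, $\tilde N=N-\nu$, and $\tilde N(f)$ is defined for $f\in L^2(\nu)$ by the isometry $\mathbb{E}(\tilde N(f))^2=\int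 f^2d\nu$. $\mathbb{P}_N$ is the measure $\mathbb{P}(d\omega)N_\omega(dx)$ on $(\Omega\times X,\mathcal{A}\times\mathcal{X})$. **Marked measure.** $N\odot\rho$ is the Poisson random measure on $X\times R$ with intensity $\nu\times\rho$ obtained by attaching to the atoms $x_n$ of $N$ i.i.d. marks $r_n$ of law $\rho$, independent of $N$: $N\odot\rho=\sum_n\varepsilon_{(x_n,r_n)}$, with $\varepsilon_z$ the Dirac mass at $z$. $(\hat\Omega,\hat{\mathcal{A}},\hat{\mathbb{P}})$ is the product of the copies of $(R,\mathcal{R},\rho)$ carrying the marks, with expectation $\hat{\mathbb{E}}$; $N\odot\rho$ lives on $(\Omega\times\hat\Omega,\mathbb{P}\times\hat{\mathbb{P}})$. For $K\in L^2_0(\mathbb{P}_N\times\rho)$, $\int K\,d(N\odot\rho)\in L^2(\mathbb{P}\times\hat{\mathbb{P}})$ is the (extension by $L^2$-continuity of the) sum $\sum_nK(\omega,x_n,r_n)$, and $\hat{\mathbb{E}}|\int K\,d(N\odot\rho)|^2=\int|K|^2dN\,d\rho$ $\mathbb{P}$-a.s. **Creation operator.** $\varepsilon^+_x(\omega)=\omega$ if $x\in\mathrm{supp}(\omega)$, and $\varepsilon^+_x(\omega)=\omega+\varepsilon_x$ if $x\notin\mathrm{supp}(\omega)$. For $F$ on $\Omega$, $(\varepsilon^+F)(\omega,x)=F(\varepsilon^+_x(\omega))$; for $H$ on $\Omega\times X$ (or $\Omega\times X\times R$), $(\varepsilon^+H)(\omega,x,\cdot)=H(\varepsilon^+_x(\omega),x,\cdot)$.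 For measurable $H\ge0$, $\mathbb{E}\int\varepsilon^+H\,d\nu=\mathbb{E}\int H\,dN$. Hence $\varepsilon^+$ identifies $\mathbb{P}_N$-classes with $\mathbb{P}\times\nu$-classes, and $F\mapsto\varepsilon^+F$ is well defined from $\mathbb{P}$-classes to $\mathbb{P}\times\nu$-classes. **Convention on integration against $N$.** The operations $\flat$ and $\gamma$ are applied in the variable $x$, with $\omega$ fixed, to functions $H(\omega,x)$ defined $\mathbb{P}\times\nu$-a.e. Integrals with respect to $N$ or $N\odot\rho$ do not distinguish $\varepsilon^+_x(\omega)$ from $\omega$: a function $K$ defined $\mathbb{P}\times\nu$-a.e. (possibly depending also on $r$) is written uniquely as $K=\varepsilon^+K'$ with $K'$ defined $\mathbb{P}_N$-a.e., and $\int K\,dN$, $\int K\,d(N\odot\rho)$, and ''$K\in L^2(\mathbb{P}_N\times\rho)$'' mean $\int K'\,dN$, $\int K'\,d(N\odot\rho)$, and ''$K'\in L^2(\mathbb{P}_N\times\rho)$''. For example, for $F=\sum_p\lambda_pe^{i\tilde N(f_p)}$ one has $(\varepsilon^+F)^\flat=\varepsilon^+\big(\sum_pi\lambda_pe^{i\tilde N(f_p)}f_p^\flat\big)$, so $\int(\varepsilon^+F)^\flat d(N\odot\rho)=\int\sum_pi\lambda_pe^{i\tilde N(f_p)}f_p^\flat\,d(N\odot\rho)$. **Up-structure.** $\mathcal{D}_0=\{\sum_{p=1}^m\lambda_pe^{i\tilde N(f_p)}: m\in\mathbb{N}^*,\ \lambda_p\in\mathbb{C},\ f_p\in\mathcal{D}(a)\cap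 L^1(\nu)\}$ ($f_p$ real), which is dense in $L^2_{\mathbb{C}}(\mathbb{P})$. On $\mathcal{D}_0$ put $A_0[F]=\sum_p\lambda_pe^{i\tilde N(f_p)}\big(i\tilde N(a[f_p])-\frac12N(\gamma[f_p])\big)$, which is well defined, symmetric and negative; $(A,\mathcal{D}(A))$ is its Friedrichs selfadjoint extension, and $\mathcal{E}[F]=-\mathbb{E}[A[F]\overline F]$ defines a closed form with domain $\mathbb{D}$, which is a local Dirichlet form with carré du champ $\Gamma$ ($\mathcal{E}[F]=\frac12\mathbb{E}\,\Gamma[F]$). $\mathbb{D}$ carries the norm $(\|F\|_{L^2(\mathbb{P})}^2+\mathcal{E}[F])^{1/2}$. The gradient $\sharp$ is defined on $\mathcal{D}_0$ by $F^\sharp=\int(\varepsilon^+F)^\flat\,d(N\odot\rho)$ and extends to a closed operator from $L^2(\mathbb{P})$ into $L^2(\mathbb{P}\times\hat{\mathbb{P}})$ with domain $\mathbb{D}$, which is a gradient for $\Gamma$; this extension is what $F^\sharp$ denotes for $F\in\mathbb{D}$. **The space $\underline{\mathbb{D}}$.** It is the closure of $\mathcal{D}_0\otimes\mathbf{d}$ (algebraic tensor product) for the norm $$\|H\|_{\underline{\mathbb{D}}}=\Big(\mathbb{E}\int\gamma[H(\omega,\cdot)](x)\,N(dx)\Big)^{1/2}+\mathbb{E}\int|H(\omega,x)|\,\xi(x)\,N(dx),$$ where $\xi>0$ is a fixed function with $N(\xi)\in L^2(\mathbb{P})$ (the integrals against $N$ being understood with the convention above). On $\mathcal{D}_0\otimes\mathbf{d}$,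 $\flat$ acts by $(\sum_iF_i\otimes u_i)^\flat=\sum_iF_iu_i^\flat$, and $\flat$ and $\gamma$ are extended to $\underline{\mathbb{D}}$ by continuity.
   Formalization: The space 𝔻̲ is taken as the closure of D₀⊗(d+ℂ), with γ and ♭ vanishing on constants, instead of D₀⊗d: for a transient form (e.g. ℝ³ with |∇u|²) ε⁺1=1 is not in the closure of D₀⊗d; the two spaces agree whenever the original claim holds. *)

(* Defs.v *)
From HB Require Import structures.
From mathcomp Require Import all_boot all_order all_algebra.
From mathcomp Require Import all_classical all_reals all_analysis.
From mathcomp Require Import measurable_realfun.
From mathcomp Require Export complex.

Set Implicit Arguments.
Unset Strict Implicit.
Unset Printing Implicit Defensive.
Import Order.TTheory GRing.Theory Num.Theory.
Import numFieldNormedType.Exports.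
Import ComplexField.Normc.

(* the real-valued projections of R[i] *)
Local Notation Re := (@complex.Re _).
Local Notation Im := (@complex.Im _).

Local Open Scope classical_set_scope.
Local Open Scope ring_scope.

(* The elements of the various L2 spaces are represented by functions; an
   operator valued in classes of functions is represented by the relation
   "v is a version of the image of u". *)

Definition norm2 d (T : measurableType d) (R : realType)
    (mu : {measure set T -> \bar R}) (f : T -> R) : \bar R :=
  'N[mu]_2%:E[EFin \o f]%E.

Definition cmeasurable d (T : measurableType d) (R : realType)
    (f : T -> R[i]) : Prop :=
  measurable_fun setT (fun x => Re (f x)) /\
  measurable_fun setT (fun x => Im (f x)).

Definition cintegral d (T : measurableType d) (R : realType)
    (mu : {measure set T -> \bar R}) (f : T -> R[i]) : R[i] :=
  ((\int[mu]_x Re (f x)) +i* (\int[mu]_x Im (f x)))%C.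

Definition cnorm2 d (T : measurableType d) (R : realType)
    (mu : {measure set T -> \bar R}) (f : T -> R[i]) : \bar R :=
  norm2 mu (fun x => normc (f x)).

Definition cL2 d (T : measurableType d) (R : realType)
    (mu : {measure set T -> \bar R}) (f : T -> R[i]) : Prop :=
  cmeasurable f /\ (cnorm2 mu f < +oo)%E.

Definition expi (R : realType) (t : R) : R[i] := (cos t +i* sin t)%C.

(* Sequential continuity, on A and for the seminorms N1 and N2, of a linear
   operator between spaces of classes, T u v meaning that v is a version of
   the image of u. *)
Definition continuous_on (R : realType) (U V : zmodType) (A : set U)
    (T : U -> V -> Prop) (N1 : U -> \bar R) (N2 : V -> \bar R) : Prop :=
  forall (u_ : nat -> U) (u : U) (v_ : nat -> V) (v : V),
    (forall n, A (u_ n)) -> A u ->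
    (forall n, T (u_ n) (v_ n)) -> T u v ->
    N1 (u_ n - u) @[n --> \oo] --> 0%E ->
    N2 (v_ n - v) @[n --> \oo] --> 0%E.

Section DirichletForms.
Context d (T : measurableType d) (R : realType).
Variables (mu : {measure set T -> \bar R}) (dom : set (T -> R)).
Variable form : (T -> R) -> (T -> R) -> R.

Record dirichlet_form : Prop := DirichletForm {
  df_L2 : forall u, dom u -> u \in Lfun mu 2%:E;
  df_ae : forall u v, dom u -> measurable_fun setT v ->
    {ae mu, forall x, u x = v x} -> dom v;
  df_lin : forall (a : R) u v, dom u -> dom v ->
    dom (fun x => a * u x + v x);
  df_dense : forall f, f \in Lfun mu 2%:E -> forall e : R, 0 < e ->
    exists2 u, dom u & (norm2 mu (f - u)%R < e%:E)%E;
  df_sym : forall u v, dom u -> dom v -> form u v = form v u;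
  df_bilin : forall (a : R) u v w, dom u -> dom v -> dom w ->
    form (fun x => a * u x + v x) w = a * form u w + form v w;
  df_ge0 : forall u, dom u -> 0 <= form u u;
  df_closed : forall (u_ : nat -> T -> R) u,
    (forall n, dom (u_ n)) -> u \in Lfun mu 2%:E ->
    (forall e : R, 0 < e -> exists n0, forall m n, (n0 <= m)%N -> (n0 <= n)%N ->
       form (u_ m - u_ n) (u_ m - u_ n) < e) ->
    norm2 mu (u_ n - u) @[n --> \oo] --> 0%E ->
    dom u /\ form (u_ n - u) (u_ n - u) @[n --> \oo] --> 0;
  df_markov : forall u, dom u ->
    let v := fun x => Num.min (Num.max (u x) 0) 1 in
    dom v /\ form v v <= form u u }.

Definition test_function (phi : R -> R) : Prop :=
  (forall n x, derivable (derive1n n phi) x 1) /\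
  compact (closure [set x | phi x != 0]).

(* Locality in the sense of Bouleau and Hirsch; no topology on T is needed. *)
Definition local_form : Prop :=
  forall u phi psi, dom u -> test_function phi -> test_function psi ->
    closure [set x | phi x != 0] `&` closure [set x | psi x != 0] = set0 ->
    form (fun x => phi (u x) - phi 0) (fun x => psi (u x) - psi 0) = 0.

(* gam is the carre du champ of form, normalized by form u u = 1/2 \int gam u u;
   continuity from dom x dom to L1 follows from cdc_energy. *)
Record carre_du_champ (gam : (T -> R) -> (T -> R) -> T -> R) : Prop :=
    CarreDuChamp {
  cdc_L1 : forall u v, dom u -> dom v -> gam u v \in Lfun mu 1;
  cdc_sym : forall u v, dom u -> dom v ->
    {ae mu, forall x, gam u v x = gam v u x};
  cdc_bilin : forall (a : R) u v w, dom u -> dom v -> dom w ->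
    {ae mu, forall x,
      gam (fun y => a * u y + v y) w x = a * gam u w x + gam v w x};
  cdc_ge0 : forall u, dom u -> {ae mu, forall x, 0 <= gam u u x};
  cdc_ae : forall u v w, dom u -> dom v -> dom w ->
    {ae mu, forall x, u x = v x} ->
    {ae mu, forall x, gam u w x = gam v w x};
  cdc_energy : forall u, dom u -> form u u = 2^-1 * \int[mu]_x gam u u x;
  cdc_eq : forall u v h, dom u -> dom v -> dom h ->
    u \in Lfun mu +oo%E -> v \in Lfun mu +oo%E -> h \in Lfun mu +oo%E ->
    form (u \* h) v + form (v \* h) u - form h (u \* v) =
    \int[mu]_x (h x * gam u v x) }.

(* w is the image of u by the generator: form u v = - (w, v) on dom. *)
Definition is_generator (u w : T -> R) : Prop :=
  [/\ dom u, w \in Lfun mu 2%:E &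
      forall v, dom v -> form u v = - \int[mu]_x (w x * v x)].

Definition form_separable : Prop :=
  exists2 e_ : nat -> T -> R, (forall n, dom (e_ n)) &
    forall u, dom u -> forall e : R, 0 < e ->
      exists n, (norm2 mu (u - e_ n)%R < e%:E)%E /\
                form (u - e_ n) (u - e_ n) < e.

(* u agrees with the element u_ n of dom on E n, and the E n cover T *)
Definition localizes (u : T -> R) (E : nat -> set T) (u_ : nat -> T -> R) :=
  [/\ forall n, measurable (E n), \bigcup_n E n = setT, forall n, dom (u_ n) &
      forall n, {ae mu, forall x, E n x -> u x = u_ n x}].

End DirichletForms.

Section Bottom.
Context dX dM (X : measurableType dX) (M : measurableType dM) (R : realType).
Variables (nu : {sigma_finite_measure set X -> \bar R}) (rho : probability M R).
Variables (d : set (X -> R)) (gam : (X -> R) -> (X -> R) -> X -> R).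
Variable flat : (X -> R) -> X * M -> R.

Definition bform (u v : X -> R) : R := 2^-1 * \int[nu]_x gam u v x.

Definition local_dirichlet_structure : Prop :=
  [/\ dirichlet_form nu d bform, local_form d bform &
      carre_du_champ nu d bform gam].

(* u \in d_loc and gam[u] = g *)
Definition gamma_loc (u g : X -> R) : Prop :=
  exists E u_, localizes nu d u E u_ /\
    forall n, {ae nu, forall x, E n x -> gam (u_ n) (u_ n) x = g x}.

(* u \in d_loc and flat u = k *)
Definition flat_loc (u : X -> R) (k : X * M -> R) : Prop :=
  exists E u_, localizes nu d u E u_ /\
    forall n, {ae (nu \x rho)%E, forall z, E n z.1 -> flat (u_ n) z = k z}.

(* F 0 = 0 is required because constants need not belong to d: they are taken
   care of by gr_one. *)
Definition chain_rule : Prop :=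
  forall (n : nat) (F : 'rV[R]_n.+1 -> R) (U : 'I_n.+1 -> X -> R),
    (forall i, d (U i)) -> F 0 = 0 ->
    (forall y, differentiable F y) ->
    (forall i, continuous (fun y => 'D_(delta_mx 0 i) F y)) ->
    (exists k : R, forall y z, `|F y - F z| <= k * `|y - z|) ->
    let U_ x := \row_i U i x in
    d (fun x => F (U_ x)) /\
    {ae (nu \x rho)%E, forall z, flat (fun x => F (U_ x)) z =
       \sum_i 'D_(delta_mx 0 i) F (U_ z.1) * flat (U i) z}.

Record gradient : Prop := Gradient {
  gr_L2 : forall u, d u -> flat u \in Lfun (nu \x rho)%E 2%:E;
  gr_ae : forall u v, d u -> d v -> {ae nu, forall x, u x = v x} ->
    {ae (nu \x rho)%E, forall z, flat u z = flat v z};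
  gr_lin : forall (a : R) u v, d u -> d v ->
    {ae (nu \x rho)%E, forall z,
      flat (fun x => a * u x + v x) z = a * flat u z + flat v z};
  gr_chain : chain_rule;
  gr_gamma : forall u, d u ->
    {ae nu, forall x, gam u u x = \int[rho]_r (flat u (x, r)) ^+ 2};
  gr_mean0 : forall u, d u ->
    {ae nu, forall x, \int[rho]_r flat u (x, r) = 0};
  gr_one : flat_loc (cst 1) (cst 0) }.

(* Complexification of d, with the constants added: they belong to d_loc and
   are annihilated by gam and flat.  Since epsilon^+(e^{i Ntilde(f)}) =
   e^{i Ntilde(f)} e^{if} with e^{if} - 1 in d, the creation operator produces
   elements of D0 (x) (d + constants); for a transient form even epsilon^+ 1 = 1
   is not a limit of elements of D0 (x) d. *)
Definition dC (u : X -> R[i]) : Prop :=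
  d (fun x => Re (u x)) /\ d (fun x => Im (u x)).

Definition d1C (u : X -> R[i]) : Prop := exists c : R[i], dC (fun x => u x - c).

Definition minus_cst (u : X -> R[i]) : X -> R[i] :=
  let c := xget 0 [set c | dC (fun x => u x - c)] in fun x => u x - c.

Definition gammaC (u : X -> R[i]) (x : X) : R :=
  let re x := Re (minus_cst u x) in let im x := Im (minus_cst u x) in
  gam re re x + gam im im x.

Definition flatC (u : X -> R[i]) (z : X * M) : R[i] :=
  (flat (fun x => Re (minus_cst u x)) z +i*
   flat (fun x => Im (minus_cst u x)) z)%C.

End Bottom.

Section Configurations.
Context dX (X : measurableType dX) (R : realType).

Definition dirac_sum (alive : nat -> Prop) (x : nat -> X) (B : set X) : \bar R :=
  (\sum_(n <oo) (if `[< alive n >] then \d_(x n) B else 0))%E.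

Record config := Config {
  config_measure :> {measure set X -> \bar R};
  config_atomic : exists alive x, forall B, measurable B ->
    config_measure B = dirac_sum alive x B }.

Fact config0_atomic : exists alive x, forall B, measurable B ->
  (mzero : {measure set X -> \bar R}) B = dirac_sum alive x B.
Proof.
exists (fun=> False), (fun=> point) => B mB; rewrite /dirac_sum.
by rewrite eseries0 // => n _ _; case: asboolP.
Qed.

HB.instance Definition _ := gen_eqMixin config.
HB.instance Definition _ := gen_choiceMixin config.
HB.instance Definition _ := isPointed.Build config (Config config0_atomic).

(* the sigma-field generated by the maps w |-> w B, B measurable *)
Definition config_measurable : set (set config) :=
  <<s \bigcup_(B in measurable)
    preimage_set_system setT (fun w : config => w B) measurable >>.

Fact config_measurable0 : config_measurable set0.
Proof. exact: sigma_algebra0. Qed.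
Fact config_measurableC A : config_measurable A -> config_measurable (~` A).
Proof. exact: sigma_algebraC. Qed.
Fact config_measurableU (F : (set config)^nat) :
  (forall i, config_measurable (F i)) -> config_measurable (\bigcup_i F i).
Proof. exact: sigma_algebra_bigcup. Qed.

Definition config_display : measure_display.
Proof. by constructor. Qed.

HB.instance Definition _ := @isMeasurable.Build config_display config
  config_measurable config_measurable0 config_measurableC config_measurableU.

Fact config_add_atomic (w : config) (x : X) : exists alive y, forall B,
  measurable B -> (measure_add w \d_x) B = dirac_sum alive y B.
Proof.
have [alive [y wE]] := config_atomic w.
exists (fun n => if n is n'.+1 then alive n' else True).
exists (fun n => if n is n'.+1 then y n' else x) => B mB.
pose f (n : nat) : \bar R := (if `[< if n is n'.+1 then alive n' else True >]
  then \d_(if n is n'.+1 then y n' else x) B else 0)%E.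
have f0 n : (0 <= f n)%E by rewrite /f; case: ifP.
rewrite measure_addE wE // [RHS](nneseries_recl (f := f)) //.
rewrite -(nneseries_addn 1 f0) {1}/f asboolT //= addeC; congr (_ + _)%E.
by apply: eq_eseriesr => n _; rewrite /f addn1.
Qed.

(* the configuration epsilon^+_x w *)
Definition add_point (x : X) (w : config) : config :=
  if `[< (0 < w [set x])%E >] then w else Config (config_add_atomic w x).

(* the operator epsilon^+ *)
Definition creation (V : Type) (F : config -> V) (z : config * X) : V :=
  F (add_point z.2 z.1).

(* N(B_1), ..., N(B_n) are independent for disjoint B_i, and N(B) is Poisson
   with parameter nu(B). *)
Record poisson_law (nu : {measure set X -> \bar R})
    (P : probability config R) : Prop := PoissonLaw {
  poisson_fin : forall B, measurable B -> (nu B < +oo)%E -> forall k : nat,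
    P [set w | w B = k%:R%:E] =
    (expR (- fine (nu B)) * fine (nu B) ^+ k / k`!%:R)%:E;
  poisson_oo : forall B, measurable B -> nu B = +oo%E ->
    P [set w | w B = +oo%E] = 1%E;
  poisson_indep : forall (n : nat) (B : 'I_n -> set X) (k : 'I_n -> \bar R),
    (forall i, measurable (B i)) ->
    (forall i j, i != j -> B i `&` B j = set0) ->
    P [set w | forall i, w (B i) = k i] =
    (\prod_i P [set w | w (B i) = k i])%E }.

(* A measurable enumeration of the atoms of N; there may be finitely many of
   them, w \in alive n means that w has an n-th atom. *)
Record atom_enumeration (P : probability config R)
    (alive : nat -> set config) (atom : nat -> config -> X) : Prop :=
    AtomEnumeration {
  alive_measurable : forall n, measurable (alive n);
  atom_measurable : forall n, measurable_fun setT (atom n);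
  atomE : {ae P, forall w : config, forall B, measurable B ->
    w B = dirac_sum (fun n => alive n w) (fun n => atom n w) B} }.

End Configurations.

Section Marks.
Context dM (M : measurableType dM) (R : realType).

Definition marks := nat -> M.

HB.instance Definition _ := gen_eqMixin marks.
HB.instance Definition _ := gen_choiceMixin marks.
HB.instance Definition _ := isPointed.Build marks (fun=> point).

(* the product sigma-field, generated by the coordinates *)
Definition marks_measurable : set (set marks) :=
  <<s \bigcup_(n in setT)
    preimage_set_system setT (fun r : marks => r n) measurable >>.

Fact marks_measurable0 : marks_measurable set0.
Proof. exact: sigma_algebra0. Qed.
Fact marks_measurableC A : marks_measurable A -> marks_measurable (~` A).
Proof. exact: sigma_algebraC. Qed.
Fact marks_measurableU (F : (set marks)^nat) :
  (forall i, marks_measurable (F i)) -> marks_measurable (\bigcup_i F i).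
Proof. exact: sigma_algebra_bigcup. Qed.

Definition marks_display : measure_display.
Proof. by constructor. Qed.

HB.instance Definition _ := @isMeasurable.Build marks_display marks
  marks_measurable marks_measurable0 marks_measurableC marks_measurableU.

(* The product probability rho^nat: it is the only probability with these
   values on the cylinders. *)
Definition product_law (rho : probability M R) (Phat : probability marks R) :
    Prop :=
  forall (n : nat) (B : 'I_n -> set M), (forall i, measurable (B i)) ->
    Phat [set r | forall i, B i (r i)] = (\prod_i rho (B i))%E.

End Marks.

Section MarkedMeasure.
Context dX dM (X : measurableType dX) (M : measurableType dM) (R : realType).
Variables (nu : {sigma_finite_measure set X -> \bar R}) (rho : probability M R).
Variables (P : probability (config X R) R) (Phat : probability (marks M) R).
Variables (alive : nat -> set (config X R)) (atom : nat -> config X R -> X).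

(* The convention on integration against N.  "versionN k k'" means that
   k = epsilon^+ k', with k' measurable.  P x nu-almost everywhere is expressed
   by iteration, because the set of the (w, x) with w [set x] > 0 need not be
   measurable for the product sigma-field if the diagonal of X is not. *)
Definition versionN (k k' : config X R * X -> R) : Prop :=
  measurable_fun setT k' /\
  {ae P, forall w, {ae nu, forall x, k (w, x) = k' (add_point x w, x)}}.

Definition versionNM (K K' : config X R * X * M -> R[i]) : Prop :=
  cmeasurable K' /\
  {ae P, forall w, {ae (nu \x rho)%E, forall z,
    K (w, z.1, z.2) = K' (add_point z.1 w, z.1, z.2)}}.

(* E \int k dN, for k >= 0.  All the k' give the same value; the infimum makes it +oo when
   there is no k'. *)
Definition EintN (k : config X R * X -> R) : \bar R :=
  ereal_inf [set (\int[P]_w \int[w]_x (k' (w, x))%:E)%E | k' in versionN k].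

(* Norms of L2(P_N x rho) and L1(P_N x rho) of K', P_N(dw,dx) = P(dw)w(dx) *)
Definition norm2PN (K' : config X R * X * M -> R[i]) : \bar R :=
  (\int[P]_w \int[w]_x \int[rho]_r ((normc (K' (w, x, r))) ^+ 2)%:E)%E
  `^ 2^-1.

Definition norm1PN (K' : config X R * X * M -> R[i]) : \bar R :=
  (\int[P]_w \int[w]_x \int[rho]_r (normc (K' (w, x, r)))%:E)%E.

Definition mean0 (K' : config X R * X * M -> R[i]) : Prop :=
  {ae P, forall w : config X R, {ae (w : {measure set X -> \bar R}), forall x,
    cintegral rho (fun r => K' (w, x, r)) = 0}}.

(* Their counterparts for K defined P x nu x rho-almost everywhere *)
Definition normPN (K : config X R * X * M -> R[i]) : \bar R :=
  ereal_inf [set norm2PN K' | K' in versionNM K].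

Definition L20 (K : config X R * X * M -> R[i]) : Prop :=
  exists2 K', versionNM K K' & (norm2PN K' < +oo)%E /\ mean0 K'.

(* the marked measure, sum of the Dirac masses at the (x_n, r_n) *)
Definition marked (w : config X R) (r : marks M) :
    {measure set (X * M) -> \bar R} :=
  mseries (fun n => if `[< alive n w >]
                    then \d_((atom n w, r n)) : {measure set (X * M) -> \bar R}
                    else mzero) 0.

Definition marked_sum (K' : config X R * X * M -> R[i])
    (z : config X R * marks M) : R[i] :=
  cintegral (marked z.1 z.2) (fun y => K' (z.1, y.1, y.2)).

(* S is a version of \int K d(N (.) rho), for K in L20: the L2-limit of the
   sums of elements of L20 which are in L1(P_N x rho), for which the sum is
   absolutely convergent. *)
Definition is_marked_integral (K : config X R * X * M -> R[i])
    (S : config X R * marks M -> R[i]) : Prop :=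
  cL2 (P \x Phat)%E S /\
  exists K' (K_ : nat -> config X R * X * M -> R[i]),
    [/\ versionNM K K',
        forall n, [/\ cmeasurable (K_ n), mean0 (K_ n),
                      (norm1PN (K_ n) < +oo)%E & (norm2PN (K_ n) < +oo)%E],
        norm2PN (K_ n - K') @[n --> \oo] --> 0%E &
        cnorm2 (P \x Phat)%E (marked_sum (K_ n) - S) @[n --> \oo] --> 0%E].

End MarkedMeasure.

Section Up.
Context dX dM (X : measurableType dX) (M : measurableType dM) (R : realType).
Variables (nu : {sigma_finite_measure set X -> \bar R}) (rho : probability M R).
Variables (d : set (X -> R)) (gam : (X -> R) -> (X -> R) -> X -> R).
Variable flat : (X -> R) -> X * M -> R.
Variables (P : probability (config X R) R) (Phat : probability (marks M) R).
Variables (alive : nat -> set (config X R)) (atom : nat -> config X R -> X).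
Variable xi : X -> R.

Definition intN (f : X -> R) (w : config X R) : R := \int[w]_x f x.

Definition Ntilde1 (f : X -> R) (w : config X R) : R :=
  intN f w - \int[nu]_x f x.

(* G is a version of Ntilde(f), f in L2(nu), for the extension of Ntilde1 from
   L1 /\ L2. *)
Definition is_Ntilde (f : X -> R) (G : config X R -> R) : Prop :=
  G \in Lfun P 2%:E /\
  exists f_ : nat -> X -> R,
    [/\ forall n, f_ n \in Lfun nu 1 /\ f_ n \in Lfun nu 2%:E,
        norm2 nu (f_ n - f) @[n --> \oo] --> 0%E &
        norm2 P (Ntilde1 (f_ n) - G) @[n --> \oo] --> 0%E].

(* f \in D(a) /\ L1(nu) *)
Definition test_exponent (f : X -> R) : Prop :=
  f \in Lfun nu 1 /\ exists w, is_generator nu d (bform nu gam) f w.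

Definition expsum m (lam : 'I_m -> R[i]) (f : 'I_m -> X -> R)
    (w : config X R) : R[i] := \sum_p lam p * expi (Ntilde1 (f p) w).

Definition D0 (F : config X R -> R[i]) : Prop :=
  exists m (lam : 'I_m.+1 -> R[i]) (f : 'I_m.+1 -> X -> R),
    (forall p, test_exponent (f p)) /\ F = expsum lam f.

Definition is_A0 (F G : config X R -> R[i]) : Prop :=
  exists m (lam : 'I_m.+1 -> R[i]) (f : 'I_m.+1 -> X -> R)
    (af : 'I_m.+1 -> X -> R) (h : 'I_m.+1 -> config X R -> R),
  [/\ forall p, f p \in Lfun nu 1 /\ is_generator nu d (bform nu gam) (f p) (af p),
      F = expsum lam f,
      forall p, is_Ntilde (af p) (h p) &
      G = fun w => \sum_p lam p * expi (Ntilde1 (f p) w) *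
            (- (2^-1 * intN (gam (f p) (f p)) w) +i* h p w)%C].

Definition A0 (F : config X R -> R[i]) : config X R -> R[i] :=
  xget 0 (is_A0 F).

(* - E [A0[F] conj(F)], a real number *)
Definition energy0 (F : config X R -> R[i]) : R :=
  - Re (cintegral P (fun w => A0 F w * (F w)^*%C)).

(* By construction, the form of the Friedrichs extension of A0 is the closure of
   the form energy0 on D0; domD is its domain. *)
Definition domD_approx (F_ : nat -> config X R -> R[i]) (F : config X R -> R[i]) :=
  [/\ forall n, D0 (F_ n),
      forall e : R, 0 < e -> exists n0, forall m n, (n0 <= m)%N -> (n0 <= n)%N ->
        energy0 (F_ m - F_ n) < e,
      cL2 P F & cnorm2 P (F_ n - F) @[n --> \oo] --> 0%E].

Definition domD (F : config X R -> R[i]) : Prop := exists F_, domD_approx F_ F.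

(* The limit does not depend on F_; the energy is +oo outside domD. *)
Definition energy (F : config X R -> R[i]) : \bar R :=
  ereal_inf [set e%:E | e in
    [set e : R | exists2 F_, domD_approx F_ F &
                   energy0 (F_ n) @[n --> \oo] --> e]].

Definition normD (F : config X R -> R[i]) : \bar R :=
  ((cnorm2 P F `^ 2) + energy F)%E `^ 2^-1.

(* The real part of the up-structure, on which Gamma is characterized; Gamma is
   then extended as an hermitian form. *)
Definition DR (F : config X R -> R) : Prop := domD (fun w => (F w)%:C%C).

Definition formR (F G : config X R -> R) : R :=
  (fine (energy (fun w => (F w + G w)%:C%C)) -
   fine (energy (fun w => (F w - G w)%:C%C))) / 4.

Definition GammaC (Gam : (config X R -> R) -> (config X R -> R) -> config X R -> R)
    (F : config X R -> R[i]) (w : config X R) : R :=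
  let re w := Re (F w) in let im w := Im (F w) in
  Gam re re w + Gam im im w.

(* D0 (x) d1C; gam is applied in x with w fixed, and flat acts termwise *)
Definition tensor (H : config X R * X -> R[i]) : Prop :=
  exists m (F : 'I_m -> config X R -> R[i]) (u : 'I_m -> X -> R[i]),
    [/\ forall i, D0 (F i), forall i, d1C d (u i) &
        H = fun z => \sum_i F i z.1 * u i z.2].

Definition is_flat0 (H : config X R * X -> R[i])
    (K : config X R * X * M -> R[i]) : Prop :=
  exists m (F : 'I_m -> config X R -> R[i]) (u : 'I_m -> X -> R[i]),
    [/\ forall i, D0 (F i), forall i, d1C d (u i),
        H = fun z => \sum_i F i z.1 * u i z.2 &
        K = fun z => \sum_i F i z.1.1 * flatC d flat (u i) (z.1.2, z.2)].

Definition gamma0 (H : config X R * X -> R[i]) (z : config X R * X) : R :=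
  gammaC d gam (fun x => H (z.1, x)) z.2.

Definition xi_norm (H : config X R * X -> R[i]) : \bar R :=
  EintN nu P (fun z => normc (H z) * xi z.2).

Definition normU0 (H : config X R * X -> R[i]) : \bar R :=
  (EintN nu P (gamma0 H) `^ 2^-1 + xi_norm H)%E.

Definition underD_approx (H_ : nat -> config X R * X -> R[i])
    (H : config X R * X -> R[i]) : Prop :=
  [/\ forall n, tensor (H_ n),
      forall e : R, 0 < e -> exists n0, forall m n, (n0 <= m)%N -> (n0 <= n)%N ->
        (normU0 (H_ m - H_ n)%R < e%:E)%E &
      xi_norm (H_ n - H) @[n --> \oo] --> 0%E].

(* the space underline(D) *)
Definition underD (H : config X R * X -> R[i]) : Prop := exists H_, underD_approx H_ H.

(* g is a version of gam[H], limit in L1(P_N) *)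
Definition is_gammaU (H : config X R * X -> R[i])
    (g : config X R * X -> R) : Prop :=
  exists2 H_, underD_approx H_ H &
    EintN nu P (fun z => `|gamma0 (H_ n) z - g z|) @[n --> \oo] --> 0%E.

(* K is a version of flat H, limit in L2(P_N x rho) *)
Definition is_flatU (H : config X R * X -> R[i])
    (K : config X R * X * M -> R[i]) : Prop :=
  exists H_ K_, [/\ underD_approx H_ H, forall n, is_flat0 (H_ n) (K_ n) &
    normPN nu rho P (K_ n - K) @[n --> \oo] --> 0%E].

Definition normU (H : config X R * X -> R[i]) : \bar R :=
  (ereal_inf [set EintN nu P g | g in is_gammaU H] `^ 2^-1 + xi_norm H)%E.

(* S is a version of the gradient of F: first on D0, then on domD *)
Definition is_sharp0 (F : config X R -> R[i])
    (S : config X R * marks M -> R[i]) : Prop :=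
  D0 F /\ exists2 K, is_flatU (creation F) K &
    is_marked_integral nu rho P Phat alive atom K S.

Definition is_sharp (F : config X R -> R[i])
    (S : config X R * marks M -> R[i]) : Prop :=
  [/\ domD F, cL2 (P \x Phat)%E S &
    exists F_ S_, [/\ forall n, is_sharp0 (F_ n) (S_ n),
      normD (F_ n - F) @[n --> \oo] --> 0%E &
      cnorm2 (P \x Phat)%E (S_ n - S) @[n --> \oo] --> 0%E]].

End Up.

(* Main.v *)
(* On config * X, the measure PN = P(dw) w(dx) is carried by eps^+ to P x nu
   (Mecke), so versions of functions given P x nu-a.e. are unique PN-a.e. For
   F = sum_p c_p exp(i Ntilde(f_p)) in D0, a version of (eps^+ F)^flat is
   K = sum_p i c_p exp(i Ntilde(f_p)) f_p^flat, and the squared norm of K in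
   L2(PN x rho) is twice the energy of F; this passes to the domain of the form
   because flat is closable: multiplying by sin(chi), chi in d, and composing with
   sin brings a function known only up to a constant back into d. The marks being
   independent and centred, integration against the marked measure is an isometry
   on the K with zero rho-mean, even for fixed w. Gamma is then identified by testing
   the functional calculus of the form against D0, whose bounded elements separate
   L1(P): the events {N(B) = k} are limits of products of
   (1 + cos(pi (N(B) - k) / 2^m)) / 2, and indicators of sets B are limits of
   resolvents of the generator a. *)
From HB Require Import structures.
Require Import Defs.
From mathcomp Require Import all_boot all_order all_algebra.
From mathcomp Require Import all_classical all_reals all_analysis.
From mathcomp Require Import measurable_realfun.
From mathcomp Require Import ring lra.

Set Implicit Arguments.
Unset Strict Implicit.
Unset Printing Implicit Defensive.
Import Order.TTheory GRing.Theory Num.Theory.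
Import numFieldNormedType.Exports.
Import ComplexField.Normc.

Local Open Scope classical_set_scope.
Local Open Scope ring_scope.

Local Notation mEFinP := measurable_EFinP.
Local Notation mcompT := measurableT_comp.
Local Notation mfunT := (measurable_fun setT).
Local Notation integrableT mu f := (mu.-integrable setT (EFin \o f)).
Local Notation Re := (@complex.Re _).
Local Notation Im := (@complex.Im _).

(** * Integration *)

(** The obstacle is one of representatives. Whether [x] lies in the support of [w] need not be
    jointly measurable, so [add_point] is traded for the measurable sum [add_atom], which differs
    from it only at the countably many atoms of [w], a [nu]-null set. Likewise the integral against
    [w] of a function of both [w] and [x] is not known to be measurable in [w]: lower integrals are
    used until the enumeration of the atoms provides a measurable version. All objects of the
    statement are then read off from one relation, [isK F K']: the pair is a limit, in L2(P) and in
    L2([PN] x [rho]), of elements of D0 with their explicit gradients, and well-definedness is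
    uniqueness of [K']. Closedness of the energy on the up-space does not give this uniqueness,
    because limits in the space underline(D) run along arbitrary tensors and not only along
    creations of elements of D0. It comes from closability below, for almost every fixed
    configuration, where the [xi]-norm yields only pointwise convergence along a subsequence and no
    control in L2([nu]). *)

Section LowerIntegral.
Import HBNNSimple.
Local Open Scope ereal_scope.
Context d (T : measurableType d) (R : realType) (mu : {measure set T -> \bar R}).

(** No measurability is assumed: the integral of a nonnegative function is a supremum over the
    simple functions below it. Random integrals are compared in this way before a measurable version
    is known. *)
Lemma le_lower_integral (f g : T -> \bar R) :
  (forall x, 0 <= f x) -> (forall x, f x <= g x) ->
  \int[mu]_x f x <= \int[mu]_x g x.
Proof.
move=> f0 fg.
have g0 x : 0 <= g x by exact: le_trans (f0 x) (fg x).
rewrite ge0_integralTE// ge0_integralTE//.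
apply: ereal_sup_le => _ [h hf <-]; exists h => // x;
exact: le_trans (hf x) (fg x).
Qed.

(** Only [g] is measurable. A simple function below [f] is below [g] off the null set, and [g] cut
    to 0 on that null set is below [f] everywhere. *)
Lemma ae_eq_lower_integral (f g : T -> \bar R) :
  (forall x, 0 <= f x) -> (forall x, 0 <= g x) -> mfunT g ->
  {ae mu, forall x, f x = g x} -> \int[mu]_x f x = \int[mu]_x g x.
Proof.
move=> f0 g0 mg [N [mN N0 fgN]].
have fgE x : ~ N x -> f x = g x.
  by move=> Nx; apply: contrapT => fg; apply: Nx; exact: fgN.
apply/eqP; rewrite eq_le; apply/andP; split.
  rewrite ge0_integralTE//; apply: ge_ereal_sup => _ [h hf <-].
  rewrite -integralT_nnsfun.
  have mh : mfunT (EFin \o h) by exact/mEFinP.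
  rewrite (@ge0_negligible_integral _ _ _ _ _ N)//; last first.
    by move=> x _; rewrite lee_fin.
  rewrite [leRHS](@ge0_negligible_integral _ _ _ _ _ N)//.
  apply: ge0_le_integral => //.
  - exact: measurableD.
  - by move=> x _; rewrite lee_fin.
  - exact: measurable_funTS.
  - exact: measurable_funTS.
  - by move=> x [_ Nx]; rewrite -fgE//; exact: hf.
rewrite (@ge0_negligible_integral _ _ _ _ _ N)// integral_mkcond.
apply: le_lower_integral => x; rewrite patchE; case: ifPn => //.
by rewrite inE => -[_ Nx]; rewrite fgE.
Qed.

End LowerIntegral.

(** * Convergence to 0 of extended real sequences *)

Section Vanishing.
Context (R : realType).
Implicit Types u v : nat -> \bar R.

(** Epsilon form of convergence to 0: eventual finiteness, a separate condition in the topological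
    form, is part of the bound. *)
Definition to0 u := forall e : R, 0 < e ->
  exists n0, forall n, (n0 <= n)%N -> (u n < e%:E)%E.

Definition cauchy0 (u : nat -> nat -> \bar R) := forall e : R, 0 < e ->
  exists n0, forall m n, (n0 <= m)%N -> (n0 <= n)%N -> (u m n < e%:E)%E.

Lemma to0P u : (forall n, (0 <= u n)%E) -> to0 u <-> u n @[n --> \oo] --> 0%E.
Proof.
move=> u0; split=> [u_0|u_0 e e0].
  apply/fine_cvgP; split.
    have [n0 h] := u_0 1 ltr01; exists n0 => // n /= /h un.
    by rewrite ge0_fin_numE// (lt_trans un)// ltry.
  apply/cvgrPdist_lt => e e0; have [n0 h] := u_0 _ e0.
  exists n0 => // n /= /h un; rewrite sub0r normrN ger0_norm ?fine_ge0//.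
  by rewrite -lte_fin fineK// ge0_fin_numE// (lt_trans un)// ltry.
have /fine_cvgP[[n1 _ fu] /cvgrPdist_lt/(_ _ e0)[n2 _ h]] := u_0.
exists (maxn n1 n2) => n; rewrite geq_max => /andP[/fu/= un /h/=].
rewrite sub0r normrN ger0_norm ?fine_ge0// => {}h.
by rewrite -(fineK un) lte_fin.
Qed.

Lemma to0_le u v : (forall n, (u n <= v n)%E) -> to0 v -> to0 u.
Proof.
move=> uv v0 e e0; have [n0 h] := v0 _ e0; exists n0 => n /h.
exact: le_lt_trans.
Qed.

Lemma to0D u v : to0 u -> to0 v -> to0 (fun n => u n + v n)%E.
Proof.
move=> u0 v0 e e0; have e20 : 0 < e / 2 by rewrite divr_gt0.
have [n1 h1] := u0 _ e20; have [n2 h2] := v0 _ e20.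
exists (maxn n1 n2) => n; rewrite geq_max => /andP[/h1 ? /h2 ?].
by rewrite [e]splitr EFinD lteD.
Qed.

Lemma to0Z (c : R) u : (forall n, (0 <= u n)%E) -> 0 <= c -> to0 u ->
  to0 (fun n => c%:E * u n)%E.
Proof.
move=> u0 c0 u_0 e e0; have c10 : 0 < c + 1 by rewrite ltr_wpDl.
have [n0 h] := u_0 _ (divr_gt0 e0 c10); exists n0 => n /h un.
apply: (@le_lt_trans _ _ ((c + 1)%:E * u n)%E).
  by rewrite lee_wpmul2r// lee_fin lerDl.
by rewrite muleC -lte_pdivlMr.
Qed.

(** The norms of the statement carry a power 1/2; the proof works with their squares. *)
Lemma to0_half u : (forall n, (0 <= u n)%E) ->
  to0 (fun n => u n `^ 2^-1)%E <-> to0 u.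
Proof.
move=> u0; split=> h e e0.
  have s0 : 0 < Num.sqrt e by rewrite sqrtr_gt0.
  have [n0 {}h] := h _ s0; exists n0 => n /h.
  have := u0 n; case: (u n) => [x|//|//]; last by rewrite poweRyr.
  rewrite lee_fin poweR_EFin !lte_fin => x0.
  by rewrite powR12_sqrt// ltr_sqrt.
have e2 : 0 < e ^+ 2 by rewrite exprn_gt0.
have [n0 {}h] := h _ e2; exists n0 => n /h.
have := u0 n; case: (u n) => [x|//|//].
rewrite lee_fin poweR_EFin !lte_fin => x0 xe.
by rewrite powR12_sqrt// -(ger0_norm (ltW e0)) -sqrtr_sqr ltr_sqrt.
Qed.

(** Turns a fixed quantity that is bounded by vanishing errors into 0. *)
Lemma to0_cst (c : \bar R) : to0 (fun=> c) -> (c <= 0)%E.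
Proof.
move=> h; apply/lee_addgt0Pr => e e0; rewrite add0e.
by have [n0 /(_ n0 (leqnn _))/ltW] := h _ e0.
Qed.

Lemma to0_sub u (phi : nat -> nat) : (forall n, (n <= phi n)%N) -> to0 u ->
  to0 (u \o phi).
Proof.
move=> nphi u0 e e0; have [n0 h] := u0 _ e0; exists n0 => n n0n.
by apply: h; exact: leq_trans (nphi n).
Qed.

End Vanishing.

(** * Almost everywhere convergence along subsequences *)

Section AlmostEverywhere.
Context d (T : measurableType d) (R : realType) (mu : {measure set T -> \bar R}).

Lemma integral_lty_ae (f : T -> \bar R) : mfunT f ->
  (forall x, 0 <= f x)%E -> (\int[mu]_x f x < +oo)%E ->
  {ae mu, forall x, (f x < +oo)%E}.
Proof.
move=> mf f0 foo.
have fi : mu.-integrable setT f.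
  by apply/integrableP; split=> //; under eq_integral do rewrite gee0_abs//.
apply: filterS (integrable_ae measurableT fi) => x /(_ I).
by rewrite ge0_fin_numE.
Qed.

Lemma integral_eq0_ae (f : T -> \bar R) : mfunT f ->
  (forall x, 0 <= f x)%E -> (\int[mu]_x f x <= 0)%E ->
  {ae mu, forall x, f x = 0%E}.
Proof.
move=> mf f0 fle0.
have : (\int[mu]_x `|f x| = 0)%E.
  under eq_integral do rewrite gee0_abs//.
  by apply/eqP; rewrite eq_le fle0 integral_ge0.
move/(ae_eq_integral_abs mu measurableT mf).1.
by apply: filterS => x /(_ I).
Qed.

Lemma to0_integral_ae (h : nat -> T -> \bar R) :
  (forall n, mfunT (h n)) -> (forall n x, 0 <= h n x)%E ->
  (\sum_(n <oo) \int[mu]_x h n x < +oo)%E ->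
  {ae mu, forall x, (\sum_(n <oo) h n x < +oo)%E}.
Proof.
move=> mh h0 hoo; apply: integral_lty_ae.
- exact: ge0_emeasurable_sum.
- by move=> x; exact: nneseries_ge0.
- by rewrite integral_nneseries.
Qed.

Lemma nneseries_lty_to0 (u : nat -> \bar R) : (forall n, 0 <= u n)%E ->
  (\sum_(n <oo) u n < +oo)%E -> to0 u.
Proof.
move=> u0 uoo; have := nneseries_tail_cvg uoo (fun k _ => u0 k).
move=> h; have {h} : to0 (fun N => \sum_(N <= k <oo) u k)%E.
  by apply/to0P => // n; exact: nneseries_ge0.
apply: to0_le => n; rewrite (@nneseries_split _ _ n 1)//.
by rewrite addn1 big_nat1 leeDl// nneseries_ge0.
Qed.

Lemma sum_half_lty (u : nat -> \bar R) : (forall n, 0 <= u n)%E ->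
  (forall n, u n <= (2^-1 ^+ n)%:E)%E -> (\sum_(n <oo) u n < +oo)%E.
Proof.
move=> u0 uh; apply: (@le_lt_trans _ _ 2%:E); last by rewrite ltry.
have h : (\sum_(n <oo) u n <= \sum_(n <oo) (0 + (2 / (2 ^ n.+1)%:R : R)%:E))%E.
  apply: lee_nneseries => // n _; rewrite add0e (le_trans (uh n))// lee_fin.
  by rewrite exprVn natrX exprS invfM mulrA divff// mul1r.
apply: (le_trans h).
apply: le_trans (epsilon_trick xpredT (fun=> lexx _) _) _; first by [].
by rewrite eseries0// add0e.
Qed.

Lemma subseq_fast (e_ : nat -> R) (u : nat -> nat -> \bar R) :
  (forall n, 0 < e_ n) -> cauchy0 u ->
  exists phi : nat -> nat, [/\ forall n, (n <= phi n)%N,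
    forall n, (phi n <= phi n.+1)%N &
    forall k m n, (phi k <= m)%N -> (phi k <= n)%N -> (u m n <= (e_ k)%:E)%E].
Proof.
move=> e_gt0 cu; have h k : exists n0, forall m n, (n0 <= m)%N -> (n0 <= n)%N ->
    (u m n <= (e_ k)%:E)%E.
  by have [n0 H] := cu _ (e_gt0 k); exists n0 => m n /H{}H /H/ltW.
have [f Hf] := choice h.
(* The partial sum dominates every earlier threshold and is monotone in [n]; the added [n] keeps the
   index above [n]. *)
exists (fun n => (\sum_(i < n.+1) (f i) + n)%N); split.
- by move=> n; rewrite leq_addl.
- by move=> n; rewrite [X in (_ <= X + _)%N]big_ord_recr/= leq_add// leq_addr.
- move=> k m n km kn; apply: Hf.
    by apply: leq_trans km; rewrite big_ord_recr/= -addnA addnCA leq_addr.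
  by apply: leq_trans kn; rewrite big_ord_recr/= -addnA addnCA leq_addr.
Qed.

(** Along a subsequence the integrals are at most 2^-n, so the sum of the functions has a finite
    integral, is finite almost everywhere, and its terms vanish there. *)
Lemma to0_ae_subseq (h : nat -> T -> \bar R) :
  (forall n, mfunT (h n)) -> (forall n x, 0 <= h n x)%E ->
  to0 (fun n => \int[mu]_x h n x)%E ->
  exists2 phi : nat -> nat, forall n, (n <= phi n)%N &
    {ae mu, forall x, to0 (fun n => h (phi n) x)}.
Proof.
move=> mh h0 hto0.
have [||phi [nphi _ phiP]] :=
  @subseq_fast (fun k => 2^-1 ^+ k) (fun m n => \int[mu]_x h n x)%E.
  by move=> n; rewrite exprn_gt0// invr_gt0.
  by move=> e e0; have [n0 H] := hto0 _ e0; exists n0 => m n _; exact: H.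
exists phi => //.
have : {ae mu, forall x, (\sum_(n <oo) h (phi n) x < +oo)%E}.
  apply: to0_integral_ae => //; apply: sum_half_lty => n.
    exact: integral_ge0.
  exact: (phiP n (phi n)).
by apply: filterS => x; exact: nneseries_lty_to0.
Qed.

(** Fatou's lemma in the form in which it is used: limit known almost everywhere, bound valid from
    some rank on, whence the shifted sequence in the proof. *)
Lemma fatou_le (f_ : nat -> T -> \bar R) (f : T -> \bar R) (c : \bar R) :
  (forall n, mfunT (f_ n)) -> (forall n x, 0 <= f_ n x)%E ->
  mfunT f -> (forall x, 0 <= f x)%E ->
  {ae mu, forall x, f_ n x @[n --> \oo] --> f x} ->
  (exists n0, forall n, (n0 <= n)%N -> (\int[mu]_x f_ n x <= c)%E) ->
  (\int[mu]_x f x <= c)%E.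
Proof.
move=> mf_ f_0 mf f0 cvf [n0 fc].
pose g n x := f_ (n + n0)%N x.
have -> : (\int[mu]_x f x = \int[mu]_x limn_einf (g^~ x))%E.
  have : {ae mu, forall x, limn_einf (g^~ x) = f x}.
    apply: filterS cvf => x cvfx.
    have /cvg_limn_einf_sup[-> _] // : g^~ x @ \oo --> f x.
    by rewrite /g (cvg_shiftn _ (f_ ^~ x)).
  move=> h; apply/esym/ae_eq_lower_integral => // x.
  by rewrite limn_einf_lim; apply: lime_ge; [exact: is_cvg_einfs|];
    near=> n; apply: le_ereal_inf_tmp => _ [m _ <-]; exact: f_0.
apply: le_trans (fatou mu measurableT _ _) _.
- by move=> n; exact: mf_.
- by move=> n x _; exact: f_0.
rewrite limn_einf_lim; apply: lime_le; first exact: is_cvg_einfs.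
near=> n; apply: (@le_trans _ _ (\int[mu]_x g n x)%E).
  by apply: ereal_inf_lbound; exists n => /=.
by apply: fc; rewrite leq_addl.
Unshelve. all: by end_near. Qed.

End AlmostEverywhere.

(** * Squared modulus of complex numbers *)

Section SquareModulus.
Context (R : realType).
Implicit Types z w : R[i].

Lemma ReD z w : Re (z + w) = Re z + Re w. Proof. by case: z; case: w. Qed.
Lemma ImD z w : Im (z + w) = Im z + Im w. Proof. by case: z; case: w. Qed.
Lemma ReN z : Re (- z) = - Re z. Proof. by case: z. Qed.
Lemma ImN z : Im (- z) = - Im z. Proof. by case: z. Qed.
Lemma ReB z w : Re (z - w) = Re z - Re w. Proof. by rewrite ReD ReN. Qed.
Lemma ImB z w : Im (z - w) = Im z - Im w. Proof. by rewrite ImD ImN. Qed.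
Lemma ReM z w : Re (z * w) = Re z * Re w - Im z * Im w.
Proof. by case: z; case: w. Qed.
Lemma ImM z w : Im (z * w) = Re z * Im w + Im z * Re w.
Proof. by case: z => a b; case: w => c e. Qed.

(** The squared modulus is kept as a polynomial in the real and imaginary parts, so that [ring]
    settles identities and measurability is immediate. *)
Definition nsq z : R := Re z ^+ 2 + Im z ^+ 2.

Lemma nsqE z : nsq z = normc z ^+ 2.
Proof. by case: z => a b; rewrite /nsq /= sqr_sqrtr// addr_ge0// sqr_ge0. Qed.

Lemma nsq_ge0 z : 0 <= nsq z. Proof. by rewrite addr_ge0// sqr_ge0. Qed.

Lemma nsq0 : nsq 0 = 0. Proof. by rewrite /nsq /= expr0n addr0. Qed.

Lemma nsqM z w : nsq (z * w) = nsq z * nsq w.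
Proof. by rewrite /nsq ReM ImM; ring. Qed.

Lemma nsqN z : nsq (- z) = nsq z.
Proof. by rewrite /nsq ReN ImN !sqrrN. Qed.

Lemma nsq_real (x : R) : nsq x%:C%C = x ^+ 2.
Proof. by rewrite /nsq /= expr0n addr0. Qed.

Lemma nsqD_le z w : nsq (z + w) <= 2 * nsq z + 2 * nsq w.
Proof.
rewrite /nsq ReD ImD -subr_ge0.
have -> : 2 * (Re z ^+ 2 + Im z ^+ 2) + 2 * (Re w ^+ 2 + Im w ^+ 2) -
  ((Re z + Re w) ^+ 2 + (Im z + Im w) ^+ 2) =
  (Re z - Re w) ^+ 2 + (Im z - Im w) ^+ 2 by ring.
by rewrite addr_ge0// sqr_ge0.
Qed.

Lemma nsq_eq0 z : nsq z = 0 -> z = 0.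
Proof.
case: z => a b; rewrite /nsq /= => /eqP; rewrite paddr_eq0 ?sqr_ge0//.
by rewrite !sqrf_eq0 => /andP[/eqP -> /eqP ->].
Qed.

Lemma Re_nsq z : Re z ^+ 2 <= nsq z. Proof. by rewrite /nsq lerDl sqr_ge0. Qed.
Lemma Im_nsq z : Im z ^+ 2 <= nsq z. Proof. by rewrite /nsq lerDr sqr_ge0. Qed.

(** Weighted arithmetic-geometric inequality. The weight stays free, so that the term of a fixed
    quantity can be made small at the expense of the other. *)
Lemma sqr_dist_le (t a b : R) : 0 < t ->
  2 * `|a * b| <= t * a ^+ 2 + t^-1 * b ^+ 2.
Proof.
move=> t0; rewrite -subr_ge0 normrM.
have -> : t * a ^+ 2 + t^-1 * b ^+ 2 - 2 * (`|a| * `|b|) =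
    t * (`|a| - t^-1 * `|b|) ^+ 2.
  rewrite -(real_normK (num_real a)) -(real_normK (num_real b)).
  by field; exact: lt0r_neq0.
by rewrite mulr_ge0// ?sqr_ge0// ltW.
Qed.

Lemma nsq_dist_le (t : R) z w : 0 < t ->
  `|nsq z - nsq w| <= t * nsq w + (1 + t^-1) * nsq (z - w).
Proof.
move=> t0; have h1 := sqr_dist_le (Re w) (Re (z - w)) t0.
have h2 := sqr_dist_le (Im w) (Im (z - w)) t0.
have -> : nsq z - nsq w = nsq (z - w) + 2 * (Re w * Re (z - w)) +
    2 * (Im w * Im (z - w)) by rewrite /nsq !ReB !ImB; ring.
apply: (le_trans (ler_normD _ _)).
apply: (@le_trans _ _ (nsq (z - w) + 2 * `|Re w * Re (z - w)| +
   2 * `|Im w * Im (z - w)|)).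
  have n2 (a : R) : 2 * `|a| = `|2 * a| by rewrite normrM normr_nat.
  rewrite !n2 lerD2r; apply: (le_trans (ler_normD _ _)).
  by rewrite lerD2r ger0_norm ?nsq_ge0.
by rewrite [in leRHS]/nsq mulrDl mul1r {1}/nsq; lra.
Qed.

Lemma normc_le_nsq z : normc z <= 1 + nsq z.
Proof.
have n0 : 0 <= normc z by case: z => a b; exact: sqrtr_ge0.
rewrite nsqE; nra.
Qed.

Lemma normc_ge0 z : 0 <= normc z. Proof. by case: z => a b; exact: sqrtr_ge0. Qed.

Lemma normc_real (x : R) : normc x%:C%C = `|x|.
Proof. by rewrite /= expr0n addr0 sqrtr_sqr. Qed.

Lemma normcN z : normc (- z) = normc z.
Proof. by case: z => a b; rewrite /= !sqrrN. Qed.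

Lemma normcD z w : normc (z + w) <= normc z + normc w.
Proof.
have := @lec_normD R z w.
by rewrite /lec /= !addr0 eqxx.
Qed.

Lemma Re_normc z : `|Re z| <= normc z.
Proof.
by rewrite -(@ler_pXn2r _ 2) ?nnegrE ?normc_ge0// real_normK ?num_real// -nsqE Re_nsq.
Qed.

Lemma Im_normc z : `|Im z| <= normc z.
Proof.
by rewrite -(@ler_pXn2r _ 2) ?nnegrE ?normc_ge0// real_normK ?num_real// -nsqE Im_nsq.
Qed.

Lemma nsq_expi (t : R) : nsq (expi t) = 1.
Proof. by rewrite /nsq /= cos2Dsin2. Qed.

Lemma normc_expi (t : R) : normc (expi t) = 1.
Proof. by rewrite /= cos2Dsin2 sqrtr1. Qed.

Lemma expiD (s t : R) : expi (s + t) = expi s * expi t.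
Proof.
apply/eqP; rewrite eq_complex /= cosD sinD eqxx /=.
by apply/eqP; ring.
Qed.

Lemma expi0 : expi (0 : R) = 1.
Proof. by rewrite /expi cos0 sin0. Qed.

Lemma expiN (t : R) : expi (- t) = (expi t)^*%C.
Proof. by rewrite /expi cosN sinN. Qed.

End SquareModulus.

Section ComplexMeasurable.
Context d (T : measurableType d) (R : realType).
Implicit Types (f g : T -> R[i]).

Lemma cmeasurable_cst (c : R[i]) : cmeasurable (fun _ : T => c).
Proof. by split; exact: measurable_cst. Qed.

Lemma cmeasurableD f g : cmeasurable f -> cmeasurable g ->
  cmeasurable (fun x => f x + g x).
Proof.
move=> [f1 f2] [g1 g2]; split.
  by under eq_fun do rewrite ReD; exact: measurable_funD.
by under eq_fun do rewrite ImD; exact: measurable_funD.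
Qed.

Lemma cmeasurableN f : cmeasurable f -> cmeasurable (fun x => - f x).
Proof.
move=> [f1 f2]; split.
  by under eq_fun do rewrite ReN; exact: mcompT.
by under eq_fun do rewrite ImN; exact: mcompT.
Qed.

Lemma cmeasurableB f g : cmeasurable f -> cmeasurable g ->
  cmeasurable (fun x => f x - g x).
Proof. by move=> mf mg; apply: cmeasurableD => //; exact: cmeasurableN. Qed.

Lemma cmeasurableM f g : cmeasurable f -> cmeasurable g ->
  cmeasurable (fun x => f x * g x).
Proof.
move=> [f1 f2] [g1 g2]; split.
  under eq_fun do rewrite ReM.
  by apply: measurable_funB; exact: measurable_funM.
under eq_fun do rewrite ImM.
by apply: measurable_funD; exact: measurable_funM.
Qed.

Lemma cmeasurable_sum (I : Type) (s : seq I) (F : I -> T -> R[i]) :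
  (forall i, cmeasurable (F i)) -> cmeasurable (fun x => \sum_(i <- s) F i x).
Proof.
move=> mF; elim: s => [|i s ih].
  by under eq_fun do rewrite big_nil; exact: cmeasurable_cst.
by under eq_fun do rewrite big_cons; exact: cmeasurableD.
Qed.

Lemma cmeasurable_conj f : cmeasurable f -> cmeasurable (fun x => (f x)^*%C).
Proof.
move=> [f1 f2]; split.
  by rewrite (_ : (fun _ => _) = (fun x => Re (f x)))//; apply/funext => x; case: (f x).
rewrite (_ : (fun _ => _) = (fun x => - Im (f x))); first exact: mcompT.
by apply/funext => x; case: (f x).
Qed.

Lemma cmeasurable_real (f : T -> R) : mfunT f ->
  cmeasurable (fun x => (f x)%:C%C).
Proof. by move=> mf; split => //=; exact: measurable_cst. Qed.

Lemma cmeasurable_expi (f : T -> R) : mfunT f ->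
  cmeasurable (fun x => expi (f x)).
Proof.
by move=> mf; split => /=; apply: mcompT => //;
  apply: continuous_measurable_fun; [exact: continuous_cos|exact: continuous_sin].
Qed.

Lemma measurable_nsq f : cmeasurable f -> mfunT (fun x => nsq (f x)).
Proof. by move=> [f1 f2]; apply: measurable_funD; exact: measurable_funX. Qed.

Lemma measurable_normc f : cmeasurable f ->
  mfunT (fun x => normc (f x)).
Proof.
move=> mf; have -> : (fun x => normc (f x)) = (fun x => Num.sqrt (nsq (f x))).
  by apply/funext => x; rewrite nsqE sqrtr_sqr ger0_norm// normc_ge0.
under eq_fun do rewrite -powR12_sqrt ?nsq_ge0//.
exact: (mcompT (@measurable_powR R 2^-1) (measurable_nsq mf)).
Qed.

End ComplexMeasurable.

Lemma cmeasurable_comp d1 d2 (T1 : measurableType d1) (T2 : measurableType d2)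
    (R : realType) (f : T2 -> R[i]) (h : T1 -> T2) :
  cmeasurable f -> mfunT h -> cmeasurable (fun x => f (h x)).
Proof.
move=> [f1 f2] mh; split; first exact: (mcompT f1 mh).
exact: (mcompT f2 mh).
Qed.

Section NonnegativeIntegral.
Local Open Scope ereal_scope.
Context d (T : measurableType d) (R : realType) (mu : {measure set T -> \bar R}).
Implicit Types f g : T -> R.

Lemma integral_EFinZ (c : R) f : (0 <= c)%R -> mfunT f ->
  (forall x, 0 <= f x)%R -> \int[mu]_x (c * f x)%:E = c%:E * \int[mu]_x (f x)%:E.
Proof.
move=> c0 mf f0; rewrite -ge0_integralZl//.
- exact/mEFinP.
- by move=> x _; rewrite lee_fin.
Qed.

Lemma integral_EFinD f g : mfunT f -> mfunT g ->
  (forall x, 0 <= f x)%R -> (forall x, 0 <= g x)%R ->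
  \int[mu]_x (f x + g x)%:E = \int[mu]_x (f x)%:E + \int[mu]_x (g x)%:E.
Proof.
move=> mf mg f0 g0; rewrite -ge0_integralD//.
- by move=> x _; rewrite lee_fin.
- exact/mEFinP.
- by move=> x _; rewrite lee_fin.
- exact/mEFinP.
Qed.

Lemma integral_EFin_le f g : mfunT f -> mfunT g ->
  (forall x, 0 <= f x)%R -> (forall x, f x <= g x)%R ->
  \int[mu]_x (f x)%:E <= \int[mu]_x (g x)%:E.
Proof.
move=> mf mg f0 fg; apply: ge0_le_integral => //.
- by move=> x _; rewrite lee_fin.
- exact/mEFinP.
- exact/mEFinP.
- by move=> x _; rewrite lee_fin.
Qed.

End NonnegativeIntegral.

(** * Squared L2 norms *)

Section SquareIntegral.
Local Open Scope ereal_scope.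
Context d (T : measurableType d) (R : realType) (mu : {measure set T -> \bar R}).
Implicit Types f g : T -> R[i].

Definition csq f : \bar R := \int[mu]_x (nsq (f x))%:E.

Lemma csq_ge0 f : 0 <= csq f.
Proof. by apply: integral_ge0 => x _; rewrite lee_fin nsq_ge0. Qed.

Lemma cnorm2E f : cnorm2 mu f = csq f `^ 2^-1.
Proof.
rewrite /cnorm2 /norm2 unlock /csq; congr (_ `^ _).
apply: eq_integral => x _ /=; rewrite ger0_norm ?normc_ge0//.
by rewrite powR_mulrn ?normc_ge0// nsqE.
Qed.

Lemma cnorm2_ge0 f : 0 <= cnorm2 mu f.
Proof. by rewrite cnorm2E poweR_ge0. Qed.

Lemma cnorm2_lty f : cnorm2 mu f < +oo <-> csq f < +oo.
Proof.
rewrite cnorm2E; split; last exact: poweR_lty.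
by apply: lty_poweRy; rewrite gt_eqF// invr_gt0.
Qed.

Lemma cnorm2_to0 (f_ : nat -> T -> R[i]) f :
  cnorm2 mu (f_ n - f)%R @[n --> \oo] --> 0 <->
  to0 (fun n => csq (fun x => f_ n x - f x)%R).
Proof.
rewrite -to0P; last by move=> n; exact: cnorm2_ge0.
rewrite -(@to0_half _ (fun n => csq (fun x => f_ n x - f x)%R)); last first.
  by move=> n; exact: csq_ge0.
by under eq_fun do rewrite cnorm2E.
Qed.

Lemma norm2E (f : T -> R) : norm2 mu f = (\int[mu]_x (f x ^+ 2)%:E) `^ 2^-1.
Proof.
rewrite /norm2 unlock; congr (_ `^ _).
apply: eq_integral => x _ /=.
by rewrite powR_mulrn// real_normK// num_real.
Qed.

Lemma csq_real (f : T -> R) : csq (fun x => (f x)%:C%C) = \int[mu]_x (f x ^+ 2)%:E.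
Proof. by apply: eq_integral => x _; rewrite nsq_real. Qed.

Lemma norm2_to0 (f_ : nat -> T -> R) (f : T -> R) :
  norm2 mu (f_ n - f)%R @[n --> \oo] --> 0 <->
  to0 (fun n => \int[mu]_x ((f_ n x - f x)%R ^+ 2)%:E).
Proof.
rewrite -to0P; last by move=> n; rewrite norm2E poweR_ge0.
rewrite -(@to0_half _ (fun n => \int[mu]_x ((f_ n x - f x)%R ^+ 2)%:E)); last first.
  by move=> n; apply: integral_ge0 => x _; rewrite lee_fin sqr_ge0.
by under eq_fun do rewrite norm2E.
Qed.

Lemma Lfun2P (f : T -> R) : f \in Lfun mu 2%:E <->
  mfunT f /\ \int[mu]_x (f x ^+ 2)%:E < +oo.
Proof.
rewrite inE /Lfun; split.
  move=> /andP[/= mf]; rewrite !inE in mf *; rewrite /finite_norm /= => h.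
  split; first exact: mf.
  have := h; rewrite -/(norm2 mu f) norm2E.
  by apply: lty_poweRy; rewrite gt_eqF// invr_gt0.
move=> [mf h]; apply/andP; split; rewrite !inE//=.
by rewrite /finite_norm -/(norm2 mu f) norm2E; exact: poweR_lty.
Qed.

Lemma Lfun1P (f : T -> R) : f \in Lfun mu 1 <-> integrableT mu f.
Proof.
split; first by move/Lfun1_integrable.
by move=> fi; apply/Lfun1_integrable.
Qed.

Lemma csqD_le f g : cmeasurable f -> cmeasurable g ->
  csq (fun x => f x + g x)%R <= 2%:E * csq f + 2%:E * csq g.
Proof.
move=> mf mg.
have [nf ng] : mfunT (fun x => nsq (f x)) /\
    mfunT (fun x => nsq (g x)) by split; exact: measurable_nsq.
have n0 (z : R[i]) : (0 <= 2 * nsq z)%R by rewrite mulr_ge0// nsq_ge0.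
rewrite /csq -!integral_EFinZ//; try by move=> x; exact: nsq_ge0.
rewrite -integral_EFinD//; last 2 first.
- exact: measurable_funM.
- exact: measurable_funM.
apply: integral_EFin_le => //.
- by apply: measurable_nsq; exact: cmeasurableD.
- by apply: measurable_funD; exact: measurable_funM.
- by move=> x; exact: nsq_ge0.
- by move=> x; exact: nsqD_le.
Qed.

Lemma csqN f : csq (fun x => - f x)%R = csq f.
Proof. by apply: eq_integral => x _; rewrite nsqN. Qed.

Lemma csqB f g : csq (fun x => f x - g x)%R = csq (fun x => g x - f x)%R.
Proof. by rewrite -csqN; apply: eq_integral => x _; rewrite opprB. Qed.

Lemma csqZ (c : R[i]) f : cmeasurable f ->
  csq (fun x => c * f x)%R = (nsq c)%:E * csq f.
Proof.
move=> mf; rewrite /csq -ge0_integralZl//; last 3 first.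
- by apply/mEFinP/measurable_nsq.
- by move=> x _; rewrite lee_fin nsq_ge0.
- by rewrite lee_fin nsq_ge0.
by apply: eq_integral => x _; rewrite nsqM EFinM.
Qed.

Lemma csqB_le f g : cmeasurable f -> cmeasurable g ->
  csq (fun x => f x - g x)%R <= 2%:E * csq f + 2%:E * csq g.
Proof. by move=> mf mg; rewrite -(csqN g); apply: csqD_le => //; exact: cmeasurableN. Qed.

Lemma csqB_tri f g h : cmeasurable f -> cmeasurable g -> cmeasurable h ->
  csq (fun x => f x - g x)%R <=
    2%:E * csq (fun x => f x - h x)%R + 2%:E * csq (fun x => g x - h x)%R.
Proof.
move=> mf mg mh; rewrite [in leLHS](_ : (fun _ => _) =
    (fun x => (f x - h x) - (g x - h x))%R).
  by apply: csqB_le; exact: cmeasurableB.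
by apply/funext => x; rewrite opprB addrA subrK.
Qed.

Lemma ae_csq f g : cmeasurable f -> cmeasurable g ->
  {ae mu, forall x, f x = g x} -> csq f = csq g.
Proof.
move=> mf mg fg; apply: ge0_ae_eq_integral => //.
- by apply/mEFinP/measurable_nsq.
- by apply/mEFinP/measurable_nsq.
- by move=> x _; rewrite lee_fin nsq_ge0.
- by move=> x _; rewrite lee_fin nsq_ge0.
- by apply: filterS fg => x -> _.
Qed.

Lemma csq0_ae f : cmeasurable f -> csq f <= 0 -> {ae mu, forall x, f x = 0%R}.
Proof.
move=> mf f0.
have : {ae mu, forall x, (nsq (f x))%:E = 0}.
  apply: integral_eq0_ae => //.
    by apply/mEFinP/measurable_nsq.
  by move=> x; rewrite lee_fin nsq_ge0.
by apply: filterS => x [/nsq_eq0].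
Qed.

Lemma csqB_lty f g : cmeasurable f -> cmeasurable g ->
  csq f < +oo -> csq g < +oo -> csq (fun x => f x - g x)%R < +oo.
Proof.
move=> mf mg foo goo; apply: le_lt_trans (csqB_le mf mg) _.
by rewrite lte_add_pinfty// lte_mul_pinfty// ?csq_ge0 ?lee_fin.
Qed.

Lemma csqD_lty f g : cmeasurable f -> cmeasurable g ->
  csq f < +oo -> csq g < +oo -> csq (fun x => f x + g x)%R < +oo.
Proof.
move=> mf mg foo goo; apply: le_lt_trans (csqD_le mf mg) _.
by rewrite lte_add_pinfty// lte_mul_pinfty// ?csq_ge0 ?lee_fin.
Qed.

(** Integrate [nsq_dist_le]: the weight is small against the norm of the limit, then the rank is
    large against the weight. *)
Lemma csq_to0_L1 (f_ : nat -> T -> R[i]) f : (forall n, cmeasurable (f_ n)) ->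
  cmeasurable f -> csq f < +oo -> to0 (fun n => csq (fun x => f_ n x - f x)%R) ->
  to0 (fun n => \int[mu]_x `|nsq (f_ n x) - nsq (f x)|%:E).
Proof.
move=> mf_ mf foo h e e0.
pose c := fine (csq f).
have c0 : (0 <= c)%R by rewrite fine_ge0// csq_ge0.
have cE : csq f = c%:E by rewrite /c fineK// ge0_fin_numE// csq_ge0.
(* Half of [e] pays for [t] times the squared norm of the limit; [c + 1] covers a vanishing
   limit. *)
pose t := (e / (2 * (c + 1)))%R.
have c1 : (0 < c + 1)%R by rewrite ltr_wpDl.
have t0 : (0 < t)%R by rewrite divr_gt0// mulr_gt0.
have k0 : (0 <= 1 + t^-1)%R by rewrite addr_ge0// invr_ge0 ltW.
have /(_ (e / 2)%R)[|n0 hn0] := to0Z (fun n => csq_ge0 _) k0 h; first by rewrite divr_gt0.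
exists n0 => n /hn0 {}hn0.
apply: (@le_lt_trans _ _ (t%:E * csq f +
    (1 + t^-1)%:E * csq (fun x => f_ n x - f x)%R)).
  have mn : mfunT (fun x => nsq (f x)) by exact: measurable_nsq.
  have mn3 : mfunT (fun x => nsq (f_ n x - f x)%R).
    by apply: measurable_nsq; exact: cmeasurableB.
  have t0' := ltW t0.
  rewrite /csq -!integral_EFinZ//; try by move=> x; exact: nsq_ge0.
  rewrite -integral_EFinD//; last 4 first.
  - exact: measurable_funM.
  - exact: measurable_funM.
  - by move=> x; rewrite mulr_ge0// nsq_ge0.
  - by move=> x; rewrite mulr_ge0// nsq_ge0.
  apply: integral_EFin_le => //.
  - apply/mcompT => //.
    by apply: measurable_funB; exact: measurable_nsq.
  - by apply: measurable_funD; exact: measurable_funM.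
  - by move=> x; exact: nsq_dist_le.
have -> : e%:E = (e / 2)%:E + (e / 2)%:E by rewrite -EFinD -splitr.
rewrite cE; apply: lteD => //.
rewrite -EFinM lte_fin.
have -> : (t * c = e / 2 * (c / (c + 1)))%R by rewrite /t; field; exact: lt0r_neq0.
by rewrite gtr_pMr ?divr_gt0// ltr_pdivrMr// mul1r ltrDl.
Qed.

Lemma csq_lty_lim (f_ : nat -> T -> R[i]) f : (forall n, cmeasurable (f_ n)) ->
  cmeasurable f -> (forall n, csq (f_ n) < +oo) ->
  to0 (fun n => csq (fun x => f_ n x - f x)%R) -> csq f < +oo.
Proof.
move=> mf_ mf foo h; have [n0 /(_ n0 (leqnn _)) hn0] := h 1%R ltr01.
have -> : csq f = csq (fun x => f_ n0 x - (f_ n0 x - f x))%R.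
  by apply: eq_integral => x _; rewrite opprB addrCA subrr addr0.
apply: csqB_lty => //; first exact: cmeasurableB.
by rewrite (lt_trans hn0)// ltry.
Qed.

Lemma csq_cvg (f_ : nat -> T -> R[i]) f : (forall n, cmeasurable (f_ n)) ->
  cmeasurable f -> (forall n, csq (f_ n) < +oo) ->
  to0 (fun n => csq (fun x => f_ n x - f x)%R) ->
  fine (csq (f_ n)) @[n --> \oo] --> fine (csq f).
Proof.
move=> mf_ mf foo h; have foo' := csq_lty_lim mf_ mf foo h.
apply/cvgrPdist_lt => e e0.
have [n0 hn0] := csq_to0_L1 mf_ mf foo' h e0.
exists n0 => // n /= /hn0 hn; rewrite -lte_fin; apply: le_lt_trans hn.
have i1 g : cmeasurable g -> csq g < +oo ->
    integrableT mu (fun x => nsq (g x)).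
  move=> mg goo; apply/integrableP; split.
    by apply/mEFinP/measurable_nsq.
  by under eq_integral do rewrite /= ger0_norm ?nsq_ge0//.
rewrite distrC; apply: (@le_trans _ _
   (`|\int[mu]_x ((nsq (f_ n x))%:E - (nsq (f x))%:E)|)); last first.
  apply: le_trans (le_abse_integral _ _ _) _ => //.
  by apply: emeasurable_funB; apply/mEFinP/measurable_nsq.
rewrite integralB//; [|exact: i1|exact: i1].
rewrite -/(csq (f_ n)) -/(csq f).
by rewrite -[X in `|X - _|%E]fineK ?ge0_fin_numE ?csq_ge0// -[X in `|_ - X|%E]fineK ?ge0_fin_numE ?csq_ge0.
Qed.

End SquareIntegral.

(** * Completeness of L2 *)

Section Completeness.
Context d (T : measurableType d) (R : realType) (mu : {measure set T -> \bar R}).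

(** Along a subsequence the squared increments integrate to at most 4^-k. Weighted by 2^k they are
    summable almost everywhere, and an increment is at most 2^-k plus 2^k times its square, so the
    telescoping series converges absolutely. Fatou's lemma turns the pointwise limit into an L2
    limit of the whole sequence. *)
Lemma L2_complete (f : nat -> T -> R) : (forall n, mfunT (f n)) ->
  cauchy0 (fun m n => \int[mu]_x ((f m x - f n x) ^+ 2)%:E)%E ->
  exists2 g : T -> R, mfunT g &
    to0 (fun n => \int[mu]_x ((f n x - g x) ^+ 2)%:E)%E.
Proof.
move=> mf cf.
have e_gt0 k : 0 < 2^-1 ^+ k * 2^-1 ^+ k :> R.
  by rewrite mulr_gt0// exprn_gt0// invr_gt0.
have [phi [nphi phiS phiP]] := subseq_fast e_gt0 cf.
pose g k := f (phi k).
have mg k : mfunT (g k) by exact: mf.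
pose S x := (\sum_(k <oo) ((2 ^+ k : R) * (g k.+1 x - g k x) ^+ 2)%:E)%E.
have mgd k : mfunT (fun x => (g k.+1 x - g k x) ^+ 2).
  by apply: measurable_funX; exact: measurable_funB.
have mgd2 k : mfunT (fun x => (2 ^+ k : R) * (g k.+1 x - g k x) ^+ 2).
  exact: measurable_funM.
have h0 k x : 0 <= (2 ^+ k : R) * (g k.+1 x - g k x) ^+ 2.
  by apply: mulr_ge0; [exact: exprn_ge0|exact: sqr_ge0].
have Soo : {ae mu, forall x, (S x < +oo)%E}.
  apply: to0_integral_ae.
  - by move=> k; exact/mEFinP.
  - by move=> k x; rewrite lee_fin.
  - apply: sum_half_lty => k.
      by apply: integral_ge0 => x _; rewrite lee_fin.
    rewrite integral_EFinZ//; last by move=> x; exact: sqr_ge0.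
    apply: (@le_trans _ _ ((2 ^+ k)%:E * (2^-1 ^+ k * 2^-1 ^+ k)%:E)%E).
      by apply: lee_wpmul2l; [rewrite lee_fin exprn_ge0|exact: phiP].
    by rewrite -EFinM mulrA -exprMn divff// expr1n mul1r.
have gcvg x : (S x < +oo)%E -> cvgn (g ^~ x).
  move=> Sx; have h : cvgn (series (fun k => 2^-1 ^+ k + (2 ^+ k : R) * (g k.+1 x - g k x) ^+ 2)).
    rewrite (_ : (fun k => _) = (geometric 1 2^-1) +
        (fun k => (2 ^+ k : R) * (g k.+1 x - g k x) ^+ 2)); last first.
      by apply/funext => k; rewrite -[X in X + _]mul1r.
    rewrite seriesD; apply: is_cvgD.
      by apply: is_cvg_geometric_series; rewrite ger0_norm// invf_lt1// ltr1n.
    exact: nnseries_is_cvg.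
  have : cvgn (series (telescope (g ^~ x))).
    apply: normed_cvg; apply: series_le_cvg h => k.
    - exact: normr_ge0.
    - by rewrite addr_ge0// exprn_ge0// invr_ge0.
    - have p0 : (0 : R) < 2 ^+ k by rewrite exprn_gt0.
      have := sqr_dist_le 1 (g k.+1 x - g k x) (divr_gt0 ltr01 p0).
      rewrite mul1r /telescope expr1n div1r invrK exprVn mulr1 => h2.
      apply: le_trans h2; apply: (@le_trans _ _ (1 * `|g k.+1 x - g k x|)).
        by rewrite mul1r.
      by rewrite ler_wpM2r// ler1n.
  rewrite telescopeK => /cvg_ex[l gl]; apply/cvg_ex; exists (l + g 0%N x).
  rewrite (_ : g^~ x = (fun n => (g n x - g 0%N x) + g 0%N x)).
    by apply: cvgD => //; exact: cvg_cst.
  by apply/funext => n; rewrite subrK.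
have [N [mN N0 NS]] := Soo.
(* The value 0 on the null set makes the modified sequence converge everywhere, so that the limit is
   measurable. *)
pose G x := if x \in N then 0 else limn (g ^~ x).
have Gcvg x : ~ N x -> g n x @[n --> \oo] --> G x.
  move=> Nx; rewrite /G memNset//; apply: gcvg.
  by apply: contrapT => h; apply: Nx; exact: NS.
have mG : mfunT G.
  apply: (@measurable_fun_cvg _ _ _ _ (fun n x => if x \in N then 0 else g n x)).
    move=> n; apply: measurable_fun_ifT => //.
    apply: (measurable_fun_bool true); rewrite setTI.
    rewrite (_ : _ @^-1` _ = N)//; apply/seteqP; split => x /=.
      by move/set_mem.
    by move/mem_set.
  move=> x _; have [xN|xN] := boolP (x \in N).
    by rewrite /G xN; exact: cvg_cst.
  by apply: Gcvg; rewrite notin_setE in xN.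
exists G => // e e0.
have [n0 hn0] := cf _ (divr_gt0 e0 (ltr0n _ 2)).
exists n0 => n n0n; apply: (@le_lt_trans _ _ (e / 2)%:E); last first.
  by rewrite lte_fin ltr_pdivrMr// ltr_pMr// ltr1n.
apply: (@fatou_le _ _ _ _ (fun k x => ((f n x - g k x) ^+ 2)%:E)).
- move=> k; apply/mEFinP/measurable_funX.
  exact: measurable_funB.
- by move=> k x; rewrite lee_fin sqr_ge0.
- by apply/mEFinP/measurable_funX; exact: measurable_funB.
- by move=> x; rewrite lee_fin sqr_ge0.
- exists N; split => // x /= h; apply: contrapT => /Gcvg cvx; apply: h.
  apply: cvg_EFin; first exact: nearW.
  apply: (@cvg_comp _ _ _ (fun k => f n x - g k x) (fun y => y ^+ 2)); last first.
    exact: exprn_continuous.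
  by apply: cvgB => //; exact: cvg_cst.
- exists n0 => k n0k; apply: ltW; apply: hn0 => //.
  exact: leq_trans n0k (nphi k).
Qed.

Lemma csq_ReIm (f : T -> R[i]) : cmeasurable f ->
  csq mu f = (\int[mu]_x ((Re (f x)) ^+ 2)%:E + \int[mu]_x ((Im (f x)) ^+ 2)%:E)%E.
Proof.
move=> [mf1 mf2]; rewrite -integral_EFinD//.
- exact: measurable_funX.
- exact: measurable_funX.
- by move=> x; exact: sqr_ge0.
- by move=> x; exact: sqr_ge0.
Qed.

Lemma csq_complete (f : nat -> T -> R[i]) : (forall n, cmeasurable (f n)) ->
  cauchy0 (fun m n => csq mu (fun x => f m x - f n x)) ->
  exists2 g, cmeasurable g & to0 (fun n => csq mu (fun x => f n x - g x)).
Proof.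
move=> mf cf.
have mB m n : cmeasurable (fun x => f m x - f n x) by exact: cmeasurableB.
have [|g1 mg1 h1] := @L2_complete (fun n x => Re (f n x)) (fun n => (mf n).1).
  move=> e /cf[n0 h]; exists n0 => m n mm nn; apply: le_lt_trans (h _ _ mm nn).
  apply: integral_EFin_le.
  - by apply: measurable_funX; apply: measurable_funB; exact: (mf _).1.
  - exact: measurable_nsq.
  - by move=> x; exact: sqr_ge0.
  - by move=> x; rewrite -ReB Re_nsq.
have [|g2 mg2 h2] := @L2_complete (fun n x => Im (f n x)) (fun n => (mf n).2).
  move=> e /cf[n0 h]; exists n0 => m n mm nn; apply: le_lt_trans (h _ _ mm nn).
  apply: integral_EFin_le.
  - by apply: measurable_funX; apply: measurable_funB; exact: (mf _).2.
  - exact: measurable_nsq.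
  - by move=> x; exact: sqr_ge0.
  - by move=> x; rewrite -ImB Im_nsq.
exists (fun x => g1 x +i* g2 x)%C => //.
apply: to0_le (to0D h1 h2) => n; rewrite csq_ReIm; last exact: cmeasurableB.
under eq_integral do rewrite ReB/=.
by under [X in (_ + X <= _)%E]eq_integral do rewrite ImB/=.
Qed.

Lemma L2M_integrable (f g : T -> R) :
  mfunT f -> (\int[mu]_x (f x ^+ 2)%:E < +oo)%E ->
  mfunT g -> (\int[mu]_x (g x ^+ 2)%:E < +oo)%E ->
  integrableT mu (fun x => f x * g x).
Proof.
move=> mf foo mg goo.
have mfg : mfunT (fun x => f x * g x) by exact: measurable_funM.
apply/integrableP; split; first exact/mEFinP.
apply: (@le_lt_trans _ _ (\int[mu]_x (f x ^+ 2 + g x ^+ 2)%:E)%E); last first.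
  rewrite integral_EFinD//; first exact: lte_add_pinfty.
  - exact: measurable_funX.
  - exact: measurable_funX.
  - by move=> x; exact: sqr_ge0.
  - by move=> x; exact: sqr_ge0.
apply: (@integral_EFin_le _ _ _ _ (fun x => `|f x * g x|)).
- exact: mcompT.
- by apply: measurable_funD; exact: measurable_funX.
- by [].
- move=> x; have := sqr_dist_le (f x) (g x) ltr01; rewrite mul1r invr1 mul1r.
  by apply: le_trans; rewrite ler_peMl// ler1n.
Qed.

End Completeness.

(** * Real inner products *)

Section InnerProduct.
Context d (T : measurableType d) (R : realType) (mu : {measure set T -> \bar R}).
Implicit Types f g h : T -> R.

Definition sqint f := mfunT f /\ (\int[mu]_x (f x ^+ 2)%:E < +oo)%E.
Definition ip f g : R := \int[mu]_x (f x * g x).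

Lemma sqint_ip f g : sqint f -> sqint g ->
  integrableT mu (fun x => f x * g x).
Proof. by move=> [mf f2] [mg g2]; exact: L2M_integrable. Qed.

Lemma sqint_lin a f g : sqint f -> sqint g -> sqint (fun x => a * f x + g x).
Proof.
move=> [mf f2] [mg g2]; have ma : mfunT (fun x => a * f x) by exact: measurable_funM.
split; first exact: measurable_funD.
have h1 : (\int[mu]_x ((a * f x) ^+ 2)%:E < +oo)%E.
  under eq_integral do rewrite exprMn.
  rewrite integral_EFinZ; [|exact: sqr_ge0|exact: measurable_funX|by move=> x; exact: sqr_ge0].
  by apply: lte_mul_pinfty => //; rewrite lee_fin sqr_ge0.
have := csqD_lty (mu := mu) (cmeasurable_real ma) (cmeasurable_real mg).
rewrite (csq_real _ g) csq_real => /(_ h1 g2).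
under eq_fun do rewrite -rmorphD /=.
by rewrite csq_real.
Qed.

Lemma ipC f g : ip f g = ip g f.
Proof. by apply: eq_Rintegral => x _; rewrite mulrC. Qed.

Lemma ip_lin a f g h : sqint f -> sqint g -> sqint h ->
  ip (fun x => a * f x + g x) h = a * ip f h + ip g h.
Proof.
move=> hf hg hh; have i1 := sqint_ip hf hh; have i2 := sqint_ip hg hh.
rewrite /ip -RintegralZl// -RintegralD//.
  by apply: eq_Rintegral => x _; rewrite mulrDl mulrA.
by have := integrableZl measurableT a i1; apply: eq_integrable.
Qed.

Lemma ip_ge0 f : 0 <= ip f f.
Proof. by apply: Rintegral_ge0 => x _; rewrite -expr2 sqr_ge0. Qed.

Lemma ipE f : sqint f -> ((ip f f)%:E = \int[mu]_x (f x ^+ 2)%:E)%E.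
Proof.
move=> [mf f2]; rewrite /ip /Rintegral; under eq_integral do rewrite -expr2.
by rewrite fineK// ge0_fin_numE// integral_ge0// => x _; rewrite lee_fin sqr_ge0.
Qed.

Lemma ip_sqr a f g : sqint f -> sqint g ->
  ip (fun x => a * f x + g x) (fun x => a * f x + g x) =
  a ^+ 2 * ip f f + 2 * a * ip f g + ip g g.
Proof.
move=> hf hg; have hw := sqint_lin a hf hg.
rewrite ip_lin// (ipC f (fun x => a * f x + g x)) (ipC g (fun x => a * f x + g x)).
by rewrite !ip_lin// (ipC g f); ring.
Qed.

(** Weighted Cauchy-Schwarz inequality, from the nonnegative squared norms of [s f + g] and
    [- s f + g]. *)
Lemma ip_norm_le (s : R) f g : 0 < s -> sqint f -> sqint g ->
  `|ip f g| <= (s * ip f f + s^-1 * ip g g) / 2.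
Proof.
move=> s0 hf hg; have := ip_ge0 (fun x => s * f x + g x).
have := ip_ge0 (fun x => - s * f x + g x); rewrite !ip_sqr//.
move: (ip f f) (ip f g) (ip g g) => a b c h1 h2.
have E : s * (s * a + s^-1 * c) = s ^+ 2 * a + c by field; rewrite gt_eqF.
by rewrite ler_norml; apply/andP; split; rewrite -(ler_pM2l s0) ?mulrN mulrA E; lra.
Qed.

Lemma ip_dist (s : R) f g : 0 < s -> sqint f -> sqint g ->
  2 * ip f g <= s * ip f f + s^-1 * ip g g.
Proof.
move=> s0 hf hg; have := ip_norm_le s0 hf hg; have := ler_norm (ip f g); lra.
Qed.

Lemma L2M_cvg (f_ : nat -> T -> R) (f g : T -> R) :
  (forall n, mfunT (f_ n)) ->
  (forall n, \int[mu]_x (f_ n x ^+ 2)%:E < +oo)%E ->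
  mfunT f -> (\int[mu]_x (f x ^+ 2)%:E < +oo)%E ->
  mfunT g -> (\int[mu]_x (g x ^+ 2)%:E < +oo)%E ->
  to0 (fun n => \int[mu]_x ((f_ n x - f x) ^+ 2)%:E)%E ->
  (\int[mu]_x (f_ n x * g x)) @[n --> \oo] --> \int[mu]_x (f x * g x).
Proof.
move=> mf_ f_oo mf foo mg goo h.
have sg : sqint g by []. have sf : sqint f by [].
have sn n : sqint (f_ n) by split.
have c1 : 0 < ip g g + 1 by rewrite ltr_wpDl// ip_ge0.
apply/cvgrPdist_lt => e e0; pose s := e / (ip g g + 1).
have s0 : 0 < s by rewrite divr_gt0.
have [n0 hn0] := h _ (mulr_gt0 s0 e0); exists n0 => // n /= /hn0.
have sD := sqint_lin (-1) sf (sn n).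
have -> : (\int[mu]_x ((f_ n x - f x) ^+ 2)%:E =
    (ip (fun x => -1 * f x + f_ n x) (fun x => -1 * f x + f_ n x))%:E)%E.
  by rewrite ipE//; apply: eq_integral => x _; rewrite mulN1r addrC.
rewrite lte_fin => hD; rewrite -/(ip f g) -/(ip (f_ n) g) distrC.
have -> : ip (f_ n) g - ip f g = ip (fun x => -1 * f x + f_ n x) g.
  by rewrite ip_lin// mulN1r addrC.
apply: le_lt_trans (@ip_norm_le s^-1 _ _ _ sD sg) _; first by rewrite invr_gt0.
have h1 : s^-1 * ip (fun x => -1 * f x + f_ n x) (fun x => -1 * f x + f_ n x) < e.
  by rewrite mulrC ltr_pdivrMr// mulrC.
have h2 : s * ip g g < e by rewrite /s mulrAC ltr_pdivrMr// mulrDr mulr1 ltrDl.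
by rewrite invrK ltr_pdivrMr// mulr_natr mulr2n ltrD.
Qed.

End InnerProduct.

(** * Configurations and the Mecke formula *)

Section Configurations.
Context dX (X : measurableType dX) (R : realType).
Local Notation config := (config X R).

(* unlike [add_point], the sum is jointly measurable *)
Definition add_atom (x : X) (w : config) : config := Config (config_add_atomic w x).

Lemma add_atomE x w B : add_atom x w B = (w B + \d_x B)%E.
Proof. exact: measure_addE. Qed.

Lemma measurable_config_eval (B : set X) : measurable B ->
  mfunT (fun w : config => (w B : \bar R)).
Proof.
move=> mB _ Y mY; apply: sub_sigma_algebra; exists B => //.
by exists Y.
Qed.

Lemma measurable_to_config d (T : measurableType d) (f : T -> config) :
  (forall B, measurable B -> mfunT (fun t => (f t B : \bar R))) ->
  mfunT f.
Proof.
move=> mf; apply: measurability; first by [].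
move=> _ [_ [B mB [Y mY <-]] <-].
have := mf B mB measurableT Y mY; rewrite !setTI.
by congr (measurable _).
Qed.

Lemma measurable_add_atom : mfunT (fun z : config * X => add_atom z.2 z.1).
Proof.
apply: measurable_to_config => B mB.
under eq_fun do rewrite add_atomE.
apply: emeasurable_funD.
  exact: (mcompT (measurable_config_eval mB) measurable_fst).
exact: (mcompT (measurable_fun_dirac mB) measurable_snd).
Qed.

Lemma measurable_add_atom_pair :
  mfunT (fun z : config * X => (add_atom z.2 z.1, z.2)).
Proof.
by apply: measurable_fun_pair => //; exact: measurable_add_atom.
Qed.

(** The mass is a series of zeros and ones: if it is finite its terms are eventually smaller than 1,
    hence zero, and a finite count remains. *)
Lemma config_nat (w : config) (B : set X) : measurable B ->
  w B = +oo%E \/ exists k : nat, w B = k%:R%:E.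
Proof.
move=> mB; have [alive [x ->//]] := config_atomic w; rewrite /dirac_sum.
pose b n := (`[< alive n >] && (x n \in B)).
have uE n : (if `[< alive n >] then \d_(x n) B else 0)%E = ((b n)%:R : R)%:E.
  by rewrite /b diracE; case: asboolP.
under eq_eseriesr do rewrite uE.
have b0 n : (0 <= (nat_of_bool (b n))%:R%:E :> \bar R)%E by rewrite lee_fin.
have [|soo] := eqVneq (\sum_(n <oo) ((b n)%:R : R)%:E)%E +oo%E; first by left.
right; have : (\sum_(n <oo) ((b n)%:R : R)%:E < +oo)%E by rewrite ltey.
move=> /(nneseries_lty_to0 b0)/(_ 1 ltr01)[n0 hn0].
exists (\sum_(i < n0) b i)%N.
have := @nneseries_split R (fun n => ((b n)%:R : R)%:E) 0 n0 (fun k _ => b0 k).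
rewrite add0n => ->; rewrite eseries0 ?adde0; last first.
  by move=> k n0k _; have := hn0 k n0k; case: (b k) => //; rewrite ltxx.
by rewrite big_mkord sumEFin -natr_sum.
Qed.

End Configurations.

(** * Integration over the enumerated atoms *)

Section Atoms.
Context dX (X : measurableType dX) (R : realType).
Local Notation config := (config X R).
Variables (P : probability config R).
Variables (alive : nat -> set config) (atom : nat -> config -> X).
Hypothesis atoms_N : atom_enumeration P alive atom.

Definition good_atoms (w : config) := forall B, measurable B ->
  w B = dirac_sum R (fun n => alive n w) (fun n => atom n w) B.

Lemma good_atoms_integral (w : config) (f : X -> \bar R) : good_atoms w ->
  mfunT f -> (forall x, 0 <= f x)%E ->
  (\int[w]_x f x = \sum_(n <oo) if `[< alive n w >] then f (atom n w) else 0)%E.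
Proof.
move=> gw mf f0.
pose m : {measure set X -> \bar R} := mseries (fun n => if `[< alive n w >]
  then \d_(atom n w) : {measure set X -> \bar R} else mzero) 0.
transitivity (\int[m]_x f x)%E.
  apply: eq_measure_integral => A mA _.
  change (w A = \sum_(0 <= n <oo) (if `[< alive n w >]
    then \d_(atom n w) : {measure set X -> \bar R} else mzero) A)%E.
  rewrite gw//; apply: eq_eseriesr => n _; by case: asboolP.
rewrite ge0_integral_measure_series//; apply: eq_eseriesr => n _.
case: asboolP => _; last by rewrite integral_measure_zero.
by rewrite integral_dirac// diracT mul1e.
Qed.

(** Each atom carries mass at least 1, so it cannot lie in a set that is null for [w]. *)
Lemma good_atoms_ae (w : config) (Q : X -> Prop) n : good_atoms w ->
  {ae (w : {measure set X -> \bar R}), forall x, Q x} -> alive n w -> Q (atom n w).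
Proof.
move=> gw [N [mN N0 QN]] an; apply: contrapT => nQ.
have NN : atom n w \in N by rewrite inE; exact: QN.
have := gw N mN; rewrite N0 => /esym N0'.
have : (1%:E <= dirac_sum R (fun n => alive n w) (fun n => atom n w) N)%E.
  rewrite /dirac_sum (@nneseriesD1 _ _ n)//; last by move=> k; case: ifP.
  rewrite asboolT// diracE NN leeDl// nneseries_ge0// => k _ _.
  by case: ifP.
by rewrite N0' lee_fin ler10.
Qed.

End Atoms.

(** * The pi-system of count events *)

Section CountEvents.
Context dX (X : measurableType dX) (R : realType).
Local Notation config := (config X R).
Variable nu : {sigma_finite_measure set X -> \bar R}.

Definition count_event (S : Type) (B : S -> set X) (k : S -> nat) : set config :=
  [set w | forall s, w (B s) = (k s)%:R%:E].

(** The pi-system on which laws and measures are compared. Finite measure of the sets keeps the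
    counts finite almost surely and their laws given by Poisson weights. *)
Definition count_events : set (set config) :=
  [set A | exists n (B : 'I_n -> set X) (k : 'I_n -> nat),
    (forall i, measurable (B i) /\ (nu (B i) < +oo)%E) /\ A = count_event B k].

Lemma measurable_count_event (S : finType) (B : S -> set X) k :
  (forall i, measurable (B i)) -> measurable (count_event B k).
Proof.
move=> mB; rewrite (_ : count_event B k =
    \bigcap_(i in [set: S]) [set w : config | w (B i) = (k i)%:R%:E]).
  apply: fin_bigcap_measurable => // i _.
  have := measurable_config_eval (R := R) (mB i) measurableT
    (emeasurable_set1 ((k i)%:R%:E)).
  by rewrite setTI.
by apply/seteqP; split => w h i; [move=> _|]; exact: h.
Qed.

Lemma count_events_measurable A : count_events A -> measurable A.
Proof.
by move=> [n [B [k [mB ->]]]]; apply: measurable_count_event => i; case: (mB i).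
Qed.

Lemma count_events_setI : setI_closed count_events.
Proof.
move=> _ _ [n [B [k [mB ->]]]] [m [C [j [mC ->]]]].
exists (n + m)%N, (fun i : 'I_(n + m) => match fintype.split i with inl a => B a | inr b => C b end),
  (fun i : 'I_(n + m) => match fintype.split i with inl a => k a | inr b => j b end); split.
  by move=> i; case: fintype.split.
apply/seteqP; split => [w [h1 h2] i /=|w h].
  by case: fintype.split => a; [exact: h1|exact: h2].
split => a.
  by have := h (lshift m a); case: splitP => [b /= /ord_inj <-//|b /= ab];
    have := ltn_ord a; rewrite ab ltnNge leq_addr.
by have := h (rshift n a); case: splitP => [b /= ab|b /= /addnI/ord_inj <-//];
    have := ltn_ord b; rewrite -ab ltnNge leq_addr.
Qed.

Lemma count_eventsT : count_events setT.
Proof.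
exists 0%N, (fun=> set0), (fun=> 0%N); split; first by case.
by apply/seteqP; split => // w _; case.
Qed.

(** For [B] of finite measure, [w B] is an integer or infinite, and the infinite case is the
    complement of countably many count events. A general [B] is cut along a countable partition of
    [X] into sets of finite measure, and [w B] is the corresponding series. *)
Lemma measurable_count_eventsE : @measurable _ config = <<s count_events >>.
Proof.
apply/seteqP; split; last first.
  apply: smallest_sub; first exact: sigma_algebra_measurable.
  by move=> A; exact: count_events_measurable.
pose T' := g_sigma_algebraType count_events.
have fin_mE (B : set X) : measurable B -> (nu B < +oo)%E ->
    measurable_fun (setT : set T') (fun w : T' => (w : config) B : \bar R).
  move=> mB Boo _ Y mY; rewrite setTI.
  have mk (k : nat) : measurable [set w : T' | (w : config) B = k%:R%:E].
    apply: sub_sigma_algebra; exists 1%N, (fun=> B), (fun=> k); split => //.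
    by apply/seteqP; split => [w h i|w h] /=; [exact: h|exact: (h ord0)].
  pose U := \bigcup_(k in [set k : nat | Y k%:R%:E]) [set w : T' | (w : config) B = k%:R%:E].
  pose V := ~` (\bigcup_k [set w : T' | (w : config) B = k%:R%:E]).
  have mU : measurable U by apply: bigcup_measurable => k _.
  have mV : measurable V by apply: measurableC; apply: bigcupT_measurable.
  have VE w : V w <-> (w : config) B = +oo%E.
    split => [Vw|wB [k _ /= h]]; last by move: wB; rewrite h.
    by have [//|[k kE]] := config_nat w mB; exfalso; apply: Vw; exists k.
  have [Yoo|Yoo] := pselect (Y +oo%E).
    rewrite (_ : _ @^-1` Y = U `|` V); first exact: measurableU.
    apply/seteqP; split => [w /= Yw|w /= [[k Yk /= ->]//|/VE ->//]].
    have [/VE|[k kE]] := config_nat w mB; [by right|left; exists k => //=].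
    by rewrite -kE.
  rewrite (_ : _ @^-1` Y = U)//.
  apply/seteqP; split => [w /= Yw|w /= [k Yk /= ->]//].
  have [wB|[k kE]] := config_nat w mB; first by rewrite wB in Yw.
  by exists k => //=; rewrite -kE.
apply: smallest_sub.
  exact: smallest_sigma_algebra.
move=> _ [B mB [Y mY <-]].
have [F [FT tF Foo]] : exists F : (set X)^nat, [/\ \bigcup_i F i = setT,
    trivIset setT F & forall i, measurable (F i) /\ (nu (F i) < +oo)%E].
  have [F FT Foo] := sigma_finiteT nu.
  exists (seqDU F); split.
  - by rewrite -seqDU_bigcup_eq.
  - exact: trivIset_seqDU.
  - move=> i; have mF j : measurable (F j) by case: (Foo j).
    have mD : measurable (seqDU F i).
      by apply: measurableD => //; apply: bigsetU_measurable.
    split => //.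
    apply: le_lt_trans (Foo i).2; apply: le_measure; rewrite ?inE//.
    exact: subset_seqDU.
have mw : measurable_fun (setT : set T') (fun w : T' => (w : config) B : \bar R).
  rewrite (_ : (fun _ => _) = fun w : T' => (\sum_(n <oo) (w : config) (B `&` F n))%E).
    apply: ge0_emeasurable_sum => // n _; apply: fin_mE.
      by apply: measurableI => //; case: (Foo n).
    apply: le_lt_trans (Foo n).2; apply: le_measure; rewrite ?inE//.
    - by apply: measurableI => //; case: (Foo n).
    - by case: (Foo n).
  apply/funext => w; rewrite -measure_semi_bigcup//.
  - by rewrite -setI_bigcupr FT setIT.
  - by move=> n; apply: measurableI => //; case: (Foo n).
  - exact: trivIset_setIl.
  - by rewrite -setI_bigcupr FT setIT.
by have := mw measurableT Y mY; rewrite setTI.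
Qed.

End CountEvents.

(** * Mecke formula on count events *)

Section Mecke.
Context dX (X : measurableType dX) (R : realType).
Local Notation config := (config X R).
Variables (nu : {sigma_finite_measure set X -> \bar R}) (P : probability config R).
Hypothesis law_N : poisson_law nu P.

Definition poisson_weight (l : \bar R) (k : nat) : R :=
  expR (- fine l) * fine l ^+ k / k`!%:R.

Lemma poisson_weightS (l : \bar R) k :
  k.+1%:R * poisson_weight l k.+1 = fine l * poisson_weight l k.
Proof.
rewrite /poisson_weight factS natrM exprS.
by field; rewrite nat1r !pnatr_eq0 -lt0n fact_gt0.
Qed.

Lemma poisson_disjoint (S : finType) (C : S -> set X) (k : S -> nat) :
  (forall s, measurable (C s) /\ (nu (C s) < +oo)%E) ->
  (forall s t, s != t -> C s `&` C t = set0) ->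
  P (count_event (R := R) C k) = (\prod_s poisson_weight (nu (C s)) (k s))%:E.
Proof.
move=> mC dC.
have h := @poisson_indep _ _ _ _ _ law_N _ (fun i : 'I_#|S| => C (enum_val i))
  (fun i => (k (enum_val i))%:R%:E) (fun i => (mC (enum_val i)).1).
transitivity (P [set w | forall i : 'I_#|S|,
    w (C (enum_val i)) = (k (enum_val i))%:R%:E]).
  congr (P _); apply/seteqP; split => [w h1 i|w h1 s]; first exact: h1.
  by have := h1 (enum_rank s); rewrite enum_rankK.
rewrite h; last by move=> i j ij; apply: dC; rewrite (inj_eq enum_val_inj).
rewrite -prodEFin; apply: (etrans (y := (\prod_(s in S)
  (poisson_weight (nu (C s)) (k s))%:E)%E)); last by apply: eq_bigl.
rewrite [RHS]big_enum_val; apply: eq_bigr => i _.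
by apply: (poisson_fin law_N); [exact: (mC _).1|exact: (mC _).2].
Qed.

Variables (m1 m2 : {measure set (config * X) -> \bar R}).
Hypothesis m1E : forall A B, measurable A -> measurable B ->
  (m1 (A `*` B) = \int[P]_w ((\1_A w)%:E * (w : {measure set X -> \bar R}) B))%E.
Hypothesis m2E : forall A B, measurable A -> measurable B ->
  (m2 (A `*` B) = \int[P]_w \int[nu]_x ((\1_A (add_atom x w) : R)%:E * (\1_B x)%:E))%E.

(** On the event, [w (C t)] is the constant [k t], so the left side is [k t] times a probability. On
    the right the added atom lies in [C t] and raises that count alone by one. Both sides agree
    because (j+1) p(j+1) = lambda p(j) for the Poisson weights. *)
Lemma mecke_disjoint (S : finType) (C : S -> set X) (k : S -> nat) (t : S) :
  (forall s, measurable (C s) /\ (nu (C s) < +oo)%E) ->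
  (forall s u, s != u -> C s `&` C u = set0) ->
  m1 (count_event C k `*` C t) = m2 (count_event C k `*` C t).
Proof.
move=> mC dC; have mA := measurable_count_event k (fun s => (mC s).1) (R := R).
have [mCt Coo] := mC t.
rewrite m1E// m2E//.
have -> : (\int[P]_w ((\1_(count_event C k) w)%:E * w (C t)) =
    ((k t)%:R : R)%:E * P (count_event C k))%E.
  under eq_integral => w _.
    rewrite (_ : _ * _ = ((k t)%:R : R)%:E * (\1_(count_event C k) w)%:E)%E; last first.
      rewrite indicE; have [/set_mem wA|] := boolP (w \in count_event C k).
        by rewrite (wA t) muleC.
      by rewrite mul0e mule0.
    over.
  rewrite ge0_integralZl//; last by apply/mEFinP; exact: measurable_indic.
  by rewrite integral_indic// setIT.
have mF : mfunT (fun z : config * X =>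
    ((\1_(count_event C k) (add_atom z.2 z.1) : R)%:E * (\1_(C t) z.2)%:E)%E).
  apply: emeasurable_funM; apply/mEFinP.
    exact: (mcompT (measurable_indic _) (@measurable_add_atom _ _ _)).
  exact: (mcompT (measurable_indic _) measurable_snd).
rewrite (fubini_tonelli (fun z : config * X =>
    ((\1_(count_event C k) (add_atom z.2 z.1) : R)%:E * (\1_(C t) z.2)%:E)%E))//.
(* Counts before the atom is added in [C t]; when [k t] is 0 no configuration qualifies, whence the
   factor [(0 < k t)] below. *)
pose k' s := if s == t then (k s).-1 else k s.
have mA' := measurable_count_event k' (fun s => (mC s).1) (R := R).
have inE x (w : config) : C t x -> (add_atom x w \in count_event C k) =
    (0 < k t)%N && (w \in count_event C k').
  move=> Ctx.
  have dE s : (\d_x (C s) : \bar R) = (s == t)%:R%:E.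
    rewrite diracE; congr (_%:R%:E)%E; have [->|st] := eqVneq s t; first by rewrite mem_set.
    rewrite memNset// => Csx; have := dC _ _ st.
    by rewrite -subset0 => /(_ x); apply.
  apply/idP/idP.
    move=> /set_mem h; have := h t; rewrite add_atomE dE eqxx => ht.
    have kt : (0 < k t)%N.
      rewrite -(ltr_nat R) -lte_fin -ht; apply: (@lt_le_trans _ _ 1%:E).
        by rewrite lte_fin.
      by rewrite leeDr.
    rewrite kt; apply/mem_set => s; have := h s; rewrite add_atomE dE /k'.
    have [->|st] := eqVneq s t; last by rewrite adde0.
    move=> /(congr1 (fun y => y - 1%:E)%E); rewrite addeK// => ->.
    by rewrite -EFinB -subn1 natrB.
  move=> /andP[kt /set_mem h]; apply/mem_set => s; rewrite add_atomE dE (h s) /k'.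
  have [->|st] := eqVneq s t; last by rewrite adde0.
  by rewrite -EFinD -natrD addn1 prednK.
transitivity (\int[nu]_x (((0 < k t)%N%:R : R)%:E * P (count_event C k') * (\1_(C t) x)%:E))%E; last first.
  apply: eq_integral => x _; rewrite [in RHS](eq_integral (fun w =>
    (((0 < k t)%N%:R * \1_(C t) x : R)%:E * (\1_(count_event C k') w)%:E)%E)); last first.
    move=> w _; rewrite !indicE; have [/set_mem Ctx|] := boolP (x \in C t); last first.
      by rewrite mulr0 mul0e mule0.
    by rewrite inE// mulr1 mule1 -EFinM; case: (0 < k t)%N => /=;
      rewrite ?mul1r ?mul0r.
  rewrite ge0_integralZl//.
  - by rewrite integral_indic// setIT EFinM -!muleA; congr (_ * _)%E; rewrite muleC.
  - by apply/mEFinP; exact: measurable_indic.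
rewrite ge0_integralZl//; last 2 first.
- by apply/mEFinP; exact: measurable_indic.
- by rewrite mule_ge0// lee_fin.
rewrite integral_indic// setIT !poisson_disjoint//.
rewrite (bigD1 t)//= [in RHS](bigD1 t)//=.
have -> : nu (C t) = (fine (nu (C t)))%:E by rewrite fineK// ge0_fin_numE.
rewrite -!EFinM; congr (_%:E).
rewrite (eq_bigr (fun s => poisson_weight (nu (C s)) (k' s))); last first.
  by move=> s /negbTE st; rewrite /k' st.
rewrite /k' eqxx; case: (k t) => [|j]; first by rewrite !mul0r.
by rewrite mul1r mulrA poisson_weightS /=; ring.
Qed.

(** Overlapping sets are cut into the cells of the partition they generate. The event is then a
    finite disjoint union, over the count vectors of the cells compatible with [k] and over the cell
    of the extra point, of the events treated by [mecke_disjoint]. *)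
Lemma mecke_partition n (B : 'I_n -> set X) (k : 'I_n -> nat) (i0 : 'I_n) :
  (forall i, measurable (B i) /\ (nu (B i) < +oo)%E) ->
  m1 (count_event B k `*` B i0) = m2 (count_event B k `*` B i0).
Proof.
move=> mB; pose S : finType := {ffun 'I_n -> bool}.
(* Cells indexed by membership vectors. Requiring some [s i] empties the outer cell, whose measure
   may be infinite. *)
pose C (s : S) : set X := [set x | (exists i, s i) /\ forall i, B i x <-> s i].
(* A common bound for the counts of all cells, so that the count vectors range over a finite
   type. *)
pose K := (\sum_i k i)%N.
have kK i : (k i <= K)%N by rewrite /K (bigD1 i)//= leq_addr.
have CB (s : S) i : s i -> C s `<=` B i by move=> si x [_ /(_ i)[_]]; exact.
have mC s : measurable (C s).
  have [[i si]|ns] := pselect (exists i, s i); last first.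
    by rewrite (_ : C s = set0)//; apply/seteqP; split => // x [].
  rewrite (_ : C s = \bigcap_(i in [set: 'I_n]) (if s i then B i else ~` B i)).
    apply: fin_bigcap_measurable => // j _; case: ifP => _; first exact: (mB j).1.
    by apply: measurableC; exact: (mB j).1.
  apply/seteqP; split => [x [_ h] j _|x h].
    by have := h j; case: (s j) => [[_]|[h' _]]; [apply|move=> /h'].
  split; first by exists i.
  by move=> j; have := h j I; case: (s j) => //= nB; split.
have Coo s : (nu (C s) < +oo)%E.
  have [[i si]|ns] := pselect (exists i, s i).
    apply: le_lt_trans (mB i).2; apply: le_measure; rewrite ?inE//; last exact: CB.
    exact: (mB i).1.
  by rewrite (_ : C s = set0) ?measure0//; apply/seteqP; split => // x [].
have dC s u : s != u -> C s `&` C u = set0.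
  move=> /eqP su; apply/seteqP; split => // x [[_ h1] [_ h2]]; apply: su.
  by apply/ffunP => i; apply/idP/idP => [/h1/h2|/h2/h1].
have Cx i x : B i x -> exists2 s : S, C s x & s i.
  move=> Bx; exists [ffun j => `[< B j x >]]; last by rewrite ffunE asboolT.
  by split; [exists i; rewrite ffunE asboolT|move=> j; rewrite ffunE asboolE].
have BE i (w : config) : w (B i) = (\sum_(s \in [set s : S | s i]) w (C s))%E.
  rewrite -measure_fin_bigcup//.
  - congr (w _); apply/seteqP; split => [x /Cx[s Csx si]|x [s si]]; first by exists s.
    exact: CB.
  - exact: finite_finset.
  - by apply/trivIsetP => s u _ _; exact: dC.
pose D := [set p : {ffun S -> 'I_K.+1} * S | is_true (p.2 i0) /\
  forall i, (\sum_(s \in [set s : S | s i]) ((p.1 s)%:R : R)) = (k i)%:R].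
pose G (p : {ffun S -> 'I_K.+1} * S) : set (config * X) :=
  count_event C (fun s => p.1 s : nat) `*` C p.2.
have -> : count_event B k `*` B i0 = \bigcup_(p in D) G p.
  apply/seteqP; split => [[w x] [/= wB /Cx[t Ct ti]]|[w x] [[j t] [/= ti jk] [/= h Ct]]].
    have wC s : exists2 j : 'I_K.+1, w (C s) = (nat_of_ord j)%:R%:E & True.
      have [[i si]|ns] := pselect (exists i, s i); last first.
        exists ord0 => //; rewrite (_ : C s = set0) ?measure0//.
        by apply/seteqP; split => // y [].
      have le : (w (C s) <= (k i)%:R%:E)%E.
        by rewrite -wB; apply: le_measure; rewrite ?inE//; [exact: (mB i).1|exact: CB].
      have [woo|[j jE]] := config_nat w (mC s); first by rewrite woo in le.
      rewrite jE lee_fin ler_nat in le.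
      have jK : (j < K.+1)%N by rewrite ltnS (leq_trans le).
      by exists (Ordinal jK).
    have [f fP] := choice (fun s => let: ex_intro2 j a b := wC s in ex_intro _ j a).
    exists ([ffun s => f s], t); last by split => //= s; rewrite ffunE.
    split => //= i; apply/EFin_inj; rewrite -(wB i) BE -fsumEFin; last exact: finite_finset.
    by apply: eq_fsbigr => s _; rewrite ffunE fP.
  split => /=; last exact: (CB t).
  move=> i; rewrite BE -jk -fsumEFin; last exact: finite_finset.
  by apply: eq_fsbigr => s _; rewrite h.
have tG : trivIset D G.
  move=> [j t] [j' t'] _ _ [[w x] [[/= h1 Ct] [/= h2 Ct']]].
  have tt' : t = t'.
    apply/eqP; apply/negPn/negP => /dC; rewrite -subset0 => /(_ x); apply.
    by split.
  congr pair => //; apply/ffunP => s; apply/ord_inj/eqP.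
  by rewrite -(eqr_nat R); apply/eqP/EFin_inj; rewrite -h1 -h2.
have mG p : D p -> measurable (G p).
  move=> _; apply: measurableX => //; exact: measurable_count_event.
have fD : finite_set D by exact: finite_finset.
rewrite !measure_fin_bigcup//.
by apply: eq_fsbigr => p _; apply: mecke_disjoint.
Qed.

End Mecke.

(** * Mecke formula: extension to all measurable sets *)

Section MeckeFormula.
Local Open Scope ereal_scope.
Context dX (X : measurableType dX) (R : realType).
Local Notation config := (config X R).
Variables (nu : {sigma_finite_measure set X -> \bar R}) (P : probability config R).
Hypothesis law_N : poisson_law nu P.

Lemma poisson_weight_sum (l : \bar R) : 0 <= l ->
  \sum_(k <oo) (poisson_weight l k)%:E = 1.
Proof.
move=> l0; rewrite [RHS](_ : _ = (expR (- fine l))%:E * (expR (fine l))%:E); last first.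
  by rewrite -EFinM expRN mulVf ?gt_eqF ?expR_gt0.
have f0 : (0 <= fine l)%R by rewrite fine_ge0.
under eq_eseriesr do rewrite /poisson_weight -mulrA EFinM.
rewrite nneseriesZl/=; last first.
  by move=> n _; rewrite lee_fin divr_ge0// exprn_ge0.
congr *%E; rewrite expRE -EFin_lim; last first.
  rewrite /pseries/=; under eq_fun do rewrite mulrC.
  exact: is_cvg_series_exp_coeff.
apply/congr_lim/funext => n/=; rewrite /pseries/= /series/= -sumEFin//.
by under eq_bigr do rewrite mulrC.
Qed.

(** The Poisson weights already sum to 1, which leaves no mass for an infinite count. *)
Lemma poisson_lty (D : set X) : measurable D -> nu D < +oo ->
  P [set w | w D = +oo] = 0.
Proof.
move=> mD Doo; pose E (k : nat) := [set w : config | w D = k%:R%:E].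
have mE k : measurable (E k).
  have := measurable_config_eval (R := R) mD measurableT
    (emeasurable_set1 ((k%:R)%:E)).
  by rewrite setTI.
transitivity (P (~` \bigcup_k E k)).
  congr (P _); apply/seteqP; split => [w wD [k _]|w h]; first by rewrite /E /= wD.
  by have [//|[k kE]] := config_nat w mD; exfalso; apply: h; exists k.
rewrite probability_setC; last exact: bigcupT_measurable.
rewrite measure_semi_bigcup//; last 2 first.
- apply/trivIsetP => i j _ _ ij; apply/seteqP; split => // w [].
  rewrite /E /= => -> [] /eqP.
  by rewrite eqr_nat (negbTE ij).
- exact: bigcupT_measurable.
rewrite (eq_eseriesr (g := fun k => (poisson_weight (nu D) k)%:E)); last first.
  by move=> k _; exact: (poisson_fin law_N mD Doo k).
by rewrite poisson_weight_sum ?subee.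
Qed.

Variables (m1 m2 : {measure set (config * X) -> \bar R}).
Hypothesis m1E : forall A B, measurable A -> measurable B ->
  m1 (A `*` B) = \int[P]_w ((\1_A w)%:E * (w : {measure set X -> \bar R}) B).
Hypothesis m2E : forall A B, measurable A -> measurable B ->
  m2 (A `*` B) = \int[P]_w \int[nu]_x ((\1_A (add_atom x w) : R)%:E * (\1_B x)%:E).

(** [D] joins the family as an extra set, and its count [K] is summed over; the event of an infinite
    count is null for both measures. *)
Lemma mecke_rectangle A D : count_events (R := R) nu A -> measurable D ->
  nu D < +oo -> m1 (A `*` D) = m2 (A `*` D).
Proof.
move=> [n [B [k [mB ->]]]] mD Doo.
have mA : measurable (count_event (R := R) B k).
  by apply: measurable_count_event => i; case: (mB i).
set A' := count_event B k in mA *.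
pose B' (i : 'I_n.+1) := if unlift ord0 i is Some j then B j else D.
pose k' K (i : 'I_n.+1) := if unlift ord0 i is Some j then k j else K.
pose E (K : nat) := [set w : config | w D = K%:R%:E].
have mB' i : measurable (B' i) /\ nu (B' i) < +oo.
  by rewrite /B'; case: (unlift ord0 i).
have EE K : A' `&` E K = count_event B' (k' K).
  apply/seteqP; split => [w [h1 h2] i|w h].
    by rewrite /B' /k'; case: (unlift ord0 i) => [j|]; [exact: h1|exact: h2].
  split; last by have := h ord0; rewrite /B' /k' unlift_none.
  by move=> j; have := h (lift ord0 j); rewrite /B' /k' liftK.
pose Eoo := [set w : config | w D = +oo].
have mEoo : measurable Eoo.
  have := measurable_config_eval (R := R) mD measurableT
    (emeasurable_set1 +oo).
  by rewrite setTI.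
have mE K : measurable (A' `&` E K).
  by rewrite EE; apply: measurable_count_event => i; case: (mB' i).
have dec : A' `*` D = (\bigcup_K ((A' `&` E K) `*` D)) `|` ((A' `&` Eoo) `*` D).
  apply/seteqP; split => [[w x] [/= wA Dx]|[w x] [[K _ [/= [wA _] Dx]]|[/= [wA _] Dx]]//].
  have [woo|[K KE]] := config_nat w mD; first by right.
  by left; exists K.
have tE : trivIset setT (fun K => (A' `&` E K) `*` D).
  apply/trivIsetP => i j _ _ ij; apply/seteqP; split => // -[w x].
  move=> [[/= [_ h1] _] [/= [_ h2] _]].
  by move: h2; rewrite /E /= h1 => -[] /eqP; rewrite eqr_nat (negbTE ij).
have Eoo0 : P Eoo = 0 by exact: poisson_lty.
have nEoo : {ae P, forall w, ~ Eoo w}.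
  by exists Eoo; split => // w /contrapT.
have decm (m : {measure set (config * X) -> \bar R}) :
    m ((A' `&` Eoo) `*` D) = 0 ->
    m (A' `*` D) = \sum_(K <oo) m ((A' `&` E K) `*` D).
  move=> m0; rewrite dec measureU.
  - transitivity (\sum_(K <oo) m ((A' `&` E K) `*` D) + 0); last by rewrite adde0.
    congr (_ + _)%E => //; apply: measure_semi_bigcup => //.
    + by move=> K; exact: measurableX.
    + by apply: bigcupT_measurable => K; exact: measurableX.
  - by apply: bigcupT_measurable => K; exact: measurableX.
  - by apply: measurableX => //; exact: measurableI.
  - apply/seteqP; split => // -[w x] [[K _ [/= [_ h1] _]] [/= [_ h2] _]].
    by move: h2; rewrite /Eoo /= h1.
rewrite !decm.
- apply: eq_eseriesr => K _; rewrite EE.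
  have := mecke_partition law_N m1E m2E (k' K) ord0 mB'.
  by have -> : B' ord0 = D by rewrite /B' unlift_none.
- rewrite m2E//; last exact: measurableI.
  rewrite -[RHS](integral0 P setT); apply: ae_eq_lower_integral => //.
    move=> w; apply: integral_ge0 => x _.
    by rewrite mule_ge0// lee_fin indicE.
  apply: filterS nEoo => w wD; apply: integral0_eq => x _.
  rewrite [X in X%:E * _]indicE memNset ?mul0e// => -[_]; rewrite /Eoo /= add_atomE.
  have [//|[K ->]] := config_nat w mD.
  by rewrite diracE.
- rewrite m1E//; last exact: measurableI.
  rewrite -[RHS](integral0 P setT); apply: ae_eq_lower_integral => //.
  apply: filterS nEoo => w wD.
  by rewrite indicE memNset ?mul0e// => -[_].
Qed.

(** Rectangles with a count event and a side of finite measure form a pi-system generating the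
    product sigma-field, and the strips [setT x F n] exhaust the space with finite mass. *)
Lemma mecke_unique Z : measurable Z -> m1 Z = m2 Z.
Proof.
move=> mZ; have [F FT Foo] := sigma_finiteT nu.
pose G := [set Z : set (config * X) | exists A, count_events (R := R) nu A /\
  exists D, [/\ measurable D, nu D < +oo & Z = A `*` D]].
have Feq n : m1 (setT `*` F n) = m2 (setT `*` F n).
  by apply: mecke_rectangle; [exact: count_eventsT|case: (Foo n)..].
apply: (@measure_unique _ _ _ G (fun n => setT `*` F n)) => //.
- rewrite measurable_prod_measurableType.
  apply/seteqP; split; last first.
    apply: smallest_sub; first exact: smallest_sigma_algebra.
    move=> _ [A [cA [D [mD _ ->]]]]; apply: sub_sigma_algebra.
    by exists A; [exact: count_events_measurable cA|exists D].
  apply: smallest_sub; first exact: smallest_sigma_algebra.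
  move=> _ [A mA [D mD <-]].
  have -> : A `*` D = (A `*` setT) `&` (setT `*` D).
    by rewrite -setXI setIT setTI.
  have FTX Y : Y = \bigcup_n (Y `&` F n) by rewrite -setI_bigcupr -FT setIT.
  apply: (@measurableI _ (g_sigma_algebraType G)).
  + rewrite (_ : A `*` setT = (fst : g_sigma_algebraType G -> config) @^-1` A); last first.
      by apply/seteqP; split => [[w x] []|[w x]].
    have : mfunT (fst : g_sigma_algebraType G -> config).
      apply: (measurability (count_events (R := R) nu)).
        exact: measurable_count_eventsE.
      move=> _ [C cC <-]; rewrite setTI.
      rewrite (_ : _ @^-1` C = \bigcup_n (C `*` F n)).
        apply: bigcupT_measurable => n; apply: sub_sigma_algebra.
        by exists C; split => //; exists (F n); case: (Foo n).
      apply/seteqP; split => [[w x] /= Cw|[w x] [n _ []]//].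
      have : setT x by []; rewrite FT => -[n _ Fnx].
      by exists n.
    by move=> /(_ measurableT A mA); rewrite setTI.
  + rewrite (FTX D) (_ : _ `*` _ = \bigcup_n (setT `*` (D `&` F n))); last first.
      by apply/seteqP; split => [[w x] [_ [n _ h]]|[w x] [n _ [_ h]]]; [exists n|split => //; exists n].
    apply: (@bigcupT_measurable _ (g_sigma_algebraType G)) => n.
    apply: sub_sigma_algebra; exists setT; split; first exact: count_eventsT.
    exists (D `&` F n); split => //; first by apply: measurableI => //; case: (Foo n).
    apply: le_lt_trans (Foo n).2; apply: le_measure; rewrite ?inE//.
      by apply: measurableI => //; case: (Foo n).
    by case: (Foo n).
- move=> _ _ [A [cA [D [mD Doo ->]]]] [A' [cA' [D' [mD' Doo' ->]]]].
  exists (A `&` A'); split; first exact: count_events_setI.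
  exists (D `&` D'); split; [exact: measurableI| |by rewrite setXI].
  apply: le_lt_trans Doo; apply: le_measure; rewrite ?inE//.
  exact: measurableI.
- move=> n; exists setT; split; first exact: count_eventsT.
  by exists (F n); case: (Foo n).
- apply/seteqP; split => // -[w x] _; have : setT x by [].
  by rewrite FT => -[n _ Fnx]; exists n.
- by move=> _ [A [cA [D [mD Doo ->]]]]; exact: mecke_rectangle.
- move=> n; rewrite Feq m2E//; last by case: (Foo n).
  have [mFn Fnoo] := Foo n.
  rewrite (eq_integral (fun _ => nu (F n))); last first.
    move=> w _; rewrite (eq_integral (fun x => (\1_(F n) x)%:E)).
      by rewrite integral_indic// setIT.
    by move=> x _; rewrite indicT mul1e.
  rewrite (_ : (\int[P]__ nu (F n)) = nu (F n))//.
  transitivity (nu (F n) * P setT); first exact: integral_cst.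
  by rewrite probability_setT mule1.
Qed.

End MeckeFormula.

Lemma ex_pushforward d1 d2 (T1 : measurableType d1) (T2 : measurableType d2)
    (R : realType) (mu : {measure set T1 -> \bar R}) (f : T1 -> T2) :
  mfunT f -> exists m : {measure set T2 -> \bar R},
    (forall A, m A = mu (f @^-1` A)) /\
    (forall g : T2 -> \bar R, mfunT g -> (forall y, 0 <= g y)%E ->
      (\int[m]_y g y = \int[mu]_x g (f x))%E).
Proof.
move=> mf; unshelve eexists (pushforward mu f); first exact: mf.
by split => // g mg g0; rewrite ge0_integral_pushforward.
Qed.

Lemma integral_mrestr d (T : measurableType d) (R : realType)
    (mu : {measure set T -> \bar R}) (D : set T) (mD : measurable D)
    (f : T -> \bar R) : mfunT f -> (forall x, 0 <= f x)%E ->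
  (\int[mrestr mu mD]_x f x = \int[mu]_x ((\1_D x)%:E * f x))%E.
Proof.
move=> mf f0; rewrite [LHS](@ge0_negligible_integral _ _ _ _ _ (~` D))//; last first.
- by rewrite /= /mrestr setICl measure0.
- exact: measurableC.
rewrite setTD setCK (@eq_measure_integral _ _ _ _ mu); last first.
  by move=> A mA AD; rewrite /= /mrestr setIidl.
rewrite integral_mkcond; apply: eq_integral => x _; rewrite patchE indicE.
by case: ifP => _; rewrite ?mul1e ?mul0e.
Qed.

Section SigmaFinitePack.
Context d (T : measurableType d) (R : realType) (m : {measure set T -> \bar R}).
Hypothesis sfm : sigma_finite setT m.

(** A copy of [m] that carries its sigma-finiteness as structure, as product measures and Fubini's
    theorem require. *)
Definition sigma_finite_pack of sigma_finite setT m : set T -> \bar R := m.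

HB.instance Definition _ := Measure.on (sigma_finite_pack sfm).
HB.instance Definition _ := Measure_isSigmaFinite.Build _ _ _ (sigma_finite_pack sfm) sfm.

Lemma ex_sigma_finite : exists m' : {sigma_finite_measure set T -> \bar R},
  forall A, m' A = m A.
Proof. by exists (sigma_finite_pack sfm). Qed.

End SigmaFinitePack.

(** * The Campbell measure P(dw) w(dx) *)

Section JointMeasure.
Local Open Scope ereal_scope.
Context dX (X : measurableType dX) (R : realType).
Local Notation config := (config X R).
Variables (nu : {sigma_finite_measure set X -> \bar R}) (P : probability config R).
Variables (alive : nat -> set config) (atom : nat -> config -> X).
Hypotheses (law_N : poisson_law nu P) (atoms_N : atom_enumeration P alive atom).

(** The Campbell measure in its two guises: image of P x [nu] under the addition of an atom, and
    random integral against [w]. That one measure satisfies both equations is the Mecke formula. *)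
Definition palm_measure (PN : {measure set (config * X) -> \bar R}) :=
  (forall f : config * X -> \bar R, mfunT f -> (forall z, 0 <= f z) ->
    \int[PN]_z f z = \int[P]_w \int[nu]_x f (add_atom x w, x)) /\
  (forall f : config * X -> \bar R, mfunT f -> (forall z, 0 <= f z) ->
    \int[PN]_z f z =
    \int[P]_w \int[(w : {measure set X -> \bar R})]_x f (w, x)).

(** The first equation defines an image measure. The second one defines the sum over [n] of the
    images of P, restricted to [alive n], under [w |-> (w, atom n w)]. They coincide by
    [mecke_unique], and sigma-finiteness is visible on the first. *)
Lemma palm_measure_exists : exists PN : {sigma_finite_measure set (config * X)%type -> \bar R},
  palm_measure PN.
Proof.
have mtau := @measurable_add_atom_pair _ X R.
have [m2 [m2E m2I]] := ex_pushforward (P \x nu) mtau.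
have matom n : mfunT (fun w : config => (w, atom n w)).
  by apply: measurable_fun_pair => //; exact: (atom_measurable atoms_N).
have [m1n /all_and2[m1nE m1nI]] :=
  choice (fun n => ex_pushforward (mrestr P (alive_measurable atoms_N n)) (matom n)).
pose m1 : {measure set (config * X)%type -> \bar R} := mseries m1n 0.
have m2F f : mfunT f -> (forall z, 0 <= f z) ->
    \int[m2]_z f z = \int[P]_w \int[nu]_x f (add_atom x w, x).
  move=> mf f0; rewrite m2I// (fubini_tonelli1 (fun z : config * X => f (add_atom z.2 z.1, z.2)))//.
  exact: (mcompT mf mtau).
have m1F f : mfunT f -> (forall z, 0 <= f z) ->
    \int[m1]_z f z = \int[P]_w \int[(w : {measure set X -> \bar R})]_x f (w, x).
  move=> mf f0; rewrite ge0_integral_measure_series//.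
  have mfa n : mfunT (fun w => f (w, atom n w)).
    exact: (mcompT mf (matom n)).
  have mfn n : mfunT (fun w : config =>
      (\1_(alive n) w : R)%:E * f (w, atom n w)).
    apply: emeasurable_funM => //; apply/mEFinP/measurable_indic.
    exact: (alive_measurable atoms_N).
  transitivity (\sum_(n <oo) \int[P]_w ((\1_(alive n) w : R)%:E * f (w, atom n w))).
    by apply: eq_eseriesr => n _; rewrite m1nI// integral_mrestr.
  rewrite -integral_nneseries//; last first.
    by move=> n w _; rewrite mule_ge0// lee_fin indicE.
  apply/esym/ae_eq_lower_integral => //.
  - by move=> w; exact: integral_ge0.
  - by move=> w; apply: nneseries_ge0 => n _ _; rewrite mule_ge0// lee_fin indicE.
  - apply: ge0_emeasurable_sum => // n w _ _.
    by rewrite mule_ge0// lee_fin indicE.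
  - apply: filterS (atomE atoms_N) => w gw.
    rewrite (@good_atoms_integral _ _ _ alive atom)//; last exact: (mcompT mf).
    apply: eq_eseriesr => n _; rewrite indicE.
    case: asboolP => an; first by rewrite mem_set// mul1e.
    by rewrite memNset// mul0e.
have m12 Z : measurable Z -> m1 Z = m2 Z.
  apply: (mecke_unique law_N) => A B mA mB.
  - have mAB : measurable (A `*` B) by exact: measurableX.
    transitivity (\int[m1]_z (\1_(A `*` B) z)%:E).
      by rewrite integral_indic// setIT.
    rewrite m1F//; last exact/mEFinP/measurable_indic.
    apply: eq_integral => w _; rewrite (eq_integral (fun x =>
      (\1_A w : R)%:E * (\1_B x)%:E)); last first.
      by move=> x _; rewrite !indicE in_setX -EFinM; case: (w \in A); case: (x \in B);
        rewrite ?mulr1 ?mul0r ?mulr0.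
    rewrite ge0_integralZl//.
    + by rewrite integral_indic// setIT.
    + exact/mEFinP/measurable_indic.
  - have mAB : measurable (A `*` B) by exact: measurableX.
    transitivity (\int[m2]_z (\1_(A `*` B) z)%:E).
      by rewrite integral_indic// setIT.
    rewrite m2F//; last exact/mEFinP/measurable_indic.
    apply: eq_integral => w _; apply: eq_integral => x _.
    by rewrite !indicE in_setX -EFinM; case: (_ \in A); case: (x \in B);
        rewrite ?mulr1 ?mul0r ?mulr0.
have sf : sigma_finite setT m2.
  have [F FT Foo] := sigma_finiteT nu.
  exists (fun n => setT `*` F n).
    apply/seteqP; split => // -[w x] _; have : setT x by [].
    by rewrite FT => -[n _ Fnx]; exists n.
  move=> n; have [mFn Fnoo] := Foo n; split; first exact: measurableX.
  rewrite m2E (_ : _ @^-1` _ = setT `*` F n); last first.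
    by apply/seteqP; split => [[w x] []|[w x] []].
  apply: (@le_lt_trans _ _ (P setT * nu (F n))).
    by rewrite -(@product_measure1E _ _ _ _ _ P nu).
  by rewrite probability_setT mul1e.
have [PN PNE] := ex_sigma_finite sf.
have PNI f : \int[PN]_z f z = \int[m2]_z f z.
  by apply: eq_measure_integral => A _ _; exact: PNE.
exists PN; split => f mf f0; first by rewrite PNI m2F.
rewrite PNI -m1F//; apply: eq_measure_integral => A mA _.
exact/esym/m12.
Qed.

End JointMeasure.

(** * Almost everywhere statements on product spaces *)

Section ProductAlmostEverywhere.
Local Open Scope ereal_scope.
Context d1 d2 (T1 : measurableType d1) (T2 : measurableType d2) (R : realType).
Variables (m1 : {sigma_finite_measure set T1 -> \bar R}).
Variables (m2 : {sigma_finite_measure set T2 -> \bar R}).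

Lemma ae_null_set d (T : measurableType d) (mu : {measure set T -> \bar R}) (A : set T) :
  measurable A -> \int[mu]_x (\1_A x)%:E = 0 -> {ae mu, forall x, ~ A x}.
Proof.
move=> mA; rewrite integral_indic// setIT => A0.
by exists A; split => // x /contrapT.
Qed.

Lemma measure_integral_indic d (T : measurableType d) (mu : {measure set T -> \bar R}) (A : set T) :
  measurable A -> mu A = \int[mu]_x (\1_A x)%:E.
Proof. by move=> mA; rewrite integral_indic// setIT. Qed.

Lemma measurable_eq_set d (T : measurableType d) (f g : T -> R) :
  mfunT f -> mfunT g -> measurable [set x | f x = g x].
Proof.
move=> mf mg; have := measurable_fun_eqr mf mg measurableT (Y := [set true]) I.
by rewrite setTI; congr measurable; apply/seteqP; split => x /= /eqP.
Qed.

Lemma null_set_integral1 d (T : measurableType d) (mu : {measure set T -> \bar R}) (A : set T) :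
  measurable A -> mu A = 0 -> \int[mu]_x (\1_A x)%:E = 0.
Proof. by move=> mA A0; rewrite integral_indic// setIT. Qed.

Lemma ae_prod_integral0 (A : set (T1 * T2)) : measurable A ->
  \int[m1]_x \int[m2]_y (\1_A (x, y) : R)%:E = 0 ->
  {ae m1, forall x, {ae m2, forall y, ~ A (x, y)}}.
Proof.
move=> mA h.
have mi : mfunT (fun z => (\1_A z : R)%:E).
  exact/mEFinP/measurable_indic.
have i0 z : 0 <= (\1_A z : R)%:E by rewrite lee_fin.
have := @integral_eq0_ae _ _ _ m1 _ (measurable_fun_fubini_tonelli_F _ mi i0).
move=> /(_ m2); rewrite /fubini_F h => /(_ _ (lexx _)) => -[].
  by move=> x; exact: integral_ge0.
move=> B [mB B0 hB]; exists B; split => // x nx; apply: hB => h0; apply: nx.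
have mAx : measurable [set y | A (x, y)].
  have := measurable_xsection x mA; congr measurable.
  by apply/seteqP; split => y /=; rewrite /xsection /= inE.
exists [set y | A (x, y)]; split => //; last by move=> y /contrapT.
by rewrite measure_integral_indic// -[RHS]h0; apply: eq_integral => y _; rewrite !indicE !inE.
Qed.

Lemma ae_prodl (Q : T1 * T2 -> Prop) : {ae m1 \x m2, forall z, Q z} ->
  {ae m1, forall x, {ae m2, forall y, Q (x, y)}}.
Proof.
move=> [A [mA A0 QA]]; have := null_set_integral1 mA A0.
have mi : mfunT (fun z => (\1_A z : R)%:E).
  exact/mEFinP/measurable_indic.
rewrite (fubini_tonelli1 (fun z => (\1_A z : R)%:E))// => /(ae_prod_integral0 mA).
apply: filterS => x; apply: filterS => y nA.
by apply: contrapT => nQ; apply: nA; exact: QA.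
Qed.

Lemma ae_prodr (Q : T1 * T2 -> Prop) : measurable [set z | Q z] ->
  {ae m1, forall x, {ae m2, forall y, Q (x, y)}} -> {ae m1 \x m2, forall z, Q z}.
Proof.
move=> mQ h; pose A := ~` [set z | Q z].
have mA : measurable A by exact: measurableC.
exists A; split => //; transitivity (\int[m1 \x m2]_z (\1_A z : R)%:E).
  by rewrite integral_indic// setIT.
have mi : mfunT (fun z => (\1_A z : R)%:E).
  exact/mEFinP/measurable_indic.
have i0 z : 0 <= (\1_A z : R)%:E by rewrite lee_fin.
rewrite (fubini_tonelli1 (fun z => (\1_A z : R)%:E))// -[RHS](integral0 m1 setT).
apply: ae_eq_lower_integral => //; first by move=> x; exact: integral_ge0.
apply: filterS h => x h; rewrite -[RHS](integral0 m2 setT).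
apply: ae_eq_lower_integral => //.
apply: filterS h => y Qy; rewrite indicE memNset//; exact.
Qed.

End ProductAlmostEverywhere.

Lemma measurable_ceq_set d (T : measurableType d) (R : realType) (f g : T -> R[i]) :
  cmeasurable f -> cmeasurable g -> measurable [set x | f x = g x].
Proof.
move=> [f1 f2] [g1 g2].
have := measurableI _ _ (measurable_eq_set f1 g1) (measurable_eq_set f2 g2).
congr measurable; apply/seteqP; split => x /=.
  by case: (f x) => a b; case: (g x) => a' b' /= [-> ->].
by move=> ->.
Qed.

(** Here [f] may be neither measurable nor nonnegative; its negative part is dealt with by the lower
    integral as well. *)
Lemma ae_ge0_integral_lower d (T : measurableType d) (R : realType)
    (mu : {measure set T -> \bar R}) (f g : T -> \bar R) :
  (forall x, 0 <= g x)%E -> mfunT g ->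
  {ae mu, forall x, f x = g x} -> (\int[mu]_x f x = \int[mu]_x g x)%E.
Proof.
move=> g0 mg fg; rewrite integralE [X in (_ - X)%E](_ : _ = 0%E).
  rewrite sube0; apply: ae_eq_lower_integral => //.
  by apply: filterS fg => x fgx; rewrite funeposE fgx; apply/max_idPl.
rewrite -[RHS](integral0 mu setT); apply: ae_eq_lower_integral => //.
by apply: filterS fg => x fgx; rewrite funenegE fgx; apply/max_idPr; rewrite leeNl oppe0.
Qed.

(** * Gradients in several variables *)

Section SmoothProduct.
Context (R : realType).

(** The factors whose products satisfy the conditions of the chain rule. The bound 2 is the one that
    [cos t - 1] requires. *)
Record tame (phi dphi : R -> R) : Prop := Tame {
  tame_derive : forall t, is_derive (t : R) (1 : R) phi (dphi t);
  tame_continuous : continuous dphi;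
  tame_bounded : forall t, `|phi t| <= 2;
  tame_derive_bounded : forall t, `|dphi t| <= 1 }.

Lemma tame_lipschitz phi dphi : tame phi dphi ->
  forall a b, `|phi a - phi b| <= `|a - b|.
Proof.
move=> h; have cphi : continuous phi.
  move=> t; apply: differentiable_continuous; apply/derivable1_diffP.
  exact: (@ex_derive _ _ _ _ _ _ _ (tame_derive h t)).
have le a b : a <= b -> `|phi b - phi a| <= `|b - a|.
  move=> ab; have [|c _ ->] := MVT_segment ab (fun x _ => tame_derive h x).
    exact: continuous_subspaceT.
  by rewrite normrM ler_piMl// (tame_derive_bounded h).
move=> a b; have [ab|/ltW ab] := leP a b; last exact: le.
by rewrite distrC [leRHS]distrC; exact: le.
Qed.

(** The shift absorbs an additive constant: if only [u - c] is in the domain, sin(u) is a function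
    of [u - c]. *)
Lemma tame_sin_shift (c : R) : tame (fun t => sin (t + c)) (fun t => cos (t + c)).
Proof.
split => [t|t|t|t].
- have h : is_derive (t + c) 1 (@sin R) (cos (t + c)) by exact: is_derive_sin.
  have h2 : is_derive (t : R) (1 : R) (fun s : R => s + c) 1.
    by apply: is_derive_eq; rewrite addr0.
  have := @is_derive1_comp R (@sin R) (fun s : R => s + c) t _ _ h h2.
  by rewrite mulr1.
- apply: (@continuous_comp _ _ _ (fun s : R => s + c) cos); last exact: continuous_cos.
  by apply: cvgD => //; exact: cvg_cst.
- by rewrite ler_norml; have := sin_geN1 (t + c); have := sin_le1 (t + c); lra.
- by rewrite ler_norml cos_geN1 cos_le1.
Qed.

Lemma tame_sin : tame (@sin R) (@cos R).
Proof.
have := tame_sin_shift 0; congr tame; apply/funext => t; by rewrite addr0.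
Qed.

(** The chain rule asks for functions that vanish at 0, whence the subtracted constant. *)
Lemma tame_cosB1 : tame (fun t : R => cos t - 1) (fun t => - sin t).
Proof.
split => [t|t|t|t].
- have h : is_derive t 1 (@cos R) (- sin t) by exact: is_derive_cos.
  by apply: is_derive_eq; rewrite subr0.
- by apply: cvgN; exact: continuous_sin.
- by rewrite ler_norml; have := cos_geN1 t; have := cos_le1 t; lra.
- by rewrite normrN ler_norml sin_geN1 sin_le1.
Qed.

(** As second factor it specializes the product rule to functions of one variable. *)
Lemma tame_cst1 : tame (cst (1 : R)) (cst 0).
Proof.
split => [t|t|t|t]; first exact: is_derive_cst.
- exact: cvg_cst.
- by rewrite /cst normr1 ler1n.
- by rewrite /cst normr0.
Qed.

Lemma coord_le_norm n (y : 'rV[R]_n) i : `|y 0 i| <= `|y|.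
Proof.
rewrite [leRHS]/Num.norm /= mx_normrE; apply/bigmax_geP; right.
by exists (ord0, i).
Qed.

Section Chain.
Variables (phi dphi psi dpsi : R -> R).
Hypotheses (hphi : tame phi dphi) (hpsi : tame psi dpsi).
Let F (y : 'rV[R]_2) : R := phi (y 0 0) * psi (y 0 1).

Lemma tame_prod_derive0 y :
  'D_(delta_mx 0 0) F y = dphi (y 0 0) * psi (y 0 1).
Proof.
have h := tame_derive hphi (y 0 0).
have -> : dphi (y 0 0) * psi (y 0 1) =
    'D_(1 : R) (psi (y 0 1) \*: phi) (y 0 0).
  by rewrite derive_val /= /GRing.scale /= mulrC.
have E : (fun k : R => k^-1 *: (F (k *: delta_mx 0 0 + y) - F y)) =
    (fun k : R => k^-1 *: ((psi (y 0 1) \*: phi) (k *: (1 : R) + y 0 0) -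
                           (psi (y 0 1) \*: phi) (y 0 0))).
  apply/funext => k /=.
  by rewrite /F !mxE /= mulr1 mulr0 add0r /GRing.scale /= mulr1 ![psi _ * _]mulrC.
by rewrite /derive E.
Qed.

Lemma tame_prod_derive1 y :
  'D_(delta_mx 0 1) F y = phi (y 0 0) * dpsi (y 0 1).
Proof.
have h := tame_derive hpsi (y 0 1).
have -> : phi (y 0 0) * dpsi (y 0 1) =
    'D_(1 : R) (phi (y 0 0) \*: psi) (y 0 1).
  by rewrite derive_val /= /GRing.scale /=.
have E : (fun k : R => k^-1 *: (F (k *: delta_mx 0 1 + y) - F y)) =
    (fun k : R => k^-1 *: ((phi (y 0 0) \*: psi) (k *: (1 : R) + y 0 1) -
                           (phi (y 0 0) \*: psi) (y 0 1))).
  apply/funext => k /=.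
  by rewrite /F !mxE /= mulr1 mulr0 add0r /GRing.scale /= mulr1.
by rewrite /derive E.
Qed.

Lemma tame_continuous_fun f df : tame f df -> continuous f.
Proof.
move=> h t; apply: differentiable_continuous; apply/derivable1_diffP.
exact: (@ex_derive _ _ _ _ _ _ _ (tame_derive h t)).
Qed.

Lemma tame_prod_differentiable y : differentiable F y.
Proof.
have c f df (i : 'I_2) : tame f df ->
    differentiable (fun y : 'rV[R]_2 => f (y 0 i)) y.
  move=> h; apply: (@differentiable_comp _ _ _ _ (fun y : 'rV[R]_2 => y 0 i) f).
    exact: differentiable_coord.
  apply/derivable1_diffP.
  exact: (@ex_derive _ _ _ _ _ _ _ (tame_derive h _)).
by apply: differentiableM; [exact: c hphi|exact: c hpsi].
Qed.

Lemma tame_prod_continuous i : continuous (fun y => 'D_(delta_mx 0 i) F y).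
Proof.
have c f (j : 'I_2) : continuous f ->
    continuous (fun y : 'rV[R]_2 => f (y 0 j) : R).
  move=> cf y.
  by apply: (@continuous_comp _ _ _ (fun y : 'rV[R]_2 => y 0 j) f);
    [exact: coord_continuous|exact: cf].
have [->|->] : i = 0 \/ i = 1.
  by case: i => -[|[|//]] ?; [left|right]; exact/val_inj.
- under eq_fun do rewrite tame_prod_derive0.
  move=> y; exact: (cvgM (c _ 0 (tame_continuous hphi) y)
                         (c _ 1 (tame_continuous_fun hpsi) y)).
- under eq_fun do rewrite tame_prod_derive1.
  move=> y; exact: (cvgM (c _ 0 (tame_continuous_fun hphi) y)
                         (c _ 1 (tame_continuous hpsi) y)).
Qed.

Lemma tame_prod_lipschitz y z : `|F y - F z| <= 4 * `|y - z|.
Proof.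
have -> : F y - F z = (phi (y 0 0) - phi (z 0 0)) * psi (y 0 1) +
    phi (z 0 0) * (psi (y 0 1) - psi (z 0 1)) by rewrite /F; ring.
apply: (le_trans (ler_normD _ _)); rewrite !normrM.
have a0 : `|phi (y 0 0) - phi (z 0 0)| <= `|y - z|.
  apply: le_trans (tame_lipschitz hphi _ _) _.
  by have := coord_le_norm (y - z) 0; rewrite !mxE.
have a1 : `|psi (y 0 1) - psi (z 0 1)| <= `|y - z|.
  apply: le_trans (tame_lipschitz hpsi _ _) _.
  by have := coord_le_norm (y - z) 1; rewrite !mxE.
have b0 := tame_bounded hphi (z 0 0); have b1 := tame_bounded hpsi (y 0 1).
have -> : 4 * `|y - z| = `|y - z| * 2 + 2 * `|y - z| by ring.
by apply: lerD; apply: ler_pM.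
Qed.

Context dX dM (X : measurableType dX) (M : measurableType dM).
Variables (nu : {sigma_finite_measure set X -> \bar R}) (rho : probability M R).
Variables (d : set (X -> R)) (flat : (X -> R) -> X * M -> R).

Lemma chain_prod u v : chain_rule nu rho d flat -> d u -> d v ->
  phi 0 * psi 0 = 0 ->
  d (fun x => phi (u x) * psi (v x)) /\
  {ae (nu \x rho)%E, forall z, flat (fun x => phi (u x) * psi (v x)) z =
    dphi (u z.1) * psi (v z.1) * flat u z +
    phi (u z.1) * dpsi (v z.1) * flat v z}.
Proof.
move=> chain du dv p0.
pose U (i : 'I_2) := if i == 0 then u else v.
have [] := chain 1%N F U.
- by move=> i; rewrite /U; case: ifP.
- by rewrite /F !mxE.
- exact: tame_prod_differentiable.
- exact: tame_prod_continuous.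
- by exists 4; exact: tame_prod_lipschitz.
have -> : (fun x => F (\row_i U i x)) = (fun x => phi (u x) * psi (v x)).
  by apply/funext => x; rewrite /F !mxE.
move=> duv h; split => //; apply: filterS h => z ->.
rewrite big_ord_recl big_ord1.
have -> : lift ord0 ord0 = 1 :> 'I_2 by exact/val_inj.
by rewrite tame_prod_derive0 tame_prod_derive1 !mxE.
Qed.

End Chain.
End SmoothProduct.

Lemma dct_to0 d (T : measurableType d) (R : realType)
    (mu : {measure set T -> \bar R}) (h : nat -> T -> R) (g : T -> R) :
  (forall n, mfunT (h n)) -> mfunT g ->
  (forall n x, 0 <= h n x) -> (forall n x, h n x <= g x) ->
  (\int[mu]_x (g x)%:E < +oo)%E ->
  {ae mu, forall x, h n x @[n --> \oo] --> 0} ->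
  to0 (fun n => \int[mu]_x (h n x)%:E)%E.
Proof.
move=> mh mg h0 hg goo hx; apply/to0P.
  by move=> n; apply: integral_ge0 => x _; rewrite lee_fin.
have g0 x : 0 <= g x by apply: le_trans (h0 0%N x) (hg 0%N x).
have := @dominated_convergence _ T R mu setT measurableT
  (fun n x => (h n x)%:E) (cst 0%E) (EFin \o g).
case.
- by move=> n; exact/mEFinP.
- exact: measurable_cst.
- by apply: filterS hx => x hx _ /=; apply/fine_cvgP; split => //; exact: nearW.
- by apply/integrableP; split; [exact/mEFinP|];
    under eq_integral do rewrite /= ger0_norm//.
- apply: aeW => x n _; rewrite /= lee_fin ger0_norm//.
by move=> _ _; rewrite integral0.
Qed.

Lemma ae_fst d1 d2 (T1 : measurableType d1) (T2 : measurableType d2) (R : realType)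
    (m1 : {sigma_finite_measure set T1 -> \bar R}) (m2 : probability T2 R)
    (Q : T1 -> Prop) :
  {ae m1, forall x, Q x} -> {ae (m1 \x m2)%E, forall z, Q z.1}.
Proof.
move=> [N [mN N0 QN]]; exists (N `*` setT); split.
- exact: measurableX.
- transitivity (m1 N * m2 setT)%E; first exact: product_measure1E.
  by rewrite (_ : m1 N = 0%E)// mul0e.
- by move=> z /= hz; split => //; apply: QN.
Qed.

Lemma ae_and d (T : measurableType d) (R : realType) (mu : {measure set T -> \bar R})
    (P Q : T -> Prop) : {ae mu, forall x, P x} -> {ae mu, forall x, Q x} ->
  {ae mu, forall x, P x /\ Q x}.
Proof. by apply: filterS2 => x. Qed.

(** * Complex integrals *)

Section ComplexIntegral.
Context d (T : measurableType d) (R : realType) (mu : {measure set T -> \bar R}).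
Implicit Types f g : T -> R[i].

Definition cintegrable f :=
  mu.-integrable setT (fun x => (Re (f x))%:E) /\
  mu.-integrable setT (fun x => (Im (f x))%:E).

Lemma cintegrable_measurable f : cintegrable f -> cmeasurable f.
Proof. by move=> [h1 h2]; split; apply/mEFinP; [exact: measurable_int h1|exact: measurable_int h2]. Qed.

Lemma cintegrableD f g : cintegrable f -> cintegrable g ->
  cintegrable (fun x => f x + g x).
Proof.
move=> [f1 f2] [g1 g2]; split.
- have := integrableD measurableT f1 g1; congr integrable; apply/funext => x.
  by rewrite ReD EFinD.
- have := integrableD measurableT f2 g2; congr integrable; apply/funext => x.
  by rewrite ImD EFinD.
Qed.

Lemma cintegralD f g : cintegrable f -> cintegrable g ->
  cintegral mu (fun x => f x + g x) = cintegral mu f + cintegral mu g.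
Proof.
move=> [f1 f2] [g1 g2]; rewrite /cintegral.
under [X in (X +i* _)%C]eq_Rintegral do rewrite ReD.
under [X in (_ +i* X)%C]eq_Rintegral do rewrite ImD.
by rewrite !RintegralD.
Qed.

Lemma cintegrableZ (c : R[i]) f : cintegrable f -> cintegrable (fun x => c * f x).
Proof.
move=> [f1 f2]; split.
- have := integrableB measurableT (integrableZl measurableT (Re c) f1)
    (integrableZl measurableT (Im c) f2).
  by congr integrable; apply/funext => x; rewrite ReM EFinB !EFinM.
- have := integrableD measurableT (integrableZl measurableT (Re c) f2)
    (integrableZl measurableT (Im c) f1).
  by congr integrable; apply/funext => x; rewrite ImM EFinD !EFinM.
Qed.

Lemma cintegralZ (c : R[i]) f : cintegrable f ->
  cintegral mu (fun x => c * f x) = c * cintegral mu f.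
Proof.
move=> [f1 f2].
have Z a (h : T -> R) : mu.-integrable setT (fun x => (h x)%:E) ->
    integrableT mu (fun x => a * h x).
  by move=> /(integrableZl measurableT a); congr integrable.
rewrite /cintegral.
under [X in (X +i* _)%C]eq_Rintegral do rewrite ReM.
under [X in (_ +i* X)%C]eq_Rintegral do rewrite ImM.
rewrite RintegralB//; [|exact: Z..]; rewrite RintegralD//; [|exact: Z..].
by rewrite !RintegralZl//; apply/eqP; rewrite eq_complex ReM ImM /= !eqxx.
Qed.

Lemma cintegrable0 : cintegrable (fun=> 0).
Proof. by split; exact: integrable0. Qed.

Lemma cintegral0 : cintegral mu (fun=> 0 : R[i]) = 0.
Proof. by rewrite /cintegral /= /Rintegral integral0. Qed.

Lemma cintegrable_sum (I : Type) (s : seq I) (F : I -> T -> R[i]) :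
  (forall i, cintegrable (F i)) -> cintegrable (fun x => \sum_(i <- s) F i x).
Proof.
move=> h; elim: s => [|i s IH].
  by under eq_fun do rewrite big_nil; exact: cintegrable0.
by under eq_fun do rewrite big_cons; exact: cintegrableD.
Qed.

Lemma cintegral_sum (I : Type) (s : seq I) (F : I -> T -> R[i]) :
  (forall i, cintegrable (F i)) ->
  cintegral mu (fun x => \sum_(i <- s) F i x) = \sum_(i <- s) cintegral mu (F i).
Proof.
move=> h; elim: s => [|i s IH].
  by under eq_fun do rewrite big_nil; rewrite big_nil cintegral0.
under eq_fun do rewrite big_cons; rewrite big_cons cintegralD// ?IH//.
exact: cintegrable_sum.
Qed.

Lemma ae_cintegral f g : cmeasurable f -> cmeasurable g ->
  {ae mu, forall x, f x = g x} -> cintegral mu f = cintegral mu g.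
Proof.
move=> [f1 f2] [g1 g2] fg; rewrite /cintegral /Rintegral; congr (fine _ +i* fine _)%C.
- by apply: ae_eq_integral => //; [exact/mEFinP..|]; apply: filterS fg => x -> _.
- by apply: ae_eq_integral => //; [exact/mEFinP..|]; apply: filterS fg => x -> _.
Qed.

Lemma ae_cintegrable f g : cmeasurable g -> {ae mu, forall x, f x = g x} ->
  cintegrable f -> cintegrable g.
Proof.
have ae (h k : T -> R) : mfunT k -> {ae mu, forall x, h x = k x} ->
    mu.-integrable setT (fun x => (h x)%:E) -> mu.-integrable setT (fun x => (k x)%:E).
  move=> mk hk /integrableP[mh hoo]; apply/integrableP; split; first exact/mEFinP.
  apply: le_lt_trans hoo; rewrite le_eqVlt; apply/orP; left; apply/eqP.
  apply: ae_eq_integral => //.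
  - by apply: mcompT => //; exact/mEFinP.
  - exact: mcompT.
  - by apply: filterS hk => x -> _.
move=> [g1 g2] fg [h1 h2]; split.
- by apply: ae h1 => //; apply: filterS fg => x ->.
- by apply: ae h2 => //; apply: filterS fg => x ->.
Qed.

Lemma csqM_cintegrable f g : cmeasurable f -> (csq mu f < +oo)%E ->
  cmeasurable g -> (csq mu g < +oo)%E -> cintegrable (fun x => f x * g x).
Proof.
move=> mf foo mg goo.
have le (h : T -> R[i]) : cmeasurable h -> (csq mu h < +oo)%E ->
   (\int[mu]_x ((Re (h x)) ^+ 2)%:E < +oo)%E /\ (\int[mu]_x ((Im (h x)) ^+ 2)%:E < +oo)%E.
  move=> mh; rewrite csq_ReIm// => hoo.
  by split; apply: le_lt_trans hoo; [rewrite leeDl//|rewrite leeDr//];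
    apply: integral_ge0 => x _; rewrite lee_fin sqr_ge0.
have [f1 f2] := le _ mf foo; have [g1 g2] := le _ mg goo.
case: mf mg => [mf1 mf2] [mg1 mg2]; split.
- have := integrableB measurableT (L2M_integrable mf1 f1 mg1 g1)
    (L2M_integrable mf2 f2 mg2 g2).
  by congr integrable; apply/funext => x; rewrite ReM EFinB.
- have := integrableD measurableT (L2M_integrable mf1 f1 mg2 g2)
    (L2M_integrable mf2 f2 mg1 g1).
  by congr integrable; apply/funext => x; rewrite ImM EFinD.
Qed.

Lemma csq_conj f : csq mu (fun x => (f x)^*%C) = csq mu f.
Proof. by apply: eq_integral => x _; rewrite /nsq; case: (f x) => a b /=; rewrite sqrrN. Qed.

Lemma csq_cintegral f : cmeasurable f -> (csq mu f < +oo)%E ->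
  csq mu f = (Re (cintegral mu (fun x => f x * (f x)^*%C)))%:E.
Proof.
move=> mf foo; have goo : (csq mu (fun x => (f x)^*%C) < +oo)%E by rewrite csq_conj.
have [h _] := csqM_cintegrable mf foo (cmeasurable_conj mf) goo.
rewrite /cintegral /= /Rintegral fineK; last exact: integrable_fin_num.
apply: eq_integral => x _; congr EFin; rewrite /nsq; case: (f x) => a b /=.
by rewrite mulrN opprK !expr2.
Qed.

End ComplexIntegral.

Lemma cintegrable_bounded d (T : measurableType d) (R : realType)
    (m : probability T R) (f : T -> R[i]) (k : R) : cmeasurable f ->
  (forall x, normc (f x) <= k) -> cintegrable m f.
Proof.
move=> [m1 m2] fk; split.
- apply/integrableP; split; first exact/mEFinP.
  apply: (@le_lt_trans _ _ (\int[m]_x (cst k%:E x))%E).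
    apply: ge0_le_integral => //.
    + by apply/mEFinP; apply: mcompT.
    + by move=> x _; rewrite lee_fin; apply: le_trans (fk x); exact: Re_normc.
  by rewrite integral_cst// ltey_eq fin_numM// fin_num_measure.
- apply/integrableP; split; first exact/mEFinP.
  apply: (@le_lt_trans _ _ (\int[m]_x (cst k%:E x))%E).
    apply: ge0_le_integral => //.
    + by apply/mEFinP; apply: mcompT.
    + by move=> x _; rewrite lee_fin; apply: le_trans (fk x); exact: Im_normc.
  by rewrite integral_cst// ltey_eq fin_numM// fin_num_measure.
Qed.

(** * Integrals that factorize *)

Section ProductFormula.
Context d1 d2 (T1 : measurableType d1) (T2 : measurableType d2) (R : realType).
Variables (m1 : {sigma_finite_measure set T1 -> \bar R}).
Variables (m2 : {sigma_finite_measure set T2 -> \bar R}).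

Lemma integrable_prod (a : T1 -> R) (b : T2 -> R) :
  integrableT m1 a -> integrableT m2 b ->
  integrableT (m1 \x m2)%E (fun z => a z.1 * b z.2) /\
  \int[(m1 \x m2)%E]_z (a z.1 * b z.2) = (\int[m1]_x a x) * (\int[m2]_y b y).
Proof.
move=> ia ib.
have /integrableP[/mEFinP ma aoo] := ia.
have /integrableP[/mEFinP mb boo] := ib.
have mab : mfunT (EFin \o (fun z : T1 * T2 => a z.1 * b z.2)).
  apply/mEFinP; apply: measurable_funM; exact: mcompT.
have i12 : integrableT (m1 \x m2)%E (fun z => a z.1 * b z.2).
  apply/(integrable12ltyP _ _ mab).
  under eq_integral => x _.
    under eq_integral => y _ do rewrite /= normrM EFinM.
    rewrite ge0_integralZl//; last by apply/mEFinP; exact: mcompT.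
    over.
  rewrite ge0_integralZr//.
  - by apply: lte_mul_pinfty => //; [apply: integral_ge0|
      rewrite ge0_fin_numE//; apply: integral_ge0].
  - by apply/mEFinP; exact: mcompT.
  - exact: integral_ge0.
split => //.
rewrite /Rintegral -(integral12_prod_meas1 i12) /fubini_F /=.
under eq_integral => x _.
  under eq_integral => y _ do rewrite /= EFinM.
  rewrite integralZl//.
  over.
have -> : (\int[m2]_y (b y)%:E)%E = (\int[m2]_y b y)%:E.
  by rewrite /Rintegral fineK//; exact: integrable_fin_num ib.
rewrite integralZr// fineM//; exact: integrable_fin_num ia.
Qed.

End ProductFormula.

Section ShiftedProduct.
Context d1 d2 d3 (T1 : measurableType d1) (T2 : measurableType d2)
  (T3 : measurableType d3) (R : realType).
Variables (m1 : {sigma_finite_measure set T1 -> \bar R}).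
Variables (m2 : {sigma_finite_measure set T2 -> \bar R}).
Variables (m : {measure set T3 -> \bar R}) (tau : T1 * T2 -> T3).
Hypothesis mtau : mfunT tau.
Hypothesis tauE : forall f : T3 -> \bar R, mfunT f ->
  (forall z, 0 <= f z)%E -> (\int[m]_z f z = \int[m1]_x \int[m2]_y f (tau (x, y)))%E.

Let tauE2 (f : T3 -> \bar R) : mfunT f -> (forall z, 0 <= f z)%E ->
  (\int[m]_z f z = \int[(m1 \x m2)%E]_z f (tau z))%E.
Proof.
move=> mf f0; rewrite tauE//; apply/esym.
exact: (@fubini_tonelli1 _ _ _ _ _ m1 m2 (fun z => f (tau z)) (mcompT mf mtau) (fun z => f0 _)).
Qed.

Lemma shift_integral (f : T3 -> \bar R) : mfunT f ->
  (\int[m]_z f z = \int[(m1 \x m2)%E]_z f (tau z))%E.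
Proof.
move=> mf; rewrite integralE [RHS]integralE; congr (_ - _)%E.
- have mp := measurable_funepos mf; have p0 z := funepos_ge0 f z.
  by rewrite (tauE2 mp p0); apply: eq_integral => z _; rewrite !funeposE.
- have mp := measurable_funeneg mf; have p0 z := funeneg_ge0 f z.
  by rewrite (tauE2 mp p0); apply: eq_integral => z _; rewrite !funenegE.
Qed.

Lemma shift_integrable (f : T3 -> \bar R) : mfunT f ->
  (m1 \x m2)%E.-integrable setT (fun z => f (tau z)) -> m.-integrable setT f.
Proof.
move=> mf /integrableP[_ h]; apply/integrableP; split => //.
by rewrite tauE2//; exact: mcompT.
Qed.

Lemma shift_cintegral (f : T3 -> R[i]) : cmeasurable f ->
  cintegral m f = cintegral (m1 \x m2)%E (fun z => f (tau z)).
Proof.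
move=> [mf1 mf2]; rewrite /cintegral /Rintegral.
by rewrite !shift_integral//; exact/mEFinP.
Qed.

Lemma shift_cintegrable (f : T3 -> R[i]) : cmeasurable f ->
  cintegrable (m1 \x m2)%E (fun z => f (tau z)) -> cintegrable m f.
Proof.
by move=> [mf1 mf2] [h1 h2]; split; apply: shift_integrable => //; exact/mEFinP.
Qed.

(** The function need not be a product; it becomes one in the coordinates before the shift. An
    exponential of N factorizes in this way when an atom is added. *)
Lemma cintegral_prod (f : T3 -> R[i]) (a : T1 -> R[i]) (b : T2 -> R[i]) :
  cmeasurable f -> cintegrable m1 a -> cintegrable m2 b ->
  {ae m1, forall x, forall y, f (tau (x, y)) = a x * b y} ->
  cintegrable m f /\ cintegral m f = cintegral m1 a * cintegral m2 b.
Proof.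
move=> mf ia ib fab.
have [ma mb] := (cintegrable_measurable ia, cintegrable_measurable ib).
have mab : cmeasurable (fun z : T1 * T2 => a z.1 * b z.2).
  by apply: cmeasurableM; apply: cmeasurable_comp.
have mft : cmeasurable (fun z => f (tau z)) by exact: cmeasurable_comp.
have fae : {ae (m1 \x m2)%E, forall z, a z.1 * b z.2 = f (tau z)}.
  apply: ae_prodr; first exact: measurable_ceq_set.
  by apply: filterS fab => x h; apply: aeW => y.
case: ia ib => [a1 a2] [b1 b2].
have [i11 e11] := integrable_prod a1 b1; have [i12 e12] := integrable_prod a1 b2.
have [i21 e21] := integrable_prod a2 b1; have [i22 e22] := integrable_prod a2 b2.
have iab : cintegrable (m1 \x m2)%E (fun z => a z.1 * b z.2).
  split.
  - by have := integrableB measurableT i11 i22; congr integrable; apply/funext => z;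
      rewrite ReM EFinB.
  - by have := integrableD measurableT i12 i21; congr integrable; apply/funext => z;
      rewrite ImM EFinD.
split.
  by apply: shift_cintegrable => //; exact: ae_cintegrable fae iab.
rewrite shift_cintegral// -(ae_cintegral mab mft fae) /cintegral.
under [X in (X +i* _)%C]eq_Rintegral do rewrite ReM.
under [X in (_ +i* X)%C]eq_Rintegral do rewrite ImM.
rewrite RintegralB// RintegralD// e11 e12 e21 e22.
by apply/eqP; rewrite eq_complex ReM ImM /= !eqxx.
Qed.

End ShiftedProduct.

(** A bundled copy of the product, which can in turn be a factor of a product: P x ([nu] x [rho]) is
    needed to integrate over the pair of an atom and its mark. *)
Lemma sigma_finite_prod d1 d2 (T1 : measurableType d1) (T2 : measurableType d2)
    (R : realType) (m1 : {sigma_finite_measure set T1 -> \bar R}) (m2 : probability T2 R) :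
  exists Q : {sigma_finite_measure set (T1 * T2)%type -> \bar R},
    forall A, Q A = (m1 \x m2)%E A.
Proof.
apply: ex_sigma_finite.
have /sigma_finiteP[E [ET _ EP]] := @sigma_finiteT _ T1 R m1.
exists (fun n => E n `*` setT).
  by rewrite -setX_bigcupl -ET setXTT.
move=> n; have [mE Eoo] := EP n; split; first exact: measurableX.
rewrite [X in (X < _)%E](_ : _ = m1 (E n) * m2 setT)%E; last exact: product_measure1E.
apply: lte_mul_pinfty; [exact: measure_ge0|by rewrite ge0_fin_numE|].
by rewrite ltey_eq fin_num_measure.
Qed.

Lemma integrable_le d (T : measurableType d) (R : realType) (mu : {measure set T -> \bar R})
    (f h : T -> R) : mfunT f -> (forall x, `|f x| <= `|h x|) ->
  integrableT mu h -> integrableT mu f.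
Proof.
move=> mf fh ih; apply: le_integrable ih => //; first exact/mEFinP.
by move=> x _; rewrite lee_fin.
Qed.

Lemma measurable_cos d (T : measurableType d) (R : realType) (f : T -> R) :
  mfunT f -> mfunT (fun x => cos (f x)).
Proof.
move=> mf; apply: (mcompT _ mf); apply: continuous_measurable_fun.
exact: continuous_cos.
Qed.

Lemma measurable_sin d (T : measurableType d) (R : realType) (f : T -> R) :
  mfunT f -> mfunT (fun x => sin (f x)).
Proof.
move=> mf; apply: (mcompT _ mf); apply: continuous_measurable_fun.
exact: continuous_sin.
Qed.

Lemma cos_le1_norm (R : realType) (t : R) : `|cos t| <= 1.
Proof. by rewrite ler_norml cos_geN1 cos_le1. Qed.

Lemma sin_le1_norm (R : realType) (t : R) : `|sin t| <= 1.
Proof. by rewrite ler_norml sin_geN1 sin_le1. Qed.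

Lemma ReM_real (R : realType) (z : R[i]) (t : R) : Re (z * t%:C%C) = Re z * t.
Proof. by rewrite ReM /= mulr0 subr0. Qed.

Lemma ImM_real (R : realType) (z : R[i]) (t : R) : Im (z * t%:C%C) = Im z * t.
Proof. by rewrite ImM /= mulr0 add0r. Qed.

Lemma cintegrable_expiM d (T : measurableType d) (R : realType)
    (mu : {measure set T -> \bar R}) (g h : T -> R) : mfunT g ->
  integrableT mu h -> cintegrable mu (fun x => expi (g x) * (h x)%:C%C).
Proof.
move=> mg ih; have mh : mfunT h by apply/mEFinP; exact: measurable_int ih.
split.
- under eq_fun do rewrite ReM_real /=.
  apply: integrable_le ih; first by apply: measurable_funM => //; exact: measurable_cos.
  by move=> x; rewrite normrM ler_piMl// cos_le1_norm.
- under eq_fun do rewrite ImM_real /=.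
  apply: integrable_le ih; first by apply: measurable_funM => //; exact: measurable_sin.
  by move=> x; rewrite normrM ler_piMl// sin_le1_norm.
Qed.

Lemma cintegral_real d (T : measurableType d) (R : realType)
    (mu : {measure set T -> \bar R}) (h : T -> R) :
  cintegral mu (fun x => (h x)%:C%C) = (\int[mu]_x h x)%:C%C.
Proof. by rewrite /cintegral /= [X in (_ +i* X)%C]/Rintegral integral0. Qed.

Lemma csq_sum_lty d (T : measurableType d) (R : realType) (mu : {measure set T -> \bar R})
    (I : Type) (s : seq I) (F : I -> T -> R[i]) :
  (forall i, cmeasurable (F i)) -> (forall i, (csq mu (F i) < +oo)%E) ->
  (csq mu (fun x => (\sum_(i <- s) F i x)%R) < +oo)%E.
Proof.
move=> mF Foo; elim: s => [|i s IH].
  under eq_fun do rewrite big_nil.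
  by rewrite /csq; under eq_integral do rewrite nsq0; rewrite integral0 ltry.
under eq_fun do rewrite big_cons; apply: csqD_lty => //; exact: cmeasurable_sum.
Qed.

Lemma mul_conj_term (R : realType) (a b e e' : R[i]) (s t : R) :
  ((0 +i* 1)%C * a * (e * s%:C%C)) * ((0 +i* 1)%C * b * (e' * t%:C%C))^*%C =
  (a * b^*%C) * (e * e'^*%C * (s * t)%:C%C).
Proof.
case: a b e e' => [a1 a2] [b1 b2] [e1 e2] [f1 f2].
by apply/eqP; rewrite eq_complex /=; apply/andP; split; apply/eqP; ring.
Qed.

Lemma conjcM (R : realType) (a b : R[i]) : ((a * b)^*)%C = (a^* * b^*)%C.
Proof.
case: a b => [a1 a2] [b1 b2].
by apply/eqP; rewrite eq_complex /=; apply/andP; split; apply/eqP; ring.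
Qed.

Lemma poweR_half_lt (R : realType) (x : \bar R) (e : R) : (0 <= x)%E ->
  (x `^ 2^-1 < (Num.sqrt e)%:E)%E -> (x < e%:E)%E.
Proof.
case: x => [x|_|//]; last by rewrite poweRyr.
rewrite lee_fin poweR_EFin !lte_fin => x0.
rewrite powR12_sqrt//; case: (ltP 0 e) => [e0|e0]; first by rewrite ltr_sqrt.
by rewrite (ler0_sqrtr e0) ltNge sqrtr_ge0.
Qed.

Lemma poweR_half_lt2 (R : realType) (x : \bar R) (e : R) : (0 <= x)%E -> 0 < e ->
  (x < (e ^+ 2)%:E)%E -> (x `^ 2^-1 < e%:E)%E.
Proof.
case: x => [x|_|//] x0 e0; last by [].
rewrite lee_fin in x0; rewrite poweR_EFin !lte_fin => xe.
by rewrite powR12_sqrt// -(ger0_norm (ltW e0)) -sqrtr_sqr ltr_sqrt// exprn_gt0.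
Qed.

Lemma poweR_half_lty (R : realType) (x : \bar R) : (0 <= x)%E ->
  (x `^ 2^-1 < +oo)%E -> (x < +oo)%E.
Proof. by case: x => [x|_|//]; rewrite ?ltry// poweRyr. Qed.

Lemma poweR_half_sqr (R : realType) (x : \bar R) : (0 <= x)%E -> ((x `^ 2^-1) `^ 2 = x)%E.
Proof. by move=> x0; rewrite -poweRrM mulVf// poweRe1. Qed.

Lemma csqBB_le d (T : measurableType d) (R : realType) (mu : {measure set T -> \bar R})
    (a b c e : T -> R[i]) : cmeasurable a -> cmeasurable b -> cmeasurable c -> cmeasurable e ->
  (csq mu (fun x => (a x - b x) - (c x - e x))%R <=
   2%:E * csq mu (fun x => a x - c x)%R + 2%:E * csq mu (fun x => b x - e x)%R)%E.
Proof.
move=> ma mb mc me.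
have := @csqB_le _ _ R mu _ _ (cmeasurableB ma mc) (cmeasurableB mb me).
by congr (_ <= _)%E; congr csq; apply/funext => x; ring.
Qed.

Lemma to0_ext (R : realType) (u v : nat -> \bar R) : u =1 v -> to0 u -> to0 v.
Proof. by move=> /funext ->. Qed.

Lemma ae_imp d (T : measurableType d) (R : realType) (mu : {measure set T -> \bar R})
    (P Q : T -> Prop) : (forall x, P x -> Q x) -> {ae mu, forall x, P x} ->
  {ae mu, forall x, Q x}.
Proof. by move=> h; apply: filterS. Qed.

(** * Transfer of integrals along a map *)

Section Transfer.
Context d1 d2 (T1 : measurableType d1) (T2 : measurableType d2) (R : realType).
Variables (m1 : {measure set T1 -> \bar R}) (m2 : {measure set T2 -> \bar R}).
Variable phi : T2 -> T1.
Hypothesis mphi : mfunT phi.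
Hypothesis phiE : forall f : T1 -> \bar R, mfunT f ->
  (forall x, 0 <= f x)%E -> (\int[m1]_x f x = \int[m2]_y f (phi y))%E.

Lemma transfer_integral (f : T1 -> \bar R) : mfunT f ->
  (\int[m1]_x f x = \int[m2]_y f (phi y))%E.
Proof.
move=> mf; rewrite integralE [RHS]integralE; congr (_ - _)%E.
- have mp := measurable_funepos mf; have p0 z := funepos_ge0 f z.
  by rewrite (phiE mp p0); apply: eq_integral => z _; rewrite !funeposE.
- have mp := measurable_funeneg mf; have p0 z := funeneg_ge0 f z.
  by rewrite (phiE mp p0); apply: eq_integral => z _; rewrite !funenegE.
Qed.

Lemma transfer_integrable (f : T1 -> \bar R) : m1.-integrable setT f ->
  m2.-integrable setT (f \o phi).
Proof.
move=> /integrableP[mf foo]; apply/integrableP; split; first exact: mcompT.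
by rewrite -(phiE (f := fun x => `|f x|)%E)//; exact: mcompT.
Qed.

End Transfer.

(** * Independent centred marks *)

Section IndependentMarks.
Context dM (M : measurableType dM) (R : realType).
Variables (rho : probability M R) (Phat : probability (marks M) R).
Hypothesis law_marks : product_law rho Phat.

Lemma measurable_coord n : mfunT (fun r : marks M => r n).
Proof.
move=> _ Y mY; apply: sub_sigma_algebra; exists n => //.
by exists Y.
Qed.

Lemma pair_law i j (A B : set M) : i != j -> measurable A -> measurable B ->
  Phat [set r | A (r i) /\ B (r j)] = (rho A * rho B)%E.
Proof.
move=> ij mA mB; pose n := (maxn i j).+1.
have li : (i < n)%N by rewrite ltnS leq_maxl.
have lj : (j < n)%N by rewrite ltnS leq_maxr.
pose C (k : 'I_n) : set M := if k == i :> nat then A else if k == j :> nat then B else setT.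
have mC k : measurable (C k) by rewrite /C; case: ifP => // _; case: ifP.
transitivity (Phat [set r | forall k : 'I_n, C k (r k)]).
  congr (Phat _); apply/seteqP; split => r /=.
    move=> [Ai Bj] k; rewrite /C; case: eqP => [->//|_]; by case: eqP => [->|].
  move=> h; split.
    by have := h (Ordinal li); rewrite /C /= eqxx.
  by have := h (Ordinal lj); rewrite /C /= eq_sym (negbTE ij) eqxx.
rewrite (law_marks mC) (bigD1 (Ordinal li))//= (bigD1 (Ordinal lj))/=; last first.
  by rewrite -val_eqE /= eq_sym.
rewrite big1 ?mule1; last first.
  move=> k /andP[ki kj]; rewrite /C -!val_eqE /= in ki kj *.
  by rewrite (negbTE ki) (negbTE kj); exact: probability_setT.
by rewrite /C /= eqxx eq_sym (negbTE ij) eqxx.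
Qed.

Lemma one_law i (A : set M) : measurable A -> Phat [set r | A (r i)] = rho A.
Proof.
move=> mA; have ii : i != i.+1 by rewrite neq_ltn ltnSn.
transitivity (Phat [set r | A (r i) /\ setT (r i.+1)]).
  by congr (Phat _); apply/seteqP; split => r //= -[].
rewrite (pair_law ii mA measurableT) -[RHS]mule1; congr (_ * _)%E.
exact: probability_setT.
Qed.

Lemma integral_mark i (f : M -> \bar R) : mfunT f -> (forall x, 0 <= f x)%E ->
  (\int[rho]_x f x = \int[Phat]_r f (r i))%E.
Proof.
move=> mf f0; have [m [mE mI]] := ex_pushforward Phat (measurable_coord i).
rewrite -(mI f mf f0); apply: eq_measure_integral => A mA _.
by rewrite mE; exact: (esym (one_law i mA)).
Qed.

Lemma integral_mark2 i j (f : M * M -> \bar R) : i != j -> mfunT f ->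
  (forall x, 0 <= f x)%E -> (\int[(rho \x rho)%E]_z f z = \int[Phat]_r f (r i, r j))%E.
Proof.
move=> ij mf f0.
have mp : mfunT (fun r : marks M => (r i, r j)).
  by apply: measurable_fun_pair; exact: measurable_coord.
have [m [mE mI]] := ex_pushforward Phat mp.
rewrite -(mI f mf f0); apply: eq_measure_integral => A mA _.
apply: product_measure_unique => // B C mB mC.
by rewrite mE; exact: (pair_law ij mB mC).
Qed.

Lemma mark_cov i j (a b : M -> R) : i != j -> integrableT rho a ->
  integrableT rho b ->
  integrableT Phat (fun r => a (r i) * b (r j)) /\
  \int[Phat]_r (a (r i) * b (r j)) = (\int[rho]_x a x) * (\int[rho]_x b x).
Proof.
move=> ij ia ib; have [iab e] := integrable_prod ia ib.
have mp : mfunT (fun r : marks M => (r i, r j)).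
  by apply: measurable_fun_pair; exact: measurable_coord.
have h f mf f0 := @integral_mark2 i j f ij mf f0.
split; first by have := transfer_integrable mp h iab.
rewrite -e /Rintegral (transfer_integral h)//; exact: measurable_int iab.
Qed.

Variable a : nat -> M -> R.
Hypothesis ma : forall n, mfunT (a n).
Hypothesis a2 : forall n, (\int[rho]_x (a n x ^+ 2)%:E < +oo)%E.
Hypothesis a0 : forall n, \int[rho]_x a n x = 0.

Let ai n : integrableT rho (a n).
Proof.
have one : (\int[rho]_r (1 ^+ 2 : R)%:E < +oo)%E.
  by under eq_integral do rewrite expr1n; rewrite integral_cst// mul1e ltey_eq fin_num_measure.
have := L2M_integrable (ma n) (a2 n) (measurable_cst (1 : R)) one.
by congr integrable; apply/funext => r /=; rewrite mulr1.
Qed.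

Let mar n : mfunT (fun r : marks M => a n (r n)).
Proof. by apply: mcompT; [exact: ma|exact: measurable_coord]. Qed.

Lemma mark_orthogonal k (s : seq nat) : k \notin s ->
  integrableT Phat (fun r => a k (r k) * \sum_(n <- s) a n (r n)) /\
  \int[Phat]_r (a k (r k) * \sum_(n <- s) a n (r n)) = 0.
Proof.
elim: s => [|n s IH].
  move=> _; under eq_fun do rewrite big_nil mulr0; split; first exact: integrable0.
  by rewrite /Rintegral integral0.
rewrite inE negb_or => /andP[kn /IH[i e]].
have [i1 e1] := mark_cov kn (ai k) (ai n).
have E : (fun r : marks M => a k (r k) * \sum_(m <- n :: s) a m (r m)) =
  (fun r => a k (r k) * a n (r n) + a k (r k) * \sum_(m <- s) a m (r m)).
  by apply/funext => r; rewrite big_cons mulrDr.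
rewrite E; split; first by have := integrableD measurableT i1 i.
by rewrite RintegralD// e e1 a0 mul0r addr0.
Qed.

(** Variances add up: the cross terms are integrals of products of functions of two distinct marks,
    independent and centred. *)
Lemma mark_sum_sqr (s : seq nat) : uniq s ->
  (\int[Phat]_r ((\sum_(n <- s) a n (r n)) ^+ 2)%:E =
   (\sum_(n <- s) \int[rho]_x (a n x ^+ 2))%:E)%E.
Proof.
move=> us.
suff [i e] : integrableT Phat (fun r => (\sum_(n <- s) a n (r n)) ^+ 2) /\
    \int[Phat]_r ((\sum_(n <- s) a n (r n)) ^+ 2) = \sum_(n <- s) \int[rho]_x (a n x ^+ 2).
  by rewrite -e /Rintegral fineK//; exact: integrable_fin_num i.
elim: s us => [_|k s IH /= /andP[ks /IH[i e]]].
  under eq_fun do rewrite big_nil expr0n /=; split; first exact: integrable0.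
  by rewrite /Rintegral integral0 big_nil.
have [i1 e1] := mark_orthogonal ks.
have ik : integrableT Phat (fun r => a k (r k) ^+ 2).
  apply/integrableP; split; first by apply/mEFinP; exact: measurable_funX.
  under eq_integral do rewrite /= ger0_norm ?sqr_ge0//.
  rewrite -(integral_mark k (f := fun x => (a k x ^+ 2)%:E))//.
  - by apply/mEFinP; exact: measurable_funX.
  - by move=> x; rewrite lee_fin sqr_ge0.
have ek : \int[Phat]_r (a k (r k) ^+ 2) = \int[rho]_x (a k x ^+ 2).
  rewrite /Rintegral -(integral_mark k (f := fun x => (a k x ^+ 2)%:E))//.
  - by apply/mEFinP; exact: measurable_funX.
  - by move=> x; rewrite lee_fin sqr_ge0.
have i2 : integrableT Phat (fun r => 2 * (a k (r k) * \sum_(n <- s) a n (r n))).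
  by have := integrableZl measurableT 2 i1; congr integrable.
have E : (fun r : marks M => (\sum_(m <- k :: s) a m (r m)) ^+ 2) =
  (fun r => a k (r k) ^+ 2 + (2 * (a k (r k) * \sum_(m <- s) a m (r m)) +
     (\sum_(m <- s) a m (r m)) ^+ 2)).
  by apply/funext => r; rewrite big_cons; ring.
have i3 := integrableD measurableT i2 i.
rewrite E; split; first by have := integrableD measurableT ik i3.
by rewrite RintegralD// RintegralD// RintegralZl// e1 mulr0 add0r ek e big_cons.
Qed.

(** By Fatou's lemma the squared distance of the m-th partial sum to [S] is at most the tail of the
    variances. The almost sure limit is therefore an L2 limit, and squared norms converge. *)
Lemma mark_series_sqr (S : marks M -> R) (V : R) : mfunT S ->
  {ae Phat, forall r, (\sum_(0 <= n < N) a n (r n)) @[N --> \oo] --> S r} ->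
  (\sum_(0 <= n < N) \int[rho]_x (a n x ^+ 2)) @[N --> \oo] --> V ->
  (\int[Phat]_r (S r ^+ 2)%:E = V%:E)%E.
Proof.
move=> mS hS hV; pose v n := \int[rho]_x (a n x ^+ 2).
have v0 n : 0 <= v n by apply: Rintegral_ge0 => x _; exact: sqr_ge0.
pose T N (r : marks M) := \sum_(0 <= n < N) a n (r n).
have mT N : mfunT (T N) by exact: measurable_sum.
pose VV N := \sum_(0 <= n < N) v n.
have VVnd m n : (m <= n)%N -> VV m <= VV n.
  by move=> mn; rewrite /VV (big_cat_nat _ mn)//= lerDl sumr_ge0.
have VVle N : VV N <= V.
  rewrite -(cvg_lim _ hV)//; apply: nondecreasing_cvgn_le; last by apply/cvg_ex; exists V.
  by move=> m n; exact: VVnd.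
have TE N : (\int[Phat]_r (T N r ^+ 2)%:E = (VV N)%:E)%E.
  by rewrite /T /VV -mark_sum_sqr// iota_uniq.
have le m : (\int[Phat]_r ((T m r - S r) ^+ 2)%:E <= (V - VV m)%:E)%E.
  apply: (@fatou_le _ _ R Phat (fun N r => ((T m r - T N r) ^+ 2)%:E)).
  - by move=> N; apply/mEFinP; apply: measurable_funX; exact: measurable_funB.
  - by move=> N r; rewrite lee_fin sqr_ge0.
  - by apply/mEFinP; apply: measurable_funX; exact: measurable_funB.
  - by move=> r; rewrite lee_fin sqr_ge0.
  - apply: (ae_imp _ hS) => r hr; apply/fine_cvgP; split; first exact: nearW.
    have h : (T m r - T N r) @[N --> \oo] --> T m r - S r by apply: cvgB => //; exact: cvg_cst.
    exact: (cvgM h h).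
  - exists m => N mN.
    have -> : (\int[Phat]_r ((T m r - T N r) ^+ 2)%:E = (\sum_(m <= n < N) v n)%:E)%E.
      rewrite -mark_sum_sqr ?iota_uniq//; apply: eq_integral => r _; congr EFin.
      by rewrite /T (big_cat_nat _ mN)//= opprD addrA subrr sub0r sqrrN.
    by rewrite lee_fin lerBrDl /VV -(big_cat_nat _ mN)//; exact: VVle.
have t0 : to0 (fun n => csq Phat (fun r => ((T n r)%:C%C - (S r)%:C%C))).
  apply: (to0_le (v := fun n => (V - VV n)%:E)).
    move=> n; apply: le_trans (le n); rewrite /csq.
    by under eq_integral do rewrite -rmorphB nsq_real.
  move=> e e0; have /cvgrPdist_lt /(_ e e0) [n0 _ hn] := hV.
  by exists n0 => n /hn /=; rewrite lte_fin; apply: le_lt_trans; exact: ler_norm.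
have mTC n := cmeasurable_real (mT n); have mSC := cmeasurable_real mS.
have Too n : (csq Phat (fun r => (T n r)%:C%C) < +oo)%E by rewrite csq_real TE ltry.
have Soo := csq_lty_lim mTC mSC Too t0.
have := csq_cvg mTC mSC Too t0; rewrite csq_real.
under eq_cvg do rewrite csq_real TE /=.
move=> hc; have e := cvg_unique (@Rhausdorff R) hc hV.
by rewrite -e fineK// -csq_real ge0_fin_numE// csq_ge0.
Qed.

End IndependentMarks.

(** Connects an integral against a discrete measure, defined by positive and negative parts, with
    the limit of the partial sums. *)
Lemma absolute_series_cvg (R : realType) (u : nat -> R) :
  (\sum_(n <oo) `|u n|%:E < +oo)%E ->
  [/\ (\sum_(n <oo) (Num.max (u n) 0)%:E)%E \is a fin_num,
      (\sum_(n <oo) (Num.max (- u n) 0)%:E)%E \is a fin_num &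
      (\sum_(0 <= n < N) u n) @[N --> \oo] -->
      fine (\sum_(n <oo) (Num.max (u n) 0)%:E -
            \sum_(n <oo) (Num.max (- u n) 0)%:E)%E].
Proof.
move=> uoo; pose p n := Num.max (u n) 0; pose q n := Num.max (- u n) 0.
have p0 n : 0 <= p n by rewrite le_max lexx orbT.
have q0 n : 0 <= q n by rewrite le_max lexx orbT.
have pf n : p n <= `|u n| by rewrite ge_max normr_ge0 ler_norm.
have qf n : q n <= `|u n| by rewrite ge_max normr_ge0 -normrN ler_norm.
have fE n : u n = p n - q n.
  by rewrite /p /q; case: (leP (u n) 0) => a1; case: (leP (- u n) 0) => b; lra.
have key (s : nat -> R) : (forall n, 0 <= s n) -> (forall n, s n <= `|u n|) ->
    (\sum_(n <oo) (s n)%:E)%E \is a fin_num /\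
    (\sum_(0 <= n < N) s n) @[N --> \oo] --> fine (\sum_(n <oo) (s n)%:E)%E.
  move=> s0 su; have fin : (\sum_(n <oo) (s n)%:E)%E \is a fin_num.
    rewrite ge0_fin_numE; last by apply: nneseries_ge0 => n _ _; rewrite lee_fin.
    by apply: le_lt_trans uoo; apply: lee_nneseries => n _ *; rewrite lee_fin.
  split => //.
  have h : (\sum_(0 <= n < N) (s n)%:E)%E @[N --> \oo] --> (\sum_(n <oo) (s n)%:E)%E.
    by apply: is_cvg_nneseries => n _ _; rewrite lee_fin.
  move: h; rewrite -{1}(fineK fin) => /fine_cvgP[_].
  rewrite (_ : fine \o _ = (fun N => \sum_(0 <= n < N) s n))//.
  by apply/funext => N /=; rewrite sumEFin.
have [pfin pc] := key p p0 pf; have [qfin qc] := key q q0 qf.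
split => //; rewrite fineB//.
rewrite (_ : (fun N => _) = (fun N => \sum_(0 <= n < N) p n - \sum_(0 <= n < N) q n)).
  exact: cvgB.
by apply/funext => N; rewrite -sumrB; apply: eq_bigr => n _.
Qed.

Lemma nneseries_fine_cvg (R : realType) (s : nat -> R) : (forall n, 0 <= s n) ->
  (\sum_(n <oo) (s n)%:E < +oo)%E ->
  (\sum_(n <oo) (s n)%:E)%E \is a fin_num /\
  (\sum_(0 <= n < N) s n) @[N --> \oo] --> fine (\sum_(n <oo) (s n)%:E)%E.
Proof.
move=> s0 soo; have fin : (\sum_(n <oo) (s n)%:E)%E \is a fin_num.
  by rewrite ge0_fin_numE//; apply: nneseries_ge0 => n _ _; rewrite lee_fin.
split => //.
have h : (\sum_(0 <= n < N) (s n)%:E)%E @[N --> \oo] --> (\sum_(n <oo) (s n)%:E)%E.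
  by apply: is_cvg_nneseries => n _ _; rewrite lee_fin.
move: h; rewrite -{1}(fineK fin) => /fine_cvgP[_].
rewrite (_ : fine \o _ = (fun N => \sum_(0 <= n < N) s n))//.
by apply/funext => N /=; rewrite sumEFin.
Qed.

Lemma nneseries_term_lty (R : realType) (u : nat -> \bar R) k : (forall n, 0 <= u n)%E ->
  (\sum_(n <oo) u n < +oo)%E -> (u k < +oo)%E.
Proof.
move=> u0; apply: le_lt_trans.
apply: (@le_trans _ _ (\sum_(0 <= n < k.+1) u n)%E).
  by rewrite big_nat_recr//= leeDr// sume_ge0.
by apply: nneseries_lim_ge => n _ _; exact: u0.
Qed.

Lemma quad_ge0 (R : realFieldType) (q c : R) : 0 <= q ->
  (forall t, 0 <= t ^+ 2 * q + 2 * t * c) -> c = 0.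
Proof.
(* The test value is t = - c / (q + 1), close to the minimizer and also valid for q = 0. *)
move=> q0 h; pose b := (q + 1)^-1.
have b0 : 0 < b by rewrite invr_gt0 ltr_wpDl.
have bq : b * q = 1 - b.
  have : b * (q + 1) = 1 by rewrite mulVf// gt_eqF// ltr_wpDl.
  by rewrite mulrDr mulr1 => <-; rewrite addrK.
have := h (- c * b).
have -> : (- c * b) ^+ 2 * q + 2 * (- c * b) * c = c ^+ 2 * b * (b * q - 2) by ring.
rewrite bq => h1; apply/eqP; rewrite -sqrf_eq0 -[_ == 0]negbK; apply/negP => c0.
have cp : 0 < c ^+ 2 by rewrite lt0r c0 sqr_ge0.
by have := mulr_gt0 cp b0; nra.
Qed.

Lemma sqint_indic d (T : measurableType d) (R : realType) (mu : {measure set T -> \bar R})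
    (B : set T) : measurable B -> (mu B < +oo)%E -> sqint mu \1_B.
Proof.
move=> mB Boo; split; first exact: measurable_indic.
under eq_integral => x _.
  rewrite (_ : \1_B x ^+ 2 = (\1_B x : R)); last first.
    by rewrite indicE; case: (x \in B); rewrite ?expr1n ?expr0n.
  over.
by rewrite -measure_integral_indic.
Qed.

(** * Resolvents of a closed quadratic form *)

Section Resolvent.
Context d (T : measurableType d) (R : realType) (mu : {sigma_finite_measure set T -> \bar R}).
Variables (dom : set (T -> R)) (form : (T -> R) -> (T -> R) -> R).
Hypothesis df : dirichlet_form mu dom form.
Implicit Types u v w g : T -> R.
Local Notation sqint := (sqint mu).
Local Notation ip := (ip mu).

Lemma dom_sqint u : dom u -> sqint u.
Proof. by move=> /(df_L2 df) /Lfun2P. Qed.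

Section Minimization.
Variables (alpha : R) (alpha_gt0 : 0 < alpha) (g : T -> R) (hg : sqint g).

Definition Qf u v := alpha * form u v + ip u v.
(** Up to the constant [ip g g] this is alpha times the energy plus the squared distance to [g]; its
    minimizer is the resolvent (1 - 2 alpha a)^-1 g or (1 - alpha a)^-1 g according to the
    normalization, here the latter since form(u, v) = - (a u, v). *)
Definition Jf u := Qf u u - 2 * ip u g.

Lemma QfC u v : dom u -> dom v -> Qf u v = Qf v u.
Proof. by move=> hu hv; rewrite /Qf (df_sym df)// ipC. Qed.

Lemma Qf_lin a u v w : dom u -> dom v -> dom w ->
  Qf (fun x => a * u x + v x) w = a * Qf u w + Qf v w.
Proof.
move=> hu hv hw; rewrite /Qf (df_bilin df)// ip_lin; try exact: dom_sqint.
ring.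
Qed.

Lemma Qf_ge0 u : dom u -> 0 <= Qf u u.
Proof. by move=> hu; rewrite addr_ge0 ?ip_ge0// mulr_ge0 ?(df_ge0 df)// ltW. Qed.

Lemma ip_le_Qf u : dom u -> ip u u <= Qf u u.
Proof. by move=> hu; rewrite lerDr mulr_ge0 ?(df_ge0 df)// ltW. Qed.

Lemma Qf_sqr a u v : dom u -> dom v ->
  Qf (fun x => a * u x + v x) (fun x => a * u x + v x) =
  a ^+ 2 * Qf u u + 2 * a * Qf u v + Qf v v.
Proof.
move=> hu hv; have hw := df_lin df a hu hv.
rewrite Qf_lin// (QfC hu hw) (QfC hv hw) !Qf_lin// (QfC hv hu); ring.
Qed.

Lemma Jf_lin a u v : dom u -> dom v ->
  Jf (fun x => a * u x + v x) = Jf v + a ^+ 2 * Qf u u + 2 * a * (Qf u v - ip u g).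
Proof.
move=> hu hv; rewrite /Jf Qf_sqr// ip_lin//; try exact: dom_sqint.
ring.
Qed.

Lemma Jf_ge u : dom u -> - ip g g <= Jf u.
Proof.
move=> hu; have := ip_dist ltr01 (dom_sqint hu) hg; have := ip_le_Qf hu.
by rewrite /Jf invr1 !mul1r; lra.
Qed.

Lemma dom_cst0 : dom (cst 0).
Proof.
have h0 : cst 0 \in Lfun mu 2%:E.
  apply/Lfun2P; split => //; under eq_integral do rewrite /cst expr0n /=.
  by rewrite integral0 ltry.
have [u du _] := df_dense df h0 ltr01.
have := df_lin df (-1) du du; congr dom; apply/funext => x.
by rewrite mulN1r addNr.
Qed.

(** A minimizing sequence is Cauchy for [Qf], hence in L2 and in energy; closedness of the form puts
    the limit in the domain, and expanding [Jf] around the sequence shows that the infimum is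
    attained. *)
Lemma minimizer : exists2 u, dom u & forall v, dom v -> Jf u <= Jf v.
Proof.
pose E : set R := [set Jf u | u in dom].
have hE : has_inf E.
  split; first by exists (Jf (cst 0)), (cst 0) => //; exact: dom_cst0.
  by exists (- ip g g) => _ [u hu <-]; exact: Jf_ge.
pose m := inf E.
have mle v : dom v -> m <= Jf v by move=> hv; apply: (ge_inf hE.2); exists v.
have /choice[u_ hu_] : forall n : nat, exists u, dom u /\ Jf u < m + n.+1%:R^-1.
  move=> n; have p : 0 < n.+1%:R^-1 :> R by rewrite invr_gt0.
  have [_ [u hu <-] hlt] := inf_adherent p hE.
  by exists u.
have du n : dom (u_ n) by have [] := hu_ n.
have dB p q : dom (fun x => -1 * u_ q x + u_ p x) by apply: (df_lin df).
(* Parallelogram identity: the midpoint of two almost minimizers cannot go below [m]. The midpoint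
   is written with an added [cst 0] to fit the form [a * u + v] of the linearity lemmas. *)
have key p q : Qf (fun x => -1 * u_ q x + u_ p x) (fun x => -1 * u_ q x + u_ p x) <=
    2 * (p.+1%:R^-1 + q.+1%:R^-1).
  have d2 : dom (fun x => 2^-1 * u_ p x + cst 0 x) by apply: (df_lin df) => //; exact: dom_cst0.
  have d3 := df_lin df 2^-1 (du q) d2.
  have := mle _ d3; rewrite Jf_lin// Jf_lin//; last exact: dom_cst0.
  rewrite Qf_sqr//.
  rewrite (QfC (du q) d2) Qf_lin//; last exact: dom_cst0.
  have Q0 w : dom w -> Qf w (cst 0) = 0.
    move=> hw; have d0 := dom_cst0; have := Qf_lin (-1) d0 d0 hw.
    rewrite (_ : (fun x => _) = cst 0); last by apply/funext => x; rewrite mulr0 addr0.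
    by rewrite mulN1r addNr (QfC hw d0).
  have J0 : Jf (cst 0) = 0.
    rewrite /Jf Q0//; last exact: dom_cst0.
    rewrite /ip /Rintegral integral0_eq ?mulr0 ?subr0// => x _; by rewrite mul0r.
  rewrite J0 (QfC dom_cst0 (du q)) !Q0//.
  have [_ hp] := hu_ p; have [_ hq] := hu_ q.
  move: hp hq; rewrite /Jf (QfC (du p) (du q)).
  move: (Qf (u_ p) (u_ p)) (Qf (u_ q) (u_ q)) (Qf (u_ q) (u_ p)) (ip (u_ p) g) (ip (u_ q) g).
  move: (p.+1%:R^-1) (q.+1%:R^-1) => ep eq a b c e f hp hq h.
  lra.
have invc (e : R) : 0 < e -> exists n0 : nat, forall n, (n0 <= n)%N -> n.+1%:R^-1 < e.
  move=> e0; have [n0 hn0] := ltr_add_invr e0; rewrite add0r in hn0.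
  exists n0 => n le; apply: le_lt_trans hn0.
  by rewrite lef_pV2 ?posrE ?ltr0n// ler_nat.
have Qc (e : R) : 0 < e -> exists n0, forall p q, (n0 <= p)%N -> (n0 <= q)%N ->
    Qf (fun x => -1 * u_ q x + u_ p x) (fun x => -1 * u_ q x + u_ p x) < e.
  move=> e0; have [n0 hn0] := invc (e / 4) (divr_gt0 e0 (ltr0n _ 4)).
  exists n0 => p q /hn0 hp /hn0 hq; apply: (le_lt_trans (key p q)).
  move: hp hq; move: (p.+1%:R^-1) (q.+1%:R^-1) => ep eq; lra.
have subE p q : (fun x => -1 * u_ q x + u_ p x) = u_ p - u_ q.
  by apply/funext => x; rewrite mulN1r addrC.
have mu_ n : mfunT (u_ n) by have [] := dom_sqint (du n).
have [|u mu' hu] := L2_complete (mu := mu) mu_.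
  move=> e e0; have [n0 hn0] := Qc _ e0; exists n0 => p q hp hq.
  have := hn0 p q hp hq; have := ip_le_Qf (dB p q) => h1 h2.
  have -> : (\int[mu]_x ((u_ p x - u_ q x) ^+ 2)%:E = \int[mu]_x ((-1 * u_ q x + u_ p x) ^+ 2)%:E)%E.
    by apply: eq_integral => x _; rewrite mulN1r addrC.
  by rewrite -(ipE (dom_sqint (dB p q))) lte_fin; exact: le_lt_trans h1 h2.
have u2 : (\int[mu]_x (u x ^+ 2)%:E < +oo)%E.
  rewrite -csq_real; apply: (csq_lty_lim (f_ := fun n x => (u_ n x)%:C%C)).
  - by move=> n; exact: cmeasurable_real.
  - exact: cmeasurable_real.
  - by move=> n; rewrite csq_real; have [] := dom_sqint (du n).
  - by apply: to0_ext hu => n; rewrite -csq_real; congr csq; apply/funext => x; rewrite rmorphB.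
have uL2 : u \in Lfun mu 2%:E by apply/Lfun2P.
have [||hdu hfu] := df_closed df du uL2.
- move=> e e0; have [n0 hn0] := Qc (alpha * e) (mulr_gt0 alpha_gt0 e0).
  exists n0 => p q hp hq; have := hn0 p q hp hq; rewrite subE /Qf => h.
  rewrite -(ltr_pM2l alpha_gt0); apply: le_lt_trans h.
  by rewrite lerDl ip_ge0.
- exact/norm2_to0.
exists u => // v hv; apply: le_trans (mle v hv).
apply/ler_addgt0Pr => e e0.
(* With s = e / (4 C) the terms in the fixed quantities cost at most e / 4; the error [u_ n - u] is
   then taken below s * e / 8 in [Qf], which survives the factor s^-1. *)
pose C := Qf u u + ip g g + 1.
have C0 : 0 < C by rewrite ltr_wpDl// addr_ge0 ?ip_ge0 ?Qf_ge0.
pose s := e / (4 * C); have s0 : 0 < s by rewrite divr_gt0// mulr_gt0.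
have [n1 hn1] := invc (e / 4) (divr_gt0 e0 (ltr0n _ 4)).
have [n2 hn2] : exists n2, forall n, (n2 <= n)%N -> ip (u_ n - u) (u_ n - u) < s * e / 16.
  have [n2 hn2] := hu (s * e / 16) (divr_gt0 (mulr_gt0 s0 e0) (ltr0n _ 16)).
  exists n2 => n /hn2; have hB := sqint_lin (-1) (conj mu' u2 : sqint u) (dom_sqint (du n)).
  have := ipE hB; rewrite (_ : (fun x => _) = u_ n - u).
    move=> E1; rewrite -lte_fin E1; apply: le_lt_trans.
    by rewrite le_eqVlt; apply/orP; left; apply/eqP/eq_integral => x _; rewrite mulN1r addrC.
  by apply/funext => x; rewrite mulN1r addrC.
have [n3 hn3] : exists n3, forall n, (n3 <= n)%N ->
    alpha * form (u_ n - u) (u_ n - u) < s * e / 16.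
  have e1 : 0 < s * e / 16 / alpha by rewrite !divr_gt0// mulr_gt0.
  move/cvgrPdist_lt : hfu => /(_ _ e1)[n3 _ hn3]; exists n3 => n hn.
  have := hn3 n hn; rewrite /= sub0r normrN => /(le_lt_trans (ler_norm _)).
  by rewrite ltr_pdivlMr// mulrC.
pose n := maxn n1 (maxn n2 n3).
have hB : dom (fun x => -1 * u x + u_ n x) by apply: (df_lin df).
have BE : (fun x => -1 * u x + u_ n x) = u_ n - u by apply/funext => x; rewrite mulN1r addrC.
have uE : u = (fun x => -1 * (u_ n - u) x + u_ n x).
  by apply/funext => x; rewrite mulN1r opprB subrK.
rewrite BE in hB.
have Qh : Qf (u_ n - u) (u_ n - u) < s * e / 8.
  have l2 : (n2 <= n)%N by rewrite !leq_max leqnn orbT.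
  have l3 : (n3 <= n)%N by rewrite !leq_max leqnn !orbT.
  rewrite /Qf; move: (hn2 n l2) (hn3 n l3); move: (ip _ _) (alpha * _) (s * e) => x y z; lra.
have Jn : Jf (u_ n) < m + e / 4.
  have [_ h] := hu_ n; apply: (lt_trans h); rewrite ltrD2l.
  by apply: hn1; rewrite leq_max leqnn.
have JE : Jf u = Jf (u_ n) + Qf (u_ n - u) (u_ n - u) - 2 * (Qf (u_ n - u) (u_ n) - ip (u_ n - u) g).
  by rewrite {1}uE Jf_lin//; ring.
have QE : Qf (u_ n - u) (u_ n) = Qf (u_ n - u) u + Qf (u_ n - u) (u_ n - u).
  have -> : Qf (u_ n - u) (u_ n) = Qf (fun x => 1 * (u_ n - u) x + u x) (u_ n - u).
    rewrite (QfC hB (du n)); congr Qf; apply/funext => x.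
    by rewrite mul1r subrK.
  by rewrite Qf_lin// mul1r (QfC hdu hB) addrC.
have dom' : dom (fun x => -1 * (u_ n - u) x + cst 0 x).
  by apply: (df_lin df) => //; exact: dom_cst0.
have QB : - (2 * Qf (u_ n - u) u) <= s * Qf u u + s^-1 * Qf (u_ n - u) (u_ n - u).
  have := Qf_ge0 (df_lin df s^-1 hB hdu); rewrite Qf_sqr// => h.
  rewrite -(ler_pM2l (_ : 0 < s^-1)) ?invr_gt0//.
  have -> : s^-1 * (s * Qf u u + s^-1 * Qf (u_ n - u) (u_ n - u)) =
      Qf u u + s^-1 ^+ 2 * Qf (u_ n - u) (u_ n - u) by field; rewrite gt_eqF.
  move: h; move: (Qf u u) (Qf (u_ n - u) u) (Qf (u_ n - u) (u_ n - u)) (s^-1) => a b c t.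
  lra.
have IB : 2 * ip (u_ n - u) g <= s^-1 * Qf (u_ n - u) (u_ n - u) + s * ip g g.
  have := @ip_dist _ _ _ mu s^-1 (u_ n - u) g; rewrite invr_gt0 s0 invrK.
  move=> /(_ isT (dom_sqint hB) hg) h; apply: (le_trans h); rewrite lerD2r.
  by rewrite ler_pM2l ?invr_gt0// ip_le_Qf.
have sC : s * (Qf u u + ip g g) <= e / 4.
  apply: (@le_trans _ _ (s * C)); first by rewrite ler_pM2l// lerDl.
  by rewrite /s le_eqVlt; apply/orP; left; apply/eqP; field; rewrite gt_eqF.
have sQ : s^-1 * Qf (u_ n - u) (u_ n - u) <= e / 8.
  rewrite mulrC ler_pdivrMr//; apply/ltW; apply: lt_le_trans Qh _.
  by rewrite [e / 8 * s]mulrC mulrA.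
rewrite JE QE; have := Qf_ge0 hB; move: QB IB sC sQ Jn.
move: (Qf u u) (Qf (u_ n - u) u) (Qf (u_ n - u) (u_ n - u)) (ip (u_ n - u) g) (ip g g) (Jf (u_ n)).
move=> a b c f h j; rewrite mulrDr; lra.
Qed.

Lemma minimizer_euler u v : dom u -> dom v -> (forall w, dom w -> Jf u <= Jf w) ->
  Qf u v = ip v g.
Proof.
move=> hu hv hm; apply/eqP; rewrite -subr_eq0; apply/eqP.
apply: (quad_ge0 (Qf_ge0 hv)) => t; have := hm _ (df_lin df t hv hu).
by rewrite Jf_lin// -addrA lerDl (QfC hv hu).
Qed.

End Minimization.

Definition resolvent_indic (alpha : R) (B : set T) u :=
  [/\ dom u, forall x, 0 <= u x <= 1 & forall v, dom v -> Qf alpha u v = ip v \1_B].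

(** Truncating a minimizer to [0, 1] does not raise its energy, by the Markov property, nor u^2 - 2
    u 1_B at any point. The truncation is thus again a minimizer. *)
Lemma resolvent_indic_exists (alpha : R) (B : set T) : 0 < alpha -> measurable B ->
  (mu B < +oo)%E -> exists u, resolvent_indic alpha B u /\
    (forall v, dom v -> Jf alpha \1_B u <= Jf alpha \1_B v).
Proof.
move=> a0 mB Boo; have hB := sqint_indic mB Boo.
have [u hu um] := minimizer a0 hB; have [] := df_markov df hu.
set v := (fun x => Num.min _ 1) => hv vu.
have v01 x : 0 <= v x <= 1.
  rewrite /v le_min ler01 andbT; apply/andP; split; first by rewrite le_max lexx orbT.
  by rewrite ge_min lexx orbT.
have Jv : Jf alpha \1_B v <= Jf alpha \1_B u.
  have sq w : dom w -> ip w w - 2 * ip w \1_B = \int[mu]_x (w x * w x - 2 * (w x * \1_B x)).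
    move=> hw; have sw := dom_sqint hw.
    have i1 := sqint_ip sw sw; have i2 := sqint_ip sw hB.
    rewrite RintegralB//; last by have := integrableZl measurableT 2 i2; apply: eq_integrable.
    by rewrite RintegralZl.
  have le : ip v v - 2 * ip v \1_B <= ip u u - 2 * ip u \1_B.
    rewrite !sq//; have int w : dom w ->
        integrableT mu (fun x => w x * w x - 2 * (w x * \1_B x)).
      move=> hw; have sw := dom_sqint hw.
      have i1 := sqint_ip sw sw; have i2 := sqint_ip sw hB.
      have := integrableB measurableT i1 (integrableZl measurableT 2 i2).
      by apply: eq_integrable.
    apply: le_Rintegral => //; [exact: int|exact: int|].
    move=> x _; rewrite /v indicE.
    have [h0|h0] := leP (u x) 0; rewrite ?(max_r h0) ?(max_l (ltW h0)).
      rewrite (min_l ler01); case: (x \in B) => /=; nra.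
    have [h1|h1] := leP (u x) 1; first by [].
    case: (x \in B) => /=; nra.
  rewrite /Jf /Qf -!addrA lerD// ler_pM2l//.
exists v; split; last by move=> w hw; apply: le_trans Jv (um w hw).
split => // w hw; apply: minimizer_euler => // w' hw'.
exact: le_trans Jv (um w' hw').
Qed.

(** By symmetry of the resolvent the integral of [u] over [A n] is the integral over [B] of the
    resolvent of the indicator of [A n], which is at most 1. The bound mu(B) passes to the limit
    along an exhaustion. *)
Lemma resolvent_indic_int (alpha : R) (B : set T) u : 0 < alpha -> measurable B ->
  (mu B < +oo)%E -> resolvent_indic alpha B u -> integrableT mu u.
Proof.
move=> a0 mB Boo [hu u01 uE]; have [mu' u2] := dom_sqint hu.
have su := dom_sqint hu; have hB := sqint_indic mB Boo.
have u0 x : 0 <= u x by have /andP[] := u01 x.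
have [A [AT nA hA]] := (sigma_finiteP _ _).1 (sigma_finiteT mu).
have bound n : (\int[mu]_x (u x * \1_(A n) x)%:E <= mu B)%E.
  have [mA Aoo] := hA n; have sA := sqint_indic mA Aoo.
  have [v [[hv v01 vE] _]] := resolvent_indic_exists a0 mA Aoo.
  have e : ip u \1_(A n) = ip v \1_B by rewrite -vE// -uE// QfC.
  have -> : (\int[mu]_x (u x * \1_(A n) x)%:E = (ip u \1_(A n))%:E)%E.
    rewrite /ip /Rintegral fineK//.
    by have := integrable_fin_num measurableT (sqint_ip su sA).
  rewrite e; have -> : ((ip v \1_B)%:E = \int[mu]_x (v x * \1_B x)%:E)%E.
    rewrite /ip /Rintegral fineK//.
    by have := integrable_fin_num measurableT (sqint_ip (dom_sqint hv) hB).
  rewrite measure_integral_indic//; apply: integral_EFin_le.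
  - by apply: measurable_funM; [have [] := dom_sqint hv|exact: measurable_indic].
  - exact: measurable_indic.
  - by move=> x; have /andP[v0 _] := v01 x; rewrite indicE mulr_ge0.
  - by move=> x; have /andP[_ v1] := v01 x; rewrite ler_piMl// indicE.
apply/integrableP; split; first exact/mEFinP.
rewrite (eq_integral (fun x => (u x)%:E)); last by move=> x _; rewrite /= ger0_norm.
apply: le_lt_trans Boo.
apply: (fatou_le (f_ := fun n x => (u x * \1_(A n) x)%:E)).
- move=> n; apply/mEFinP; apply: measurable_funM => //.
  by apply: measurable_indic; have [] := hA n.
- by move=> n x; rewrite lee_fin indicE mulr_ge0.
- exact/mEFinP.
- by move=> x; rewrite lee_fin.
- apply: aeW => x; have [n0 _ An0] : (\bigcup_i A i) x by rewrite -AT.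
  apply: cvg_near_cst; exists n0 => // n /= hn.
  have : A n x by move: An0; apply/subsetPset; exact: nA.
  by move=> An; rewrite indicE mem_set// mulr1.
- by exists 0%N => n _; exact: bound.
Qed.

(** The resolvent [u] of the indicator has generator alpha^-1 (u - 1_B). Comparing [Jf] at [u] and
    at an element [v] of the domain close to 1_B bounds the distance of [u] to 1_B, once alpha is
    small against the energy of [v]. *)
Lemma generator_approx_indic (B : set T) (e : R) : measurable B -> (mu B < +oo)%E ->
  0 < e -> exists u, [/\ u \in Lfun mu 1, exists w, is_generator mu dom form u w &
    (\int[mu]_x ((u x - \1_B x) ^+ 2)%:E < e%:E)%E].
Proof.
move=> mB Boo e0; have hB := sqint_indic mB Boo.
have LB : (\1_B : T -> R) \in Lfun mu 2%:E by apply/Lfun2P; have [] := hB.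
have e2 : 0 < Num.sqrt (e / 2) by rewrite sqrtr_gt0 divr_gt0.
have [v hv] := df_dense df LB e2.
rewrite norm2E => hvB; have {hvB} := poweR_half_lt _ hvB.
rewrite integral_ge0//; last by move=> x _; rewrite lee_fin sqr_ge0.
move=> /(_ isT) hvB.
pose al := e / (2 * (form v v + 1)).
have f0 := df_ge0 df hv.
have a0 : 0 < al by rewrite divr_gt0// mulr_gt0// ltr_wpDl.
have [u [hr um]] := resolvent_indic_exists a0 mB Boo.
have [hu u01 uE] := hr.
exists u; split.
- by apply/Lfun1P; exact: resolvent_indic_int hr.
- exists (fun x => al^-1 * (u x - \1_B x)); split => //.
    apply/Lfun2P; suff : sqint (fun x => al^-1 * (u x - \1_B x)) by [].
    have s1 := sqint_lin (-1) hB (dom_sqint hu).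
    have s2 := sqint_lin al^-1 s1 (dom_sqint dom_cst0).
    have -> : (fun x => al^-1 * (u x - \1_B x)) =
        (fun x => al^-1 * (-1 * \1_B x + u x) + cst 0 x).
      by apply/funext => x; rewrite addr0 mulN1r [- _ + _]addrC.
    exact: s2.
  move=> w hw; have := uE w hw; rewrite /Qf => h.
  have sw := dom_sqint hw; have su := dom_sqint hu.
  have := ip_lin (-1) hB su sw; have s1 := sqint_lin (-1) hB su.
  rewrite (_ : (fun x => _) = (fun x => u x - \1_B x)) => [h1|]; last first.
    by apply/funext => x; rewrite mulN1r addrC.
  have -> : \int[mu]_x (al^-1 * (u x - \1_B x) * w x) = al^-1 * ip (fun x => u x - \1_B x) w.
    rewrite /ip -RintegralZl//.
      by apply: eq_Rintegral => x _; rewrite mulrA.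
    have := sqint_ip s1 sw; apply: eq_integrable => // x _ /=.
    by rewrite mulN1r [- _ + _]addrC.
  rewrite h1 (ipC _ _ w).
  have -> : form u w = al^-1 * (al * form u w) by rewrite mulKf// gt_eqF.
  by rewrite -mulrN; congr (_ * _); lra.
- have expand w : dom w -> (\int[mu]_x ((w x - \1_B x) ^+ 2)%:E =
      (ip w w - 2 * ip w \1_B + ip \1_B \1_B)%:E)%E.
    move=> hw; have sw := dom_sqint hw; have s1 := sqint_lin (-1) hB sw.
    have -> : (fun x => ((w x - \1_B x) ^+ 2)%:E) =
        (fun x => ((-1 * \1_B x + w x) ^+ 2)%:E).
      by apply/funext => x; rewrite mulN1r addrC.
    rewrite -ipE//; congr EFin.
    by rewrite ip_lin// (ipC _ \1_B) (ipC _ w) !ip_lin// (ipC _ \1_B w); ring.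
  rewrite expand// lte_fin; move: hvB.
  have -> : (\int[mu]_x (((\1_B - v)%R x) ^+ 2)%:E = \int[mu]_x ((v x - \1_B x) ^+ 2)%:E)%E.
    by apply: eq_integral => x _; rewrite -sqrrN opprB.
  rewrite expand// lte_fin; have := um v hv; have := df_ge0 df hu.
  have : al * form v v <= e / 2.
    rewrite /al -mulrA ler_pM2l// mulrC ler_pdivrMr ?mulr_gt0// ?ltr_wpDl//.
    move: (form v v) f0 => x x0; lra.
  rewrite /Jf /Qf; have : 0 <= al * form u u by rewrite mulr_ge0 ?(df_ge0 df)// ltW.
  move: (al * form u u) (al * form v v) (ip u u) (ip v v) (ip u \1_B) (ip v \1_B) (ip \1_B \1_B).
  move=> a b c f h i j; lra.
Qed.

End Resolvent.

(** * Trigonometric separation of integers *)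

Lemma two_power_odd (n : nat) : (0 < n)%N -> exists a b : nat, n = (2 ^ a * b.*2.+1)%N.
Proof.
elim/ltn_ind: n => n IH n0; have [on|en] := boolP (odd n).
  by exists 0%N, n./2; rewrite expn0 mul1n -[LHS]odd_double_half on.
have nE : n = (n./2).*2 by rewrite -[LHS]odd_double_half (negbTE en).
have h0 : (0 < n./2)%N by rewrite -double_gt0 -nE.
have [|a [b E]] := IH n./2 _ h0.
  by rewrite {2}nE -addnn -[X in (X < _)%N]addn0 ltn_add2l.
by exists a.+1, b; rewrite expnS -mulnA -E mul2n.
Qed.

Lemma cos_odd_pi (R : realType) (b : nat) : cos (pi * (b.*2.+1)%:R : R) = -1.
Proof.
elim: b => [|b IH]; first by rewrite mulr1 cospi.
rewrite doubleS -[b.*2.+3]addn2 natrD mulrDr -IH.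
by rewrite (mulr_natr _ 2) cosD2pi.
Qed.

(** Up to sign n - k is 2^a times an odd number, and the cosine of an odd multiple of pi is -1. The
    factor (1 + cos) / 2 of index [a] thus detects that n differs from k. *)
Lemma vanishing_factor (R : realType) (n k : nat) : n != k -> exists a : nat,
  cos (pi / 2 ^+ a * (n%:R - k%:R)) = -1 :> R.
Proof.
have main p q : (q < p)%N -> exists a : nat, cos (pi / 2 ^+ a * (p%:R - q%:R)) = -1 :> R.
  move=> qp; have [|a [b E]] := @two_power_odd (p - q); first by rewrite subn_gt0.
  exists a; rewrite -natrB; last exact: ltnW.
  rewrite E natrM natrX mulrA divfK ?expf_neq0// ?cos_odd_pi//.
rewrite neq_ltn => /orP[/main[a E]|/main//]; exists a.
by rewrite -E -cosN; congr cos; ring.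
Qed.

(** Multiplication by such a factor only shifts the exponent, so combinations of exponentials are
    preserved. *)
Lemma expi_half_cos (R : realType) (a t : R) : expi a * ((1 + cos t) / 2)%:C%C =
  (2^-1)%:C%C * expi a + ((4^-1)%:C%C * expi (a + t) + (4^-1)%:C%C * expi (a - t)).
Proof.
rewrite !expiD expiN /expi.
move: (cos a) (sin a) (cos t) (sin t) => ca sa ct st.
apply/eqP; rewrite eq_complex /=; apply/andP; split; apply/eqP; by field.
Qed.

Lemma bounded_Lfun d (T : measurableType d) (R : realType) (mu : {measure set T -> \bar R})
    (f : T -> R) (c : R) : mfunT f -> (forall x, `|f x| <= c) ->
  f \in Lfun mu +oo%E.
Proof.
move=> mf fc; rewrite inE /Lfun; apply/andP; split; rewrite !inE//=.
rewrite /finite_norm unlock; case: ifP => _; last exact: ltry.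
apply: (@le_lt_trans _ _ c%:E); last exact: ltry.
by apply/ess_sup_inf.ess_supP; apply: aeW => x /=; rewrite lee_fin.
Qed.

Lemma sqintM d (T : measurableType d) (R : realType) (mu : {measure set T -> \bar R})
    (b k : T -> R) (c : R) : mfunT b -> (forall x, `|b x| <= c) ->
  sqint mu k -> sqint mu (fun x => b x * k x).
Proof.
move=> mb bc [mk k2]; split; first exact: measurable_funM.
apply: (@le_lt_trans _ _ (\int[mu]_x (c ^+ 2 * k x ^+ 2)%:E)%E).
  apply: integral_EFin_le.
  - by apply: measurable_funX; exact: measurable_funM.
  - by apply: measurable_funM => //; exact: measurable_funX.
  - by move=> x; exact: sqr_ge0.
  - move=> x; rewrite exprMn ler_wpM2r ?sqr_ge0// -real_normK ?num_real//.
    by have := bc x; have := normr_ge0 (b x); move: `|b x| => t t0 tc; nra.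
rewrite integral_EFinZ; [|exact: sqr_ge0|exact: measurable_funX|by move=> x; exact: sqr_ge0].
by apply: lte_mul_pinfty => //; rewrite lee_fin sqr_ge0.
Qed.

(** * The up-structure *)

Section UpStructure.
Context dX dM (X : measurableType dX) (M : measurableType dM) (R : realType).
Local Notation config := (config X R).
Variables (nu : {sigma_finite_measure set X -> \bar R}) (rho : probability M R).
Variables (d : set (X -> R)) (gam : (X -> R) -> (X -> R) -> X -> R).
Variable flat : (X -> R) -> X * M -> R.
Hypothesis bottom : local_dirichlet_structure nu d gam.
Hypothesis grad : gradient nu rho d gam flat.
Variables (P : probability config R) (Phat : probability (marks M) R).
Variables (alive : nat -> set config) (atom : nat -> config -> X).
Hypotheses (singletons : forall x : X, measurable [set x]).
Hypotheses (diffuse : forall x : X, nu [set x] = 0%E).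
Hypotheses (atoms_N : atom_enumeration P alive atom) (law_marks : product_law rho Phat).
Variable PN : {sigma_finite_measure set (config * X)%type -> \bar R}.
Hypothesis palm : palm_measure nu P PN.
Variable xi : X -> R.
Hypotheses (xi_measurable : mfunT xi) (xi_gt0 : forall x, 0 < xi x).
Hypothesis xi_L2 : ('N[P]_2%:E[(fun w : config => \int[w]_x (xi x)%:E)] < +oo)%E.
Local Notation CXM := (config * X * M)%type.
Local Notation NR := (nu \x rho)%E.
Local Notation mN := (PN \x rho)%E.
Local Notation PP := (P \x Phat)%E.
Local Notation cm := (fun w : config => w : {measure set X -> \bar R}).
Local Notation bf := (bform nu gam).
Local Notation iC := (0 +i* 1 : R[i])%C.
Local Notation test_exponent := (test_exponent nu d gam).
Local Notation Ntilde1 := (Ntilde1 nu).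
Local Notation marked_sum := (marked_sum alive atom).
Local Notation domD := (domD nu d gam P).
Local Notation domD_approx := (domD_approx nu d gam P).
Local Notation energy0 := (energy0 nu d gam P).
Local Notation energy := (energy nu d gam P).
Local Notation normD := (normD nu d gam P).
Local Notation normU0 := (normU0 nu d gam P xi).
Local Notation normU := (normU nu d gam P xi).
Local Notation xi_norm := (xi_norm nu P xi).
Local Notation underD_approx := (underD_approx nu d gam P xi).
Local Notation is_flat0 := (is_flat0 nu d gam flat).
Local Notation tensor := (tensor nu d gam).
Local Notation is_gammaU := (is_gammaU nu d gam P xi).
Local Notation is_flatU := (is_flatU nu rho d gam flat P xi).
Local Notation is_sharp := (is_sharp nu rho d gam flat P Phat alive atom xi).
Local Notation is_marked_integral := (is_marked_integral nu rho P Phat alive atom).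
Local Notation versionN := (versionN nu P).
Local Notation versionNM := (versionNM nu rho P).
Local Notation EintN := (EintN nu P).
Local Notation normPN := (normPN nu rho P).
Local Notation DR := (DR nu d gam P).
Local Notation formR := (formR nu d gam P).

(** * Versions with respect to the Campbell measure *)

Section Palm.
Local Open Scope ereal_scope.

Lemma palm_ae_nu (Q : config * X -> Prop) : {ae PN, forall z, Q z} ->
  {ae P, forall w, {ae nu, forall x, Q (add_atom x w, x)}}.
Proof.
move=> [A [mA A0 QA]].
have mB : measurable ((fun z : config * X => (add_atom z.2 z.1, z.2)) @^-1` A).
  by rewrite -[X in measurable X]setTI; exact: measurable_add_atom_pair.
have : {ae P \x nu, forall z, Q (add_atom z.2 z.1, z.2)}.
  exists ((fun z : config * X => (add_atom z.2 z.1, z.2)) @^-1` A); split => //; last first.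
    by move=> z /= nQ; exact: QA.
  transitivity (\int[P \x nu]_z (\1_A (add_atom z.2 z.1, z.2) : R)%:E).
    by rewrite measure_integral_indic.
  rewrite (fubini_tonelli1 (fun z : config * X => (\1_A (add_atom z.2 z.1, z.2) : R)%:E))//.
    rewrite -(null_set_integral1 mA A0) (palm.1 (fun z => (\1_A z)%:E))//.
    exact/mEFinP/measurable_indic.
  have mi : mfunT (fun z => (\1_A z : R)%:E).
    exact/mEFinP/measurable_indic.
  exact: (mcompT mi (@measurable_add_atom_pair _ X R)).
by move/ae_prodl.
Qed.

Lemma palm_ae_of_nu (Q : config * X -> Prop) : measurable [set z | Q z] ->
  {ae P, forall w, {ae nu, forall x, Q (add_atom x w, x)}} -> {ae PN, forall z, Q z}.
Proof.
move=> mQ h; pose A := ~` [set z | Q z].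
have mA : measurable A by exact: measurableC.
exists A; split => //; transitivity (\int[PN]_z (\1_A z : R)%:E).
  by rewrite integral_indic// setIT.
rewrite palm.1//; last exact/mEFinP/measurable_indic.
rewrite -[RHS](integral0 P setT); apply: ae_eq_lower_integral => //.
  by move=> w; exact: integral_ge0.
apply: filterS h => w h; rewrite -[RHS](integral0 nu setT).
apply: ae_eq_lower_integral => //.
by apply: filterS h => y Qy; rewrite indicE memNset//; exact.
Qed.

(** The series over the enumerated atoms is measurable in [w] and equals the integral against [w]
    wherever the enumeration is valid. *)
Lemma palm_slice (f : config * X -> \bar R) : mfunT f ->
  (forall z, 0 <= f z) -> exists G : config -> \bar R,
  [/\ mfunT G, forall w, 0 <= G w &
    {ae P, forall w : config, \int[(w : {measure set X -> \bar R})]_x f (w, x) = G w}].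
Proof.
move=> mf f0.
exists (fun w => \sum_(n <oo) ((\1_(alive n) w : R)%:E * f (w, atom n w))); split.
- apply: ge0_emeasurable_sum => [n w _ _|n _]; first by rewrite mule_ge0// lee_fin indicE.
  apply: emeasurable_funM.
    by apply/mEFinP/measurable_indic; exact: (alive_measurable atoms_N).
  apply: (mcompT mf).
  by apply: measurable_fun_pair => //; exact: (atom_measurable atoms_N).
- by move=> w; apply: nneseries_ge0 => n _ _; rewrite mule_ge0// lee_fin indicE.
apply: filterS (atomE atoms_N) => w gw.
rewrite (@good_atoms_integral _ _ _ alive atom)//; last exact: (mcompT mf).
apply: eq_eseriesr => n _; rewrite indicE.
case: asboolP => an; first by rewrite mem_set// mul1e.
by rewrite memNset// mul0e.
Qed.

Lemma palm_ae_N (Q : config * X -> Prop) : {ae PN, forall z, Q z} ->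
  {ae P, forall w : config, {ae (w : {measure set X -> \bar R}), forall x, Q (w, x)}}.
Proof.
move=> [A [mA A0 QA]].
have mi : mfunT (fun z => (\1_A z : R)%:E).
  exact/mEFinP/measurable_indic.
have i0 z : 0 <= (\1_A z : R)%:E by rewrite lee_fin.
have [G [mG G0 GE]] := palm_slice mi i0.
have : {ae P, forall w, G w = 0}.
  apply: integral_eq0_ae => //.
  rewrite -(ae_eq_lower_integral _ _ _ GE)//; last by move=> w; exact: integral_ge0.
  by rewrite -(palm.2 (fun z => (\1_A z)%:E))// (null_set_integral1 mA A0).
apply: filterS2 GE => w <- h0.
have mAx : measurable [set x | A (w, x)].
  have := measurable_xsection w mA; congr measurable.
  by apply/seteqP; split => y /=; rewrite /xsection /= inE.
exists [set x | A (w, x)]; split => //; last by move=> y /= nQ; exact: QA.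
by rewrite measure_integral_indic// -[RHS]h0; apply: eq_integral => y _; rewrite !indicE !inE.
Qed.

(** The atoms of [w] are countably many points of [nu]-measure 0, and off them the two operations
    coincide. *)
Lemma add_point_ae :
  {ae P, forall w, {ae nu, forall x, add_point x w = add_atom x w}}.
Proof.
apply: filterS (atomE atoms_N) => w gw.
have : nu.-negligible (\bigcup_n [set atom n w]).
  apply: negligible_bigcup => n; exists [set atom n w]; split => //.
  exact: diffuse.
apply: negligibleS => x /= h; apply: contrapT => nx; apply: h.
rewrite /add_point asboolF// gw// /dirac_sum eseries0 ?ltxx// => n _ _.
case: asboolP => // _; rewrite diracE memNset// => /= h; apply: nx.
by exists n => //=; rewrite h.
Qed.

Lemma versionNP (k k' : config * X -> R) : versionN k k' <->
  mfunT k' /\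
  {ae P, forall w, {ae nu, forall x, k (w, x) = k' (add_atom x w, x)}}.
Proof.
split=> -[mk' h]; split => //.
  apply: filterS2 h add_point_ae => w h1 h2.
  by apply: filterS2 h1 h2 => x -> ->.
apply: filterS2 h add_point_ae => w h1 h2.
by apply: filterS2 h1 h2 => x -> ->.
Qed.

Lemma versionN_unique k k1 k2 : versionN k k1 -> versionN k k2 ->
  {ae PN, forall z, k1 z = k2 z}.
Proof.
move=> /versionNP[m1 h1] /versionNP[m2 h2]; apply: palm_ae_of_nu.
  exact: measurable_eq_set.
apply: filterS2 h1 h2 => w h1 h2; apply: filterS2 h1 h2 => x <-.
exact.
Qed.

Lemma palm_integral_ae (k g : config * X -> R) : mfunT k ->
  mfunT g -> (forall z, 0 <= g z)%R -> {ae PN, forall z, k z = g z} ->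
  \int[P]_w \int[(w : {measure set X -> \bar R})]_x (k (w, x))%:E = \int[PN]_z (g z)%:E.
Proof.
move=> mk mg g0 kg.
have mg' : mfunT (EFin \o g) by exact/mEFinP.
have g0' z : 0 <= (EFin \o g) z by rewrite lee_fin.
have [G [mG G0 GE]] := palm_slice mg' g0'.
rewrite (palm.2 (EFin \o g))// (ae_ge0_integral_lower G0)//.
  apply/esym/ae_ge0_integral_lower => //.
apply: filterS2 GE (palm_ae_N kg) => w <- h.
apply: ae_eq_integral => //.
- exact/mEFinP/(mcompT mk).
- exact/mEFinP/(mcompT mg).
- by apply: filterS h => x /= -> _.
Qed.

(** All versions have the same integral, so the infimum defining [EintN] runs over a single
    value. *)
Lemma EintNE (k k' g : config * X -> R) : versionN k k' ->
  mfunT g -> (forall z, 0 <= g z)%R -> {ae PN, forall z, k' z = g z} ->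
  EintN k = \int[PN]_z (g z)%:E.
Proof.
move=> kk' mg g0 kg.
rewrite /EintN (_ : [set _ | _ in _] = [set \int[PN]_z (g z)%:E]) ?ereal_inf1//.
apply/seteqP; split => [_ [k2 kk2 <-]|_ ->] /=.
  apply: palm_integral_ae => //; first exact: kk2.1.
  by apply: filterS2 (versionN_unique kk' kk2) kg => z <-.
by exists k' => //; apply: palm_integral_ae => //; exact: kk'.1.
Qed.

Lemma EintN_lty (k : config * X -> R) : EintN k < +oo ->
  exists k', versionN k k'.
Proof.
move=> koo; apply: contrapT => /forallNP h.
suff : EintN k = +oo by move=> E; rewrite E in koo.
rewrite /EintN (_ : [set _ | _ in _] = set0) ?ereal_inf0//.
by apply/seteqP; split => // y [k' kk' _]; exact: (h _ kk').
Qed.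

Lemma measurable_tauM (w : config) :
  mfunT (fun z : X * M => (add_atom z.1 w, z.1, z.2)).
Proof.
have ma : mfunT (fun z : X * M => (add_atom z.1 w, z.1)).
  have mw : mfunT (fun z : X * M => (w, z.1)).
    by apply: measurable_fun_pair => //; exact: measurable_fst.
  exact: (mcompT (@measurable_add_atom_pair _ X R) mw).
by apply: measurable_fun_pair => //; exact: measurable_snd.
Qed.

Lemma mN_integral (f : CXM -> \bar R) : mfunT f ->
  (forall z, 0 <= f z) -> \int[mN]_z f z =
  \int[P]_w \int[NR]_z f (add_atom z.1 w, z.1, z.2).
Proof.
move=> mf f0; pose F z := \int[rho]_r f (z, r).
have mF : mfunT F by exact: (measurable_fun_fubini_tonelli_F _ mf f0).
have F0 z : 0 <= F z by exact: integral_ge0.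
rewrite (_ : \int[mN]_x _ = \int[PN]_z F z); last exact: (fubini_tonelli1 _ mf f0).
rewrite (palm.1 F mF F0).
apply: eq_integral => w _.
rewrite (fubini_tonelli1 (fun z : X * M => f (add_atom z.1 w, z.1, z.2)))//.
exact: (mcompT mf (measurable_tauM w)).
Qed.

Lemma mN_ae (Q : CXM -> Prop) : {ae mN, forall z, Q z} ->
  {ae P, forall w, {ae NR, forall z, Q (add_atom z.1 w, z.1, z.2)}}.
Proof.
move=> [A [mA A0 QA]].
have mi : mfunT (fun z => (\1_A z : R)%:E).
  exact/mEFinP/measurable_indic.
have i0 z : 0 <= (\1_A z : R)%:E by rewrite lee_fin.
pose F z := \int[rho]_r (\1_A (z, r) : R)%:E.
have mF : mfunT F by exact: (measurable_fun_fubini_tonelli_F _ mi i0).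
have F0 z : 0 <= F z by exact: integral_ge0.
have : {ae PN, forall z, F z = 0}.
  apply: integral_eq0_ae => //; rewrite -(null_set_integral1 mA A0).
  by rewrite (fubini_tonelli1 _ mi i0).
move=> /palm_ae_nu; apply: filterS => w h.
have mB : measurable ((fun z : X * M => (add_atom z.1 w, z.1, z.2)) @^-1` A).
  by rewrite -[X in measurable X]setTI; exact: measurable_tauM.
exists ((fun z : X * M => (add_atom z.1 w, z.1, z.2)) @^-1` A); split => //; last first.
  by move=> z /= nQ; exact: QA.
transitivity (\int[NR]_z (\1_A (add_atom z.1 w, z.1, z.2) : R)%:E).
  by rewrite measure_integral_indic.
rewrite (fubini_tonelli1 (fun z : X * M => (\1_A (add_atom z.1 w, z.1, z.2) : R)%:E))//; last first.
  exact: (mcompT mi (measurable_tauM w)).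
rewrite -[RHS](integral0 nu setT); apply: ae_eq_lower_integral => //.
by move=> x; exact: integral_ge0.
Qed.

Lemma mN_ae_of (Q : CXM -> Prop) : measurable [set z | Q z] ->
  {ae P, forall w, {ae NR, forall z, Q (add_atom z.1 w, z.1, z.2)}} ->
  {ae mN, forall z, Q z}.
Proof.
move=> mQ h; pose A := ~` [set z | Q z].
have mA : measurable A by exact: measurableC.
exists A; split => //; transitivity (\int[mN]_z (\1_A z : R)%:E).
  by rewrite integral_indic// setIT.
rewrite mN_integral//; last exact/mEFinP/measurable_indic.
rewrite -[RHS](integral0 P setT); apply: ae_eq_lower_integral => //.
  by move=> w; exact: integral_ge0.
apply: filterS h => w h; rewrite -[RHS](integral0 NR setT).
apply: ae_eq_lower_integral => //.
by apply: filterS h => y Qy; rewrite indicE memNset//; exact.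
Qed.

Lemma add_point_ae_NR :
  {ae P, forall w, {ae NR, forall z : X * M, add_point z.1 w = add_atom z.1 w}}.
Proof.
apply: filterS add_point_ae => w [A [mA A0 QA]].
exists (A `*` setT); split; first exact: measurableX.
  apply: (etrans (@product_measure1E _ _ _ _ _ nu rho _ _ mA measurableT)).
  transitivity (0 * rho setT); last by rewrite mul0e.
  by congr (_ * _); exact: A0.
by move=> [x r] /= h; split => //; exact: QA.
Qed.

Lemma versionNMP (K K' : CXM -> R[i]) : versionNM K K' <->
  cmeasurable K' /\
  {ae P, forall w, {ae NR, forall z, K (w, z.1, z.2) = K' (add_atom z.1 w, z.1, z.2)}}.
Proof.
split=> -[mk' h]; split => //.
  apply: filterS2 h add_point_ae_NR => w h1 h2.
  by apply: filterS2 h1 h2 => x -> ->.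
apply: filterS2 h add_point_ae_NR => w h1 h2.
by apply: filterS2 h1 h2 => x -> ->.
Qed.


Lemma versionNM_unique K K1 K2 : versionNM K K1 ->
  versionNM K K2 -> {ae mN, forall z, K1 z = K2 z}.
Proof.
move=> /versionNMP[m1 h1] /versionNMP[m2 h2]; apply: mN_ae_of.
  exact: measurable_ceq_set.
apply: filterS2 h1 h2 => w h1 h2; apply: filterS2 h1 h2 => x <-.
exact.
Qed.

Lemma versionNM_ae K K1 K2 : versionNM K K1 -> cmeasurable K2 ->
  {ae mN, forall z, K1 z = K2 z} -> versionNM K K2.
Proof.
move=> /versionNMP[m1 h1] mK2 /mN_ae h2; apply/versionNMP; split => //.
by apply: filterS2 h1 h2 => w h1 h2; apply: filterS2 h1 h2 => x -> ->.
Qed.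

Lemma versionNMB K L K' L' : versionNM K K' -> versionNM L L' ->
  versionNM (K - L)%R (fun z => K' z - L' z)%R.
Proof.
move=> [m1 h1] [m2 h2]; split; first exact: cmeasurableB.
apply: filterS2 h1 h2 => w h1 h2; apply: filterS2 h1 h2 => z h1 h2.
by rewrite -h1 -h2.
Qed.

Lemma norm2PNE K' : cmeasurable K' -> norm2PN rho P K' = csq mN K' `^ 2^-1.
Proof.
move=> mK; rewrite /norm2PN /csq; congr (_ `^ _).
have mf : mfunT (fun z => (nsq (K' z))%:E).
  by apply/mEFinP; exact: measurable_nsq.
have f0 z : 0 <= (nsq (K' z))%:E by rewrite lee_fin nsq_ge0.
pose F z := \int[rho]_r (nsq (K' (z, r)))%:E.
have mF : mfunT F by exact: (measurable_fun_fubini_tonelli_F _ mf f0).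
have F0 z : 0 <= F z by exact: integral_ge0.
rewrite (_ : \int[mN]_x _ = \int[PN]_z F z); last exact: (fubini_tonelli1 _ mf f0).
rewrite (palm.2 F mF F0).
apply: eq_integral => w _; apply: eq_integral => x _; apply: eq_integral => r _.
by rewrite nsqE.
Qed.

Lemma norm1PNE K' : cmeasurable K' ->
  norm1PN rho P K' = \int[mN]_z (normc (K' z))%:E.
Proof.
move=> mK; rewrite /norm1PN.
have mf : mfunT (fun z => (normc (K' z))%:E).
  by apply/mEFinP; exact: measurable_normc.
have f0 z : 0 <= (normc (K' z))%:E by rewrite lee_fin normc_ge0.
pose F z := \int[rho]_r (normc (K' (z, r)))%:E.
have mF : mfunT F by exact: (measurable_fun_fubini_tonelli_F _ mf f0).
have F0 z : 0 <= F z by exact: integral_ge0.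
rewrite (_ : \int[mN]_x _ = \int[PN]_z F z); last exact: (fubini_tonelli1 _ mf f0).
by rewrite (palm.2 F mF F0).
Qed.

Lemma normPNE K K' : versionNM K K' ->
  normPN K = csq mN K' `^ 2^-1.
Proof.
move=> KK'; rewrite /normPN.
rewrite (_ : [set _ | _ in _] = [set csq mN K' `^ 2^-1]) ?ereal_inf1//.
apply/seteqP; split => [_ [k2 kk2 <-]|_ ->] /=.
  rewrite norm2PNE; last exact: kk2.1.
  by rewrite (ae_csq kk2.1 KK'.1)//; exact: versionNM_unique kk2 KK'.
by exists K' => //; rewrite norm2PNE//; exact: KK'.1.
Qed.

Lemma normPN_lty K : normPN K < +oo -> exists K', versionNM K K'.
Proof.
move=> koo; apply: contrapT => /forallNP h.
suff : normPN K = +oo by move=> E; rewrite E in koo.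
rewrite /normPN (_ : [set _ | _ in _] = set0) ?ereal_inf0//.
by apply/seteqP; split => // y [k' kk' _]; exact: (h _ kk').
Qed.

Lemma normPN_ge0 K : 0 <= normPN K.
Proof. by apply: le_ereal_inf_tmp => _ [K' _ <-]; exact: poweR_ge0. Qed.

Lemma normPN_to0 (K_ : nat -> CXM -> R[i]) K K_' K' :
  (forall n, versionNM (K_ n) (K_' n)) -> versionNM K K' ->
  normPN (K_ n - K)%R @[n --> \oo] --> 0 <->
  to0 (fun n => csq mN (fun z => K_' n z - K' z)%R).
Proof.
move=> h1 h2; rewrite -to0P; last by move=> n; exact: normPN_ge0.
rewrite -(@to0_half _ (fun n => csq mN (fun z => K_' n z - K' z)%R)); last first.
  by move=> n; exact: csq_ge0.
by under eq_fun do rewrite (normPNE (versionNMB (h1 _) h2)).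
Qed.

(** A finite distance forces a version: the infimum over no version is infinite, so some [K_ n0 - K]
    has one, and so does [K] by difference. *)
Lemma normPN_to0_version (K_ : nat -> CXM -> R[i]) K K_' :
  (forall n, versionNM (K_ n) (K_' n)) ->
  normPN (K_ n - K)%R @[n --> \oo] --> 0 ->
  exists2 K', versionNM K K' &
  to0 (fun n => csq mN (fun z => K_' n z - K' z)%R).
Proof.
move=> h1 h; have : to0 (fun n => normPN (K_ n - K)%R).
  by apply/to0P => // n; exact: normPN_ge0.
move=> /(_ 1%R ltr01)[n0 /(_ n0 (leqnn _)) hn].
have [V hV] := normPN_lty (lt_trans hn (ltry _)).
have hK : versionNM K (fun z => K_' n0 z - V z)%R.
  have := versionNMB (h1 n0) hV; congr versionNM.
  by apply/funext => z; rewrite !fctE opprB addrCA subrr addr0.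
by exists (fun z => K_' n0 z - V z)%R => //; exact/(normPN_to0 h1 hK).
Qed.

Lemma creation_versionM (K' : CXM -> R[i]) : cmeasurable K' ->
  versionNM (fun z => K' (add_point z.1.2 z.1.1, z.1.2, z.2)) K'.
Proof. by move=> mK; split => //; apply: filterE => w; exact: filterE. Qed.

End Palm.

(** * The bottom space: energy and closability of flat *)

Section Base.

Lemma dom_form : dirichlet_form nu d bf. Proof. by case: bottom. Qed.
Lemma dom_cdc : carre_du_champ nu d bf gam. Proof. by case: bottom. Qed.
Let df := dom_form.
Let cdc := dom_cdc.

Lemma dom_L2 u : d u ->
  mfunT u /\ (\int[nu]_x (u x ^+ 2)%:E < +oo)%E.
Proof. by move=> /(df_L2 df) /Lfun2P. Qed.

Lemma dom_measurable u : d u -> mfunT u.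
Proof. by move=> /dom_L2[]. Qed.

Lemma dom0 : d (cst 0).
Proof.
have h0 : cst 0 \in Lfun nu 2%:E.
  apply/Lfun2P; split => //.
  under eq_integral do rewrite /cst expr0n /=.
  by rewrite integral0 ltry.
have [u du _] := df_dense df h0 ltr01.
have := df_lin df (- 1) du du; congr d; apply/funext => x.
by rewrite mulN1r addNr.
Qed.

Lemma domD' u v : d u -> d v -> d (fun x => u x + v x).
Proof.
by move=> du dv; have := df_lin df 1 du dv; congr d; apply/funext => x; rewrite mul1r.
Qed.

Lemma domB u v : d u -> d v -> d (fun x => u x - v x).
Proof.
move=> du dv; have := df_lin df (- 1) dv du; congr d; apply/funext => x.
by rewrite mulN1r addrC.
Qed.

Lemma flat_L2 u : d u ->
  mfunT (flat u) /\ (\int[NR]_z (flat u z ^+ 2)%:E < +oo)%E.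
Proof. by move=> /(gr_L2 grad) /Lfun2P. Qed.

Lemma flat_measurable u : d u -> mfunT (flat u).
Proof. by move=> /flat_L2[]. Qed.

Lemma flatB u v : d u -> d v ->
  {ae NR, forall z, flat (fun x => u x - v x) z = flat u z - flat v z}.
Proof.
move=> du dv; have h := gr_lin grad (- 1) dv du.
have -> : (fun x => u x - v x) = (fun x => -1 * v x + u x).
  by apply/funext => x; rewrite mulN1r addrC.
by apply: filterS h => z ->; rewrite mulN1r addrC.
Qed.

Lemma flat_cst0 : {ae NR, forall z, flat (cst 0) z = 0}.
Proof.
have := flatB dom0 dom0.
have -> : (fun x : X => cst (0 : R) x - cst 0 x) = cst 0.
  by apply/funext => x; rewrite subr0.
by apply: filterS => z {1}->; rewrite subrr.
Qed.

Lemma flat_energy u : d u -> (\int[NR]_z (flat u z ^+ 2)%:E = (2 * bf u u)%:E)%E.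
Proof.
move=> du; have [mf foo] := flat_L2 du.
have mf2 : mfunT (fun z => (flat u z ^+ 2)%:E).
  by apply/mEFinP; exact: measurable_funX.
have FE : (\int[NR]_z (flat u z ^+ 2)%:E =
    \int[nu]_x \int[rho]_r (flat u (x, r) ^+ 2)%:E)%E.
  by apply: (fubini_tonelli1 _ mf2) => z; rewrite lee_fin sqr_ge0.
have mG : mfunT (fun x => \int[rho]_r (flat u (x, r) ^+ 2)%:E)%E.
  have f0 z : (0 <= (flat u z ^+ 2)%:E)%E by rewrite lee_fin sqr_ge0.
  exact: (measurable_fun_fubini_tonelli_F _ mf2 f0).
have G0 x : (0 <= \int[rho]_r (flat u (x, r) ^+ 2)%:E)%E.
  by apply: integral_ge0 => r _; rewrite lee_fin sqr_ge0.
have Goo : {ae nu, forall x, (\int[rho]_r (flat u (x, r) ^+ 2)%:E < +oo)%E}.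
  by apply: integral_lty_ae => //; rewrite -FE.
have /Lfun1P gi := cdc_L1 cdc du du.
have mg : mfunT (gam u u).
  by apply/mEFinP; exact: (measurable_int _ gi).
have gE : {ae nu, forall x,
    (gam u u x)%:E = (\int[rho]_r (flat u (x, r) ^+ 2)%:E)%E}.
  apply: filterS2 (gr_gamma grad du) Goo => x -> h.
  rewrite /Rintegral fineK// ge0_fin_numE//.
rewrite FE /bform mulrA mulfV// mul1r /Rintegral fineK; last first.
  apply: integrable_fin_num => //.
apply/esym/ae_eq_integral => //; first exact/mEFinP.
by apply: filterS gE => x h _.
Qed.

(** Twice the energy is the squared norm of flat, so convergent flats make the sequence Cauchy for
    the form. As its L2 limit is 0, closedness sends its energy to 0. *)
Lemma flat_closed (v_ : nat -> X -> R) (L : X * M -> R) :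
  (forall n, d (v_ n)) -> mfunT L ->
  to0 (fun n => \int[nu]_x (v_ n x ^+ 2)%:E)%E ->
  to0 (fun n => \int[NR]_z ((flat (v_ n) z - L z) ^+ 2)%:E)%E ->
  {ae NR, forall z, L z = 0}.
Proof.
move=> dv mL v0 fL.
have mf n := flat_measurable (dv n).
have csqE (f : X * M -> R) : mfunT f ->
  csq NR (fun z => (f z)%:C%C) = (\int[NR]_z (f z ^+ 2)%:E)%E.
  by move=> _; rewrite csq_real.
have EB m n : (\int[NR]_z ((flat (v_ m) z - flat (v_ n) z) ^+ 2)%:E =
    (2 * bf (v_ m - v_ n) (v_ m - v_ n))%:E)%E.
  rewrite -flat_energy; last exact: (domB (dv m) (dv n)).
  apply: ae_eq_integral => //.
  - apply/mEFinP/measurable_funX; exact: measurable_funB.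
  - by apply/mEFinP; apply: measurable_funX;
    exact: (flat_measurable (domB (dv m) (dv n))).
  - by apply: filterS (flatB (dv m) (dv n)) => z h _; rewrite -h.
have tri (f g h : X * M -> R) : mfunT f -> mfunT g ->
    mfunT h -> (\int[NR]_z ((f z - g z) ^+ 2)%:E <=
      2%:E * \int[NR]_z ((f z - h z) ^+ 2)%:E +
      2%:E * \int[NR]_z ((g z - h z) ^+ 2)%:E)%E.
  move=> m1 m2 m3; rewrite -!(csq_real NR).
  have := @csqB_tri _ _ R NR _ _ _ (cmeasurable_real m1) (cmeasurable_real m2) (cmeasurable_real m3).
  by under eq_fun do rewrite -rmorphB /=; under [X in (_ <= 2%:E * csq _ X + _)%E]eq_fun do
    rewrite -rmorphB /=; under [X in (_ <= _ + 2%:E * csq _ X)%E]eq_fun do rewrite -rmorphB /=.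
have [] := df_closed df dv (u := cst 0).
- exact: (df_L2 df dom0).
- move=> e e0; have [n0 h] := fL (e / 2) (divr_gt0 e0 (ltr0n _ 2)).
  exists n0 => m n hm hn; rewrite -lte_fin -(@lte_pmul2l _ 2%:E)// -EFinM -EB.
  apply: (le_lt_trans (tri _ _ _ (mf m) (mf n) mL)).
  rewrite -EFinM (_ : (2 * e)%:E = 2%:E * (e / 2)%:E + 2%:E * (e / 2)%:E)%E; last first.
    by rewrite -!EFinM -EFinD; congr EFin; field.
  by apply: lteD; rewrite lte_pmul2l// h.
- apply/norm2_to0; move: v0; congr to0; apply/funext => n.
  by apply: eq_integral => x _; rewrite subr0.
move=> _ b0; apply: filterS; last first.
  apply: (@integral_eq0_ae _ _ R NR (fun z => (L z ^+ 2)%:E)).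
  - exact/mEFinP/measurable_funX.
  - by move=> z; rewrite lee_fin sqr_ge0.
  apply: (@to0_cst R (\int[NR]_z (L z ^+ 2)%:E)%E).
  apply: (to0_le (v := fun n => 2%:E * (\int[NR]_z ((flat (v_ n) z - L z) ^+ 2)%:E)
     + 2%:E * (2 * bf (v_ n - cst 0) (v_ n - cst 0))%:E)%E).
    move=> n; have -> : (2 * bf (v_ n - cst 0) (v_ n - cst 0))%:E = (\int[NR]_z (flat (v_ n) z ^+ 2)%:E)%E.
      rewrite flat_energy// (_ : v_ n - cst 0 = v_ n)//.
      by apply/funext => x; exact: subr0.
    have := tri L (cst 0) (flat (v_ n)) mL _ (mf n).
    under eq_integral do rewrite subr0.
    under [X in (_ <= 2%:E * X + _)%E]eq_integral do rewrite -opprB sqrrN.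
    under [X in (_ <= _ + 2%:E * X)%E]eq_integral do rewrite sub0r sqrrN.
    exact.
  apply: to0D; first by apply: to0Z => // n; apply: integral_ge0 => z _; rewrite lee_fin sqr_ge0.
  apply: to0Z => //.
    by move=> n; rewrite lee_fin mulr_ge0//; apply: (df_ge0 df); exact: domB (dv n) dom0.
  move=> e e0; have /cvgrPdist_lt /(_ (e / 2) (divr_gt0 e0 (ltr0n _ 2))) [n0 _ h] := b0.
  exists n0 => n hn; rewrite lte_fin; have := h n hn.
  rewrite /= sub0r normrN => /(le_lt_trans (ler_norm _)); lra.
by move=> z [] /eqP; rewrite sqrf_eq0 => /eqP.
Qed.

Lemma chain_prod_d phi dphi psi dpsi u v : tame phi dphi -> tame psi dpsi ->
  d u -> d v -> phi 0 * psi 0 = 0 ->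
  d (fun x => phi (u x) * psi (v x)) /\
  {ae NR, forall z, flat (fun x => phi (u x) * psi (v x)) z =
    dphi (u z.1) * psi (v z.1) * flat u z +
    phi (u z.1) * dpsi (v z.1) * flat v z}.
Proof. by move=> h1 h2 du dv p0; exact: (chain_prod h1 h2 (gr_chain grad)). Qed.

(* u need not be in d, only in d up to a constant *)
Definition cfl (u : X -> R) (k : X * M -> R) := exists c : R,
  d (fun x => u x - c) /\ {ae NR, forall z, k z = flat (fun x => u x - c) z}.

(* sin(chi) sin(u) is in d for chi in d, since sin(0) = 0: this localizes u *)
Lemma sin_closable (chi : X -> R) (u_ : nat -> X -> R) (k_ : nat -> X * M -> R)
    (K : X * M -> R) :
  d chi -> (forall n, cfl (u_ n) (k_ n)) -> (forall n, mfunT (k_ n)) ->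
  mfunT K -> (\int[NR]_z (K z ^+ 2)%:E < +oo)%E ->
  {ae nu, forall x, u_ n x @[n --> \oo] --> 0} ->
  to0 (fun n => \int[NR]_z ((k_ n z - K z) ^+ 2)%:E)%E ->
  {ae NR, forall z, sin (chi z.1) * K z = 0}.
Proof.
move=> dchi cu mk mK Koo u0 kK.
have /choice[c_ cE] n : exists c : R, d (fun x => u_ n x - c) /\
  {ae NR, forall z, k_ n z = flat (fun x => u_ n x - c) z} := cu n.
have mu n : mfunT (u_ n).
  have -> : u_ n = (fun x => (u_ n x - c_ n) + c_ n).
    by apply/funext => x; rewrite subrK.
  by apply: measurable_funD => //; exact: (dom_measurable (cE n).1).
have mchi := dom_measurable dchi.
have [mfc fcoo] := flat_L2 dchi.
pose w_ n x := sin (chi x) * sin (u_ n x).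
have W n : d (w_ n) /\ {ae NR, forall z, flat (w_ n) z =
    cos (chi z.1) * sin (u_ n z.1) * flat chi z +
    sin (chi z.1) * cos (u_ n z.1) * k_ n z}.
  have [dn kE] := cE n.
  have [] := chain_prod_d (tame_sin R) (tame_sin_shift (c_ n)) dchi dn.
    by rewrite sin0 mul0r.
  have -> : (fun x => sin (chi x) * sin (u_ n x - c_ n + c_ n)) = w_ n.
    by apply/funext => x; rewrite /w_ subrK.
  move=> h1 h2; split => //; apply: filterS2 h2 kE => z -> ->.
  by rewrite subrK.
have ms (f : X -> R) : mfunT f -> mfunT (fun x => sin (f x)).
  move=> mf; apply: (mcompT _ mf); apply: continuous_measurable_fun.
  exact: continuous_sin.
have mc (f : X -> R) : mfunT f -> mfunT (fun x => cos (f x)).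
  move=> mf; apply: (mcompT _ mf); apply: continuous_measurable_fun.
  exact: continuous_cos.
have m1 (f : X -> R) : mfunT f -> mfunT (fun z : X * M => f z.1).
  by move=> mf; exact: mcompT.
have u0R : {ae NR, forall z : X * M, u_ n z.1 @[n --> \oo] --> 0}.
  exact: (ae_fst rho u0).
have sin21 (t : R) : sin t ^+ 2 <= 1 by rewrite -(cos2Dsin2 t) lerDr sqr_ge0.
have cos21 (t : R) : cos t ^+ 2 <= 1 by rewrite -(cos2Dsin2 t) lerDl sqr_ge0.
apply: (flat_closed (v_ := w_)).
- by move=> n; case: (W n).
- by apply: measurable_funM => //; exact: (m1 _ (ms _ mchi)).
- apply: (dct_to0 (g := fun x => chi x ^+ 2)).
  + by move=> n; apply: measurable_funX; apply: measurable_funM; exact: ms.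
  + exact: measurable_funX.
  + by move=> n x; rewrite sqr_ge0.
  + move=> n x; rewrite /w_ exprMn; apply: (le_trans (ler_piMr (sqr_ge0 _) (sin21 _))).
    rewrite -[leLHS]real_normK ?num_real// -[leRHS]real_normK ?num_real//.
    rewrite lerXn2r ?nnegrE//.
    by have := tame_lipschitz (tame_sin R) (chi x) 0; rewrite sin0 !subr0.
  + by case: (dom_L2 dchi).
  + apply: filterS u0 => x h.
    have -> : 0 = (sin (chi x) * sin 0) ^+ 2 :> R by rewrite sin0 mulr0 expr0n.
    rewrite /w_; apply: (cvgM (f := fun n => sin (chi x) * sin (u_ n x)) (g := fun n => sin (chi x) * sin (u_ n x)));
    by apply: cvgMr; exact: (continuous_cvg _ (@continuous_sin R 0) h).
(* The flat of [w_ n] minus sin(chi) K is A + B + C almost everywhere: A and C vanish by domination,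
   by the flat of chi and by K, and B is controlled by [k_ n - K]. *)
pose A n z := cos (chi z.1) * sin (u_ n z.1) * flat chi z.
pose B n z := sin (chi z.1) * cos (u_ n z.1) * (k_ n z - K z).
pose C n z := sin (chi z.1) * (cos (u_ n z.1) - 1) * K z.
have mA n : mfunT (A n).
  by apply: measurable_funM => //; apply: (m1 (fun x => cos (chi x) * sin (u_ n x)));
    apply: measurable_funM; [exact: mc|exact: ms].
have mB n : mfunT (B n).
  by apply: measurable_funM; [apply: (m1 (fun x => sin (chi x) * cos (u_ n x)));
    apply: measurable_funM; [exact: ms|exact: mc]|exact: measurable_funB].
have mC n : mfunT (C n).
  apply: measurable_funM => //; apply: (m1 (fun x => sin (chi x) * (cos (u_ n x) - 1))).
  by apply: measurable_funM; [exact: ms|apply: measurable_funB => //; exact: mc].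
have A0 : to0 (fun n => \int[NR]_z (A n z ^+ 2)%:E)%E.
  apply: (dct_to0 (g := fun z => flat chi z ^+ 2)) => //.
  - by move=> n; exact: measurable_funX.
  - exact: measurable_funX.
  - by move=> n x; rewrite sqr_ge0.
  - move=> n z; rewrite /A !exprMn -[leRHS]mul1r ler_wpM2r ?sqr_ge0//.
    by rewrite mulr_ile1 ?sqr_ge0.
  apply: filterS u0R => z h.
  have -> : 0 = (cos (chi z.1) * sin 0 * flat chi z) ^+ 2 :> R.
    by rewrite sin0 mulr0 mul0r expr0n.
  have g : A n z @[n --> \oo] --> cos (chi z.1) * sin 0 * flat chi z.
    apply: cvgMl; apply: cvgMr; exact: (continuous_cvg _ (@continuous_sin R 0) h).
  exact: (cvgM g g).
have B0 : to0 (fun n => \int[NR]_z (B n z ^+ 2)%:E)%E.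
  apply: to0_le kK => n; apply: integral_EFin_le => //.
  - exact: measurable_funX.
  - by apply: measurable_funX; exact: measurable_funB.
  - by move=> z; rewrite sqr_ge0.
  - move=> z; rewrite /B !exprMn -[leRHS]mul1r ler_wpM2r ?sqr_ge0//.
    by rewrite mulr_ile1 ?sqr_ge0.
have C0 : to0 (fun n => \int[NR]_z (C n z ^+ 2)%:E)%E.
  apply: (dct_to0 (g := fun z => 4 * K z ^+ 2)) => //.
  - by move=> n; exact: measurable_funX.
  - by apply: measurable_funM => //; exact: measurable_funX.
  - by move=> n x; rewrite sqr_ge0.
  - move=> n z; rewrite /C !exprMn ler_wpM2r ?sqr_ge0//.
    rewrite -[leRHS]mul1r ler_pM ?sqr_ge0//.
    have := cos_geN1 (u_ n z.1); have := cos_le1 (u_ n z.1); nra.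
  - rewrite integral_EFinZ//; [exact: lte_mul_pinfty|exact: measurable_funX|].
    by move=> z; rewrite sqr_ge0.
  apply: filterS u0R => z h.
  have -> : 0 = (sin (chi z.1) * (cos 0 - 1) * K z) ^+ 2 :> R.
    by rewrite cos0 subrr mulr0 mul0r expr0n.
  have g : C n z @[n --> \oo] --> sin (chi z.1) * (cos 0 - 1) * K z.
    apply: cvgMl; apply: cvgMr; apply: cvgB; last exact: cvg_cst.
    exact: (continuous_cvg _ (@continuous_cos R 0) h).
  exact: (cvgM g g).
have sq (t : X * M -> R) z : (0 <= (t z ^+ 2)%:E)%E by rewrite lee_fin sqr_ge0.
have sqi (t : X * M -> R) : (0 <= \int[NR]_z (t z ^+ 2)%:E)%E.
  exact: integral_ge0.
apply: (to0_le (v := fun n => 3%:E * (\int[NR]_z (A n z ^+ 2)%:E +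
  (\int[NR]_z (B n z ^+ 2)%:E + \int[NR]_z (C n z ^+ 2)%:E)))%E); last first.
  apply: to0Z => //.
    by move=> n; apply: adde_ge0; [exact: sqi|apply: adde_ge0; exact: sqi].
  by apply: to0D => //; exact: to0D.
move=> n.
have mA2 : mfunT (fun z => A n z ^+ 2) by exact: measurable_funX.
have mB2 : mfunT (fun z => B n z ^+ 2) by exact: measurable_funX.
have mC2 : mfunT (fun z => C n z ^+ 2) by exact: measurable_funX.
have mBC : mfunT (fun z => B n z ^+ 2 + C n z ^+ 2).
  exact: measurable_funD.
have pp (t : X * M -> R) z : 0 <= t z ^+ 2 by rewrite sqr_ge0.
have ppBC z : 0 <= B n z ^+ 2 + C n z ^+ 2 by rewrite addr_ge0.
rewrite -(integral_EFinD _ mB2 mC2 (pp _) (pp _)).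
rewrite -(integral_EFinD _ mA2 mBC (pp _) ppBC).
rewrite -integral_EFinZ//; last 2 first.
- exact: measurable_funD.
- by move=> z; rewrite addr_ge0.
have mG : mfunT
    (fun z => 3 * (A n z ^+ 2 + (B n z ^+ 2 + C n z ^+ 2))).
  by apply: measurable_funM => //; exact: measurable_funD.
have mABC : mfunT (fun z => (A n z + B n z + C n z) ^+ 2).
  by apply: measurable_funX; apply: measurable_funD => //; exact: measurable_funD.
have mW : mfunT (fun z => (flat (w_ n) z - sin (chi z.1) * K z) ^+ 2).
  apply: measurable_funX; apply: measurable_funB; first by exact: flat_measurable (W n).1.
  by apply: measurable_funM => //; exact: (m1 _ (ms _ mchi)).
have -> : (\int[NR]_z ((flat (w_ n) z - sin (chi z.1) * K z) ^+ 2)%:E =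
    \int[NR]_z ((A n z + B n z + C n z) ^+ 2)%:E)%E.
  apply: ae_eq_integral => //; [exact/mEFinP|exact/mEFinP|].
  case: (W n) => _; apply: filterS => z -> _; congr (_ ^+ 2)%:E.
  by rewrite /A /B /C; ring.
apply: integral_EFin_le => // z; first exact: sqr_ge0.
have := sqr_ge0 (A n z - B n z); have := sqr_ge0 (B n z - C n z).
have := sqr_ge0 (A n z - C n z); nra.
Qed.

(** On a set of finite measure, elements of [d] converge to 1 almost everywhere along a subsequence.
    Where such a chi is at distance less than 1 from 1 it lies in (0, 2), sin(chi) is positive, and
    K must vanish. *)
Lemma cfl_closable (u_ : nat -> X -> R) (k_ : nat -> X * M -> R) (K : X * M -> R) :
  (forall n, cfl (u_ n) (k_ n)) -> (forall n, mfunT (k_ n)) ->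
  mfunT K -> (\int[NR]_z (K z ^+ 2)%:E < +oo)%E ->
  {ae nu, forall x, u_ n x @[n --> \oo] --> 0} ->
  to0 (fun n => \int[NR]_z ((k_ n z - K z) ^+ 2)%:E)%E ->
  {ae NR, forall z, K z = 0}.
Proof.
move=> cu mk mK Koo u0 kK.
have /sigma_finiteP[E [ET _ EP]] := @sigma_finiteT _ X R nu.
suff h j : {ae NR, forall z, E j z.1 -> K z = 0}.
  have := ae_foralln h; apply: filterS => z hz.
  have : (\bigcup_i E i) z.1 by rewrite -ET.
  by move=> [j _ ej]; exact: hz ej.
have [mE Eoo] := EP j.
have iE : (\1_(E j) : X -> R) \in Lfun nu 2%:E.
  apply/Lfun2P; split => //.
  under eq_integral => x _.
    rewrite (_ : _ ^+ 2 = \1_(E j) x); last by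
      rewrite indicE; case: (x \in E j); rewrite ?expr1n ?expr0n.
    over.
  by rewrite integral_indic// setIT.
have /choice[chi_ chiP] n : exists u, d u /\
    (norm2 nu (\1_(E j) - u)%R < (n.+1%:R^-1)%:E)%E.
  have [//|u du hu] := df_dense df iE (e := n.+1%:R^-1).
  by exists u.
have mchi n : mfunT (chi_ n) by exact: dom_measurable (chiP n).1.
have [] := @to0_ae_subseq _ X R nu (fun n x => ((\1_(E j) x - chi_ n x) ^+ 2)%:E).
- by move=> n; apply/mEFinP; apply: measurable_funX; exact: measurable_funB.
- by move=> n x; rewrite lee_fin sqr_ge0.
- apply/to0_half; first by move=> n; apply: integral_ge0 => x _; rewrite lee_fin sqr_ge0.
  move=> e e0; have [n0 hn0] := ltr_add_invr e0; rewrite add0r in hn0.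
  exists n0 => n hn; rewrite -norm2E; apply: lt_trans (chiP n).2 _.
  by rewrite lte_fin; apply: le_lt_trans hn0; rewrite lef_pV2 ?posrE// ler_nat.
move=> phi _ hphi.
have := ae_foralln (fun n => sin_closable (chiP (phi n)).1 cu mk mK Koo u0 kK).
apply: filterS2 (ae_fst rho hphi) => z hz sz Ez.
have [n0 hn] := hz 1 ltr01.
have := hn n0 (leqnn _); rewrite lte_fin indicE mem_set// => lt1.
have /eqP := sz n0; rewrite mulf_eq0 => /orP[/eqP s0|/eqP//].
exfalso; suff : 0 < sin (chi_ (phi n0) z.1) by rewrite s0 ltxx.
have {}lt1 : (1 - chi_ (phi n0) z.1) ^+ 2 < 1 := lt1.
by apply: sin2_gt0; apply/andP; split; nra.
Qed.

End Base.

(** * Flat of complex functions defined up to constants *)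

Section ComplexBase.

Lemma cfl_lin a u k v l : cfl u k -> cfl v l ->
  cfl (fun x => a * u x + v x) (fun z => a * k z + l z).
Proof.
move=> [c [du ku]] [c' [dv lv]]; exists (a * c + c').
have E : (fun x => a * u x + v x - (a * c + c')) =
    (fun x => a * (u x - c) + (v x - c')) by apply/funext => x; ring.
rewrite E; split; first exact: (df_lin dom_form).
have h := gr_lin grad a du dv.
by apply: filterS3 ku lv h => z -> -> ->.
Qed.

Lemma cfl_ae u k l : {ae NR, forall z, k z = l z} -> cfl u k -> cfl u l.
Proof.
by move=> kl [c [du ku]]; exists c; split => //; apply: filterS2 kl ku => z -> ->.
Qed.

Lemma cfl_cst c : cfl (cst c) (cst 0).
Proof.
exists c; have -> : (fun x : X => cst c x - c) = cst 0.
  by apply/funext => x; rewrite subrr.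
split; first exact: dom0.
by apply: filterS flat_cst0 => z ->.
Qed.

(** Two choices of the constant differ by a constant function lying in [d]; its flat vanishes by
    closability, applied to a constant sequence. *)
Lemma cfl_unique u k l : cfl u k -> cfl u l -> {ae NR, forall z, k z = l z}.
Proof.
move=> [c [du ku]] [c' [dv lv]].
have [mf foo] := flat_L2 du; have [mg goo] := flat_L2 dv.
pose K z := flat (fun x => u x - c) z - flat (fun x => u x - c') z.
have mK : mfunT K by exact: measurable_funB.
have Koo : (\int[NR]_z (K z ^+ 2)%:E < +oo)%E.
  have := @csqB_lty _ _ R NR _ _ (cmeasurable_real mf) (cmeasurable_real mg).
  rewrite !csq_real => /(_ foo goo); under eq_fun do rewrite -rmorphB /=.
  by rewrite csq_real.
suff h : {ae NR, forall z, K z = 0}.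
  by apply: filterS3 h ku lv => z /eqP; rewrite subr_eq0 => /eqP -> -> ->.
apply: (cfl_closable (u_ := fun=> cst 0) (k_ := fun=> K)) => //.
- move=> n; exists (c - c').
  have -> : (fun x : X => cst 0 x - (c - c')) = (fun x => (u x - c) - (u x - c')).
    by apply/funext => x; rewrite /cst; ring.
  split; first exact: domB _ _ du dv.
  have /= h := flatB du dv.
  by move: h; apply: filterS => z ->.
- by apply: aeW => x; exact: cvg_cst.
- move=> e e0; exists 0%N => n _; under eq_integral do rewrite subrr expr0n /=.
  by rewrite integral0 lte_fin.
Qed.

Definition cflC (u : X -> R[i]) (k : X * M -> R[i]) :=
  cfl (fun x => Re (u x)) (fun z => Re (k z)) /\
  cfl (fun x => Im (u x)) (fun z => Im (k z)).

Lemma cflC_ae u k l : {ae NR, forall z, k z = l z} -> cflC u k -> cflC u l.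
Proof.
by move=> kl [h1 h2]; split; [apply: cfl_ae h1|apply: cfl_ae h2]; apply: filterS kl => z ->.
Qed.

Lemma cflCZ (a : R[i]) u k : cflC u k -> cflC (fun x => a * u x) (fun z => a * k z).
Proof.
move=> [h1 h2]; split.
- have -> : (fun x => Re (a * u x)) =
    (fun x => Re a * Re (u x) + (- Im a * Im (u x) + cst 0 x)).
    by apply/funext => x; rewrite ReM; rewrite /cst; ring.
  apply: cfl_ae (cfl_lin (Re a) h1 (cfl_lin (- Im a) h2 (cfl_cst 0))).
  by apply: aeW => z; rewrite ReM; rewrite /cst; ring.
- have -> : (fun x => Im (a * u x)) =
    (fun x => Re a * Im (u x) + (Im a * Re (u x) + cst 0 x)).
    by apply/funext => x; rewrite ImM; rewrite /cst; ring.
  apply: cfl_ae (cfl_lin (Re a) h2 (cfl_lin (Im a) h1 (cfl_cst 0))).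
  by apply: aeW => z; rewrite ImM; rewrite /cst; ring.
Qed.

Lemma cflCD u k v l : cflC u k -> cflC v l ->
  cflC (fun x => u x + v x) (fun z => k z + l z).
Proof.
move=> [h1 h2] [h3 h4]; split.
- have -> : (fun x => Re (u x + v x)) = (fun x => 1 * Re (u x) + Re (v x)).
    by apply/funext => x; rewrite ReD mul1r.
  by apply: cfl_ae (cfl_lin 1 h1 h3); apply: aeW => z; rewrite ReD mul1r.
- have -> : (fun x => Im (u x + v x)) = (fun x => 1 * Im (u x) + Im (v x)).
    by apply/funext => x; rewrite ImD mul1r.
  by apply: cfl_ae (cfl_lin 1 h2 h4); apply: aeW => z; rewrite ImD mul1r.
Qed.

Lemma cflC_cst (c : R[i]) : cflC (cst c) (cst 0).
Proof. by split; exact: cfl_cst. Qed.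

Lemma cflC_sum m (F : 'I_m -> R[i]) (u : 'I_m -> X -> R[i]) (k : 'I_m -> X * M -> R[i]) :
  (forall i, cflC (u i) (k i)) ->
  cflC (fun x => \sum_i F i * u i x) (fun z => \sum_i F i * k i z).
Proof.
move=> h; elim: m => [|m IH] in F u k h *.
  have -> : (fun x => \sum_(i < 0) F i * u i x) = cst 0.
    by apply/funext => x; rewrite big_ord0.
  by apply: cflC_ae (cflC_cst 0); apply: aeW => z; rewrite big_ord0.
have -> : (fun x => \sum_(i < m.+1) F i * u i x) =
   (fun x => F ord0 * u ord0 x + \sum_(i < m) F (lift ord0 i) * u (lift ord0 i) x).
  by apply/funext => x; rewrite big_ord_recl.
apply: cflC_ae (cflCD (cflCZ (F ord0) (h ord0))
  (IH (fun i => F (lift ord0 i)) _ _ (fun i => h (lift ord0 i)))).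
by apply: aeW => z; rewrite big_ord_recl.
Qed.

Lemma cflC_unique u k l : cflC u k -> cflC u l -> {ae NR, forall z, k z = l z}.
Proof.
move=> [h1 h2] [h3 h4]; apply: filterS2 (cfl_unique h1 h3) (cfl_unique h2 h4) => z.
by case: (k z) (l z) => [a b] [a' b'] /= -> ->.
Qed.

Lemma cflC_closable (u_ : nat -> X -> R[i]) (k_ : nat -> X * M -> R[i]) K :
  (forall n, cflC (u_ n) (k_ n)) -> (forall n, cmeasurable (k_ n)) ->
  cmeasurable K -> (csq NR K < +oo)%E ->
  {ae nu, forall x, to0 (fun n => (normc (u_ n x))%:E)} ->
  to0 (fun n => csq NR (fun z => k_ n z - K z)) ->
  {ae NR, forall z, K z = 0}.
Proof.
move=> cu mk mK Koo u0 kK.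
have t0 (f : R[i] -> R) (x : X) : (forall z, `|f z| <= normc z) ->
    to0 (fun n => (normc (u_ n x))%:E) -> f (u_ n x) @[n --> \oo] --> 0.
  move=> hf h; apply/cvgrPdist_lt => e e0; have [n0 hn] := h e e0.
  exists n0 => // n /= /hn; rewrite lte_fin sub0r normrN; exact: le_lt_trans.
have kKle (f : R[i] -> R) : (forall z w, f (z - w) = f z - f w) ->
    (forall z, f z ^+ 2 <= nsq z) -> (forall g : X * M -> R[i], cmeasurable g ->
      mfunT (fun z => f (g z))) ->
    to0 (fun n => \int[NR]_z ((f (k_ n z) - f (K z)) ^+ 2)%:E)%E /\
    (\int[NR]_z (f (K z) ^+ 2)%:E < +oo)%E.
  move=> fB fle mf; have le (g : X * M -> R[i]) : cmeasurable g ->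
      (\int[NR]_z (f (g z) ^+ 2)%:E <= csq NR g)%E.
    move=> mg; apply: integral_EFin_le => //.
    - by apply: measurable_funX; exact: mf.
    - exact: measurable_nsq.
    - by move=> z; rewrite sqr_ge0.
  split; last exact: le_lt_trans (le _ mK) Koo.
  apply: to0_le kK => n; under eq_integral do rewrite -fB.
  exact: (le (fun z => k_ n z - K z) (cmeasurableB (mk n) mK)).
have [r1 r2] := kKle (fun z => Re z) (@ReB _) (@Re_nsq _) (fun g mg => mg.1).
have [i1 i2] := kKle (fun z => Im z) (@ImB _) (@Im_nsq _) (fun g mg => mg.2).
have hr : {ae NR, forall z, Re (K z) = 0}.
  apply: (cfl_closable (fun n => (cu n).1) (fun n => (mk n).1) mK.1 r2 _ r1).
  by apply: filterS u0 => x; apply: (t0 (fun z => Re z)) => z; exact: Re_normc.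
have hi : {ae NR, forall z, Im (K z) = 0}.
  apply: (cfl_closable (fun n => (cu n).2) (fun n => (mk n).2) mK.2 i2 _ i1).
  by apply: filterS u0 => x; apply: (t0 (fun z => Im z)) => z; exact: Im_normc.
apply: filterS2 hr hi => z; by case: (K z) => a b /= -> ->.
Qed.

Lemma d1C_minus_cst u : d1C d u -> dC d (minus_cst d u).
Proof. by move=> h; exact: (xgetPex 0 h). Qed.

Lemma flatC_cfl u : d1C d u -> cflC u (flatC d flat u).
Proof.
move=> /d1C_minus_cst; rewrite /minus_cst; set c := xget _ _ => -[h1 h2]; split.
- exists (Re c); have E : (fun x => Re (u x) - Re c) = (fun x => Re (u x - c)).
    by apply/funext => x; rewrite ReB.
  by rewrite E; split => //; exact: aeW.
- exists (Im c); have E : (fun x => Im (u x) - Im c) = (fun x => Im (u x - c)).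
    by apply/funext => x; rewrite ImB.
  by rewrite E; split => //; exact: aeW.
Qed.

Lemma cflC_d1C u k : cflC u k -> d1C d u.
Proof.
move=> [[c [h1 _]] [c' [h2 _]]]; exists (c +i* c')%C; split.
- by move: h1; congr d; apply/funext => x; case: (u x).
- by move: h2; congr d; apply/funext => x; case: (u x).
Qed.

Lemma d1C_measurable u : d1C d u -> cmeasurable u.
Proof.
move=> [c [h1 h2]].
have := cmeasurableD (conj (dom_measurable h1) (dom_measurable h2) :
  cmeasurable (fun x => u x - c)) (cmeasurable_cst _ c).
by congr cmeasurable; apply/funext => x; rewrite subrK.
Qed.

Lemma flatC_measurable u : d1C d u -> cmeasurable (flatC d flat u).
Proof. by move=> /d1C_minus_cst[h1 h2]; split; exact: flat_measurable _ _. Qed.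

Lemma flatC_csq u : d1C d u -> (csq NR (flatC d flat u) < +oo)%E.
Proof.
move=> h; rewrite csq_ReIm; last exact: flatC_measurable.
have [h1 h2] := d1C_minus_cst h.
by apply: lte_add_pinfty; [exact: (flat_L2 h1).2|exact: (flat_L2 h2).2].
Qed.

Lemma gam_flat u : d u -> {ae nu, forall x,
  (gam u u x)%:E = (\int[rho]_r (flat u (x, r) ^+ 2)%:E)%E /\
  rho.-integrable setT (fun r => (flat u (x, r))%:E)}.
Proof.
move=> du; have [mf foo] := flat_L2 du.
have mf2 : mfunT (fun z => (flat u z ^+ 2)%:E).
  by apply/mEFinP; exact: measurable_funX.
have f0 z : (0 <= (flat u z ^+ 2)%:E)%E by rewrite lee_fin sqr_ge0.
have FE : (\int[NR]_z (flat u z ^+ 2)%:E =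
    \int[nu]_x \int[rho]_r (flat u (x, r) ^+ 2)%:E)%E.
  exact: (fubini_tonelli1 _ mf2).
have mG : mfunT (fun x => \int[rho]_r (flat u (x, r) ^+ 2)%:E)%E.
  exact: (measurable_fun_fubini_tonelli_F _ mf2 f0).
have G0 x : (0 <= \int[rho]_r (flat u (x, r) ^+ 2)%:E)%E.
  by apply: integral_ge0 => r _; rewrite lee_fin sqr_ge0.
have Goo : {ae nu, forall x, (\int[rho]_r (flat u (x, r) ^+ 2)%:E < +oo)%E}.
  by apply: integral_lty_ae => //; rewrite -FE.
apply: filterS2 (gr_gamma grad du) Goo => x -> h; split.
  by rewrite /Rintegral fineK// ge0_fin_numE.
have ms : mfunT (fun r => flat u (x, r)).
  by apply: mcompT => //; exact: measurable_pair1.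
have -> : (fun r => (flat u (x, r))%:E) = (EFin \o (fun r => 1 * flat u (x, r))).
  by apply/funext => r /=; rewrite mul1r.
apply: L2M_integrable => //.
under eq_integral do rewrite expr1n.
by rewrite integral_cst// mul1e ltey_eq fin_num_measure.
Qed.

Lemma gammaC_flat u : d1C d u -> {ae nu, forall x,
  (gammaC d gam u x)%:E = (\int[rho]_r (nsq (flatC d flat u (x, r)))%:E)%E}.
Proof.
move=> h; have [h1 h2] := d1C_minus_cst h.
apply: filterS2 (gam_flat h1) (gam_flat h2) => x [e1 _] [e2 _].
rewrite /gammaC EFinD e1 e2 -integral_EFinD//.
- apply: measurable_funX; apply: mcompT; last exact: measurable_pair1.
  exact: flat_measurable _ h1.
- apply: measurable_funX; apply: mcompT; last exact: measurable_pair1.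
  exact: flat_measurable _ h2.
- by move=> r; rewrite sqr_ge0.
- by move=> r; rewrite sqr_ge0.
Qed.

(** Both parts of e^{if} - 1, namely cos f - 1 and sin f, vanish with f, so that the constant 1 is
    the only one to subtract. *)
Lemma cflC_expi f : d f ->
  cflC (fun x => expi (f x)) (fun z => (0 +i* flat f z)%C * expi (f z.1)).
Proof.
move=> df; split.
- have [] := chain_prod_d (tame_cosB1 R) (tame_cst1 R) df df.
    by rewrite cos0 subrr mul0r.
  move=> h1 h2; exists 1; have E : (fun x => Re (expi (f x)) - 1) =
      (fun x => (cos (f x) - 1) * cst 1 (f x)).
    by apply/funext => x; rewrite /= /cst mulr1.
  rewrite E; split => //; apply: filterS h2 => z ->; rewrite ReM /= /cst.
  by ring.
- have [] := chain_prod_d (tame_sin R) (tame_cst1 R) df df.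
    by rewrite sin0 mul0r.
  move=> h1 h2; exists 0; have E : (fun x => Im (expi (f x)) - 0) =
      (fun x => sin (f x) * cst 1 (f x)).
    by apply/funext => x; rewrite /= /cst mulr1 subr0.
  rewrite E; split => //; apply: filterS h2 => z ->; rewrite ImM /= /cst.
  by ring.
Qed.

(** Polarization of [flat_energy]. *)
Lemma bform_flat u v : d u -> d v ->
  integrableT NR (fun z => flat u z * flat v z) /\
  bf u v = 2^-1 * \int[NR]_z (flat u z * flat v z).
Proof.
move=> du dv.
have [mu uoo] := flat_L2 du; have [mv voo] := flat_L2 dv.
have iuv := L2M_integrable mu uoo mv voo.
have iuu := L2M_integrable mu uoo mu uoo.
have ivv := L2M_integrable mv voo mv voo.
split => //.
have duv := domD' du dv.
have [muv uvoo] := flat_L2 duv.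
have df := dom_form.
have bl := df_bilin df; have bs := df_sym df.
have E : bf (fun x => 1 * u x + v x) (fun x => 1 * u x + v x) = bf u u + 2 * bf u v + bf v v.
  have d1 := df_lin df 1 du dv.
  rewrite bl// mul1r (bs _ _ du d1) (bs _ _ dv d1) !bl// !mul1r (bs v u)//; ring.
have en w : d w -> 2 * bf w w = \int[NR]_z (flat w z ^+ 2).
  by move=> dw; rewrite /Rintegral (flat_energy dw).
have E2 : \int[NR]_z (flat (fun x => 1 * u x + v x) z ^+ 2) =
   \int[NR]_z (flat u z * flat u z + (2 * (flat u z * flat v z) + flat v z * flat v z)).
  rewrite /Rintegral; congr fine; apply: ae_eq_integral => //.
  - apply/mEFinP; apply: measurable_funX.
    by apply: flat_measurable _ _; exact: df_lin df 1 _ _ du dv.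
  - apply/mEFinP; apply: measurable_funD; first exact: measurable_funM.
    by apply: measurable_funD; [apply: measurable_funM => //|]; exact: measurable_funM.
  - apply: filterS (gr_lin grad 1 du dv) => z -> _; congr EFin; ring.
have i2 : integrableT NR (fun z => 2 * (flat u z * flat v z)).
  have := integrableZl measurableT 2 iuv; congr integrable.
have E3 : \int[NR]_z (flat u z * flat u z + (2 * (flat u z * flat v z) + flat v z * flat v z)) =
  2 * bf u u + 2 * \int[NR]_z (flat u z * flat v z) + 2 * bf v v.
  rewrite RintegralD//; last first.
    by have := integrableD measurableT i2 ivv; congr integrable.
  rewrite RintegralD// RintegralZl// !en//; ring.
have := en _ (df_lin df 1 du dv); rewrite E E2 E3.
pose I := \int[NR]_z (flat u z * flat v z).
rewrite -/I; move: I (bf u u) (bf u v) (bf v v) => I a b c; lra.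
Qed.

End ComplexBase.

(** * The random sums N(f) and their compensation *)

Section CompensatedSum.

Lemma mean_intN (f : X -> \bar R) : mfunT f -> (forall x, 0 <= f x)%E ->
  (\int[P]_w \int[cm w]_x f x = \int[nu]_x f x)%E.
Proof.
move=> mf f0; have mF : mfunT (fun z : config * X => f z.2).
  exact: mcompT.
rewrite -(palm.2 _ mF (fun z => f0 _)) (palm.1 _ mF (fun z => f0 _)) /=.
rewrite integral_cst//; last first.
by rewrite -[RHS]mule1; congr (_ * _)%E; exact: probability_setT.
Qed.

Lemma measurable_integral_config (f : X -> \bar R) : mfunT f ->
  (forall x, 0 <= f x)%E -> mfunT (fun w => \int[cm w]_x f x)%E.
Proof.
by move=> mf f0; apply: (@measurable_fun_integral_kernel _ _ _ _ _ cm) => // U;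
  exact: measurable_config_eval.
Qed.

Lemma Lfun1_integrable (f : X -> R) : f \in Lfun nu 1 -> integrableT nu f.
Proof. by move=> /Lfun1P. Qed.

Lemma integrable_config (f : X -> R) : integrableT nu f ->
  {ae P, forall w : config, integrableT (cm w) f}.
Proof.
move=> /integrableP[mf foo].
have ma : mfunT (fun x => `|(EFin \o f) x|)%E by exact: mcompT.
have := @integral_lty_ae _ _ R P _ (measurable_integral_config ma (fun x => abse_ge0 _)).
move=> /(_ (fun w => integral_ge0 _ (fun x _ => abse_ge0 _))).
by rewrite mean_intN// => /(_ foo); apply: filterS => w h; apply/integrableP.
Qed.

Lemma measurable_intN (f : X -> R) : mfunT f ->
  mfunT (fun w : config => intN f w).
Proof.
move=> /mEFinP mf.
have -> : (fun w : config => intN f w) = fine \o (fun w : config =>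
    (\int[cm w]_x (EFin \o f)^\+ x - \int[cm w]_x (EFin \o f)^\- x)%E).
  by apply/funext => w; rewrite /intN /Rintegral integralE.
apply: mcompT => //; apply: emeasurable_funB; apply: measurable_integral_config.
- exact: measurable_funepos.
- by move=> x; exact: funepos_ge0.
- exact: measurable_funeneg.
- by move=> x; exact: funeneg_ge0.
Qed.

Lemma measurable_Ntilde1 (f : X -> R) : mfunT f ->
  mfunT (fun w : config => Ntilde1 f w).
Proof. by move=> mf; apply: measurable_funB => //; exact: measurable_intN. Qed.

Lemma integral_add_atom (f : X -> \bar R) (x : X) (w : config) :
  mfunT f -> (forall y, 0 <= f y)%E ->
  (\int[cm (add_atom x w)]_y f y = \int[cm w]_y f y + f x)%E.
Proof.
move=> mf f0; have := @ge0_integral_measure_add _ X R (cm w) (\d_x) setT measurableT f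
  (fun y _ => f0 y) mf.
by rewrite integral_dirac// diracT mul1e.
Qed.

Lemma Ntilde1_add_atom (f : X -> R) (x : X) (w : config) :
  integrableT (cm w) f ->
  Ntilde1 f (add_atom x w) = Ntilde1 f w + f x.
Proof.
move=> fi; have /integrableP[mf foo] := fi.
rewrite /Ntilde1 /intN; suff -> : \int[cm (add_atom x w)]_y f y = \int[cm w]_y f y + f x by ring.
have id : (\d_x : {measure set X -> \bar R}).-integrable setT (EFin \o f).
  apply/integrableP; split => //; rewrite integral_dirac ?diracT ?mul1e ?ltry//.
  exact: mcompT.
have := @integral_measure_add _ X R (cm w) (\d_x) setT measurableT (EFin \o f) fi id.
rewrite integral_dirac// diracT mul1e /Rintegral => ->.
by rewrite fineD//; exact: integrable_fin_num.
Qed.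

(** Wherever f is integrable for [w], an added atom adds the value of f there; the exceptional set
    of configurations does not depend on [x]. *)
Lemma Ntilde1_shift (f : X -> R) : integrableT nu f ->
  {ae P, forall w : config, forall x, Ntilde1 f (add_atom x w) = Ntilde1 f w + f x}.
Proof.
by move=> /integrable_config; apply: filterS => w h x; exact: Ntilde1_add_atom.
Qed.

Lemma Ntilde1B (f g : X -> R) : integrableT nu f ->
  integrableT nu g ->
  {ae P, forall w : config, Ntilde1 (fun x => f x - g x) w =
     Ntilde1 f w - Ntilde1 g w}.
Proof.
move=> fi gi; apply: filterS2 (integrable_config fi) (integrable_config gi) => w fw gw.
by rewrite /Ntilde1 /intN !RintegralB//; ring.
Qed.

(** One factor N(u) is integrated against the Campbell measure; by the Mecke formula the other
    becomes N(u) + u(x), and the added term produces the integral of u^2. *)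
Lemma mean_NtildeK (u : X -> R) : mfunT u -> (forall x, 0 <= u x) ->
  (\int[nu]_x (u x)%:E < +oo)%E ->
  (\int[P]_w ((\int[cm w]_x (u x)%:E) ^+ 2) =
   (\int[nu]_x (u x)%:E) ^+ 2 + \int[nu]_x (u x ^+ 2)%:E)%E.
Proof.
move=> mu u0 uoo.
have mu' : mfunT (EFin \o u) by exact/mEFinP.
have u0' x : (0 <= (EFin \o u) x)%E by rewrite lee_fin.
have mN := measurable_integral_config mu' u0'.
have N0 (w : config) : (0 <= \int[cm w]_x (u x)%:E)%E.
  by apply: integral_ge0 => x _; rewrite lee_fin.
pose F (z : config * X) := ((\int[cm z.1]_x (u x)%:E) * (u z.2)%:E)%E.
have mF : mfunT F.
  by apply: emeasurable_funM; [exact: (mcompT mN)|exact: (mcompT mu')].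
have F0 z : (0 <= F z)%E by apply: mule_ge0 => //; rewrite lee_fin.
transitivity (\int[PN]_z F z)%E.
  rewrite (palm.2 _ mF F0); apply: eq_integral => w _ /=; rewrite /F /=.
  by rewrite (ge0_integralZl (cm w) measurableT mu' (fun x _ => u0' x) (N0 w)).
rewrite (palm.1 _ mF F0).
transitivity (\int[P]_w ((\int[nu]_x (u x)%:E) * (\int[cm w]_x (u x)%:E) +
    \int[nu]_x (u x ^+ 2)%:E))%E.
  apply: eq_integral => w _.
  transitivity (\int[nu]_x ((\int[cm w]_y (u y)%:E) * (u x)%:E + (u x ^+ 2)%:E))%E.
    apply: eq_integral => x _; rewrite /F /= integral_add_atom//.
    by rewrite (ge0_muleDl _ (N0 w) (u0' x)) /= -EFinM -expr2.
  have mNu : mfunT (fun x => (\int[cm w]_y (u y)%:E) * (u x)%:E)%E.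
    exact: emeasurable_funM.
  have Nu0 x : (0 <= (\int[cm w]_y (u y)%:E) * (u x)%:E)%E.
    by apply: mule_ge0 => //; rewrite lee_fin.
  have mu2 : mfunT (fun x => (u x ^+ 2)%:E).
    by apply/mEFinP; exact: measurable_funX.
  have u20 x : (0 <= (u x ^+ 2)%:E)%E by rewrite lee_fin sqr_ge0.
  rewrite (ge0_integralD nu measurableT (fun x _ => Nu0 x) mNu (fun x _ => u20 x) mu2).
  by rewrite (ge0_integralZl nu measurableT mu' (fun x _ => u0' x) (N0 w)) muleC.
have iu0 : (0 <= \int[nu]_x (u x)%:E)%E.
  by apply: integral_ge0 => x _; rewrite lee_fin.
set C := (\int[nu]_x (u x ^+ 2)%:E)%E.
have C0 : (0 <= C)%E by apply: integral_ge0 => x _; rewrite lee_fin sqr_ge0.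
set I := (\int[nu]_x (u x)%:E)%E in iu0 *.
have mIN : mfunT (fun w : config => I * \int[cm w]_x (u x)%:E)%E.
  exact: emeasurable_funM.
rewrite (ge0_integralD P measurableT (fun w _ => mule_ge0 iu0 (N0 w)) mIN
  (fun w _ => C0) (measurable_cst _)).
rewrite (ge0_integralZl P measurableT mN (fun w _ => N0 w) iu0).
rewrite (mean_intN mu' u0') -/I; congr (_ + _)%E.
rewrite integral_cst// -[RHS]mule1; congr (_ * _)%E; exact: probability_setT.
Qed.

Lemma Ntilde1_sqr_ge0 (u : X -> R) : mfunT u -> (forall x, 0 <= u x) ->
  (\int[nu]_x (u x)%:E < +oo)%E -> (\int[nu]_x (u x ^+ 2)%:E < +oo)%E ->
  (\int[P]_w (Ntilde1 u w ^+ 2)%:E = \int[nu]_x (u x ^+ 2)%:E)%E.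
Proof.
move=> mu u0 uoo u2oo.
have mu' : mfunT (EFin \o u) by exact/mEFinP.
have u0' x : (0 <= (EFin \o u) x)%E by rewrite lee_fin.
have iu : integrableT nu u.
  by apply/integrableP; split => //; under eq_integral do rewrite /= ger0_norm//.
pose m := \int[nu]_x u x.
have mE : (\int[nu]_x (u x)%:E = m%:E)%E.
  by rewrite /m /Rintegral fineK//; exact: integrable_fin_num iu.
have m0 : 0 <= m by rewrite -lee_fin -mE; apply: integral_ge0 => x _; rewrite lee_fin.
have NE : {ae P, forall w : config, (\int[cm w]_x (u x)%:E = (intN u w)%:E)%E}.
  apply: filterS (integrable_config iu) => w h.
  by rewrite /intN /Rintegral fineK//; exact: integrable_fin_num h.
have mN := measurable_intN mu.
have N0 w : 0 <= intN u w.
  by rewrite /intN /Rintegral fine_ge0//; apply: integral_ge0 => x _; rewrite lee_fin.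
have E2 : (\int[P]_w (intN u w ^+ 2)%:E = (m ^+ 2)%:E + \int[nu]_x (u x ^+ 2)%:E)%E.
  transitivity (\int[P]_w ((\int[cm w]_x (u x)%:E) ^+ 2))%E.
    apply: ae_eq_integral => //.
    - by apply/mEFinP; exact: measurable_funX.
    - by under eq_fun do rewrite expe2; apply: emeasurable_funM;
        exact: measurable_integral_config.
    - by apply: filterS NE => w -> _; rewrite -EFin_expe.
  by rewrite mean_NtildeK// mE -EFin_expe.
have E1 : (\int[P]_w (intN u w)%:E = m%:E)%E.
  rewrite -mE -(mean_intN mu' u0'); apply: ae_eq_integral => //.
  - exact/mEFinP.
  - exact: measurable_integral_config.
  - by apply: filterS NE => w -> _.
have mT := measurable_Ntilde1 mu.
have P1 (c : R) : (\int[P]_w c%:E = c%:E)%E.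
  by rewrite integral_cst// -[RHS]mule1; congr (_ * _)%E; exact: probability_setT.
(* The cross term is moved to the left so that both sides are integrals of nonnegative functions,
   which add without integrability conditions. *)
have : (\int[P]_w (Ntilde1 u w ^+ 2 + 2 * m * intN u w)%:E =
        \int[P]_w (intN u w ^+ 2 + m ^+ 2)%:E)%E.
  by apply: eq_integral => w _; congr EFin; rewrite /Ntilde1 -/m; ring.
rewrite integral_EFinD//; last 4 first.
- exact: measurable_funX.
- exact: measurable_funM.
- by move=> w; rewrite sqr_ge0.
- by move=> w; rewrite !mulr_ge0.
rewrite integral_EFinD//; last 3 first.
- exact: measurable_funX.
- by move=> w; rewrite sqr_ge0.
- by move=> w; rewrite sqr_ge0.
rewrite integral_EFinZ ?mulr_ge0// E1 E2 P1 -EFinM.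
have : (0 <= \int[P]_w (Ntilde1 u w ^+ 2)%:E)%E.
  by apply: integral_ge0 => w _; rewrite lee_fin sqr_ge0.
have : (0 <= \int[nu]_x (u x ^+ 2)%:E)%E.
  by apply: integral_ge0 => w _; rewrite lee_fin sqr_ge0.
move: u2oo; set A := integral _ _ _; set B := integral _ _ _.
by case: A B => [a||] [b||]//= _ _ _; rewrite -?EFinD => -[] e; congr EFin; nra.
Qed.

(** Splitting into positive and negative parts costs the factor 2, harmless for continuity and
    Cauchy estimates. *)
Lemma Ntilde1_sqr_le (f : X -> R) : integrableT nu f ->
  (\int[nu]_x (f x ^+ 2)%:E < +oo)%E ->
  (\int[P]_w (Ntilde1 f w ^+ 2)%:E <= 2%:E * \int[nu]_x (f x ^+ 2)%:E)%E.
Proof.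
move=> fi f2oo; have /integrableP[/mEFinP mf foo] := fi.
pose p x := Num.max (f x) 0; pose n x := Num.max (- f x) 0.
have mp : mfunT p by exact: measurable_maxr.
have mn : mfunT n by apply: measurable_maxr => //; exact: mcompT.
have p0 x : 0 <= p x by rewrite le_max lexx orbT.
have n0 x : 0 <= n x by rewrite le_max lexx orbT.
have pf x : p x <= `|f x| by rewrite ge_max normr_ge0 ler_norm.
have nf x : n x <= `|f x| by rewrite ge_max normr_ge0 -normrN ler_norm.
have fE : f = (fun x => p x - n x).
  by apply/funext => x; rewrite /p /n; case: (leP (f x) 0) => a;
    case: (leP (- f x) 0) => b; lra.
have sq x : f x ^+ 2 = p x ^+ 2 + n x ^+ 2.
  by rewrite /p /n; case: (leP (f x) 0) => a; case: (leP (- f x) 0) => b; nra.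
have E : (\int[nu]_x (f x ^+ 2)%:E =
    \int[nu]_x (p x ^+ 2)%:E + \int[nu]_x (n x ^+ 2)%:E)%E.
  have p2 := measurable_funX 2 mp; have n2 := measurable_funX 2 mn.
  rewrite -(integral_EFinD _ p2 n2 (fun x => sqr_ge0 _) (fun x => sqr_ge0 _)).
  by apply: eq_integral => x _; rewrite sq.
have [p2 n2] : (\int[nu]_x (p x ^+ 2)%:E < +oo)%E /\ (\int[nu]_x (n x ^+ 2)%:E < +oo)%E.
  by split; apply: le_lt_trans f2oo; rewrite E; [rewrite leeDl//|rewrite leeDr//];
    apply: integral_ge0 => x _; rewrite lee_fin sqr_ge0.
have [p1 n1] : (\int[nu]_x (p x)%:E < +oo)%E /\ (\int[nu]_x (n x)%:E < +oo)%E.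
  by split; apply: le_lt_trans foo; apply: integral_EFin_le => //; exact: mcompT.
have pi : integrableT nu p.
  apply/integrableP; split; first exact/mEFinP.
  by under eq_integral do rewrite /= ger0_norm//.
have ni : integrableT nu n.
  apply/integrableP; split; first exact/mEFinP.
  by under eq_integral do rewrite /= ger0_norm//.
have mT g : mfunT g -> mfunT (fun w : config => Ntilde1 g w ^+ 2).
  by move=> mg; apply: measurable_funX; exact: measurable_Ntilde1.
have -> : (\int[P]_w (Ntilde1 f w ^+ 2)%:E =
    \int[P]_w ((Ntilde1 p w - Ntilde1 n w) ^+ 2)%:E)%E.
  apply: ae_eq_integral => //.
  - by apply/mEFinP; exact: mT.
  - by apply/mEFinP; apply: measurable_funX; apply: measurable_funB;
      exact: measurable_Ntilde1.
  - by rewrite fE; apply: filterS (Ntilde1B pi ni) => w -> _.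
apply: (@le_trans _ _ (\int[P]_w (2 * Ntilde1 p w ^+ 2 + 2 * Ntilde1 n w ^+ 2)%:E)%E).
  apply: integral_EFin_le.
  - by apply: measurable_funX; apply: measurable_funB; exact: measurable_Ntilde1.
  - by apply: measurable_funD; apply: measurable_funM => //; exact: mT.
  - by move=> w; rewrite sqr_ge0.
  - by move=> w; have := sqr_ge0 (Ntilde1 p w + Ntilde1 n w); nra.
rewrite integral_EFinD; [|by apply: measurable_funM => //; exact: mT
  |by apply: measurable_funM => //; exact: mT
  |by move=> w; rewrite mulr_ge0 ?sqr_ge0|by move=> w; rewrite mulr_ge0 ?sqr_ge0].
rewrite !integral_EFinZ//; [|exact: mT|by move=> w; rewrite sqr_ge0|exact: mT|
  by move=> w; rewrite sqr_ge0].
have sq0 (g : X -> R) : (0 <= \int[nu]_x (g x ^+ 2)%:E)%E.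
  by apply: integral_ge0 => x _; rewrite lee_fin sqr_ge0.
by rewrite !Ntilde1_sqr_ge0// E (ge0_muleDr _ (sq0 p) (sq0 n)).
Qed.

(** Where |h| exceeds 1/(n+1) it is at most (n+1) h^2, so the truncation to this set is
    integrable. *)
Lemma L2_truncation (h : X -> R) : mfunT h ->
  (\int[nu]_x (h x ^+ 2)%:E < +oo)%E ->
  exists f_ : nat -> X -> R, [/\ forall n, integrableT nu (f_ n),
    forall n, (\int[nu]_x (f_ n x ^+ 2)%:E < +oo)%E &
    to0 (fun n => \int[nu]_x ((f_ n x - h x) ^+ 2)%:E)%E].
Proof.
move=> mh hoo; pose A n : set X := [set x | n.+1%:R^-1 < `|h x|].
have mA n : measurable (A n).
  have -> : A n = setT `&` (fun x => `|h x|) @^-1` `]n.+1%:R^-1, +oo[%classic.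
    by rewrite setTI; apply/seteqP; split => x; rewrite /A /= in_itv/= andbT.
  have mnh : mfunT (fun x => `|h x|) by exact: mcompT.
  exact: mnh.
pose f_ n x := h x * \1_(A n) x.
have mf n : mfunT (f_ n) by apply: measurable_funM.
have f2 n x : f_ n x ^+ 2 <= h x ^+ 2.
  rewrite /f_ exprMn ler_piMr ?sqr_ge0// indicE; case: (x \in A n); rewrite ?expr1n ?expr0n//.
exists f_; split.
- move=> n; apply/integrableP; split; first exact/mEFinP.
  apply: (@le_lt_trans _ _ (\int[nu]_x (n.+1%:R * h x ^+ 2)%:E)%E).
    apply: integral_EFin_le.
    + exact: mcompT.
    + by apply: measurable_funM => //; exact: measurable_funX.
    + by move=> x.
    + move=> x; rewrite /f_ indicE; case: (boolP (x \in A n)); last first.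
        by rewrite mulr0 normr0 => _; rewrite mulr_ge0 ?sqr_ge0.
      rewrite inE /A /= => hx; rewrite mulr1 -real_normK ?num_real// expr2 mulrA.
      rewrite ler_peMl// -ler_pdivrMl ?ltr0n// mulr1; exact: ltW.
  rewrite integral_EFinZ//; [exact: lte_mul_pinfty|exact: measurable_funX|].
  by move=> x; rewrite sqr_ge0.
- move=> n; apply: le_lt_trans hoo; apply: integral_EFin_le => //.
  + exact: measurable_funX.
  + exact: measurable_funX.
  + by move=> x; rewrite sqr_ge0.
apply: (dct_to0 (g := fun x => h x ^+ 2)) => //.
- by move=> n; apply: measurable_funX; exact: measurable_funB.
- exact: measurable_funX.
- by move=> n x; rewrite sqr_ge0.
- move=> n x; rewrite /f_ indicE; case: (x \in A n).
    by rewrite mulr1 subrr expr0n/= sqr_ge0.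
  by rewrite mulr0 sub0r sqrrN.
apply: aeW => x; have [h0|h0] := eqVneq (h x) 0.
  under eq_fun do rewrite /f_ h0 mul0r subrr expr0n /=.
  exact: cvg_cst.
have hp : 0 < `|h x| by rewrite normr_gt0.
have [n0 hn0] := ltr_add_invr hp; rewrite add0r in hn0.
apply: cvg_near_cst; exists n0 => // n /= hn.
rewrite /f_ indicE mem_set ?mulr1 ?subrr ?expr0n//= /A /=.
by apply: le_lt_trans hn0; rewrite lef_pV2 ?posrE// ler_nat.
Qed.

Lemma Ntilde_exists (h : X -> R) : h \in Lfun nu 2%:E -> exists G, is_Ntilde nu P h G.
Proof.
move=> /Lfun2P[mh hoo]; have [f_ [f1 f2 fh]] := L2_truncation mh hoo.
have mf n : mfunT (f_ n).
  by apply/mEFinP; exact: measurable_int (f1 n).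
have mT n := measurable_Ntilde1 (mf n).
have fB m n : integrableT nu (fun x => f_ m x - f_ n x).
  by have := integrableB measurableT (f1 m) (f1 n).
have tri m n : (\int[nu]_x ((f_ m x - f_ n x) ^+ 2)%:E <=
    2%:E * \int[nu]_x ((f_ m x - h x) ^+ 2)%:E + 2%:E * \int[nu]_x ((f_ n x - h x) ^+ 2)%:E)%E.
  rewrite -!(csq_real nu).
  have := @csqB_tri _ _ R nu _ _ _ (cmeasurable_real (mf m)) (cmeasurable_real (mf n)) (cmeasurable_real mh).
  by under eq_fun do rewrite -rmorphB /=; under [X in (_ <= 2%:E * csq _ X + _)%E]eq_fun do
    rewrite -rmorphB /=; under [X in (_ <= _ + 2%:E * csq _ X)%E]eq_fun do rewrite -rmorphB /=.
have poo n : (\int[nu]_x ((f_ n x - h x) ^+ 2)%:E < +oo)%E.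
  have := @csqB_lty _ _ R nu _ _ (cmeasurable_real (mf n)) (cmeasurable_real mh).
  rewrite !csq_real => /(_ (f2 n) hoo); under eq_fun do rewrite -rmorphB /=.
  by rewrite csq_real.
have [] := @L2_complete _ _ R P (fun n w => Ntilde1 (f_ n) w) mT.
  move=> e e0; have [n0 hn] := fh (e / 16) (divr_gt0 e0 (ltr0n _ 16)).
  exists n0 => m n hm hn'.
  have -> : (\int[P]_w ((Ntilde1 (f_ m) w - Ntilde1 (f_ n) w) ^+ 2)%:E =
      \int[P]_w (Ntilde1 (fun x => f_ m x - f_ n x) w ^+ 2)%:E)%E.
    apply: ae_eq_integral => //.
    - by apply/mEFinP; apply: measurable_funX; exact: measurable_funB.
    - by apply/mEFinP; apply: measurable_funX; apply: measurable_Ntilde1;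
        exact: measurable_funB.
    - by apply: filterS (Ntilde1B (f1 m) (f1 n)) => w -> _.
  have Boo : (\int[nu]_x ((f_ m x - f_ n x) ^+ 2)%:E < +oo)%E.
    by apply: le_lt_trans (tri m n) _; apply: lte_add_pinfty; exact: lte_mul_pinfty.
  apply: (le_lt_trans (Ntilde1_sqr_le (fB m n) Boo)).
  apply: (@le_lt_trans _ _ (2%:E * (2%:E * (e / 16)%:E + 2%:E * (e / 16)%:E))%E).
    apply: lee_wpmul2l => //; apply: (le_trans (tri m n)).
    by apply: leeD; apply: lee_wpmul2l => //; apply: ltW; exact: hn.
  rewrite (_ : (2%:E * _)%E = (2 * (2 * (e / 16) + 2 * (e / 16)))%:E)// lte_fin.
  lra.
move=> G mG hG; exists G; split.
  apply/Lfun2P; split => //.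
  have := @csq_lty_lim _ _ R P (fun n w => (Ntilde1 (f_ n) w)%:C%C) (fun w => (G w)%:C%C).
  rewrite csq_real; apply.
  - by move=> n; exact: cmeasurable_real.
  - exact: cmeasurable_real.
  - move=> n; rewrite csq_real; apply: (le_lt_trans (Ntilde1_sqr_le (f1 n) (f2 n))).
    exact: lte_mul_pinfty.
  - by move: hG; congr to0; apply/funext => n; rewrite -csq_real; congr csq;
      apply/funext => w; rewrite rmorphB.
exists f_; split.
- by move=> n; split; [exact/Lfun1P|apply/Lfun2P].
- exact/norm2_to0.
- exact/norm2_to0.
Qed.

End CompensatedSum.

(** * Campbell formula for bounded factors *)

Section Campbell.

Lemma PN_cintegral_prod (f : config * X -> R[i]) a b :
  cmeasurable f -> cintegrable P a -> cintegrable nu b ->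
  {ae P, forall w, forall x, f (add_atom x w, x) = a w * b x} ->
  cintegrable PN f /\ cintegral PN f = cintegral P a * cintegral nu b.
Proof.
move=> mf ia ib fab.
apply: (@cintegral_prod _ _ _ config X (config * X)%type R P nu PN
  (fun z => (add_atom z.2 z.1, z.2))) => //.
- exact: measurable_add_atom_pair.
- exact: palm.1.
Qed.

Lemma mN_cintegral_prod (f : CXM -> R[i]) a b :
  cmeasurable f -> cintegrable P a -> cintegrable NR b ->
  {ae P, forall w, forall z, f (add_atom z.1 w, z.1, z.2) = a w * b z} ->
  cintegrable mN f /\ cintegral mN f = cintegral P a * cintegral NR b.
Proof.
move=> mf ia ib fab; have [Q QE] := sigma_finite_prod nu rho.
have QI (g : X * M -> \bar R) : (\int[Q]_z g z = \int[NR]_z g z)%E.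
  by apply: eq_measure_integral => A _ _; exact: QE.
have ibQ : cintegrable Q b.
  by case: ib => -[/integrableP[h1 h2] /integrableP[h3 h4]]; split; apply/integrableP;
    split => //; rewrite QI.
have -> : cintegral NR b = cintegral Q b by rewrite /cintegral /Rintegral !QI.
apply: (@cintegral_prod _ _ _ config (X * M)%type (CXM)%type R P Q mN
  (fun y => (add_atom y.2.1 y.1, y.2.1, y.2.2))) => //.
- apply: measurable_fun_pair; last exact: mcompT.
  have h : mfunT (fun y : config * (X * M) => (y.1, y.2.1)).
    by apply: measurable_fun_pair => //; exact: mcompT.
  rewrite (_ : (fun y : config * (X * M) => (add_atom y.2.1 y.1, y.2.1)) =
    (fun z : config * X => (add_atom z.2 z.1, z.2)) \o (fun y => (y.1, y.2.1)))//.
  by apply: mcompT => //; exact: measurable_add_atom_pair.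
- move=> g mg g0; rewrite (mN_integral mg g0); apply: eq_integral => w _.
  by rewrite QI.
Qed.

(** Integrability on both sides is bundled with the identity, which makes the property stable under
    differences and so extends it to signed factors. *)
Definition campbell (a : config -> R) (h : X -> R) :=
  [/\ integrableT PN (fun z => a z.1 * h z.2),
      integrableT P (fun w => a w * intN h w) &
      \int[PN]_z (a z.1 * h z.2) = \int[P]_w (a w * intN h w)].

Lemma campbell_ge0 (k : R) (a : config -> R) (h : X -> R) : mfunT a -> (forall w, 0 <= a w) ->
  (forall w, a w <= k) -> (forall x, 0 <= h x) -> integrableT nu h ->
  campbell a h.
Proof.
move=> ma a0 ak h0 ih; have /integrableP[/mEFinP mh hoo] := ih.
have mh' : mfunT (EFin \o h) by exact/mEFinP.
have h0' x : (0 <= (EFin \o h) x)%E by rewrite lee_fin.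
have mF : mfunT (fun z : config * X => a z.1 * h z.2).
  by apply: measurable_funM; exact: mcompT.
have mG : mfunT (fun w : config => a w * intN h w).
  by apply: measurable_funM => //; exact: measurable_intN.
have N0 w : 0 <= intN h w.
  by rewrite /intN /Rintegral fine_ge0//; apply: integral_ge0 => x _; rewrite lee_fin.
have E : (\int[PN]_z (a z.1 * h z.2)%:E = \int[P]_w (a w * intN h w)%:E)%E.
  rewrite (palm.2 (fun z => (a z.1 * h z.2)%:E)); last 2 first.
  - exact/mEFinP.
  - by move=> z; rewrite lee_fin mulr_ge0.
  apply: ae_ge0_integral_lower.
  - by move=> w; rewrite lee_fin mulr_ge0.
  - exact/mEFinP.
  apply: filterS (integrable_config ih) => w hw /=.
  under eq_integral do rewrite EFinM.
  rewrite (ge0_integralZl (cm w) measurableT mh' (fun x _ => h0' x)) ?lee_fin//.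
  by rewrite EFinM /intN /Rintegral fineK//; exact: integrable_fin_num hw.
have oo : (\int[PN]_z (a z.1 * h z.2)%:E < +oo)%E.
  rewrite (palm.1 (fun z => (a z.1 * h z.2)%:E)); last 2 first.
  - exact/mEFinP.
  - by move=> z; rewrite lee_fin mulr_ge0.
  apply: (@le_lt_trans _ _ (\int[P]_w (k%:E * \int[nu]_x (h x)%:E))%E).
    apply: le_lower_integral.
      by move=> w; apply: integral_ge0 => x _; rewrite lee_fin mulr_ge0.
    move=> w /=; have k0 : 0 <= k by exact: le_trans (a0 w) (ak w).
    rewrite -(ge0_integralZl nu measurableT mh' (fun x _ => h0' x)) ?lee_fin//.
    apply: le_lower_integral => x; first by rewrite lee_fin mulr_ge0.
    by rewrite -EFinM lee_fin ler_wpM2r.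
  have k0 : 0 <= k by exact: le_trans (a0 point) (ak point).
  rewrite integral_cst//; apply: lte_mul_pinfty.
  - by apply: mule_ge0; [rewrite lee_fin|apply: integral_ge0 => x _; rewrite lee_fin].
  - rewrite fin_numM// ge0_fin_numE; last by apply: integral_ge0 => x _; rewrite lee_fin.
    by move: hoo; under eq_integral do rewrite /= ger0_norm//.
  - by rewrite ltey_eq fin_num_measure.
split.
- apply/integrableP; split; first exact/mEFinP.
  by under eq_integral do rewrite /= ger0_norm ?mulr_ge0//.
- apply/integrableP; split; first exact/mEFinP.
  by under eq_integral do rewrite /= ger0_norm ?mulr_ge0//; rewrite -E.
- by rewrite /Rintegral E.
Qed.

Lemma campbellBr (a : config -> R) (h k : X -> R) : mfunT a ->
  integrableT nu h -> integrableT nu k ->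
  campbell a h -> campbell a k -> campbell a (fun x => h x - k x).
Proof.
move=> ma ih ik [h1 h2 h3] [k1 k2 k3].
have mh : mfunT h by apply/mEFinP; exact: measurable_int ih.
have mk : mfunT k by apply/mEFinP; exact: measurable_int ik.
have e1 : (fun z : config * X => a z.1 * (h z.2 - k z.2)) =
  (fun z => a z.1 * h z.2 - a z.1 * k z.2) by apply/funext => z; rewrite mulrBr.
have aeN : {ae P, forall w : config, (a w * intN h w - a w * intN k w) =
    (a w * intN (fun x => h x - k x) w)}.
  apply: filterS2 (integrable_config ih) (integrable_config ik) => w hw kw.
  by rewrite -mulrBr; congr (_ * _); rewrite /intN RintegralB.
have mB : mfunT (fun w => a w * intN (fun x => h x - k x) w).
  by apply: measurable_funM => //; apply: measurable_intN; exact: measurable_funB.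
have i1 := integrableB measurableT h1 k1; have i2 := integrableB measurableT h2 k2.
have E1 : \int[P]_w (a w * intN (fun x => h x - k x) w) =
    \int[P]_w (a w * intN h w - a w * intN k w).
  rewrite /Rintegral; congr fine; apply/esym/ae_eq_integral => //.
  - by apply/mEFinP; apply: measurable_funB;
      apply: measurable_funM => //; exact: measurable_intN.
  - exact/mEFinP.
  - by apply: filterS aeN => w -> _.
split.
- by rewrite e1; move: i1; congr integrable.
- have aeC : {ae P, forall w : config, (a w * intN h w - a w * intN k w)%:C%C =
      (a w * intN (fun x => h x - k x) w)%:C%C} by apply: filterS aeN => w ->.
  have iC : cintegrable P (fun w => (a w * intN h w - a w * intN k w)%:C%C).
    by split; [move: i2; congr integrable|exact: integrable0].
  exact: (ae_cintegrable (cmeasurable_real mB) aeC iC).1.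
- by rewrite e1 RintegralB// h3 k3 E1 RintegralB.
Qed.

Lemma campbellBl a b h : campbell a h -> campbell b h -> campbell (fun w => a w - b w) h.
Proof.
move=> [h1 h2 h3] [k1 k2 k3].
have e1 : (fun z : config * X => (a z.1 - b z.1) * h z.2) =
  (fun z => a z.1 * h z.2 - b z.1 * h z.2) by apply/funext => z; rewrite mulrBl.
have e2 : (fun w => (a w - b w) * intN h w) =
  (fun w => a w * intN h w - b w * intN h w) by apply/funext => z; rewrite mulrBl.
have i1 := integrableB measurableT h1 k1; have i2 := integrableB measurableT h2 k2.
split.
- by rewrite e1; move: i1; congr integrable.
- by rewrite e2; move: i2; congr integrable.
- by rewrite e1 e2 !RintegralB// h3 k3.
Qed.

Lemma campbell_bounded (k : R) (a : config -> R) (h : X -> R) : mfunT a -> (forall w, `|a w| <= k) ->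
  integrableT nu h -> campbell a h.
Proof.
move=> ma ak ih; have /integrableP[/mEFinP mh hoo] := ih.
have k0 : 0 <= k by apply: le_trans (normr_ge0 _) (ak point).
pose p x := Num.max (h x) 0; pose n x := Num.max (- h x) 0.
have mp : mfunT p by exact: measurable_maxr.
have mn : mfunT n by apply: measurable_maxr => //; exact: mcompT.
have p0 x : 0 <= p x by rewrite le_max lexx orbT.
have n0 x : 0 <= n x by rewrite le_max lexx orbT.
have pf x : p x <= `|h x| by rewrite ge_max normr_ge0 ler_norm.
have nf x : n x <= `|h x| by rewrite ge_max normr_ge0 -normrN ler_norm.
have fE : h = (fun x => p x - n x).
  by apply/funext => x; rewrite /p /n; case: (leP (h x) 0) => a1;
    case: (leP (- h x) 0) => b; lra.
have i (q : X -> R) : mfunT q -> (forall x, 0 <= q x) -> (forall x, q x <= `|h x|) ->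
    integrableT nu q.
  move=> mq q0 qh; apply/integrableP; split; first exact/mEFinP.
  under eq_integral do rewrite /= ger0_norm//.
  by apply: le_lt_trans hoo; apply: integral_EFin_le => //; exact: mcompT.
have pos (q : X -> R) : mfunT q -> (forall x, 0 <= q x) -> (forall x, q x <= `|h x|) ->
    campbell a q.
  move=> mq q0 qh; have iq := i q mq q0 qh.
  (* A bounded factor is a difference of two bounded nonnegative ones. *)
  have -> : a = (fun w => (a w + k) - cst k w) by apply/funext => w; rewrite /cst addrK.
  apply: campbellBl.
    apply: (@campbell_ge0 (k + k)) => //.
    - exact: measurable_funD.
    - by move=> w; have := ak w; rewrite ler_norml => /andP[]; lra.
    - by move=> w; have := ak w; rewrite ler_norml => /andP[]; lra.
  exact: (@campbell_ge0 k).
rewrite fE; apply: campbellBr => //; [exact: i|exact: i|exact: pos|exact: pos].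
Qed.

Lemma campbell_complex (a : config -> R[i]) (h : X -> R) (k : R) : cmeasurable a ->
  (forall w, normc (a w) <= k) -> integrableT nu h ->
  [/\ cintegrable P (fun w => a w * (intN h w)%:C%C),
      cintegrable PN (fun z => a z.1 * (h z.2)%:C%C) &
      cintegral PN (fun z => a z.1 * (h z.2)%:C%C) =
      cintegral P (fun w => a w * (intN h w)%:C%C)].
Proof.
move=> [m1 m2] ak ih.
have [r1 r2 r3] := campbell_bounded m1 (fun w => le_trans (Re_normc _) (ak w)) ih.
have [i1 i2 i3] := campbell_bounded m2 (fun w => le_trans (Im_normc _) (ak w)) ih.
have eR (z : R[i]) (t : R) : Re (z * t%:C%C) = Re z * t by rewrite ReM /= mulr0 subr0.
have eI (z : R[i]) (t : R) : Im (z * t%:C%C) = Im z * t by rewrite ImM /= mulr0 add0r.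
split.
- by split; [move: r2|move: i2]; congr integrable; apply/funext => w; rewrite /= ?eR ?eI.
- by split; [move: r1|move: i1]; congr integrable; apply/funext => w; rewrite /= ?eR ?eI.
rewrite /cintegral; under [in LHS]eq_Rintegral do rewrite eR.
under [X in (_ +i* X)%C = _]eq_Rintegral do rewrite eI.
under [X in _ = (X +i* _)%C]eq_Rintegral do rewrite eR.
under [X in _ = (_ +i* X)%C]eq_Rintegral do rewrite eI.
by rewrite r3 i3.
Qed.

End Campbell.

(** * Expectations of exponentials *)

Section ExponentialFormulas.

Definition expN (g : X -> R) (w : config) : R[i] := expi (Ntilde1 g w).
(** A factor common to both expressions of the energy; it is carried along unevaluated. *)
Definition meanexp (g : X -> R) : R[i] := cintegral P (expN g).

Lemma expN_measurable g : mfunT g -> cmeasurable (expN g).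
Proof. by move=> mg; apply: cmeasurable_expi; exact: measurable_Ntilde1. Qed.

Lemma expN_integrable g : mfunT g -> cintegrable P (expN g).
Proof.
move=> mg; apply: (@cintegrable_bounded _ _ _ _ _ 1); first exact: expN_measurable.
by move=> w; rewrite normc_expi.
Qed.

Lemma integrable_measurable (f : X -> R) :
  integrableT nu f -> mfunT f.
Proof. by move=> fi; apply/mEFinP; exact: measurable_int fi. Qed.

Lemma expN_shift g : integrableT nu g ->
  {ae P, forall w, forall x, expN g (add_atom x w) = expN g w * expi (g x)}.
Proof.
by move=> /Ntilde1_shift; apply: filterS => w h x; rewrite /expN h expiD.
Qed.

(** The left side is an integral against the Campbell measure; in coordinates before the atom is
    added the exponential acquires the factor e^{ig(x)} and the integral factorizes. *)
Lemma expN_intN (g h : X -> R) : integrableT nu g ->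
  integrableT nu h ->
  cintegrable P (fun w => expN g w * (intN h w)%:C%C) /\
  cintegral P (fun w => expN g w * (intN h w)%:C%C) =
    meanexp g * cintegral nu (fun x => expi (g x) * (h x)%:C%C).
Proof.
move=> ig ih; have mg := integrable_measurable ig; have mh := integrable_measurable ih.
have n1 w : normc (expN g w) <= 1 by rewrite normc_expi.
have [i1 i2 <-] := campbell_complex (expN_measurable mg) n1 ih.
split => //.
have [] // := @PN_cintegral_prod
  (fun z => expN g z.1 * (h z.2)%:C%C) (expN g) (fun x => expi (g x) * (h x)%:C%C).
- exact: cintegrable_measurable i2.
- exact: expN_integrable.
- exact: cintegrable_expiM.
- by apply: filterS (expN_shift ig) => w hw x /=; rewrite hw mulrA.
Qed.

Lemma expN_Ntilde1 (g h : X -> R) : integrableT nu g ->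
  integrableT nu h ->
  cintegral P (fun w => expN g w * (Ntilde1 h w)%:C%C) =
    meanexp g * cintegral nu (fun x => (expi (g x) - 1) * (h x)%:C%C).
Proof.
move=> ig ih; have mg := integrable_measurable ig; have mh := integrable_measurable ih.
have [i1 e1] := expN_intN ig ih.
have -> : (fun w => expN g w * (Ntilde1 h w)%:C%C) = (fun w =>
    expN g w * (intN h w)%:C%C + (- (\int[nu]_x h x)%:C%C) * expN g w).
  by apply/funext => w; rewrite /Ntilde1 rmorphB /=; ring.
have -> : (fun x => (expi (g x) - 1) * (h x)%:C%C) = (fun x =>
    expi (g x) * (h x)%:C%C + (- 1) * (h x)%:C%C).
  by apply/funext => w; ring.
have ie := expN_integrable mg.
have ihC : cintegrable nu (fun x => (h x)%:C%C) by split => //; exact: integrable0.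
rewrite cintegralD//; last exact: cintegrableZ.
rewrite cintegralD//; [|exact: cintegrable_expiM|exact: cintegrableZ].
rewrite !cintegralZ// e1 cintegral_real -/(meanexp g); ring.
Qed.

Lemma sqr_cosB1_le (t : R) : (cos t - 1) ^+ 2 <= 4 * t ^+ 2.
Proof.
have h : `|cos t - 1| <= `|t|.
  have := tame_lipschitz (tame_cosB1 R) t 0; rewrite cos0 subrr !subr0; exact.
have := normr_ge0 (cos t - 1).
rewrite -[(cos t - 1) ^+ 2]real_normK ?num_real// -[t ^+ 2]real_normK ?num_real//.
by move: h; nra.
Qed.

Lemma sqr_sin_le (t : R) : (sin t) ^+ 2 <= t ^+ 2.
Proof.
have h : `|sin t| <= `|t|.
  have := tame_lipschitz (tame_sin R) t 0; rewrite sin0 !subr0; exact.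
rewrite -[(sin t) ^+ 2]real_normK ?num_real// -[t ^+ 2]real_normK ?num_real//.
by rewrite lerXn2r ?nnegrE.
Qed.

(** Both sides of [expN_Ntilde1] are continuous in h for the L2 norm: on the left the exponential is
    bounded, on the right e^{ig} - 1 is in L2 because g is. *)
Lemma expN_Ntilde (g h : X -> R) (G : config -> R) : integrableT nu g ->
  (\int[nu]_x (g x ^+ 2)%:E < +oo)%E -> mfunT h ->
  (\int[nu]_x (h x ^+ 2)%:E < +oo)%E -> is_Ntilde nu P h G ->
  cintegrable P (fun w => expN g w * (G w)%:C%C) /\
  cintegral P (fun w => expN g w * (G w)%:C%C) =
    meanexp g * cintegral nu (fun x => (expi (g x) - 1) * (h x)%:C%C).
Proof.
move=> ig g2 mh h2 [/Lfun2P[mG G2] [f_ [fL /norm2_to0 fh /norm2_to0 fG]]].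
have mg := integrable_measurable ig.
have fi n : integrableT nu (f_ n) by apply/Lfun1P; case: (fL n).
have f2 n : (\int[nu]_x (f_ n x ^+ 2)%:E < +oo)%E by case: (fL n) => _ /Lfun2P[].
have mf n := integrable_measurable (fi n).
have mN g' : mfunT g' -> mfunT (fun w : config => Ntilde1 g' w).
  exact: measurable_Ntilde1.
have N2 n : (\int[P]_w (Ntilde1 (f_ n) w ^+ 2)%:E < +oo)%E.
  apply: (le_lt_trans (Ntilde1_sqr_le (fi n) (f2 n))); exact: lte_mul_pinfty.
have b2 (b : R -> R) : mfunT (fun w : config => b (Ntilde1 g w)) ->
    (forall t, `|b t| <= 1) -> (\int[P]_w ((b (Ntilde1 g w)) ^+ 2)%:E < +oo)%E.
  move=> mb b1; apply: (@le_lt_trans _ _ (\int[P]_w 1%:E)%E).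
    apply: integral_EFin_le => //.
    - exact: measurable_funX.
    - by move=> w; rewrite sqr_ge0.
    - by move=> w; rewrite -real_normK ?num_real// expr_le1.
  by rewrite integral_cst// mul1e ltey_eq fin_num_measure.
have mc := measurable_cos (mN _ mg); have ms := measurable_sin (mN _ mg).
have c2 := b2 _ mc (@cos_le1_norm R); have s2 := b2 _ ms (@sin_le1_norm R).
have mc' : mfunT (fun x => cos (g x) - 1).
  by apply: measurable_funB => //; exact: measurable_cos.
have ms' := measurable_sin mg.
have c2' : (\int[nu]_x ((cos (g x) - 1) ^+ 2)%:E < +oo)%E.
  apply: (@le_lt_trans _ _ (\int[nu]_x (4 * g x ^+ 2)%:E)%E).
    apply: integral_EFin_le => //.
    - exact: measurable_funX.
    - by apply: measurable_funM => //; exact: measurable_funX.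
    - by move=> w; rewrite sqr_ge0.
    - by move=> w; exact: sqr_cosB1_le.
  rewrite integral_EFinZ//; [exact: lte_mul_pinfty|exact: measurable_funX|].
  by move=> x; rewrite sqr_ge0.
have s2' : (\int[nu]_x ((sin (g x)) ^+ 2)%:E < +oo)%E.
  apply: le_lt_trans g2; apply: integral_EFin_le => //.
  - exact: measurable_funX.
  - exact: measurable_funX.
  - by move=> w; rewrite sqr_ge0.
  - by move=> w; exact: sqr_sin_le.
have L1 := L2M_cvg (fun n => mN _ (mf n)) N2 mG G2 mc c2 fG.
have L2 := L2M_cvg (fun n => mN _ (mf n)) N2 mG G2 ms s2 fG.
have R1 := L2M_cvg mf f2 mh h2 mc' c2' fh.
have R2 := L2M_cvg mf f2 mh h2 ms' s2' fh.
have eL (H : config -> R) : cintegral P (fun w => expN g w * (H w)%:C%C) =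
    ((\int[P]_w (H w * cos (Ntilde1 g w))) +i* (\int[P]_w (H w * sin (Ntilde1 g w))))%C.
  rewrite /cintegral; congr (_ +i* _)%C; apply: eq_Rintegral => w _.
    by rewrite ReM_real mulrC.
  by rewrite ImM_real mulrC.
have eR (k : X -> R) : cintegral nu (fun x => (expi (g x) - 1) * (k x)%:C%C) =
    ((\int[nu]_x (k x * (cos (g x) - 1))) +i* (\int[nu]_x (k x * sin (g x))))%C.
  rewrite /cintegral; congr (_ +i* _)%C; apply: eq_Rintegral => w _.
    by rewrite ReM_real ReB mulrC.
  by rewrite ImM_real ImB subr0 mulrC.
split.
  have j1 := L2M_integrable mG G2 mc c2; have j2 := L2M_integrable mG G2 ms s2.
  split.
  - by move: j1; congr integrable; apply/funext => w; apply: (congr1 EFin); rewrite ReM_real mulrC.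
  - by move: j2; congr integrable; apply/funext => w; apply: (congr1 EFin); rewrite ImM_real mulrC.
have E n := expN_Ntilde1 ig (fi n).
rewrite eL eR; apply/eqP; rewrite eq_complex ReM ImM /=; apply/andP; split; apply/eqP.
- apply: (cvg_unique _ L1) => //.
  have -> : (fun n => \int[P]_x (Ntilde1 (f_ n) x * cos (Ntilde1 g x))) =
    (fun n => Re (meanexp g) * \int[nu]_x (f_ n x * (cos (g x) - 1)) -
              Im (meanexp g) * \int[nu]_x (f_ n x * sin (g x))).
    by apply/funext => n; have := E n; rewrite eL eR => /(congr1 (fun z => Re z)); rewrite ReM.
  by apply: cvgB; apply: cvgMr.
- apply: (cvg_unique _ L2) => //.
  have -> : (fun n => \int[P]_x (Ntilde1 (f_ n) x * sin (Ntilde1 g x))) =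
    (fun n => Re (meanexp g) * \int[nu]_x (f_ n x * sin (g x)) +
              Im (meanexp g) * \int[nu]_x (f_ n x * (cos (g x) - 1))).
    by apply/funext => n; have := E n; rewrite eL eR => /(congr1 (fun z => Im z)); rewrite ImM.
  by apply: cvgD; apply: cvgMr.
Qed.

(** The integral of e^{ig} gamma[f, k] against [nu], written with flats so that bilinearity is that
    of [flat]. *)
Definition flatD (f k g : X -> R) : R[i] :=
  cintegral NR (fun z => expi (g z.1) * (flat f z * flat k z)%:C%C).

Lemma flatM_integrable f k : d f -> d k ->
  integrableT NR (fun z => flat f z * flat k z).
Proof. by move=> df dk; case: (bform_flat df dk). Qed.

(** The generator is tested against cos g - 1 and sin g, elements of [d] whose flats are - sin(g)
    and cos(g) times the flat of g. *)
Lemma generator_flatD f af g : is_generator nu d bf f af -> d g ->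
  cintegral nu (fun x => (expi (g x) - 1) * (af x)%:C%C) = (0 -i* 2^-1)%C * flatD f g g.
Proof.
move=> [df _ gen] dg; have mg := dom_measurable dg.
have mg1 : mfunT (fun z : X * M => g z.1) by exact: mcompT.
have [] := chain_prod_d (tame_cosB1 R) (tame_cst1 R) dg dg.
  by rewrite cos0 subrr mul0r.
have -> : (fun x => (cos (g x) - 1) * cst 1 (g x)) = (fun x => cos (g x) - 1).
  by apply/funext => x; rewrite /cst mulr1.
move=> dc fc.
have [] := chain_prod_d (tame_sin R) (tame_cst1 R) dg dg.
  by rewrite sin0 mul0r.
have -> : (fun x => sin (g x) * cst 1 (g x)) = (fun x => sin (g x)).
  by apply/funext => x; rewrite /cst mulr1.
move=> ds fs.
have mff := measurable_int _ (flatM_integrable df dg).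
have mff' : mfunT (fun z => flat f z * flat g z) by exact/mEFinP.
have e1 : \int[nu]_x (af x * (cos (g x) - 1)) =
    2^-1 * \int[NR]_z (sin (g z.1) * (flat f z * flat g z)).
  rewrite -[LHS]opprK -(gen _ dc) (bform_flat df dc).2 -mulrN; congr (_ * _).
  rewrite -mulN1r -RintegralZl//; last exact: flatM_integrable.
  rewrite /Rintegral; congr fine; apply: ae_eq_integral => //.
  - apply/mEFinP; apply: measurable_funM => //; apply: measurable_funM;
      by apply: flat_measurable _ _.
  - by apply/mEFinP; apply: measurable_funM => //; exact: measurable_sin.
  - by apply: filterS fc => z -> _; rewrite /cst; congr EFin; ring.
have e2 : \int[nu]_x (af x * sin (g x)) =
    - (2^-1 * \int[NR]_z (cos (g z.1) * (flat f z * flat g z))).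
  rewrite -[LHS]opprK -(gen _ ds) (bform_flat df ds).2; congr (- (_ * _)).
  rewrite /Rintegral; congr fine; apply: ae_eq_integral => //.
  - by apply/mEFinP; apply: measurable_funM; apply: flat_measurable _ _.
  - by apply/mEFinP; apply: measurable_funM => //; exact: measurable_cos.
  - by apply: filterS fs => z -> _; rewrite /cst; congr EFin; ring.
rewrite /flatD /cintegral.
under [X in (X +i* _)%C = _]eq_Rintegral do rewrite ReM_real ReB mulrC.
under [X in (_ +i* X)%C = _]eq_Rintegral do rewrite ImM_real ImB subr0 mulrC.
under [X in _ = _ * (X +i* _)%C]eq_Rintegral do rewrite ReM_real.
under [X in _ = _ * (_ +i* X)%C]eq_Rintegral do rewrite ImM_real.
rewrite /= e1 e2; apply/eqP; rewrite eq_complex ReM ImM /=.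
by apply/andP; split; apply/eqP; ring.
Qed.

Lemma gam_bounded_integral (b : X -> R) f : mfunT b ->
  (forall x, `|b x| <= 1) -> d f ->
  \int[nu]_x (b x * gam f f x) = \int[NR]_z (b z.1 * (flat f z * flat f z)).
Proof.
move=> mb b1 df.
have iff := flatM_integrable df df.
have mff : mfunT (fun z => flat f z * flat f z).
  by apply/mEFinP; exact: measurable_int iff.
have mb1 : mfunT (fun z : X * M => b z.1) by exact: mcompT.
have ib : integrableT NR (fun z => b z.1 * (flat f z * flat f z)).
  apply: integrable_le iff; first exact: measurable_funM.
  by move=> z; rewrite [leLHS]normrM ler_piMl.
rewrite /Rintegral -(integral12_prod_meas1 ib) /fubini_F /=; congr fine.
have /Lfun1P gi := cdc_L1 dom_cdc df df.
apply: ae_eq_integral => //.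
- by apply/mEFinP; apply: measurable_funM => //; apply/mEFinP;
    exact: measurable_int gi.
- exact: measurable_fubini_F ib.
- apply: filterS (gam_flat df) => x [e _] _.
  under eq_integral do rewrite EFinM.
  have e2 : (gam f f x)%:E = (\int[rho]_r (flat f (x, r) * flat f (x, r))%:E)%E.
    by rewrite e; apply: eq_integral => r _; rewrite expr2.
  rewrite EFinM e2 integralZl//.
  apply/integrableP; split.
    apply/mEFinP; have := @measurable_pair1 _ _ X M x => mp.
    by apply: measurable_funM; apply: mcompT => //; exact: flat_measurable _ df.
  under eq_integral do rewrite /= -expr2 ger0_norm ?sqr_ge0//.
  by rewrite -e ltry.
Qed.

Lemma gam_flatD f g : d f -> mfunT g ->
  cintegral nu (fun x => expi (g x) * (gam f f x)%:C%C) = flatD f f g.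
Proof.
move=> df mg; rewrite /flatD /cintegral.
under [X in (X +i* _)%C = _]eq_Rintegral do rewrite ReM_real.
under [X in (_ +i* X)%C = _]eq_Rintegral do rewrite ImM_real.
under [X in _ = (X +i* _)%C]eq_Rintegral do rewrite ReM_real.
under [X in _ = (_ +i* X)%C]eq_Rintegral do rewrite ImM_real.
congr (_ +i* _)%C.
- apply: (gam_bounded_integral (b := fun x => cos (g x))) => //; first exact: measurable_cos.
  by move=> x; exact: cos_le1_norm.
- apply: (gam_bounded_integral (b := fun x => sin (g x))) => //; first exact: measurable_sin.
  by move=> x; exact: sin_le1_norm.
Qed.

Lemma flatDB f k l g : d f -> d k -> d l -> mfunT g ->
  flatD f (fun x => k x - l x) g = flatD f k g - flatD f l g.
Proof.
move=> df dk dl mg; have dkl := domB dk dl.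
have mg1 : mfunT (fun z : X * M => g z.1) by exact: mcompT.
have i k' : d k' -> cintegrable NR (fun z => expi (g z.1) * (flat f z * flat k' z)%:C%C).
  by move=> dk'; apply: cintegrable_expiM => //; exact: flatM_integrable.
rewrite /flatD (ae_cintegral (g := fun z => expi (g z.1) * (flat f z * flat k z)%:C%C +
  (-1) * (expi (g z.1) * (flat f z * flat l z)%:C%C))).
- by rewrite cintegralD; [|exact: i|apply: cintegrableZ; exact: i];
    rewrite cintegralZ; [rewrite mulN1r|exact: i].
- exact: cintegrable_measurable (i _ dkl).
- by apply: cintegrable_measurable; apply: cintegrableD; [exact: i|apply: cintegrableZ; exact: i].
- by apply: filterS (flatB dk dl) => z ->; rewrite mulrBr rmorphB /=; ring.
Qed.

End ExponentialFormulas.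

(** * Gradient and energy on D0 *)

Section FiniteEnergy.

Definition kap m (lam : 'I_m -> R[i]) (f : 'I_m -> X -> R) (z : CXM) : R[i] :=
  \sum_p (iC * lam p) * (expN (f p) z.1.1 * (flat (f p) (z.1.2, z.2))%:C%C).

Lemma test_exponent_facts f : test_exponent f ->
  [/\ d f, integrableT nu f, mfunT f &
      (\int[nu]_x (f x ^+ 2)%:E < +oo)%E].
Proof.
by move=> [/Lfun1P fi [af [df _ _]]]; have [mf f2] := dom_L2 df.
Qed.

Lemma expsum_measurable m (lam : 'I_m -> R[i]) (f : 'I_m -> X -> R) :
  (forall p, mfunT (f p)) -> cmeasurable (expsum nu lam f).
Proof.
move=> mf; apply: cmeasurable_sum => p; apply: cmeasurableM; first exact: cmeasurable_cst.
exact: expN_measurable.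
Qed.

Lemma expsum_bounded m (lam : 'I_m -> R[i]) (f : 'I_m -> X -> R) w :
  normc (expsum nu lam f w) <= \sum_p normc (lam p).
Proof.
rewrite /expsum; elim/big_ind2: _ => [|x1 x2 y1 y2 h1 h2|p _].
- by rewrite (normc_real (0 : R)) normr0.
- by apply: le_trans (normcD _ _) _; exact: lerD.
- by rewrite normcM normc_expi mulr1.
Qed.

Lemma measurable_mark (f : X -> R) : d f ->
  mfunT (fun z : CXM => flat f (z.1.2, z.2)).
Proof.
move=> df; apply: (mcompT (flat_measurable df)).
by apply: measurable_fun_pair => //; exact: mcompT.
Qed.

Lemma kap_term_measurable (f : X -> R) : d f ->
  cmeasurable (fun z : CXM => expN f z.1.1 * (flat f (z.1.2, z.2))%:C%C).
Proof.
move=> df; apply: cmeasurableM; last by apply: cmeasurable_real; exact: measurable_mark.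
apply: (cmeasurable_comp (f := expN f)).
  by apply: expN_measurable; exact: (dom_measurable df).
exact: mcompT.
Qed.

Lemma kap_term_csq (f : X -> R) : d f ->
  (csq mN (fun z => expN f z.1.1 * (flat f (z.1.2, z.2))%:C%C)%R < +oo)%E.
Proof.
move=> df; rewrite /csq (eq_integral (fun z => (flat f (z.1.2, z.2) ^+ 2)%:E)); last first.
  by move=> z _; rewrite nsqM nsq_expi mul1r nsq_real.
rewrite (mN_integral (f := fun z => (flat f (z.1.2, z.2) ^+ 2)%:E)); last 2 first.
- by apply/mEFinP; apply: measurable_funX; exact: measurable_mark.
- by move=> z; rewrite lee_fin sqr_ge0.
have h : (\int[NR]_z (flat f z ^+ 2)%:E < +oo)%E := (flat_L2 df).2.
rewrite (eq_integral (fun=> \int[NR]_z (flat f z ^+ 2)%:E)%E); last first.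
  by move=> w _; apply: eq_integral => -[x r].
rewrite integral_cst//; apply: lte_mul_pinfty.
- by apply: integral_ge0 => z _; rewrite lee_fin sqr_ge0.
- by rewrite ge0_fin_numE//; apply: integral_ge0 => z _; rewrite lee_fin sqr_ge0.
- by rewrite ltey_eq fin_num_measure.
Qed.

Lemma kap_measurable m (lam : 'I_m -> R[i]) (f : 'I_m -> X -> R) :
  (forall p, d (f p)) -> cmeasurable (kap lam f).
Proof.
move=> df; apply: cmeasurable_sum => p; apply: cmeasurableM; first exact: cmeasurable_cst.
exact: kap_term_measurable.
Qed.

Lemma kap_csq m (lam : 'I_m -> R[i]) (f : 'I_m -> X -> R) :
  (forall p, d (f p)) -> (csq mN (kap lam f) < +oo)%E.
Proof.
move=> df; apply: csq_sum_lty => p.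
  by apply: cmeasurableM; [exact: cmeasurable_cst|exact: kap_term_measurable].
rewrite csqZ; last exact: kap_term_measurable.
by apply: lte_mul_pinfty; [rewrite lee_fin nsq_ge0|by []|exact: kap_term_csq].
Qed.

Lemma kap_cflC m (lam : 'I_m -> R[i]) (f : 'I_m -> X -> R) :
  (forall p, test_exponent (f p)) ->
  {ae P, forall w, cflC (fun x => expsum nu lam f (add_atom x w))
    (fun z => kap lam f (add_atom z.1 w, z.1, z.2))}.
Proof.
move=> tf.
have h p : {ae P, forall w, forall x,
    expN (f p) (add_atom x w) = expN (f p) w * expi (f p x)}.
  by apply: expN_shift _ _; have [] := test_exponent_facts (tf p).
have : {ae P, forall w, forall p, forall x,
    expN (f p) (add_atom x w) = expN (f p) w * expi (f p x)}.
  exact: filter_forall.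
apply: filterS => w hw.
have -> : (fun x => expsum nu lam f (add_atom x w)) =
    (fun x => \sum_p (lam p * expN (f p) w) * expi (f p x)).
  by apply/funext => x; apply: eq_bigr => p _; rewrite -mulrA -hw.
have -> : (fun z : X * M => kap lam f (add_atom z.1 w, z.1, z.2)) =
    (fun z => \sum_p (lam p * expN (f p) w) * ((0 +i* flat (f p) z)%C * expi (f p z.1))).
  apply/funext => -[x r]; apply: eq_bigr => p _; rewrite /= hw.
  have -> : (0 +i* flat (f p) (x, r))%C = iC * (flat (f p) (x, r))%:C%C.
    by apply/eqP; rewrite eq_complex ReM ImM /=; apply/andP; split; apply/eqP; ring.
  by ring.
apply: cflC_sum _ _ _ _ _ => p; apply: cflC_expi _ _.
by have [] := test_exponent_facts (tf p).
Qed.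

(** The gradient is attached to a decomposition of F, hence a relation; [D0k_unique] shows that
    different decompositions agree almost everywhere. *)
Definition D0k (F : config -> R[i]) (k : CXM -> R[i]) :=
  exists m (lam : 'I_m.+1 -> R[i]) (f : 'I_m.+1 -> X -> R),
    [/\ forall p, test_exponent (f p), F = expsum nu lam f & k = kap lam f].

Lemma D0_D0k F : D0 nu d gam F -> exists k, D0k F k.
Proof. by move=> [m [lam [f [tf ->]]]]; exists (kap lam f), m, lam, f. Qed.

Lemma D0k_D0 F k : D0k F k -> D0 nu d gam F.
Proof. by move=> [m [lam [f [tf -> _]]]]; exists m, lam, f. Qed.

Lemma D0k_facts F k : D0k F k ->
  [/\ cmeasurable F, exists c, forall w, normc (F w) <= c, cmeasurable k &
      (csq mN k < +oo)%E].
Proof.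
move=> [m [lam [f [tf -> ->]]]].
have df p : d (f p) by have [] := test_exponent_facts (tf p).
split; [|by eexists; exact: expsum_bounded|exact: kap_measurable|exact: kap_csq].
by apply: expsum_measurable => p; have [] := test_exponent_facts (tf p).
Qed.

Lemma D0k_cflC F k : D0k F k ->
  {ae P, forall w, cflC (fun x => F (add_atom x w))
    (fun z => k (add_atom z.1 w, z.1, z.2))}.
Proof. by move=> [m [lam [f [tf -> ->]]]]; exact: kap_cflC. Qed.

Lemma D0k_unique F k l : D0k F k -> D0k F l -> {ae mN, forall z, k z = l z}.
Proof.
move=> Fk Fl; have [_ _ mk _] := D0k_facts Fk; have [_ _ ml _] := D0k_facts Fl.
apply: mN_ae_of _ (measurable_ceq_set mk ml) _.
apply: filterS2 (D0k_cflC Fk) (D0k_cflC Fl) => w.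
exact: cflC_unique _ _ _.
Qed.

Lemma D0k_lin (a : R[i]) F k G l : D0k F k -> D0k G l ->
  D0k (fun w => a * F w + G w) (fun z => a * k z + l z).
Proof.
move=> [m [lam [f [tf -> ->]]]] [n [mu [g [tg -> ->]]]].
pose lg (p : 'I_(m.+1 + n.+1)) : R[i] * (X -> R) :=
  match fintype.split p with
  | inl i => (a * lam i, f i) | inr j => (mu j, g j) end.
have e1 i : lg (lshift n.+1 i) = (a * lam i, f i).
  by rewrite /lg -[lshift _ _]/(unsplit (inl i)) unsplitK.
have e2 j : lg (rshift m.+1 j) = (mu j, g j).
  by rewrite /lg -[rshift _ _]/(unsplit (inr j)) unsplitK.
exists (m + n.+1)%N, (fun p => (lg p).1), (fun p => (lg p).2); split.
- by move=> p; rewrite /lg; case: (fintype.split _) => j; [exact: tf|exact: tg].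
- apply/funext => w; rewrite /expsum.
  rewrite (@big_split_ord _ _ _ m.+1 n.+1) /= mulr_sumr; congr (_ + _).
    by apply: eq_bigr => i _; rewrite e1 /= mulrA.
  by apply: eq_bigr => i _; rewrite e2.
- apply/funext => z; rewrite /kap.
  rewrite (@big_split_ord _ _ _ m.+1 n.+1) /= mulr_sumr; congr (_ + _).
    by apply: eq_bigr => i _; rewrite e1 /=; ring.
  by apply: eq_bigr => i _; rewrite e2.
Qed.

Lemma D0kB F k G l : D0k F k -> D0k G l -> D0k (F - G) (fun z => k z - l z).
Proof.
move=> Fk Gl; have := D0k_lin (-1) Gl Fk.
have -> : (fun w => -1 * G w + F w) = F - G.
  by apply/funext => w; rewrite mulN1r addrC.
by have -> : (fun z => -1 * l z + k z) = (fun z => k z - l z);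
  last by []; apply/funext => w; rewrite mulN1r addrC.
Qed.

(** The term N(gamma[f]) contributes -1/2 D(f, f) and the compensated generator +1/2 D(f, f - k),
    where D stands for [flatD] with exponent [g]. The D(f, f) cancel and -1/2 D(f, k) remains. *)
Lemma A0_term (f k af : X -> R) (h : config -> R) : test_exponent f -> test_exponent k ->
  is_generator nu d bf f af -> is_Ntilde nu P af h ->
  let g x := f x - k x in
  let t w := expN g w * (- (2^-1 * intN (gam f f) w) +i* h w)%C in
  cintegrable P t /\
  cintegral P t = - (2^-1)%:C%C * (meanexp g * flatD f k g).
Proof.
move=> tf tk gf hN g t.
have [df fi mf f2] := test_exponent_facts tf.
have [dk ki mk k2] := test_exponent_facts tk.
have dg : d g := domB df dk.
have gi : integrableT nu g by have := integrableB measurableT fi ki.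
have mg := integrable_measurable gi.
have g2 : (\int[nu]_x (g x ^+ 2)%:E < +oo)%E := (dom_L2 dg).2.
have /Lfun1P gami := cdc_L1 dom_cdc df df.
have /Lfun2P[maf af2] : af \in Lfun nu 2%:E by case: gf.
have [i1 e1] := expN_intN gi gami.
have [i2 e2] := expN_Ntilde gi g2 maf af2 hN.
have -> : t = (fun w => (- (2^-1)%:C%C) * (expN g w * (intN (gam f f) w)%:C%C) +
    iC * (expN g w * (h w)%:C%C)).
  apply/funext => w; rewrite /t.
  have -> : (- (2^-1 * intN (gam f f) w) +i* h w)%C =
      (- (2^-1)%:C%C) * (intN (gam f f) w)%:C%C + iC * (h w)%:C%C.
    by apply/eqP; rewrite eq_complex !(ReD, ImD, ReM, ImM) /=; apply/andP; split; apply/eqP; ring.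
  by ring.
split; first by apply: cintegrableD; exact: cintegrableZ.
rewrite cintegralD; [|exact: cintegrableZ|exact: cintegrableZ].
rewrite !cintegralZ// e1 e2 (generator_flatD gf dg) (gam_flatD df mg).
have fgE : flatD f g g = flatD f f g - flatD f k g.
  exact: (flatDB df df dk mg).
rewrite fgE; move: (meanexp g) (flatD f f g) (flatD f k g).
move=> [c1 c2] [x1 x2] [y1 y2].
by apply/eqP; rewrite eq_complex /=; apply/andP; split; apply/eqP; field.
Qed.

Lemma expN_conj f k : test_exponent f -> test_exponent k ->
  {ae P, forall w, expN f w * (expN k w)^*%C = expN (fun x => f x - k x) w}.
Proof.
move=> tf tk; have [_ fi _ _] := test_exponent_facts tf.
have [_ ki _ _] := test_exponent_facts tk.
by apply: filterS (Ntilde1B fi ki) => w h; rewrite /expN h expiD expiN.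
Qed.

(** In a cross term the two exponentials combine into that of f_p - f_q, and the integral factorizes
    by [mN_cintegral_prod] into the same double sum as the energy. *)
Lemma kap_csqE m (lam : 'I_m -> R[i]) (f : 'I_m -> X -> R) :
  (forall p, test_exponent (f p)) ->
  csq mN (kap lam f) = (Re (\sum_p \sum_q (lam p * (lam q)^*%C) *
    (meanexp (fun x => f p x - f q x) *
     flatD (f p) (f q) (fun x => f p x - f q x))))%:E.
Proof.
move=> tf; have df p : d (f p) by have [] := test_exponent_facts (tf p).
rewrite csq_cintegral; [|exact: kap_measurable|exact: kap_csq]; congr (Re _)%:E.
pose T p q (z : CXM) := expN (f p) z.1.1 * (expN (f q) z.1.1)^*%C *
  (flat (f p) (z.1.2, z.2) * flat (f q) (z.1.2, z.2))%:C%C.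
have -> : (fun z => kap lam f z * (kap lam f z)^*%C) =
    (fun z => \sum_p \sum_q (lam p * (lam q)^*%C) * T p q z).
  apply/funext => z; rewrite /kap rmorph_sum /= mulr_suml; apply: eq_bigr => p _.
  by rewrite mulr_sumr; apply: eq_bigr => q _; exact: mul_conj_term.
have TI p q : cintegrable mN (T p q) /\ cintegral mN (T p q) =
    meanexp (fun x => f p x - f q x) *
    flatD (f p) (f q) (fun x => f p x - f q x).
  have [dp ip mp p2] := test_exponent_facts (tf p).
  have [dq iq mq q2] := test_exponent_facts (tf q).
  have mpq : mfunT (fun x => f p x - f q x) by exact: measurable_funB.
  apply: (mN_cintegral_prod (f := T p q)
    (a := expN (fun x => f p x - f q x))
    (b := fun z => expi (f p z.1 - f q z.1) * (flat (f p) z * flat (f q) z)%:C%C)).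
  - have mz1 (e : config -> R[i]) : cmeasurable e -> cmeasurable (fun z : CXM => e z.1.1).
      by move=> me; apply: (cmeasurable_comp me); exact: mcompT.
    apply: cmeasurableM.
      apply: cmeasurableM; first by apply: mz1; exact: expN_measurable.
      by apply: cmeasurable_conj; apply: mz1; exact: expN_measurable.
    by apply: cmeasurable_real; apply: measurable_funM; exact: measurable_mark.
  - exact: expN_integrable.
  - apply: cintegrable_expiM; last exact: (flatM_integrable dp dq).
    exact: (mcompT mpq).
  - apply: filterS3 (expN_shift ip) (expN_shift iq) (expN_conj (tf p) (tf q)).
    move=> w h1 h2 h3 [x r].
    transitivity (expN (f p) (add_atom x w) * (expN (f q) (add_atom x w))^*%C *
      (flat (f p) (x, r) * flat (f q) (x, r))%:C%C); first by [].
    rewrite h1 h2 -h3 conjcM -[f p (x, r).1 - f q (x, r).1]/(f p x - f q x).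
    by rewrite expiD expiN; ring.
rewrite cintegral_sum; last first.
  by move=> p; apply: cintegrable_sum => q; apply: cintegrableZ; case: (TI p q).
apply: eq_bigr => p _; rewrite cintegral_sum; last first.
  by move=> q; apply: cintegrableZ; case: (TI p q).
by apply: eq_bigr => q _; have [i e] := TI p q; rewrite cintegralZ// e.
Qed.

Lemma is_A0_energy m (lam : 'I_m -> R[i]) (f : 'I_m -> X -> R) (af : 'I_m -> X -> R)
    (h : 'I_m -> config -> R) :
  (forall p, test_exponent (f p)) -> (forall p, is_generator nu d bf (f p) (af p)) ->
  (forall p, is_Ntilde nu P (af p) (h p)) ->
  - Re (cintegral P (fun w => (\sum_p lam p * expi (Ntilde1 (f p) w) *
            (- (2^-1 * intN (gam (f p) (f p)) w) +i* h p w)%C) *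
      (expsum nu lam f w)^*%C)) = 2^-1 * fine (csq mN (kap lam f)).
Proof.
move=> tf gf hN; rewrite kap_csqE// -[fine _]/(Re _).
pose g p q x := f p x - f q x.
pose T p q w := expN (g p q) w * (- (2^-1 * intN (gam (f p) (f p)) w) +i* h p w)%C.
have TI p q : cintegrable P (T p q) /\ cintegral P (T p q) =
    - (2^-1)%:C%C * (meanexp (g p q) * flatD (f p) (f q) (g p q)).
  exact: (A0_term (tf p) (tf q) (gf p) (hN p)).
have ITs p : cintegrable P (fun w => \sum_q (lam p * (lam q)^*%C) * T p q w).
  by apply: cintegrable_sum => q; apply: cintegrableZ; case: (TI p q).
have mh p : mfunT (h p) by have [/Lfun2P[]] := hN p.
have mf p : mfunT (f p) by have [] := test_exponent_facts (tf p).
rewrite (ae_cintegral (g := fun w => \sum_p \sum_q (lam p * (lam q)^*%C) * T p q w)).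
- rewrite cintegral_sum//.
  transitivity (- Re (- (2^-1)%:C%C * \sum_p \sum_q (lam p * (lam q)^*%C) *
      (meanexp (g p q) * flatD (f p) (f q) (g p q)))).
    congr (- Re _); rewrite mulr_sumr; apply: eq_bigr => p _.
    rewrite cintegral_sum; last by move=> q; apply: cintegrableZ; case: (TI p q).
    rewrite mulr_sumr; apply: eq_bigr => q _; have [i e] := TI p q.
    by rewrite (cintegralZ _ i) e; ring.
  by set S := \sum_p _; rewrite ReM /=; ring.
- apply: cmeasurableM; last by apply: cmeasurable_conj; exact: expsum_measurable.
  apply: cmeasurable_sum => p; apply: cmeasurableM.
    by apply: cmeasurableM; [exact: cmeasurable_cst|exact: expN_measurable].
  split => //=; apply: mcompT => //; apply: measurable_funM => //.
  apply: measurable_intN; have /Lfun1P gami := cdc_L1 dom_cdc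
    (let: And4 a _ _ _ := test_exponent_facts (tf p) in a)
    (let: And4 a _ _ _ := test_exponent_facts (tf p) in a).
  exact: integrable_measurable gami.
- by apply: cintegrable_measurable; exact: cintegrable_sum.
have : {ae P, forall w, forall p, forall q, expN (f p) w * (expN (f q) w)^*%C = expN (g p q) w}.
  apply: filter_forall => p; apply: filter_forall => q; exact: expN_conj.
apply: filterS => w hw; rewrite /expsum rmorph_sum /= mulr_suml; apply: eq_bigr => p _.
rewrite mulr_sumr; apply: eq_bigr => q _; rewrite /T -hw rmorphM /= /expN; ring.
Qed.

Lemma A0_exists F : D0 nu d gam F -> is_A0 nu d gam P F (A0 nu d gam P F).
Proof.
move=> [m [lam [f [tf FE]]]]; apply: xgetPex.
have /choice[af afP] p : exists af, is_generator nu d bf (f p) af by case: (tf p).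
have /choice[h hP] p : exists h, is_Ntilde nu P (af p) h.
  by apply: Ntilde_exists; case: (afP p).
exists (fun w => \sum_p lam p * expi (Ntilde1 (f p) w) *
            (- (2^-1 * intN (gam (f p) (f p)) w) +i* h p w)%C).
by exists m, lam, f, af, h; split => // p; split => //; case: (tf p).
Qed.

(** [A0] chooses some decomposition of F and some versions of the compensated sums; the energy
    depends on them only through [kap], which is unique almost everywhere. *)
Lemma energy0E F k : D0k F k -> energy0 F = 2^-1 * fine (csq mN k).
Proof.
move=> Fk; have [m [lam [f [af [h [gf FE hN AE]]]]]] := A0_exists (D0k_D0 Fk).
have tf p : test_exponent (f p) by have [fL gp] := gf p; split => //; exists (af p).
rewrite /energy0 AE FE (is_A0_energy lam tf (fun p => (gf p).2) hN).
have Fk' : D0k F (kap lam f) by exists m, lam, f.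
have [_ _ mk _] := D0k_facts Fk; have [_ _ mk' _] := D0k_facts Fk'.
by rewrite (ae_csq mk' mk (D0k_unique Fk' Fk)).
Qed.

End FiniteEnergy.

(** * Closability of flat on the space underline(D) *)

Section FlatVersions.
Local Open Scope ring_scope.

Definition versionC (H H' : config * X -> R[i]) :=
  cmeasurable H' /\
  {ae P, forall w, {ae nu, forall x, H (w, x) = H' (add_atom x w, x)}}.

Lemma versionCB H1 H1' H2 H2' : versionC H1 H1' -> versionC H2 H2' ->
  versionC (H1 - H2) (fun z => H1' z - H2' z).
Proof.
move=> [m1 h1] [m2 h2]; split; first exact: cmeasurableB.
by apply: filterS2 h1 h2 => w; apply: filterS2 => x e1 e2; rewrite -e1 -e2.
Qed.

Lemma versionC_creation F : cmeasurable F -> versionC (creation F) (F \o fst).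
Proof.
move=> mF; split; first by apply: (cmeasurable_comp mF); exact: measurable_fst.
by apply: filterS add_point_ae => w; apply: filterS => x e;
  rewrite /creation /= e.
Qed.

Lemma xi_normE H H' : versionC H H' ->
  xi_norm H = (\int[PN]_z (normc (H' z) * xi z.2)%:E)%E.
Proof.
move=> [mH' hH]; apply: (EintNE
  (k' := fun z => normc (H' z) * xi z.2)).
- apply/versionNP; split.
    apply: measurable_funM; [exact: measurable_normc|exact: mcompT].
  by apply: filterS hH => w; apply: filterS => x /= ->.
- by apply: measurable_funM; [exact: measurable_normc|exact: mcompT].
- by move=> z; rewrite mulr_ge0 ?normc_ge0// ltW.
- exact: aeW.
Qed.

(** [H'] is a version of [H] and [K'] one of its flat. The flat is characterized for almost every
    fixed configuration by [cflC], without reference to a decomposition of [H] as a tensor. *)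
Definition flv (H H' : config * X -> R[i]) (K' : CXM -> R[i]) :=
  [/\ versionC H H', cmeasurable K', (csq mN K' < +oo)%E &
    {ae P, forall w, cflC (fun x => H (w, x)) (fun z => K' (add_atom z.1 w, z.1, z.2))}].

Lemma flvB H1 H1' K1 H2 H2' K2 : flv H1 H1' K1 -> flv H2 H2' K2 ->
  flv (H1 - H2) (fun z => H1' z - H2' z) (fun z => K1 z - K2 z).
Proof.
move=> [v1 m1 c1 h1] [v2 m2 c2 h2]; split.
- exact: versionCB.
- exact: cmeasurableB.
- exact: csqB_lty.
apply: filterS2 h1 h2 => w e1 e2.
have := cflCD e1 (cflCZ (-1) e2).
have -> : (fun x => H1 (w, x) + -1 * H2 (w, x)) = (fun x => (H1 - H2) (w, x)).
  by apply/funext => x; rewrite mulN1r.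
by apply: cflC_ae; apply: aeW => z; rewrite mulN1r.
Qed.

(** In a tensor, F is evaluated before the atom is added, whereas versions see the enlarged
    configuration; the factor e^{-if(x)} undoes the addition. *)
Lemma D0_version F : D0 nu d gam F -> exists F' : config * X -> R[i],
  [/\ cmeasurable F', exists c, forall z, normc (F' z) <= c &
    {ae P, forall w, forall x, F w = F' (add_atom x w, x)}].
Proof.
move=> [m [lam [f [tf ->]]]].
have mf p : mfunT (f p) by have [] := test_exponent_facts (tf p).
have fi p : integrableT nu (f p) by have [] := test_exponent_facts (tf p).
exists (fun z => \sum_p lam p * (expN (f p) z.1 * expi (- f p z.2))); split.
- apply: cmeasurable_sum => p; apply: cmeasurableM; first exact: cmeasurable_cst.
  apply: cmeasurableM.
    apply: (cmeasurable_comp (f := expN (f p))); [exact: expN_measurable|exact: measurable_fst].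
  apply: cmeasurable_expi; apply: (mcompT (f := fun x => - f p x)) => //.
  exact: mcompT.
- exists (\sum_p normc (lam p)) => z; elim/big_ind2: _ => [|x1 x2 y1 y2 h1 h2|p _].
  + by rewrite (normc_real (0 : R)) normr0.
  + by apply: le_trans (normcD _ _) _; exact: lerD.
  + by rewrite !normcM !normc_expi !mulr1.
have h p : {ae P, forall w, forall x,
    expN (f p) (add_atom x w) = expN (f p) w * expi (f p x)}.
  by apply: expN_shift _ _; exact: fi.
have : {ae P, forall w, forall p, forall x,
    expN (f p) (add_atom x w) = expN (f p) w * expi (f p x)}.
  exact: filter_forall.
apply: filterS => w hw x; rewrite /expsum; apply: eq_bigr => p _.
by rewrite /= hw -mulrA -expiD subrr expi0 mulr1.
Qed.

Lemma term_csq (F' : config * X -> R[i]) (c : R) (u : X -> R[i]) : cmeasurable F' ->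
  (forall z, normc (F' z) <= c) -> d1C d u ->
  cmeasurable (fun z : CXM => F' z.1 * flatC d flat u (z.1.2, z.2)) /\
  (csq mN (fun z => (F' z.1 * flatC d flat u (z.1.2, z.2))%R) < +oo)%E.
Proof.
move=> mF Fc du.
have mfl : cmeasurable (fun z : CXM => flatC d flat u (z.1.2, z.2)).
  apply: (cmeasurable_comp (f := flatC d flat u)); first exact: flatC_measurable _ du.
  by apply: measurable_fun_pair => //; exact: mcompT.
have mFf : cmeasurable (fun z : CXM => F' z.1 * flatC d flat u (z.1.2, z.2)).
  by apply: cmeasurableM => //; apply: (cmeasurable_comp mF); exact: measurable_fst.
split => //.
apply: (@le_lt_trans _ _ (\int[mN]_z (c ^+ 2 * nsq (flatC d flat u (z.1.2, z.2)))%:E)%E).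
  apply: integral_EFin_le.
  - exact: measurable_nsq.
  - by apply: measurable_funM => //; exact: measurable_nsq.
  - by move=> z; exact: nsq_ge0.
  - move=> z; rewrite nsqM ler_wpM2r ?nsq_ge0// nsqE lerXn2r ?nnegrE ?normc_ge0//.
    exact: le_trans (normc_ge0 _) (Fc z.1).
rewrite integral_EFinZ ?sqr_ge0//; [|exact: measurable_nsq|by move=> z; exact: nsq_ge0].
apply: lte_mul_pinfty; rewrite ?lee_fin ?sqr_ge0//.
rewrite (mN_integral (f := fun z => (nsq (flatC d flat u (z.1.2, z.2)))%:E)); last 2 first.
- by apply/mEFinP; exact: measurable_nsq.
- by move=> z; rewrite lee_fin nsq_ge0.
have h := flatC_csq du.
rewrite (eq_integral (fun=> csq NR (flatC d flat u))); last first.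
  by move=> w _; apply: eq_integral => -[x r].
rewrite integral_cst//; apply: lte_mul_pinfty; first exact: csq_ge0.
- by rewrite ge0_fin_numE// csq_ge0.
- by rewrite ltey_eq fin_num_measure.
Qed.

Lemma is_flat0_flv H K : is_flat0 H K ->
  exists H' K', flv H H' K' /\ versionNM K K'.
Proof.
move=> [m [F [u [F0 du -> ->]]]].
have /choice[F' F'P] i := D0_version (F0 i).
have /choice[c cP] i : exists c, forall z, normc (F' i z) <= c by have [] := F'P i.
have mF' i : cmeasurable (F' i) by have [] := F'P i.
exists (fun z => \sum_i F' i z * u i z.2).
exists (fun z => \sum_i F' i z.1 * flatC d flat (u i) (z.1.2, z.2)).
have ti i := term_csq (mF' i) (cP i) (du i).
have mK' : cmeasurable (fun z : CXM =>
    \sum_i F' i z.1 * flatC d flat (u i) (z.1.2, z.2)).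
  by apply: cmeasurable_sum => i; case: (ti i).
have FE : {ae P, forall w, forall i, forall x, F i w = F' i (add_atom x w, x)}.
  by apply: filter_forall => i; have [] := F'P i.
split; last first.
  apply/versionNMP; split => //; apply: filterS FE => w hw; apply: aeW => -[x r] /=.
  by apply: eq_bigr => i _; rewrite -hw.
split => //.
- split.
    apply: cmeasurable_sum => i; apply: cmeasurableM => //.
    apply: (cmeasurable_comp (f := u i)); first exact: d1C_measurable _ (du i).
    exact: measurable_snd.
  by apply: filterS FE => w hw; apply: aeW => x; apply: eq_bigr => i _ /=; rewrite -hw.
- by apply: csq_sum_lty => i; case: (ti i).
apply: filterS FE => w hw /=.
have -> : (fun z : X * M => \sum_i F' i (add_atom z.1 w, z.1) * flatC d flat (u i) (z.1, z.2)) =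
    (fun z => \sum_i F i w * flatC d flat (u i) z).
  by apply/funext => -[x r]; apply: eq_bigr => i _; rewrite -hw.
by apply: cflC_sum _ _ _ _ _ => i; exact: flatC_cfl.
Qed.

Lemma tensor_flat0 H : tensor H -> exists K, is_flat0 H K.
Proof.
move=> [m [F [u [F0 du ->]]]].
by exists (fun z => \sum_i F i z.1.1 * flatC d flat (u i) (z.1.2, z.2)), m, F, u.
Qed.

Lemma flat0_tensor H K : is_flat0 H K -> tensor H.
Proof. by move=> [m [F [u [F0 du -> _]]]]; exists m, F, u. Qed.

Lemma tensor_flv H : tensor H -> exists H' K', flv H H' K'.
Proof. by move=> /tensor_flat0[K /is_flat0_flv[H' [K' [h _]]]]; exists H', K'. Qed.

(* Along a subsequence everything converges for a.e. fixed configuration, where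
   the closability of the flat operator of the bottom space applies. *)
Lemma flv_closable (H_ H_' : nat -> config * X -> R[i]) (K_ : nat -> CXM -> R[i]) K :
  (forall n, flv (H_ n) (H_' n) (K_ n)) -> cmeasurable K -> (csq mN K < +oo)%E ->
  to0 (fun n => \int[PN]_z (normc (H_' n z) * xi z.2)%:E)%E ->
  to0 (fun n => csq mN (fun z => K_ n z - K z)) ->
  {ae mN, forall z, K z = 0}.
Proof.
move=> fl mK Koo h0 k0.
have mH n : cmeasurable (H_' n) by have [[]] := fl n.
have mK_ n : cmeasurable (K_ n) by have [] := fl n.
have mHx n : mfunT (fun z => normc (H_' n z) * xi z.2).
  by apply: measurable_funM; [exact: measurable_normc|exact: mcompT].
have [] := @to0_ae_subseq _ _ R PN (fun n z => (normc (H_' n z) * xi z.2)%:E) _ _ h0.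
- by move=> n; exact/mEFinP.
- by move=> n z; rewrite lee_fin mulr_ge0 ?normc_ge0// ltW.
move=> phi phin hphi.
have mD n : cmeasurable (fun z => K_ n z - K z) by exact: cmeasurableB.
pose q n w := (\int[NR]_z (nsq (K_ n (add_atom z.1 w, z.1, z.2) - K (add_atom z.1 w, z.1, z.2)))%:E)%E.
have [Q QE] := sigma_finite_prod nu rho.
have QI (g : X * M -> \bar R) : (\int[Q]_z g z = \int[NR]_z g z)%E.
  by apply: eq_measure_integral => A _ _; exact: QE.
have mtau : mfunT
    (fun y : config * (X * M) => (add_atom y.2.1 y.1, y.2.1, y.2.2)).
  apply: measurable_fun_pair; last exact: mcompT.
  rewrite (_ : (fun y : config * (X * M) => (add_atom y.2.1 y.1, y.2.1)) =
    (fun z : config * X => (add_atom z.2 z.1, z.2)) \o (fun y => (y.1, y.2.1)))//.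
  apply: mcompT; first exact: measurable_add_atom_pair.
  by apply: measurable_fun_pair => //; exact: mcompT.
have mq n : mfunT (q n).
  have mf : mfunT (fun y : config * (X * M) =>
     (nsq (K_ n (add_atom y.2.1 y.1, y.2.1, y.2.2) - K (add_atom y.2.1 y.1, y.2.1, y.2.2)))%:E).
    apply/mEFinP; apply: (mcompT (f := fun z => nsq (K_ n z - K z))) => //.
    exact: measurable_nsq.
  have f0 (y : config * (X * M)) : (0 <=
     (nsq (K_ n (add_atom y.2.1 y.1, y.2.1, y.2.2) - K (add_atom y.2.1 y.1, y.2.1, y.2.2)))%:E)%E.
    by rewrite lee_fin nsq_ge0.
  have h : mfunT (fun w => \int[Q]_z (nsq (K_ n (add_atom z.1 w, z.1, z.2) -
      K (add_atom z.1 w, z.1, z.2)))%:E)%E := measurable_fun_fubini_tonelli_F _ mf f0.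
  by move: h; congr measurable_fun; apply/funext => w; rewrite QI.
have q0 n w : (0 <= q n w)%E by apply: integral_ge0 => z _; rewrite lee_fin nsq_ge0.
have qE n : (csq mN (fun z => K_ n z - K z)%R = \int[P]_w q n w)%E.
  rewrite /csq (mN_integral (f := fun z => (nsq (K_ n z - K z))%:E))//.
  - by apply/mEFinP; exact: measurable_nsq.
  - by move=> z; rewrite lee_fin nsq_ge0.
(* A second extraction, from the first subsequence: the flats then converge in L2([nu] x [rho]) for
   almost every fixed configuration. *)
have [] := @to0_ae_subseq _ _ R P (fun n => q (phi n)).
- by move=> n; exact: mq.
- by move=> n w; exact: q0.
- by have := to0_sub phin k0; congr to0; apply/funext => n /=; rewrite qE.
move=> psi psin hpsi.
apply: mN_ae_of _ (measurable_ceq_set mK (cmeasurable_cst _ 0)) _.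
have hv : {ae P, forall w, forall n,
    {ae nu, forall x, H_ n (w, x) = H_' n (add_atom x w, x)} /\
    cflC (fun x => H_ n (w, x)) (fun z => K_ n (add_atom z.1 w, z.1, z.2))}.
  by apply: ae_foralln => n; have [[_ a1] _ _ a2] := fl n; apply: filterS2 a1 a2 => w.
have hK : {ae P, forall w,
    (\int[NR]_z (nsq (K (add_atom z.1 w, z.1, z.2)))%:E < +oo)%E}.
  have mf : mfunT (fun y : config * (X * M) =>
     (nsq (K (add_atom y.2.1 y.1, y.2.1, y.2.2)))%:E).
    apply/mEFinP; apply: (mcompT (f := fun z => nsq (K z))) => //.
    exact: measurable_nsq.
  have f0 (y : config * (X * M)) : (0 <=
     (nsq (K (add_atom y.2.1 y.1, y.2.1, y.2.2)))%:E)%E by rewrite lee_fin nsq_ge0.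
  have mF : mfunT (fun w => \int[Q]_z
      (nsq (K (add_atom z.1 w, z.1, z.2)))%:E)%E := measurable_fun_fubini_tonelli_F _ mf f0.
  have F0 w : (0 <= \int[Q]_z (nsq (K (add_atom z.1 w, z.1, z.2)))%:E)%E.
    by apply: integral_ge0 => z _; rewrite lee_fin nsq_ge0.
  have h := @integral_lty_ae _ _ R P _ mF F0.
  have h1 : (\int[P]_w \int[Q]_z (nsq (K (add_atom z.1 w, z.1, z.2)))%:E < +oo)%E.
    have := Koo; rewrite /csq (mN_integral (f := fun z => (nsq (K z))%:E)); last 2 first.
    - by apply/mEFinP; exact: measurable_nsq.
    - by move=> z; rewrite lee_fin nsq_ge0.
    by congr (_ < _)%E; apply: eq_integral => w _; rewrite QI.
  by apply: filterS (h h1) => w; rewrite QI.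
have hall := ae_and (ae_and hv hK) (ae_and hpsi (palm_ae_nu hphi)).
apply: filterS hall => w [[hvw hKw] [hq hx]].
have mt := measurable_tauM w.
apply: (cflC_closable
  (u_ := fun n x => H_ (phi (psi n)) (w, x))
  (k_ := fun n z => K_ (phi (psi n)) (add_atom z.1 w, z.1, z.2))).
- by move=> n; case: (hvw (phi (psi n))).
- by move=> n; apply: (cmeasurable_comp (mK_ _)); exact: mt.
- by apply: (cmeasurable_comp mK); exact: mt.
- exact: hKw.
- have hv2 := ae_foralln (fun n => (hvw n).1).
  apply: filterS2 hx hv2 => x hx hv2 e e0.
  (* Positivity of [xi x] removes the weight: the threshold is [e * xi x]. *)
  have [n0 hn] := to0_sub psin hx (mulr_gt0 e0 (xi_gt0 x)).
  exists n0 => n /hn; rewrite /= hv2 !lte_fin ltr_pM2r//.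
- exact: hq.
Qed.

(** [gamma0] makes its own choice of a constant on each section; uniqueness of flat identifies the
    corresponding flat with [K'], whose square integral over the marks is then a version. *)
Lemma flv_gamma H H' K' : flv H H' K' -> exists g : config * X -> R,
  [/\ versionN (gamma0 d gam H) g, forall z, 0 <= g z,
    {ae PN, forall z, (g z)%:E = (\int[rho]_r (nsq (K' (z, r)))%:E)%E} &
    EintN (gamma0 d gam H) = csq mN K'].
Proof.
move=> [[mH' hH] mK Koo hK].
have mn : mfunT (fun z => (nsq (K' z))%:E).
  by apply/mEFinP; exact: measurable_nsq.
have n0 z : (0 <= (nsq (K' z))%:E)%E by rewrite lee_fin nsq_ge0.
have mG : mfunT (fun z => \int[rho]_r (nsq (K' (z, r)))%:E)%E.
  exact: (measurable_fun_fubini_tonelli_F _ mn n0).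
have G0 z : (0 <= \int[rho]_r (nsq (K' (z, r)))%:E)%E by exact: integral_ge0.
have GE : (csq mN K' = \int[PN]_z \int[rho]_r (nsq (K' (z, r)))%:E)%E.
  exact: (fubini_tonelli1 _ mn).
pose g z := fine (\int[rho]_r (nsq (K' (z, r)))%:E)%E.
have mg : mfunT g by apply: mcompT.
have g0 z : 0 <= g z by exact: fine_ge0.
have gE : {ae PN, forall z, (g z)%:E = (\int[rho]_r (nsq (K' (z, r)))%:E)%E}.
  have := @integral_lty_ae _ _ R PN _ mG G0; rewrite -GE => /(_ Koo).
  by apply: filterS => z h; rewrite /g fineK// ge0_fin_numE.
have v : versionN (gamma0 d gam H) g.
  apply/versionNP; split => //; apply: filterS2 hK (palm_ae_nu gE) => w cw gw.
  have dw := cflC_d1C cw.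
  have ce := cflC_unique cw (flatC_cfl dw).
  apply: filterS3 (gammaC_flat dw) (ae_prodl ce) gw => x e1 e2 e3.
  apply: EFin_inj; rewrite /gamma0 e1 /=.
  have -> : (\int[rho]_r (nsq (flatC d flat (fun x0 => H (w, x0)) (x, r)))%:E =
      \int[rho]_r (nsq (K' (add_atom x w, x, r)))%:E)%E.
    apply: ae_eq_integral => //.
    - apply/mEFinP; apply: measurable_nsq; apply: (cmeasurable_comp
        (flatC_measurable dw)); exact: measurable_pair1.
    - exact: (mcompT mn (measurable_pair1 _)).
    - by apply: filterS e2 => r /= -> _.
  by rewrite e3.
exists g; split => //.
rewrite (EintNE v mg g0 (aeW _ (fun=> erefl))) GE.
apply: ae_eq_integral => //; first exact/mEFinP.
by apply: filterS gE => z -> _.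
Qed.

End FlatVersions.

(** * The domain of the form and the gradients of its elements *)

Section UpDomain.

Definition xiint (H : config * X -> R[i]) : \bar R :=
  (\int[PN]_z (normc (H z) * xi z.2)%:E)%E.

Let mxi (H : config * X -> R[i]) : cmeasurable H ->
  mfunT (fun z => normc (H z) * xi z.2).
Proof.
by move=> mH; apply: measurable_funM; [exact: measurable_normc|exact: mcompT].
Qed.

Let xi0 (H : config * X -> R[i]) z : 0 <= normc (H z) * xi z.2.
Proof. by rewrite mulr_ge0 ?normc_ge0// ltW. Qed.

Lemma xiint_ge0 H : (0 <= xiint H)%E.
Proof. by apply: integral_ge0 => z _; rewrite lee_fin xi0. Qed.

Lemma xiintB_le H1 H2 : cmeasurable H1 -> cmeasurable H2 ->
  (xiint (fun z => H1 z - H2 z)%R <= xiint H1 + xiint H2)%E.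
Proof.
move=> m1 m2; rewrite /xiint -integral_EFinD; [|exact: mxi|exact: mxi|exact: xi0|exact: xi0].
apply: integral_EFin_le.
- by apply: mxi; exact: cmeasurableB.
- by apply: measurable_funD; exact: mxi.
- exact: xi0.
- move=> z; rewrite -mulrDl; apply: ler_wpM2r; first exact: ltW.
  by apply: le_trans (normcD _ _) _; rewrite normcN.
Qed.

Lemma xiintB_tri H1 H2 H3 : cmeasurable H1 -> cmeasurable H2 -> cmeasurable H3 ->
  (xiint (fun z => H1 z - H2 z)%R <=
   xiint (fun z => H1 z - H3 z)%R + xiint (fun z => H2 z - H3 z)%R)%E.
Proof.
move=> m1 m2 m3; have := xiintB_le (cmeasurableB m1 m3) (cmeasurableB m2 m3).
by congr (_ <= _)%E; congr xiint; apply/funext => z; ring.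
Qed.

(** The left side is the expectation of |F| N(xi), bounded by the weighted arithmetic-geometric
    inequality. The constant is the expectation of N(xi)^2: this is the role of the condition on
    [xi]. *)
Lemma xi_bound : exists2 C : R, 0 <= C & forall (t : R) (F : config -> R[i]), 0 < t ->
  cmeasurable F -> (xiint (F \o fst) <= (t * C)%:E + t^-1%:E * csq P F)%E.
Proof.
have mX : mfunT (EFin \o xi) by exact/mEFinP.
have X0 x : (0 <= (EFin \o xi) x)%E by rewrite lee_fin ltW.
have mS := measurable_integral_config mX X0.
have S0 (w : config) : (0 <= \int[cm w]_x (xi x)%:E)%E.
  by apply: integral_ge0 => x _; rewrite lee_fin ltW.
pose S2 : \bar R := (\int[P]_w ((\int[cm w]_x (xi x)%:E) * (\int[cm w]_x (xi x)%:E)))%E.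
have S2oo : (S2 < +oo)%E.
  have := xi_L2; rewrite unlock => h.
  have : (\int[P]_w (`|\int[cm w]_x (xi x)%:E| `^ 2) < +oo)%E.
    have h0 : (0 <= \int[P]_w (`|\int[cm w]_x (xi x)%:E| `^ 2))%E.
      by apply: integral_ge0 => w _; exact: poweR_ge0.
    exact: poweR_half_lty h.
  congr (_ < _)%E; apply: eq_integral => w _; rewrite gee0_abs//.
  have := S0 w; case: (\int[cm w]_x (xi x)%:E)%E => [r|//|//] r0.
  - by rewrite poweR_EFin powR_mulrn// expr2 EFinM.
  - by rewrite poweRyr// mulyy.
have Soo : {ae P, forall w : config, (\int[cm w]_x (xi x)%:E < +oo)%E}.
  have mSS : mfunT (fun w : config =>
    (\int[cm w]_x (xi x)%:E) * (\int[cm w]_x (xi x)%:E))%E by exact: emeasurable_funM.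
  have := @integral_lty_ae _ _ R P _ mSS (fun w => mule_ge0 (S0 w) (S0 w)) S2oo.
  apply: filterS => w; have := S0 w; case: (\int[cm w]_x (xi x)%:E)%E => [r| |]//= _ _.
  by rewrite ltry.
pose s w := intN xi w.
have ms : mfunT s by exact: measurable_intN.
have s0 w : 0 <= s w by rewrite /s /intN /Rintegral fine_ge0.
have sE : {ae P, forall w : config, (\int[cm w]_x (xi x)%:E = (s w)%:E)%E}.
  by apply: filterS Soo => w h; rewrite /s /intN /Rintegral fineK// ge0_fin_numE.
have sq : (\int[P]_w (s w ^+ 2)%:E = S2)%E.
  apply: ae_eq_integral => //.
  - by apply/mEFinP; exact: measurable_funX.
  - exact: emeasurable_funM.
  - by apply: filterS sE => w -> _; rewrite expr2 EFinM.
have S20 : (0 <= S2)%E by rewrite -sq; apply: integral_ge0 => w _; rewrite lee_fin sqr_ge0.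
exists (fine S2); first exact: fine_ge0.
move=> t F t0 mF.
have mFn : mfunT (fun w => normc (F w)) by exact: measurable_normc.
have E : (xiint (F \o fst) = \int[P]_w (normc (F w) * s w)%:E)%E.
  rewrite /xiint (palm.2 (fun z => (normc (F z.1) * xi z.2)%:E)); last 2 first.
  - by apply/mEFinP; apply: (mxi (H := F \o fst)); apply: (cmeasurable_comp mF); exact: measurable_fst.
  - by move=> z; rewrite lee_fin (xi0 (F \o fst)).
  apply: ae_ge0_integral_lower.
  - by move=> w; rewrite lee_fin mulr_ge0 ?normc_ge0.
  - by apply/mEFinP; exact: measurable_funM.
  apply: filterS sE => w h /=; under eq_integral do rewrite EFinM.
  rewrite (ge0_integralZl (cm w) measurableT mX (fun x _ => X0 x)) ?lee_fin ?normc_ge0//.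
  by rewrite h EFinM.
rewrite E.
apply: (@le_trans _ _ (\int[P]_w (t * s w ^+ 2 + t^-1 * nsq (F w))%:E)%E).
  apply: integral_EFin_le.
  - exact: measurable_funM.
  - by apply: measurable_funD; apply: measurable_funM => //;
      [exact: measurable_funX|exact: measurable_nsq].
  - by move=> w; rewrite mulr_ge0 ?normc_ge0.
  - move=> w; rewrite nsqE mulrC; have := sqr_dist_le (s w) (normc (F w)) t0.
    have := ler_norm (s w * normc (F w)); have := mulr_ge0 (s0 w) (normc_ge0 (F w)).
    by move: (s w * normc (F w)) => y; lra.
have mn := measurable_nsq mF.
rewrite integral_EFinD; [|by apply: measurable_funM => //; exact: measurable_funX|
  by apply: measurable_funM|by move=> w; rewrite mulr_ge0 ?sqr_ge0 ?ltW|
  by move=> w; rewrite mulr_ge0 ?nsq_ge0// ltW// invr_gt0].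
have tn := ltW t0; have tin : 0 <= t^-1 by rewrite invr_ge0.
rewrite !integral_EFinZ//; [|by move=> w; exact: nsq_ge0|exact: measurable_funX|
  by move=> w; exact: sqr_ge0].
rewrite sq -{1}(@fineK _ S2) ?ge0_fin_numE// -EFinM//.
Qed.

Lemma to0_xiint (F_ : nat -> config -> R[i]) : (forall n, cmeasurable (F_ n)) ->
  to0 (fun n => csq P (F_ n)) -> to0 (fun n => xiint (F_ n \o fst)).
Proof.
move=> mF h e e0; have [C C0 hC] := xi_bound.
have t0 : 0 < e / (2 * (C + 1)) by rewrite divr_gt0// mulr_gt0// ltr_wpDl.
have te0 : 0 < e / (2 * (C + 1)) * (e / 2) by rewrite mulr_gt0// divr_gt0.
have [n0 hn] := h _ te0; exists n0 => n /hn hlt.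
apply: (le_lt_trans (hC _ _ t0 (mF n))).
set t := e / (2 * (C + 1)) in t0 te0 hlt *.
have {}hlt : (t^-1%:E * csq P (F_ n) < (e / 2)%:E)%E.
  by rewrite -(@lte_pmul2l _ t%:E) ?lte_fin// muleA -EFinM mulfV ?gt_eqF// mul1e -EFinM.
have tC : t * C <= e / 2.
  rewrite /t; have C1 : 0 < C + 1 by rewrite ltr_wpDl.
  rewrite invfM !mulrA -mulrA ler_piMr//; first by rewrite divr_ge0// ltW.
  by rewrite mulrC ler_pdivrMr// mul1r lerDl.
rewrite [X in (_ < X%:E)%E](splitr e) EFinD.
by apply: lee_ltD => //; rewrite lee_fin.
Qed.

(* H_' and K_' are versions of H_ and of its flat; F is the limit *)
Definition flU (F : config -> R[i]) (K' : CXM -> R[i]) :=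
  cmeasurable K' /\ exists H_ H_' K_ K_',
  [/\ forall n, flv (H_ n) (H_' n) (K_' n),
      forall n, is_flat0 (H_ n) (K_ n),
      forall n, versionNM (K_ n) (K_' n),
      to0 (fun n => xiint (fun z => H_' n z - F z.1)) &
      to0 (fun n => csq mN (fun z => K_' n z - K' z))].

Lemma flU_csq F K' : flU F K' -> (csq mN K' < +oo)%E.
Proof.
move=> [mK [H_ [H_' [K_ [K_' [h1 _ _ _ h5]]]]]].
by apply: csq_lty_lim _ mK _ h5 => n; have [] := h1 n.
Qed.

(** Closability applies to the difference of the two approximating sequences, whose [xi]-norm
    vanishes. *)
Lemma flU_unique F K1 K2 : cmeasurable F -> flU F K1 -> flU F K2 ->
  {ae mN, forall z, K1 z = K2 z}.
Proof.
move=> mF U1 U2; have c1 := flU_csq U1; have c2 := flU_csq U2.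
case: U1 U2 => mK1 [H1 [H1' [_ [L1 [v1 _ _ x1 k1]]]]] [mK2 [H2 [H2' [_ [L2 [v2 _ _ x2 k2]]]]]].
have m1 n : cmeasurable (H1' n) by have [[]] := v1 n.
have m2 n : cmeasurable (H2' n) by have [[]] := v2 n.
have l1 n : cmeasurable (L1 n) by have [] := v1 n.
have l2 n : cmeasurable (L2 n) by have [] := v2 n.
have mFf : cmeasurable (fun z : config * X => F z.1).
  by apply: (cmeasurable_comp mF); exact: measurable_fst.
suff : {ae mN, forall z, K1 z - K2 z = 0}.
  by apply: filterS => z /eqP; rewrite subr_eq0 => /eqP.
apply: (flv_closable (fun n => flvB (v1 n) (v2 n))).
- exact: cmeasurableB.
- exact: csqB_lty.
- apply: (to0_le (v := fun n => (xiint (fun z => H1' n z - F z.1)%R +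
    xiint (fun z => H2' n z - F z.1)%R)%E)); last exact: to0D.
  by move=> n; exact: xiintB_tri.
- apply: (to0_le (v := fun n => (2%:E * csq mN (fun z => L1 n z - K1 z)%R +
    2%:E * csq mN (fun z => L2 n z - K2 z)%R)%E)); first by move=> n; exact: csqBB_le.
  by apply: to0D; apply: to0Z => // n; exact: csq_ge0.
Qed.

(** The creation of an exponential is the tensor of the exponential, taken before the addition, with
    e^{if}. As a function of the enlarged configuration it is F itself, whence the version
    [F \o fst]. *)
Lemma D0k_tensor F k : D0k F k -> exists H K,
  [/\ is_flat0 H K, flv H (F \o fst) k & versionNM K k].
Proof.
move=> Fk; have [mF _ mk ck] := D0k_facts Fk.
have [m [lam [f [tf FE kE]]]] := Fk.
pose Fi (p : 'I_m.+1) : config -> R[i] := expsum nu (fun _ : 'I_1 => lam p) (fun _ : 'I_1 => f p).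
pose ui (p : 'I_m.+1) x : R[i] := expi (f p x).
have FiE p w : Fi p w = lam p * expN (f p) w by rewrite /Fi /expsum big_ord1.
have dui p : d1C d (ui p).
  apply: cflC_d1C; apply: cflC_expi.
  by have [] := test_exponent_facts (tf p).
pose H (z : config * X) := \sum_p Fi p z.1 * ui p z.2.
pose K (z : CXM) := \sum_p Fi p z.1.1 * flatC d flat (ui p) (z.1.2, z.2).
have HK : is_flat0 H K.
  exists m.+1, Fi, ui; split => // p.
  by exists 0%N, (fun=> lam p), (fun=> f p).
have hF : {ae P, forall w, forall x, H (w, x) = F (add_atom x w)}.
  have h p : {ae P, forall w, forall x,
      expN (f p) (add_atom x w) = expN (f p) w * expi (f p x)}.
    by apply: expN_shift _ _; have [] := test_exponent_facts (tf p).
  have : {ae P, forall w, forall p, forall x,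
      expN (f p) (add_atom x w) = expN (f p) w * expi (f p x)}.
    exact: filter_forall.
  apply: filterS => w hw x; rewrite FE /expsum; apply: eq_bigr => p _.
  by rewrite -[expi (Ntilde1 _ _)]/(expN (f p) (add_atom x w)) hw /= FiE -mulrA.
have vH : flv H (F \o fst) k.
  split => //.
  - split; first by apply: (cmeasurable_comp mF); exact: measurable_fst.
    by apply: filterS hF => w hw; exact: aeW.
  - apply: filterS2 hF (D0k_cflC Fk) => w hw.
    by have -> : (fun x => H (w, x)) = (fun x => F (add_atom x w)) by exact/funext.
exists H, K; split => //.
have [H' [K' [[_ mK' _ c'] vK]]] := is_flat0_flv HK.
have [_ _ _ c] := vH.
apply: (versionNM_ae vK mk).
apply: mN_ae_of _ (measurable_ceq_set mK' mk) _.
by apply: filterS2 c' c => w; exact: cflC_unique _ _ _.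
Qed.

(** Closure of the graph of [D0k]: [K'] is a version of the flat of the creation of F. Its domain is
    [domD], and energy, flat, gamma and sharp are all computed from [K']. *)
Definition isK (F : config -> R[i]) (K' : CXM -> R[i]) :=
  [/\ cL2 P F, cmeasurable K' & exists F_ k_,
   [/\ forall n, D0k (F_ n) (k_ n), to0 (fun n => csq P (fun w => F_ n w - F w)) &
       to0 (fun n => csq mN (fun z => k_ n z - K' z))]].

(** L2 convergence of the functionals controls the [xi]-norm of their creations by [to0_xiint]; the
    creation of F is thus a limit of tensors in the norm of underline(D). *)
Lemma isK_flU F K' : isK F K' -> flU F K'.
Proof.
move=> [[mF _] mK [F_ [k_ [Fk F0 k0]]]]; split => //.
have /choice[H_ /choice[K_ HK]] n : exists H K,
  [/\ is_flat0 H K, flv H (F_ n \o fst) (k_ n) & versionNM K (k_ n)].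
  exact: D0k_tensor.
exists H_, (fun n => F_ n \o fst), K_, k_; split => //.
- by move=> n; have [] := HK n.
- by move=> n; have [] := HK n.
- by move=> n; have [] := HK n.
- apply: (to0_xiint (F_ := fun n w => F_ n w - F w)) => // n; apply: cmeasurableB => //.
  by have [] := D0k_facts (Fk n).
Qed.

Lemma isK_unique F K1 K2 : isK F K1 -> isK F K2 -> {ae mN, forall z, K1 z = K2 z}.
Proof.
move=> h1 h2; have [[mF _] _ _] := h1.
by apply: (flU_unique mF); exact: isK_flU.
Qed.

Lemma isK_csq F K' : isK F K' -> (csq mN K' < +oo)%E.
Proof. by move=> /isK_flU/flU_csq. Qed.

Lemma isKB F1 K1 F2 K2 : isK F1 K1 -> isK F2 K2 -> isK (F1 - F2) (fun z => K1 z - K2 z).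
Proof.
move=> [[m1 /cnorm2_lty f1] mK1 [G1 [k1 [d1 g1 l1]]]] [[m2 /cnorm2_lty f2] mK2 [G2 [k2 [d2 g2 l2]]]].
have mG1 n : cmeasurable (G1 n) by have [] := D0k_facts (d1 n).
have mG2 n : cmeasurable (G2 n) by have [] := D0k_facts (d2 n).
have mk1 n : cmeasurable (k1 n) by have [] := D0k_facts (d1 n).
have mk2 n : cmeasurable (k2 n) by have [] := D0k_facts (d2 n).
split; [split|exact: cmeasurableB|].
- exact: (cmeasurableB m1 m2).
- by apply/cnorm2_lty; apply: (csqB_lty m1 m2 f1 f2).
exists (fun n => G1 n - G2 n), (fun n z => k1 n z - k2 n z); split.
- by move=> n; exact: D0kB.
- apply: (to0_le (v := fun n => (2%:E * csq P (fun z => G1 n z - F1 z)%R +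
    2%:E * csq P (fun z => G2 n z - F2 z)%R)%E)); first by move=> n; exact: csqBB_le.
  by apply: to0D; apply: to0Z => // n; exact: csq_ge0.
- apply: (to0_le (v := fun n => (2%:E * csq mN (fun z => k1 n z - K1 z)%R +
    2%:E * csq mN (fun z => k2 n z - K2 z)%R)%E)); first by move=> n; exact: csqBB_le.
  by apply: to0D; apply: to0Z => // n; exact: csq_ge0.
Qed.

Lemma isK_D0k F k : D0k F k -> isK F k.
Proof.
move=> Fk; have [mF [c Fc] mk ck] := D0k_facts Fk.
split => //.
- split => //; apply/cnorm2_lty.
  have c0 : 0 <= c by apply: le_trans (Fc point); exact: normc_ge0.
  apply: (@le_lt_trans _ _ (\int[P]_w (c ^+ 2)%:E)%E).
    apply: integral_EFin_le => //; first exact: measurable_nsq.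
      by move=> w; exact: nsq_ge0.
    by move=> w; rewrite nsqE lerXn2r ?nnegrE ?normc_ge0.
  by rewrite integral_cst// ltey_eq fin_numM// fin_num_measure.
exists (fun=> F), (fun=> k); split => //.
- move=> e e0; exists 0%N => n _; rewrite /csq.
  by under eq_integral do rewrite subrr nsq0; rewrite integral0 lte_fin.
- move=> e e0; exists 0%N => n _; rewrite /csq.
  by under eq_integral do rewrite subrr nsq0; rewrite integral0 lte_fin.
Qed.

Lemma energy0_csq F k : D0k F k -> (csq mN k = (2 * energy0 F)%:E)%E.
Proof.
move=> Fk; have [_ _ _ ck] := D0k_facts Fk.
rewrite (energy0E Fk) mulrA mulfV// mul1r fineK//.
by rewrite ge0_fin_numE// csq_ge0.
Qed.

(** The energy of a difference is half the squared norm of the difference of the gradients, so an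
    energy-Cauchy sequence has convergent gradients. *)
Lemma domD_approx_isK F_ k_ F : domD_approx F_ F ->
  (forall n, D0k (F_ n) (k_ n)) ->
  exists2 K', isK F K' & to0 (fun n => csq mN (fun z => k_ n z - K' z)).
Proof.
move=> [D0F cF FL2 /cnorm2_to0 F0] Fk.
have mk n : cmeasurable (k_ n) by have [] := D0k_facts (Fk n).
have [] := @csq_complete _ _ R mN k_ mk.
  move=> e e0; have [n0 hn] := cF (e / 2) (divr_gt0 e0 (ltr0n _ 2)).
  exists n0 => m n hm hn'; rewrite (energy0_csq (D0kB (Fk m) (Fk n))) lte_fin.
  by have := hn _ _ hm hn'; lra.
move=> K' mK' hK; exists K' => //; split => //.
by exists F_, k_.
Qed.

Lemma domD_isK F : domD F <-> exists K', isK F K'.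
Proof.
split=> [[F_ hF]|[K' [FL2 mK [F_ [k_ [Fk F0 k0]]]]]].
  have /choice[k_ Fk] n : exists k, D0k (F_ n) k.
    by apply: D0_D0k; case: hF => h _ _ _; exact: h.
  by have [K' hK _] := domD_approx_isK hF Fk; exists K'.
exists F_; split => //.
- by move=> n; exact: D0k_D0 (Fk n).
- have mk n : cmeasurable (k_ n) by have [] := D0k_facts (Fk n).
  move=> e e0; have [n0 hn] := k0 (e / 2) (divr_gt0 e0 (ltr0n _ 2)).
  exists n0 => m n hm hn'; suff : ((2 * energy0 (F_ m - F_ n))%:E < (2 * e)%:E)%E.
    by rewrite lte_fin; lra.
  rewrite -(energy0_csq (D0kB (Fk m) (Fk n))).
  apply: (le_lt_trans (csqB_tri mN (mk m) (mk n) mK)).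
  have -> : (2 * e)%:E = (2%:E * (e / 2)%:E + 2%:E * (e / 2)%:E)%E.
    by rewrite -!EFinM -EFinD; congr EFin; field.
  by apply: lteD; rewrite lte_pmul2l// hn.
- exact/cnorm2_to0.
Qed.

(** Along every approximating sequence the energies tend to this value, because the limit of the
    gradients is unique; the infimum runs over a single number. *)
Lemma energyE F K' : isK F K' -> (energy F = (2^-1)%:E * csq mN K')%E.
Proof.
move=> hK; have cK := isK_csq hK.
have lim F_ : domD_approx F_ F ->
    energy0 (F_ n) @[n --> \oo] --> 2^-1 * fine (csq mN K').
  move=> hF; have /choice[k_ Fk] n : exists k, D0k (F_ n) k.
    by apply: D0_D0k; case: hF => h _ _ _; exact: h.
  have [K1 hK1 l1] := domD_approx_isK hF Fk.
  have [_ mK1 _] := hK1; have [_ mK _] := hK.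
  have mk n : cmeasurable (k_ n) by have [] := D0k_facts (Fk n).
  have ck n : (csq mN (k_ n) < +oo)%E by have [] := D0k_facts (Fk n).
  rewrite (ae_csq mK mK1 (isK_unique hK hK1)).
  under eq_cvg do rewrite (energy0E (Fk _)).
  by apply: cvgMr; exact: csq_cvg mk mK1 ck l1.
have -> : ((2^-1)%:E * csq mN K' = (2^-1 * fine (csq mN K'))%:E)%E.
  by rewrite EFinM fineK// ge0_fin_numE// csq_ge0.
rewrite /energy; have -> : [set e : R | exists2 F_, domD_approx F_ F &
    energy0 (F_ n) @[n --> \oo] --> e] = [set 2^-1 * fine (csq mN K')].
  apply/seteqP; split => [e [F_ hF he]|_ ->].
    exact: (cvg_unique _ he (lim _ hF)).
  have [F_ hF] : domD F by apply/domD_isK; exists K'.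
  by exists F_ => //; exact: lim.
by rewrite image_set1 ereal_inf1.
Qed.

Lemma normDE F K' : isK F K' ->
  normD F = ((csq P F + (2^-1)%:E * csq mN K') `^ 2^-1)%E.
Proof.
by move=> hK; rewrite /normD (energyE hK) cnorm2E poweR_half_sqr// csq_ge0.
Qed.

Lemma normD_to0 (F_ : nat -> config -> R[i]) F K_ K' : (forall n, isK (F_ n) (K_ n)) ->
  isK F K' -> normD (F_ n - F) @[n --> \oo] --> 0%E <->
  to0 (fun n => csq P (fun w => F_ n w - F w)) /\
  to0 (fun n => csq mN (fun z => K_ n z - K' z)).
Proof.
move=> hn h; have hB n := isKB (hn n) h.
have p0 n : (0 <= csq P (F_ n - F)%R + (2^-1)%:E * csq mN (fun z => K_ n z - K' z)%R)%E.
  by rewrite adde_ge0 ?csq_ge0// mule_ge0 ?csq_ge0// lee_fin invr_ge0.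
rewrite -to0P; last by move=> n; exact: poweR_ge0.
have E : (fun n => normD (F_ n - F)) =
    (fun n => (csq P (F_ n - F)%R + (2^-1)%:E * csq mN (fun z => (K_ n z - K' z)%R)) `^ 2^-1)%E.
  by apply/funext => n; exact: normDE.
rewrite E to0_half//; split=> [h0|[h1 h2]].
- split.
    by apply: to0_le h0 => n; rewrite leeDl// mule_ge0 ?csq_ge0// lee_fin invr_ge0.
  move=> e e0; have [n0 hn0] := h0 (e / 2) (divr_gt0 e0 (ltr0n _ 2)).
  exists n0 => n /hn0 hlt.
  rewrite -(@lte_pmul2l _ (2^-1)%:E) ?lte_fin ?invr_gt0// -EFinM mulrC.
  by apply: le_lt_trans hlt; rewrite leeDr// csq_ge0.
- apply: to0D => //; apply: to0Z => // n; exact: csq_ge0.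
Qed.

End UpDomain.

(** * Creation, flat and gamma on the domain *)

Section UpOperators.

Lemma xi_normB_creation H H' F : versionC H H' -> cmeasurable F ->
  xi_norm (H - creation F) = xiint (fun z => H' z - F z.1).
Proof.
move=> vH mF; rewrite (xi_normE
  (versionCB vH (versionC_creation mF))).
by [].
Qed.

Lemma normU0B H1 H1' K1 H2 H2' K2 : flv H1 H1' K1 -> flv H2 H2' K2 ->
  normU0 (H1 - H2) =
  (csq mN (fun z => (K1 z - K2 z)%R) `^ 2^-1 + xiint (fun z => (H1' z - H2' z)%R))%E.
Proof.
move=> v1 v2; have v := flvB v1 v2.
have [g [_ _ _ gE]] := flv_gamma v.
rewrite /normU0 gE; have [vC _ _ _] := v.
by rewrite (xi_normE vC).
Qed.

Lemma flU_underD F H_ H_' K_' K' : cmeasurable F -> cmeasurable K' ->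
  (forall n, flv (H_ n) (H_' n) (K_' n)) -> (forall n, tensor (H_ n)) ->
  to0 (fun n => xiint (fun z => H_' n z - F z.1)) ->
  to0 (fun n => csq mN (fun z => K_' n z - K' z)) ->
  underD_approx H_ (creation F).
Proof.
move=> mF mK fl tH hx hk; have vC n : versionC (H_ n) (H_' n) by have [] := fl n.
have mH n : cmeasurable (H_' n) by have [] := vC n.
have mK' n : cmeasurable (K_' n) by have [] := fl n.
have mFf : cmeasurable (fun z : config * X => F z.1).
  by apply: (cmeasurable_comp mF); exact: measurable_fst.
split => //.
- move=> e e0; have e20 : 0 < e / 2 by rewrite divr_gt0.
  have e40 : 0 < e / 4 by rewrite divr_gt0.
  have e80 : 0 < (e / 2) ^+ 2 / 4 by rewrite divr_gt0// exprn_gt0.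
  have [n1 h1] := hx _ e40; have [n2 h2] := hk _ e80.
  exists (maxn n1 n2) => m n; rewrite !geq_max => /andP[m1 m2] /andP[k1 k2].
  rewrite (normU0B (fl m) (fl n)) [X in (_ < X%:E)%E](splitr e) EFinD; apply: lteD.
    apply: poweR_half_lt2 => //; first exact: csq_ge0.
    apply: (le_lt_trans (csqB_tri mN (mK' m) (mK' n) mK)).
    have -> : ((e / 2) ^+ 2)%:E = (2%:E * ((e / 2) ^+ 2 / 4)%:E + 2%:E * ((e / 2) ^+ 2 / 4)%:E)%E.
      by rewrite -!EFinM -EFinD; congr EFin; field.
    by apply: lteD; rewrite lte_pmul2l// h2.
  apply: (le_lt_trans (xiintB_tri (mH m) (mH n) mFf)).
  have -> : (e / 2)%:E = ((e / 4)%:E + (e / 4)%:E)%E.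
    by rewrite -EFinD; congr EFin; field.
  by apply: lteD; rewrite h1.
- have -> : (fun n => xi_norm (H_ n - creation F)) =
      (fun n => xiint (fun z => H_' n z - F z.1)).
    by apply/funext => n; exact: xi_normB_creation.
  by apply/to0P => // n; exact: xiint_ge0.
Qed.

Lemma flU_is_flatU F K K' : cmeasurable F -> flU F K' -> versionNM K K' ->
  is_flatU (creation F) K.
Proof.
move=> mF [mK' [H_ [H_' [K_ [K_' [h1 h2 h3 h4 h5]]]]]] vK.
exists H_, K_; split => //.
- by apply: (flU_underD mF mK' h1 _ h4 h5) => n; exact: flat0_tensor (h2 n).
- exact/(normPN_to0 h3 vK).
Qed.

Lemma underD_approx_xi H_ H_' F : cmeasurable F -> (forall n, versionC (H_ n) (H_' n)) ->
  xi_norm (H_ n - creation F) @[n --> \oo] --> 0%E ->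
  to0 (fun n => xiint (fun z => H_' n z - F z.1)).
Proof.
move=> mF vC; have -> : (fun n => xi_norm (H_ n - creation F)) =
    (fun n => xiint (fun z => H_' n z - F z.1)).
  by apply/funext => n; exact: xi_normB_creation.
by move=> h; apply/to0P => // n; exact: xiint_ge0.
Qed.

Lemma is_flatU_flU F K : cmeasurable F -> is_flatU (creation F) K ->
  exists2 K', versionNM K K' & flU F K'.
Proof.
move=> mF [H_ [K_ [[tH cH xH] fl kK]]].
have /choice[H_' /choice[K_' HK]] n := is_flat0_flv (fl n).
have [K' vK k0] := normPN_to0_version (fun n => (HK n).2) kK.
exists K' => //; split; first by case: vK.
exists H_, H_', K_, K_'; split => //.
- by move=> n; case: (HK n).
- by move=> n; case: (HK n).
- by apply: underD_approx_xi mF _ xH => n; have [[] ] := HK n.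
Qed.

Lemma isK_measurable F K' : isK F K' -> cmeasurable F.
Proof. by move=> [[]]. Qed.

(** By uniqueness every approximation of the creation of F by tensors, not only one coming from D0,
    leads to the same flat. *)
Lemma is_flatUP F K0 K : isK F K0 ->
  is_flatU (creation F) K <-> versionNM K K0.
Proof.
move=> hK; have mF := isK_measurable hK; have [_ mK0 _] := hK.
have U0 := isK_flU hK.
split=> [h|]; last exact: flU_is_flatU.
have [K' vK U] := is_flatU_flU mF h.
have e := flU_unique mF U U0.
exact: (versionNM_ae vK mK0 e).
Qed.

Lemma isK_version K0 : cmeasurable K0 ->
  versionNM (fun z => K0 (add_point z.1.2 z.1.1, z.1.2, z.2)) K0.
Proof. exact: creation_versionM. Qed.

Lemma isK_underD F K0 : isK F K0 -> underD nu d gam P xi (creation F).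
Proof.
move=> hK; have [_ mK0 _] := hK.
have /(is_flatUP _ hK)[H_ [K_ [h _ _]]] := isK_version mK0.
by exists H_.
Qed.

(** Gamma as the square integral of the flat over the marks. For [K'] in L2 the integral is infinite
    on a null set only, where [fine] gives 0. *)
Definition gsq (K' : CXM -> R[i]) (z : config * X) : R :=
  fine (\int[rho]_r (nsq (K' (z, r)))%:E)%E.

Lemma gsq_ge0 K' z : 0 <= gsq K' z.
Proof. by apply: fine_ge0; apply: integral_ge0 => r _; rewrite lee_fin nsq_ge0. Qed.

Lemma gsq_facts K' : cmeasurable K' -> (csq mN K' < +oo)%E ->
  [/\ mfunT (gsq K'),
     {ae PN, forall z, (gsq K' z)%:E = (\int[rho]_r (nsq (K' (z, r)))%:E)%E} &
     (\int[PN]_z (gsq K' z)%:E = csq mN K')%E].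
Proof.
move=> mK Koo.
have mn : mfunT (fun z => (nsq (K' z))%:E).
  by apply/mEFinP; exact: measurable_nsq.
have n0 z : (0 <= (nsq (K' z))%:E)%E by rewrite lee_fin nsq_ge0.
have mG : mfunT (fun z => \int[rho]_r (nsq (K' (z, r)))%:E)%E.
  exact: (measurable_fun_fubini_tonelli_F _ mn n0).
have G0 z : (0 <= \int[rho]_r (nsq (K' (z, r)))%:E)%E by exact: integral_ge0.
have GE : (csq mN K' = \int[PN]_z \int[rho]_r (nsq (K' (z, r)))%:E)%E.
  exact: (fubini_tonelli1 _ mn).
have mg : mfunT (gsq K') by apply: mcompT.
have gE : {ae PN, forall z, (gsq K' z)%:E = (\int[rho]_r (nsq (K' (z, r)))%:E)%E}.
  have := @integral_lty_ae _ _ R PN _ mG G0; rewrite -GE => /(_ Koo).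
  by apply: filterS => z h; rewrite /gsq fineK// ge0_fin_numE.
split => //; rewrite GE; apply: ae_eq_integral => //; first exact/mEFinP.
by apply: filterS gE => z -> _.
Qed.

Lemma gsq_to0 K_ K' : (forall n, cmeasurable (K_ n)) -> (forall n, (csq mN (K_ n) < +oo)%E) ->
  cmeasurable K' -> (csq mN K' < +oo)%E -> to0 (fun n => csq mN (fun z => K_ n z - K' z)) ->
  to0 (fun n => \int[PN]_z `|gsq (K_ n) z - gsq K' z|%:E)%E.
Proof.
move=> mK_ cK_ mK cK h.
have := csq_to0_L1 mK_ mK cK h; apply: to0_le => n.
have [mg1 g1 _] := gsq_facts (mK_ n) (cK_ n); have [mg2 g2 _] := gsq_facts mK cK.
have mD : mfunT (fun z => `|nsq (K_ n z) - nsq (K' z)|%:E).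
  apply/mEFinP; apply: mcompT => //.
  by apply: measurable_funB; exact: measurable_nsq.
have D0 z : (0 <= `|nsq (K_ n z) - nsq (K' z)|%:E)%E by rewrite lee_fin.
have FE : (\int[mN]_z `|nsq (K_ n z) - nsq (K' z)|%:E =
    \int[PN]_z \int[rho]_r `|nsq (K_ n (z, r)) - nsq (K' (z, r))|%:E)%E.
  exact: (fubini_tonelli1 _ mD D0).
have mG : mfunT
    (fun z => \int[rho]_r `|nsq (K_ n (z, r)) - nsq (K' (z, r))|%:E)%E.
  exact: (measurable_fun_fubini_tonelli_F _ mD D0).
rewrite FE; apply: ae_ge0_le_integral => //.
- apply/mEFinP; apply: mcompT => //; exact: measurable_funB.
- by move=> z _; apply: integral_ge0.
apply: filterS2 g1 g2 => z e1 e2 _.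
have ms (L : CXM -> R[i]) : cmeasurable L -> mfunT (fun r => nsq (L (z, r))).
  move=> mL; apply: (measurable_nsq (f := fun r => L (z, r))).
  by apply: (cmeasurable_comp mL); exact: measurable_pair1.
have iq (L : CXM -> R[i]) : cmeasurable L -> (gsq L z)%:E = (\int[rho]_r (nsq (L (z, r)))%:E)%E ->
    integrableT rho (fun r => nsq (L (z, r))).
  move=> mL e; apply/integrableP; split; first by apply/mEFinP; exact: ms.
  by under eq_integral do rewrite /= ger0_norm ?nsq_ge0//; rewrite -e ltry.
have i1 := iq _ (mK_ n) e1; have i2 := iq _ mK e2.
rewrite /gsq -[fine _]/(\int[rho]_r nsq (K_ n (z, r))) -[X in _ - X]/(\int[rho]_r nsq (K' (z, r))).
rewrite -RintegralB//.
have iB : integrableT rho (fun r => nsq (K_ n (z, r)) - nsq (K' (z, r))).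
  by have := integrableB measurableT i1 i2.
have := le_abse_integral rho measurableT (measurable_int _ iB).
rewrite /Rintegral; have := integrable_fin_num measurableT iB.
by move=> /fineK <-.
Qed.

Lemma gammaU_exists F K0 : isK F K0 -> exists g,
  is_gammaU (creation F) g /\ versionN g (gsq K0).
Proof.
move=> hK; have [_ mK0 _] := hK; have mF := isK_measurable hK.
have cK0 := isK_csq hK.
have [_ [H_ [H_' [K_ [K_' [h1 h2 h3 h4 h5]]]]]] :=
  isK_flU hK.
have [mg _ _] := gsq_facts mK0 cK0.
pose g z := gsq K0 (add_point z.2 z.1, z.2).
have vg : versionN g (gsq K0) by split => //; apply: aeW => w; exact: aeW.
exists g; split => //; exists H_.
  by apply: (flU_underD mF mK0 h1 _ h4 h5) => n; exact: flat0_tensor (h2 n).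
have mK_ n : cmeasurable (K_' n) by have [] := h1 n.
have cK_ n : (csq mN (K_' n) < +oo)%E by have [] := h1 n.
have E n : EintN (fun z => `|gamma0 d gam (H_ n) z - g z|) =
    (\int[PN]_z `|gsq (K_' n) z - gsq K0 z|%:E)%E.
  have [gn [v0 _ gE _]] := flv_gamma (h1 n).
  have [mgn gE' _] := gsq_facts (mK_ n) (cK_ n).
  apply: (EintNE (k' := fun z => `|gn z - gsq K0 z|)).
  - move: v0 vg => /versionNP[m1 a1] /versionNP[m2 a2]; apply/versionNP; split.
      by apply: mcompT => //; exact: measurable_funB.
    by apply: filterS2 a1 a2 => w; apply: filterS2 => x -> ->.
  - by apply: mcompT => //; exact: measurable_funB.
  - by move=> z.
  - by apply: filterS2 gE gE' => z e1 e2; congr (`|_ - _|); apply: EFin_inj; rewrite e1 e2.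
under eq_cvg do rewrite E.
apply/to0P; first by move=> n; apply: integral_ge0 => z _; rewrite lee_fin.
exact: gsq_to0.
Qed.

(** A sequence that is Cauchy in underline(D) has convergent flats; their limit is [K0] by
    uniqueness, so the gammas converge in L1 to [gsq K0] as well as to [g]. *)
Lemma gammaU_version F K0 g g' : isK F K0 ->
  is_gammaU (creation F) g -> versionN g g' ->
  {ae PN, forall z, g' z = gsq K0 z}.
Proof.
move=> hK [H_ [tH cH xH] gH] vg; have [_ mK0 _] := hK; have mF := isK_measurable hK.
have cK0 := isK_csq hK.
have /choice[H_' /choice[K_ fl]] n := tensor_flv (tH n).
have mK_ n : cmeasurable (K_ n) by have [] := fl n.
have cK_ n : (csq mN (K_ n) < +oo)%E by have [] := fl n.
have [] := @csq_complete _ _ R mN K_ mK_.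
  move=> e e0; have s0 : 0 < Num.sqrt e by rewrite sqrtr_gt0.
  have [n0 hn] := cH _ s0; exists n0 => m n hm hn'.
  have := hn m n hm hn'; rewrite (normU0B (fl m) (fl n)) => h.
  apply: poweR_half_lt; first exact: csq_ge0.
  by apply: le_lt_trans h; rewrite leeDl// xiint_ge0.
move=> K1 mK1 k1.
have U1 : flU F K1.
  have /choice[L_ flL] n := tensor_flat0 (tH n).
  have /choice[H2 /choice[L2 HL]] n := is_flat0_flv (flL n).
  split => //; exists H_, H_', L_, K_; split => //.
  - move=> n; have [[_ mL _ c1] vL] := HL n; have [_ _ _ c2] := fl n.
    apply: (versionNM_ae vL (mK_ n)).
    apply: mN_ae_of _ (measurable_ceq_set mL (mK_ n)) _.
    by apply: filterS2 c1 c2 => w; exact: cflC_unique _ _ _.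
  - by apply: underD_approx_xi mF _ xH => n; have [] := fl n.
have U0 := isK_flU hK.
have K10 := flU_unique mF U1 U0.
have k0 : to0 (fun n => csq mN (fun z => K_ n z - K0 z)).
  apply: to0_ext k1 => n; apply: ae_csq; [exact: cmeasurableB|exact: cmeasurableB|].
  by apply: filterS K10 => z ->.
have mg' : mfunT g' by case: vg.
have [mg0 _ _] := gsq_facts mK0 cK0.
have E n : EintN (fun z => `|gamma0 d gam (H_ n) z - g z|) =
    (\int[PN]_z `|gsq (K_ n) z - g' z|%:E)%E.
  have [gn [v0 _ gE _]] := flv_gamma (fl n).
  have [mgn gE' _] := gsq_facts (mK_ n) (cK_ n).
  apply: (EintNE (k' := fun z => `|gn z - g' z|)).
  - move: v0 vg => /versionNP[m1 a1] /versionNP[m2 a2]; apply/versionNP; split.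
      by apply: mcompT => //; exact: measurable_funB.
    by apply: filterS2 a1 a2 => w; apply: filterS2 => x -> ->.
  - by apply: mcompT => //; exact: measurable_funB.
  - by move=> z.
  - by apply: filterS2 gE gE' => z e1 e2; congr (`|_ - _|); apply: EFin_inj; rewrite e1 e2.
have h1 : to0 (fun n => \int[PN]_z `|gsq (K_ n) z - g' z|%:E)%E.
  apply/to0P; first by move=> n; apply: integral_ge0 => z _; rewrite lee_fin.
  by move: gH; under eq_cvg do rewrite E.
have h2 := gsq_to0 mK_ cK_ mK0 cK0 k0.
have mD (a b : config * X -> R) : mfunT a -> mfunT b ->
    mfunT (fun z => `|a z - b z|).
  by move=> ma mb; apply: mcompT => //; exact: measurable_funB.
have : (\int[PN]_z `|g' z - gsq K0 z|%:E <= 0)%E.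
  apply: (@to0_cst R); apply: to0_le (to0D h1 h2) => n.
  have [mgn _ _] := gsq_facts (mK_ n) (cK_ n).
  rewrite -integral_EFinD//; [|exact: mD|exact: mD].
  apply: integral_EFin_le => //; [exact: mD|by apply: measurable_funD; exact: mD|].
  move=> z; rewrite (_ : g' z - gsq K0 z = (gsq (K_ n) z - gsq K0 z) - (gsq (K_ n) z - g' z)); last by ring.
  by apply: (le_trans (ler_normB _ _)); rewrite addrC.
move=> /(@integral_eq0_ae _ _ R PN (fun z => `|g' z - gsq K0 z|%:E)) h.
apply: filterS (h _ _); last by move=> z; rewrite lee_fin.
  by move=> z [] /eqP; rewrite normr_eq0 subr_eq0 => /eqP.
by apply/mEFinP; exact: mD.
Qed.

(** A [g] with finite integral has a version, equal to [gsq K0] almost everywhere; any other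
    contributes an infinite value to the infimum. *)
Lemma normUE F K0 : isK F K0 ->
  normU (creation F) = (csq mN K0 `^ 2^-1 + xiint (F \o fst))%E.
Proof.
move=> hK; have [_ mK0 _] := hK; have mF := isK_measurable hK.
have cK0 := isK_csq hK.
have [mg0 _ gE] := gsq_facts mK0 cK0.
rewrite /normU; congr (_ `^ _ + _)%E; last first.
  exact: (xi_normE
    (versionC_creation mF)).
have val g : is_gammaU (creation F) g -> (csq mN K0 <= EintN g)%E.
  move=> hg; have [/EintN_lty[g' vg]|] := ltP (EintN g) +oo%E; last first.
    by rewrite leye_eq => /eqP ->; rewrite leey.
  by rewrite (EintNE vg mg0 (gsq_ge0 K0)
    (gammaU_version hK hg vg)) gE.
have [g [hg vg]] := gammaU_exists hK.
apply/eqP; rewrite eq_le; apply/andP; split.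
- apply: ereal_inf_lbound; exists g => //.
  by rewrite (EintNE vg mg0 (gsq_ge0 K0) (aeW _ (fun=> erefl))).
- by apply: le_ereal_inf_tmp => _ [k hk <-]; exact: val.
Qed.

Lemma ae_PN_snd (Q : X -> Prop) : {ae nu, forall x, Q x} -> {ae PN, forall z, Q z.2}.
Proof.
move=> [N [mN N0 QN]]; have mA : measurable ((setT : set config) `*` N) by exact: measurableX.
have : {ae PN, forall z, ~ ((setT : set config) `*` N) z}.
  apply: palm_ae_of_nu _ _ _; first exact: measurableC.
  apply: aeW => w; exists N; split => // x /=.
  by apply: contra_notP => nN [].
by apply: filterS => z nz; apply: contrapT => nQ; apply: nz; split => //; exact: QN.
Qed.

Definition pmean0 (K' : CXM -> R[i]) :=
  {ae PN, forall z, cintegral rho (fun r => K' (z, r)) = 0}.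

Lemma kap_pmean0 m (lam : 'I_m -> R[i]) (f : 'I_m -> X -> R) :
  (forall p, d (f p)) -> pmean0 (kap lam f).
Proof.
move=> df.
have h p : {ae PN, forall z, rho.-integrable setT (fun r => (flat (f p) (z.2, r))%:E) /\
    \int[rho]_r flat (f p) (z.2, r) = 0}.
  have := ae_PN_snd (ae_and (gam_flat (df p)) (gr_mean0 grad (df p))).
  by apply: filterS => z [[_ ?]].
have : {ae PN, forall z, forall p, rho.-integrable setT (fun r => (flat (f p) (z.2, r))%:E) /\
    \int[rho]_r flat (f p) (z.2, r) = 0} by exact: filter_forall.
apply: filterS => z hz; rewrite /kap /=.
have iC p : cintegrable rho (fun r => (flat (f p) (z.2, r))%:C%C).
  by split; [case: (hz p)|exact: integrable0].
rewrite (_ : (fun r => _) = (fun r => \sum_p ((0 +i* 1)%C * lam p * expN (f p) z.1) *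
    (flat (f p) (z.2, r))%:C%C)); last first.
  by apply/funext => r; apply: eq_bigr => p _; rewrite mulrA.
rewrite cintegral_sum; last by move=> p; exact: cintegrableZ.
apply: big1 => p _; rewrite cintegralZ// cintegral_real; case: (hz p) => _ ->.
by rewrite mulr0.
Qed.

(** Nonnegativity of the variance under the probability [rho]; [g] stands for the real or the
    imaginary part. *)
Lemma Re_sqr_integral (f : M -> R[i]) (g : R[i] -> R) : (forall z, g z ^+ 2 <= nsq z) ->
  mfunT (fun r => g (f r)) -> cmeasurable f -> (csq rho f < +oo)%E ->
  integrableT rho (fun r => g (f r)) /\
  (((\int[rho]_r g (f r)) ^+ 2)%:E <= csq rho f)%E.
Proof.
move=> gle mg mf foo; pose h r := g (f r).
have h2 : (\int[rho]_r (h r ^+ 2)%:E < +oo)%E.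
  apply: le_lt_trans foo; apply: integral_EFin_le => //.
  - exact: measurable_funX.
  - exact: measurable_nsq.
  - by move=> r; exact: sqr_ge0.
  - by move=> r; exact: gle.
have m1 : mfunT (fun _ : M => 1 : R) by exact: measurable_cst.
have one : (\int[rho]_r (1 ^+ 2 : R)%:E < +oo)%E.
  by under eq_integral do rewrite expr1n; rewrite integral_cst// mul1e ltey_eq fin_num_measure.
have ih : integrableT rho h.
  by have := L2M_integrable mg h2 m1 one; congr integrable; apply/funext => r /=; rewrite mulr1.
split => //; set m := \int[rho]_r _.
have ih2 : integrableT rho (fun r => h r ^+ 2).
  apply/integrableP; split; first by apply/mEFinP; exact: measurable_funX.
  by under eq_integral do rewrite /= ger0_norm ?sqr_ge0//.
apply: (@le_trans _ _ (\int[rho]_r (h r ^+ 2)%:E)%E); last first.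
  by apply: integral_EFin_le => //; [exact: measurable_funX|exact: measurable_nsq|
    move=> r; exact: sqr_ge0|move=> r; exact: gle].
have -> : (\int[rho]_r (h r ^+ 2)%:E = (\int[rho]_r (h r ^+ 2))%:E)%E.
  by rewrite /Rintegral fineK//; exact: integrable_fin_num ih2.
have i2m : integrableT rho (fun r => 2 * m * h r).
  by have := integrableZl measurableT (2 * m) ih; congr integrable.
have ic : integrableT rho (fun r => m ^+ 2).
  exact: finite_measure_integrable_cst.
have : 0 <= \int[rho]_r ((h r - m) ^+ 2).
  by apply: Rintegral_ge0 => r _; exact: sqr_ge0.
rewrite lee_fin.
have -> : \int[rho]_r ((h r - m) ^+ 2) = \int[rho]_r (h r ^+ 2 - 2 * m * h r + m ^+ 2).
  by apply: eq_Rintegral => r _; ring.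
rewrite RintegralD//; last by have := integrableB measurableT ih2 i2m.
have -> : \int[rho]_r m ^+ 2 = m ^+ 2.
  rewrite Rintegral_cst// (_ : fine _ = 1) ?mulr1//.
  by rewrite -[RHS]/(fine 1%E); congr fine; exact: probability_setT.
rewrite RintegralB// RintegralZl// -/m; nra.
Qed.

(** Along a subsequence the sections converge in L2([rho]) for almost every fixed [z], and the mean
    over the marks is continuous for that norm. *)
Lemma pmean0_closed K_ K' : (forall n, cmeasurable (K_ n)) -> (forall n, pmean0 (K_ n)) ->
  (forall n, (csq mN (K_ n) < +oo)%E) -> cmeasurable K' ->
  to0 (fun n => csq mN (fun z => K_ n z - K' z)) -> pmean0 K'.
Proof.
move=> mK_ m0 cK_ mK k0; have cK := csq_lty_lim mK_ mK cK_ k0.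
have mB n : cmeasurable (fun z => K_ n z - K' z) by exact: cmeasurableB.
have cB n : (csq mN (fun z => K_ n z - K' z)%R < +oo)%E by exact: csqB_lty.
have [] := @to0_ae_subseq _ _ R PN (fun n z => (gsq (fun z => K_ n z - K' z) z)%:E).
- by move=> n; apply/mEFinP; have [] := gsq_facts (mB n) (cB n).
- by move=> n z; rewrite lee_fin gsq_ge0.
- by apply: to0_ext k0 => n; have [_ _ ->] := gsq_facts (mB n) (cB n).
move=> phi _ hphi.
have h1 : {ae PN, forall z, forall n,
   (gsq (fun z => K_ n z - K' z) z)%:E = (\int[rho]_r (nsq (K_ n (z, r) - K' (z, r)))%:E)%E}.
  by apply: ae_foralln => n; have [] := gsq_facts (mB n) (cB n).
have h2 : {ae PN, forall z, forall n,
   (gsq (K_ n) z)%:E = (\int[rho]_r (nsq (K_ n (z, r)))%:E)%E}.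
  by apply: ae_foralln => n; have [] := gsq_facts (mK_ n) (cK_ n).
have [_ h3 _] := gsq_facts mK cK.
have h4 : {ae PN, forall z, forall n, cintegral rho (fun r => K_ n (z, r)) = 0}.
  exact: ae_foralln.
apply: filterS (ae_and (ae_and hphi h1) (ae_and h2 (ae_and h3 h4))).
move=> z [[hz e1] [e2 [e3 e4]]].
have ms (L : CXM -> R[i]) : cmeasurable L -> cmeasurable (fun r => L (z, r)).
  by move=> mL; apply: (cmeasurable_comp mL); exact: measurable_pair1.
have key (g : R[i] -> R) : (forall a b, g (a - b) = g a - g b) -> (forall a, g a ^+ 2 <= nsq a) ->
    (forall L : M -> R[i], cmeasurable L -> mfunT (fun r => g (L r))) ->
    (forall n, \int[rho]_r g (K_ n (z, r)) = 0) -> \int[rho]_r g (K' (z, r)) = 0.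
  move=> gB gle mg g0.
  have I (L : CXM -> R[i]) : cmeasurable L ->
      (gsq L z)%:E = (\int[rho]_r (nsq (L (z, r)))%:E)%E ->
      integrableT rho (fun r => g (L (z, r))).
    move=> mL e; have [] // := Re_sqr_integral gle (mg _ (ms _ mL)) (ms _ mL).
    by rewrite /csq -e ltry.
  apply/eqP; rewrite -sqrf_eq0 eq_le sqr_ge0 andbT -lee_fin.
  apply: (@to0_cst R); apply: to0_le hz => n; rewrite e1.
  have mBz := ms _ (mB (phi n)).
  have [] := Re_sqr_integral gle (mg _ mBz) mBz.
    by rewrite /csq -e1 ltry.
  move=> _; under [X in ((X ^+ 2)%:E <= _)%E -> _]eq_Rintegral do rewrite gB.
  rewrite RintegralB//; [|exact: I (e2 _)|exact: I e3].
  by rewrite g0 sub0r sqrrN.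
have r0 n : \int[rho]_r Re (K_ n (z, r)) = 0 by have := e4 n; rewrite /cintegral => -[].
have i0 n : \int[rho]_r Im (K_ n (z, r)) = 0 by have := e4 n; rewrite /cintegral => -[].
rewrite /cintegral (key (fun z => Re z) (@ReB _) (@Re_nsq _) (fun L mL => mL.1) r0).
by rewrite (key (fun z => Im z) (@ImB _) (@Im_nsq _) (fun L mL => mL.2) i0).
Qed.

Lemma isK_pmean0 F K' : isK F K' -> pmean0 K'.
Proof.
move=> [_ mK [F_ [k_ [Fk _ k0]]]].
have mk n : cmeasurable (k_ n) by have [] := D0k_facts (Fk n).
have ck n : (csq mN (k_ n) < +oo)%E by have [] := D0k_facts (Fk n).
apply: pmean0_closed mk _ ck mK k0 => n.
have [m [lam [f [tf _ ->]]]] := Fk n.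
by apply: kap_pmean0 => p; have [] := test_exponent_facts (tf p).
Qed.

Lemma pmean0_mean0 K' : pmean0 K' -> mean0 rho P K'.
Proof. by move=> /palm_ae_N. Qed.

Lemma isK_L20 F K0 K : isK F K0 -> versionNM K K0 -> L20 nu rho P K.
Proof.
move=> hK vK; have [_ mK0 _] := hK.
exists K0 => //; split; last exact: pmean0_mean0 (isK_pmean0 hK).
rewrite (norm2PNE mK0).
have := isK_csq hK.
exact: poweR_lty.
Qed.

End UpOperators.

(** * Sums over the marked atoms *)

Section MarkedSums.

Definition mark_term (g : CXM -> R) (w : config) (r : marks M) (n : nat) : R :=
  if `[< alive n w >] then g (w, atom n w, r n) else 0.

(** The integral against the marked measure, unfolded into the series of positive and of negative
    parts; joint measurability in configuration and marks is visible on this form. *)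
Definition marked_real (g : CXM -> R) (z : config * marks M) : R :=
  fine (\sum_(n <oo) (Num.max (mark_term g z.1 z.2 n) 0)%:E -
        \sum_(n <oo) (Num.max (- mark_term g z.1 z.2 n) 0)%:E)%E.

Lemma marked_integral_ge0 (w : config) (r : marks M) (f : X * M -> \bar R) :
  mfunT f -> (forall y, 0 <= f y)%E ->
  (\int[marked alive atom w r]_y f y =
   \sum_(n <oo) if `[< alive n w >] then f (atom n w, r n) else 0)%E.
Proof.
move=> mf f0; rewrite ge0_integral_measure_series//; apply: eq_eseriesr => n _.
case: asboolP => _; last by rewrite integral_measure_zero.
by rewrite integral_dirac// diracT mul1e.
Qed.

Lemma marked_realE (g : CXM -> R) (w : config) (r : marks M) :
  mfunT g ->
  \int[marked alive atom w r]_y g (w, y.1, y.2) = marked_real g (w, r).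
Proof.
move=> mg; have mgw : mfunT (fun y : X * M => g (w, y.1, y.2)).
  apply: (mcompT mg); apply: measurable_fun_pair; last exact: measurable_snd.
  by apply: measurable_fun_pair => //; exact: measurable_fst.
rewrite /Rintegral integralE /marked_real; congr (fine (_ - _)%E).
- rewrite marked_integral_ge0.
  + apply: eq_eseriesr => n _; rewrite /mark_term /=; case: asboolP => _; last by rewrite maxxx.
    by rewrite funeposE -EFin_max.
  + by apply: measurable_funepos; exact/mEFinP.
  + by move=> y; exact: funepos_ge0.
- rewrite marked_integral_ge0.
  + apply: eq_eseriesr => n _; rewrite /mark_term /=; case: asboolP => _; last by rewrite oppr0 maxxx.
    by rewrite funenegE -EFinN -EFin_max.
  + by apply: measurable_funeneg; exact/mEFinP.
  + by move=> y; exact: funeneg_ge0.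
Qed.

Lemma marked_sumE (K : CXM -> R[i]) (z : config * marks M) : cmeasurable K ->
  marked_sum K z = (marked_real (fun y => Re (K y)) z +i* marked_real (fun y => Im (K y)) z)%C.
Proof.
move=> [m1 m2]; case: z => w r; rewrite /Defs.marked_sum /cintegral /=.
by rewrite -(marked_realE w r m1) -(marked_realE w r m2).
Qed.

Lemma measurable_mark_term g n : mfunT g ->
  mfunT (fun z : config * marks M => mark_term g z.1 z.2 n).
Proof.
move=> mg.
have -> : (fun z : config * marks M => mark_term g z.1 z.2 n) =
    (fun z => \1_(alive n) z.1 * g (z.1, atom n z.1, z.2 n)).
  apply/funext => z; rewrite /mark_term indicE; case: asboolP => an.
    by rewrite mem_set// mul1r.
  by rewrite memNset// mul0r.
apply: measurable_funM.
  apply: (mcompT (f := fun w => (\1_(alive n) w : R))) => //.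
  by apply: measurable_indic; exact: (alive_measurable atoms_N).
apply: (mcompT mg); apply: measurable_fun_pair.
  apply: measurable_fun_pair => //.
  exact: (mcompT (atom_measurable atoms_N n)).
exact: (mcompT (measurable_coord n)).
Qed.

Lemma measurable_marked_real g : mfunT g ->
  mfunT (marked_real g).
Proof.
move=> mg; apply: mcompT => //; apply: emeasurable_funB.
- apply: ge0_emeasurable_sum => [n z _ _|n _]; first by rewrite lee_fin le_max lexx orbT.
  apply/mEFinP; apply: measurable_maxr => //; exact: measurable_mark_term.
- apply: ge0_emeasurable_sum => [n z _ _|n _]; first by rewrite lee_fin le_max lexx orbT.
  apply/mEFinP; apply: measurable_maxr => //; apply: mcompT => //.
  exact: measurable_mark_term.
Qed.

Lemma marked_sum_measurable (K : CXM -> R[i]) : cmeasurable K -> cmeasurable (marked_sum K).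
Proof.
move=> mK; have [m1 m2] := mK.
have -> : marked_sum K = fun z => (marked_real (fun y => Re (K y)) z +i*
    marked_real (fun y => Im (K y)) z)%C by apply/funext => z; exact: marked_sumE.
by split; exact: measurable_marked_real.
Qed.

Record summable_at (g : CXM -> R) (w : config) : Prop := SummableAt {
  sa_good : forall B, measurable B ->
    w B = dirac_sum R (fun n => alive n w) (fun n => atom n w) B;
  sa_L1 : (\int[cm w]_x \int[rho]_r `|g (w, x, r)|%:E < +oo)%E;
  sa_L2 : (\int[cm w]_x \int[rho]_r (g (w, x, r) ^+ 2)%:E < +oo)%E;
  sa_mean0 : {ae cm w, forall x, \int[rho]_r g (w, x, r) = 0} }.

Section FixedConfiguration.
Variables (g : CXM -> R) (w : config).
Hypothesis mg : mfunT g.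
Hypothesis sw : summable_at g w.

Let a n x := if `[< alive n w >] then g (w, atom n w, x) else 0.

Let mgw x : mfunT (fun r => g (w, x, r)).
Proof. by apply: mcompT => //; exact: measurable_pair1. Qed.

Let ma n : mfunT (a n).
Proof. by rewrite /a; case: asboolP => _ //; exact: mgw. Qed.

Let series (f : R -> R) : f 0 = 0 -> (forall t, 0 <= f t) -> mfunT f ->
  (\sum_(n <oo) \int[rho]_x (f (a n x))%:E = \int[cm w]_x \int[rho]_r (f (g (w, x, r)))%:E)%E.
Proof.
move=> f00 f0 mf.
have mF : mfunT (fun z => (f (g z))%:E).
  by apply/mEFinP; exact: mcompT.
have F0 z : (0 <= (f (g z))%:E)%E by rewrite lee_fin.
have mG : mfunT (fun z => \int[rho]_r (f (g (z, r)))%:E)%E.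
  exact: (measurable_fun_fubini_tonelli_F _ mF F0).
rewrite (@good_atoms_integral _ _ _ alive atom w); [|exact: (sa_good sw)| |].
- apply: eq_eseriesr => n _; rewrite /a; case: asboolP => _ //.
  by rewrite f00 integral0.
- exact: (mcompT mG (measurable_pair1 _)).
- by move=> x; exact: integral_ge0.
Qed.

Let a2E : (\sum_(n <oo) \int[rho]_x (a n x ^+ 2)%:E =
  \int[cm w]_x \int[rho]_r (g (w, x, r) ^+ 2)%:E)%E.
Proof.
apply: (series (f := fun t => t ^+ 2)); first by rewrite expr0n.
  by move=> t; exact: sqr_ge0.
exact: measurable_funX.
Qed.

Let a2 n : (\int[rho]_x (a n x ^+ 2)%:E < +oo)%E.
Proof.
apply: (@nneseries_term_lty _ (fun n => \int[rho]_x (a n x ^+ 2)%:E)%E).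
  by move=> k; apply: integral_ge0 => x _; rewrite lee_fin sqr_ge0.
by rewrite a2E; exact: (sa_L2 sw).
Qed.

Let a0 n : \int[rho]_x a n x = 0.
Proof.
rewrite /a; case: asboolP => an; last by rewrite /Rintegral integral0.
exact: (@good_atoms_ae _ _ _ alive atom w _ n (sa_good sw) (sa_mean0 sw) an).
Qed.

(** The expectation of the sum of absolute values is the integral in [sa_L1], so the series
    converges absolutely for almost all marks. *)
Lemma mark_series_cvg : {ae Phat, forall r,
  (\sum_(0 <= n < N) mark_term g w r n) @[N --> \oo] --> marked_real g (w, r)}.
Proof.
pose h n (r : marks M) := (`|a n (r n)|%:E)%E.
have mh n : mfunT (h n).
  apply/mEFinP; apply: mcompT => //.
  by apply: mcompT; [exact: ma|exact: measurable_coord].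
have h0 n r : (0 <= h n r)%E by rewrite lee_fin.
apply: (ae_imp (P := fun r => (\sum_(n <oo) h n r < +oo)%E)).
  move=> r; rewrite /h => hr.
  have [_ _] := absolute_series_cvg hr.
  by rewrite /marked_real /mark_term /a.
apply: to0_integral_ae => //.
have -> : (\sum_(n <oo) \int[Phat]_r h n r = \sum_(n <oo) \int[rho]_x `|a n x|%:E)%E.
  apply: eq_eseriesr => n _.
  rewrite (integral_mark law_marks n (f := fun x => `|a n x|%:E))//.
  by apply/mEFinP; apply: mcompT.
rewrite (series (f := fun t => `|t|)) ?normr0//.
exact: (sa_L1 sw).
Qed.

Lemma marked_real_sqr : (\int[Phat]_r (marked_real g (w, r) ^+ 2)%:E =
  \int[cm w]_x \int[rho]_r (g (w, x, r) ^+ 2)%:E)%E.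
Proof.
pose v n := \int[rho]_x (a n x ^+ 2).
have vE n : ((v n)%:E = \int[rho]_x (a n x ^+ 2)%:E)%E.
  rewrite /v /Rintegral fineK// ge0_fin_numE//.
  by apply: integral_ge0 => x _; rewrite lee_fin sqr_ge0.
have v0 n : 0 <= v n by apply: Rintegral_ge0 => x _; exact: sqr_ge0.
have vS : (\sum_(n <oo) (v n)%:E = \int[cm w]_x \int[rho]_r (g (w, x, r) ^+ 2)%:E)%E.
  by rewrite -a2E; apply: eq_eseriesr => n _.
have voo : (\sum_(n <oo) (v n)%:E < +oo)%E by rewrite vS; exact: (sa_L2 sw).
have [vfin vc] := nneseries_fine_cvg v0 voo.
rewrite -vS -[RHS](fineK vfin).
apply: (mark_series_sqr law_marks ma a2 a0 (S := fun r => marked_real g (w, r))) => //.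
- by apply: mcompT; [exact: measurable_marked_real|exact: measurable_pair1].
- exact: mark_series_cvg.
Qed.

End FixedConfiguration.

(** The integrands for which the marked integral is an actual sum; L1 gives absolute convergence, L2
    the isometry. *)
Record good_mark (K : CXM -> R[i]) : Prop := GoodMark {
  gm_measurable : cmeasurable K;
  gm_mean0 : mean0 rho P K;
  gm_L1 : (\int[mN]_z (normc (K z))%:E < +oo)%E;
  gm_L2 : (csq mN K < +oo)%E }.

Lemma palm_lty (F : config * X -> \bar R) : mfunT F -> (forall z, 0 <= F z)%E ->
  (\int[PN]_z F z < +oo)%E ->
  {ae P, forall w : config, (\int[cm w]_x F (w, x) < +oo)%E}.
Proof.
move=> mF F0; rewrite (palm.2 F mF F0) => Foo.
have [G [mG G0 GE]] := palm_slice mF F0.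
have : (\int[P]_w G w < +oo)%E.
  apply: le_lt_trans Foo; rewrite le_eqVlt; apply/orP; left; apply/eqP/esym.
  exact: ae_ge0_integral_lower.
move=> /(integral_lty_ae mG G0); apply: filterS2 GE => w -> //.
Qed.

Lemma good_summable (K : CXM -> R[i]) : good_mark K -> {ae P, forall w,
  summable_at (fun y => Re (K y)) w /\ summable_at (fun y => Im (K y)) w}.
Proof.
move=> [mK m0 L1 L2].
have slice (f : R[i] -> R) : (forall z, 0 <= f z) ->
    mfunT (fun z => f (K z)) -> (\int[mN]_z (f (K z))%:E < +oo)%E ->
    {ae P, forall w : config, (\int[cm w]_x \int[rho]_r (f (K (w, x, r)))%:E < +oo)%E}.
  move=> f0 mf foo.
  have mF : mfunT (fun z => (f (K z))%:E) by exact/mEFinP.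
  have F0 z : (0 <= (f (K z))%:E)%E by rewrite lee_fin.
  have FE : (\int[mN]_z (f (K z))%:E = \int[PN]_z \int[rho]_r (f (K (z, r)))%:E)%E.
    exact: (fubini_tonelli1 _ mF F0).
  apply: (palm_lty (F := fun z => \int[rho]_r (f (K (z, r)))%:E)%E).
  - exact: (measurable_fun_fubini_tonelli_F _ mF F0).
  - by move=> z; exact: integral_ge0.
  - by rewrite -FE.
have le (f : R[i] -> R) (h : R[i] -> R) : (forall z, 0 <= f z <= h z) ->
    mfunT (fun z => f (K z)) -> mfunT (fun z => h (K z)) ->
    (\int[mN]_z (h (K z))%:E < +oo)%E -> (\int[mN]_z (f (K z))%:E < +oo)%E.
  move=> fh mf mh; apply: le_lt_trans; apply: integral_EFin_le => //.
  - by move=> z; have /andP[] := fh (K z).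
  - by move=> z; have /andP[] := fh (K z).
have [m1 m2] := mK; have mn := measurable_nsq mK; have mc := measurable_normc mK.
have mr : mfunT (fun z => `|Re (K z)|) by exact: mcompT.
have mi : mfunT (fun z => `|Im (K z)|) by exact: mcompT.
have mr2 : mfunT (fun z => Re (K z) ^+ 2) by exact: measurable_funX.
have mi2 : mfunT (fun z => Im (K z) ^+ 2) by exact: measurable_funX.
have s1 := slice (fun z => `|Re z|) (fun=> normr_ge0 _) mr
  (le _ (fun z => normc z) (fun z => introT andP (conj (normr_ge0 _) (Re_normc z))) mr mc L1).
have s2 := slice (fun z => `|Im z|) (fun=> normr_ge0 _) mi
  (le _ (fun z => normc z) (fun z => introT andP (conj (normr_ge0 _) (Im_normc z))) mi mc L1).
have s3 := slice (fun z => Re z ^+ 2) (fun=> sqr_ge0 _) mr2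
  (le _ (fun z => nsq z) (fun z => introT andP (conj (sqr_ge0 _) (Re_nsq z))) mr2 mn L2).
have s4 := slice (fun z => Im z ^+ 2) (fun=> sqr_ge0 _) mi2
  (le _ (fun z => nsq z) (fun z => introT andP (conj (sqr_ge0 _) (Im_nsq z))) mi2 mn L2).
apply: filterS (ae_and (ae_and s1 s2) (ae_and (ae_and s3 s4) (ae_and (atomE atoms_N) m0))).
move=> w [[h1 h2] [[h3 h4] [h5 h6]]]; split; split => //.
- by apply: filterS h6 => x; rewrite /cintegral => -[].
- by apply: filterS h6 => x; rewrite /cintegral => -[].
Qed.

Lemma marked_csq_slice (K : CXM -> R[i]) : good_mark K -> {ae P, forall w,
  (\int[Phat]_r (nsq (marked_sum K (w, r)))%:E =
   \int[cm w]_x \int[rho]_r (nsq (K (w, x, r)))%:E)%E}.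
Proof.
move=> gK; have [mK _ _ _] := gK; have [m1 m2] := mK.
apply: filterS (good_summable gK) => w [s1 s2].
have h1 := marked_real_sqr m1 s1; have h2 := marked_real_sqr m2 s2.
have mm (g : CXM -> R) : mfunT g -> mfunT (fun r => marked_real g (w, r) ^+ 2).
  move=> mg; apply: measurable_funX.
  by apply: mcompT; [exact: measurable_marked_real|exact: measurable_pair1].
have -> : (\int[Phat]_r (nsq (marked_sum K (w, r)))%:E = \int[Phat]_r
    (marked_real (fun y => Re (K y)) (w, r) ^+ 2 + marked_real (fun y => Im (K y)) (w, r) ^+ 2)%:E)%E.
  by apply: eq_integral => r _; rewrite (marked_sumE (w, r) mK).
rewrite integral_EFinD; [|exact: mm|exact: mm|by move=> r; exact: sqr_ge0|by move=> r; exact: sqr_ge0].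
rewrite h1 h2.
have ms (g : CXM -> R) x : mfunT g -> mfunT (fun r => g (w, x, r) ^+ 2).
  by move=> mg; apply: measurable_funX; apply: (mcompT mg); exact: measurable_pair1.
have mG (g : CXM -> R) : mfunT g ->
    mfunT (fun x => \int[rho]_r (g (w, x, r) ^+ 2)%:E)%E.
  move=> mg; have mF : mfunT (fun z => (g z ^+ 2)%:E).
    by apply/mEFinP; exact: measurable_funX.
  have F0 z : (0 <= (g z ^+ 2)%:E)%E by rewrite lee_fin sqr_ge0.
  have h : mfunT (fun z => \int[rho]_r (g (z, r) ^+ 2)%:E)%E.
    exact: (measurable_fun_fubini_tonelli_F _ mF F0).
  exact: (mcompT h (measurable_pair1 _)).
have G0 (g : CXM -> R) x : (0 <= \int[rho]_r (g (w, x, r) ^+ 2)%:E)%E.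
  by apply: integral_ge0 => r _; rewrite lee_fin sqr_ge0.
rewrite -(ge0_integralD (cm w) measurableT (fun x _ => G0 _ x) (mG _ m1) (fun x _ => G0 _ x) (mG _ m2)).
apply: eq_integral => x _; rewrite -integral_EFinD//; [exact: ms m1|exact: ms m2| |].
- by move=> r; exact: sqr_ge0.
- by move=> r; exact: sqr_ge0.
Qed.

Lemma marked_csq (K : CXM -> R[i]) : good_mark K -> csq PP (marked_sum K) = csq mN K.
Proof.
move=> gK; have [mK _ _ _] := gK.
have mS := measurable_nsq (marked_sum_measurable mK).
have mSe : mfunT (fun z => (nsq (marked_sum K z))%:E) by exact/mEFinP.
have S0 z : (0 <= (nsq (marked_sum K z))%:E)%E by rewrite lee_fin nsq_ge0.
have FE : (csq PP (marked_sum K) = \int[P]_w \int[Phat]_r (nsq (marked_sum K (w, r)))%:E)%E.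
  exact: (fubini_tonelli1 _ mSe S0).
have mn := measurable_nsq mK.
have mne : mfunT (fun z => (nsq (K z))%:E) by exact/mEFinP.
have n0 z : (0 <= (nsq (K z))%:E)%E by rewrite lee_fin nsq_ge0.
have GE : (csq mN K = \int[PN]_z \int[rho]_r (nsq (K (z, r)))%:E)%E.
  exact: (fubini_tonelli1 _ mne n0).
have mG : mfunT (fun z => \int[rho]_r (nsq (K (z, r)))%:E)%E.
  exact: (measurable_fun_fubini_tonelli_F _ mne n0).
have G0 z : (0 <= \int[rho]_r (nsq (K (z, r)))%:E)%E by exact: integral_ge0.
rewrite FE GE (palm.2 _ mG G0); apply/esym; apply: ae_ge0_integral_lower.
- by move=> w; apply: integral_ge0.
- exact: (measurable_fun_fubini_tonelli_F _ mSe S0).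
- by apply: filterS (marked_csq_slice gK) => w ->.
Qed.

Lemma good_markB (K L : CXM -> R[i]) : good_mark K -> good_mark L -> good_mark (fun z => K z - L z).
Proof.
move=> gK gL; have [mK K0 K1 K2] := gK; have [mL L0 L1 L2] := gL.
have mB := cmeasurableB mK mL; split => //.
- apply: filterS (ae_and (ae_and (good_summable gK) (good_summable gL)) (ae_and K0 L0)).
  move=> w [[[kr ki] [lr li]] [k0 l0]].
  have fin (g : CXM -> R) : mfunT g -> summable_at g w ->
      {ae cm w, forall x, rho.-integrable setT (fun r => (g (w, x, r))%:E)}.
    move=> mg sg; have mF : mfunT (fun z => (`|g z|)%:E).
      by apply/mEFinP; exact: mcompT.
    have F0 z : (0 <= (`|g z|)%:E)%E by rewrite lee_fin.
    have h : mfunT (fun z => \int[rho]_r (`|g (z, r)|)%:E)%E.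
      exact: (measurable_fun_fubini_tonelli_F _ mF F0).
    have hw : mfunT (fun x => \int[rho]_r (`|g (w, x, r)|)%:E)%E.
      exact: (mcompT h (measurable_pair1 _)).
    have := @integral_lty_ae _ _ R (cm w) _ hw (fun x => integral_ge0 _ (fun r _ => F0 _)) (sa_L1 sg).
    apply: filterS => x hx; apply/integrableP; split => //.
    by apply/mEFinP; apply: (mcompT mg); exact: measurable_pair1.
  have f1 := fin _ mK.1 kr; have f2 := fin _ mK.2 ki.
  have f3 := fin _ mL.1 lr; have f4 := fin _ mL.2 li.
  apply: filterS (ae_and (ae_and (ae_and f1 f2) (ae_and f3 f4)) (ae_and k0 l0)).
  move=> x [[[i1 i2] [i3 i4]] [e1 e2]].
  rewrite (_ : (fun r => _) = (fun r => K (w, x, r) + (-1) * L (w, x, r))); last first.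
    by apply/funext => r; rewrite mulN1r.
  have iL : cintegrable rho (fun r => L (w, x, r)) by [].
  have iK : cintegrable rho (fun r => K (w, x, r)) by [].
  by rewrite cintegralD//; [rewrite cintegralZ// e1 e2 mulr0 addr0|exact: cintegrableZ].
- apply: (@le_lt_trans _ _ (\int[mN]_z (normc (K z) + normc (L z))%:E)%E).
    apply: integral_EFin_le.
    + exact: measurable_normc.
    + by apply: measurable_funD; exact: measurable_normc.
    + by move=> z; exact: normc_ge0.
    + by move=> z; apply: le_trans (normcD _ _) _; rewrite normcN.
  rewrite integral_EFinD; [exact: lte_add_pinfty|exact: measurable_normc|exact: measurable_normc|
    by move=> z; exact: normc_ge0|by move=> z; exact: normc_ge0].
- exact: csqB_lty.
Qed.

(** Linearity is obtained from the limits of the partial sums, hence only where the three series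
    converge; elsewhere the difference of positive and negative parts may be indeterminate. *)
Lemma marked_sumB (K L : CXM -> R[i]) : good_mark K -> good_mark L ->
  {ae PP, forall z, marked_sum (fun y => K y - L y) z = marked_sum K z - marked_sum L z}.
Proof.
move=> gK gL; have gB := good_markB gK gL.
have [mK _ _ _] := gK; have [mL _ _ _] := gL; have [mB _ _ _] := gB.
apply: ae_prodr.
  apply: measurable_ceq_set; first exact: marked_sum_measurable.
  by apply: cmeasurableB; exact: marked_sum_measurable.
apply: filterS3 (good_summable gK) (good_summable gL) (good_summable gB).
move=> w [kr ki] [lr li] [br bi].
have key (f : R[i] -> R) : (forall a b, f (a - b) = f a - f b) ->
    mfunT (fun z => f (K z)) -> mfunT (fun z => f (L z)) ->
    mfunT (fun z => f (K z - L z)) ->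
    summable_at (fun z => f (K z)) w -> summable_at (fun z => f (L z)) w ->
    summable_at (fun z => f (K z - L z)) w ->
    {ae Phat, forall r, marked_real (fun z => f (K z - L z)) (w, r) =
      marked_real (fun z => f (K z)) (w, r) - marked_real (fun z => f (L z)) (w, r)}.
  move=> fB m1 m2 m3 s1 s2 s3.
  have c1 := mark_series_cvg m1 s1; have c2 := mark_series_cvg m2 s2.
  have c3 := mark_series_cvg m3 s3.
  apply: (ae_imp _ (ae_and c1 (ae_and c2 c3))) => r [h1 [h2 h3]].
  apply: (cvg_unique (@Rhausdorff R) h3).
  rewrite (_ : (fun N => _) = (fun N => \sum_(0 <= n < N) mark_term (fun z => f (K z)) w r n -
      \sum_(0 <= n < N) mark_term (fun z => f (L z)) w r n)).
    exact: cvgB.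
  apply/funext => N; rewrite -sumrB; apply: eq_bigr => n _; rewrite /mark_term.
  by case: asboolP => _; rewrite ?fB// subrr.
have k1 := key (fun z => Re z) (@ReB _) mK.1 mL.1 mB.1 kr lr br.
have k2 := key (fun z => Im z) (@ImB _) mK.2 mL.2 mB.2 ki li bi.
apply: (ae_imp _ (ae_and k1 k2)) => r [e1 e2].
by rewrite !marked_sumE// e1 e2.
Qed.

End MarkedSums.

(** * Extension of the marked integral to L2 *)

Section MarkedIntegral.
Implicit Types (K L : CXM -> R[i]) (S T : config * marks M -> R[i]).

(** [is_marked_integral] read on versions, with norms replaced by their squares. *)
Definition mintf K S :=
  [/\ cmeasurable K, cL2 PP S & exists K_ : nat -> CXM -> R[i],
    [/\ forall n, good_mark (K_ n), to0 (fun n => csq mN (fun z => K_ n z - K z)) &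
        to0 (fun n => csq PP (fun z => marked_sum (K_ n) z - S z))]].

Lemma mintf_ae K L S : mintf K S -> cmeasurable L -> {ae mN, forall z, K z = L z} ->
  mintf L S.
Proof.
move=> [mK cS [K_ [gK hK hS]]] mL KL; split => //; exists K_; split => //.
apply: to0_ext hK => n; have [mKn _ _ _] := gK n.
apply: ae_csq; [exact: cmeasurableB|exact: cmeasurableB|].
by apply: filterS KL => z ->.
Qed.

Lemma mintfB K L S T : mintf K S -> mintf L T ->
  mintf (fun z => K z - L z) (fun z => S z - T z).
Proof.
move=> [mK [mS S2] [K_ [gK hK hS]]] [mL [mT T2] [L_ [gL hL hT]]].
move/cnorm2_lty in S2; move/cnorm2_lty in T2.
have mKn n : cmeasurable (K_ n) by have [] := gK n.
have mLn n : cmeasurable (L_ n) by have [] := gL n.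
have sK n : cmeasurable (marked_sum (K_ n)) by apply: marked_sum_measurable.
have sL n : cmeasurable (marked_sum (L_ n)) by apply: marked_sum_measurable.
have two (u v : nat -> \bar R) : (forall n, 0 <= u n)%E -> (forall n, 0 <= v n)%E ->
    to0 u -> to0 v -> to0 (fun n => 2%:E * u n + 2%:E * v n)%E.
  by move=> u0 v0 hu hv; apply: to0D; apply: to0Z.
split; first exact: cmeasurableB.
  by split; [exact: cmeasurableB|apply/cnorm2_lty; exact: csqB_lty].
exists (fun n z => K_ n z - L_ n z); split.
- by move=> n; exact: good_markB.
- apply: to0_le (two _ _ _ _ hK hL) => [n|n|n]; try exact: csq_ge0.
  exact: csqBB_le.
- apply: to0_le (two _ _ _ _ hS hT) => [n|n|n]; try exact: csq_ge0.
  rewrite (_ : csq _ _ = csq PP (fun z => (marked_sum (K_ n) z - marked_sum (L_ n) z) - (S z - T z))).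
    exact: csqBB_le.
  apply: ae_csq.
  + apply: cmeasurableB; last exact: cmeasurableB.
    by apply: marked_sum_measurable; exact: cmeasurableB.
  + by apply: cmeasurableB; exact: cmeasurableB.
  + by apply: filterS (marked_sumB (gK n) (gL n)) => z ->.
Qed.

Lemma mintf_csq K S : mintf K S -> csq PP S = csq mN K.
Proof.
move=> [mK [mS S2] [K_ [gK hK hS]]]; move/cnorm2_lty in S2.
have mKn n : cmeasurable (K_ n) by have [] := gK n.
have Koon n : (csq mN (K_ n) < +oo)%E by have [] := gK n.
have sK n : cmeasurable (marked_sum (K_ n)) by apply: marked_sum_measurable.
have e n : csq PP (marked_sum (K_ n)) = csq mN (K_ n).
  exact: marked_csq.
have Koo := csq_lty_lim mKn mK Koon hK.
have c1 := csq_cvg mKn mK Koon hK.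
have c2 : fine (csq PP (marked_sum (K_ n))) @[n --> \oo] --> fine (csq PP S).
  by apply: csq_cvg => // n; rewrite e.
move: c2; under eq_fun do rewrite e; move=> c2.
have f1 : csq PP S \is a fin_num by rewrite ge0_fin_numE// csq_ge0.
have f2 : csq mN K \is a fin_num by rewrite ge0_fin_numE// csq_ge0.
by rewrite -(fineK f1) -(fineK f2); congr EFin; exact: (cvg_unique (@Rhausdorff R) c2 c1).
Qed.

Lemma mintf_aer K S T : mintf K S -> cmeasurable T -> {ae PP, forall z, S z = T z} ->
  mintf K T.
Proof.
move=> [mK [mS S2] [K_ [gK hK hS]]] mT ST; move/cnorm2_lty in S2.
split => //; first by split => //; apply/cnorm2_lty; rewrite -(ae_csq mS mT ST).
exists K_; split => //; apply: to0_ext hS => n.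
have sK : cmeasurable (marked_sum (K_ n)).
  by apply: marked_sum_measurable; have [] := gK n.
apply: ae_csq; [exact: cmeasurableB|exact: cmeasurableB|].
by apply: filterS ST => z ->.
Qed.

Lemma pmean0_truncation K (A : set (config * X)) : pmean0 K ->
  pmean0 (fun z => (\1_A z.1)%:C%C * K z).
Proof.
rewrite /pmean0; apply: filterS => z; rewrite /= indicE; case: (z \in A) => /= K0.
  by rewrite -[RHS]K0; congr cintegral; apply/funext => r; rewrite mul1r.
by rewrite -[RHS](cintegral0 rho); congr cintegral; apply/funext => r; rewrite mul0r.
Qed.

Lemma cmeasurable_truncation d1 (T : measurableType d1) d2 (T' : measurableType d2)
    (A : set T') (h : T -> T') (K : T -> R[i]) : measurable A -> mfunT h ->
  cmeasurable K -> cmeasurable (fun z => (\1_A (h z))%:C%C * K z).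
Proof.
move=> mA mh mK; apply: cmeasurableM => //; apply: cmeasurable_real.
by apply: (mcompT (f := fun w => (\1_A w : R))) => //; exact: measurable_indic.
Qed.

Lemma nsq_truncation (T : Type) (A : set T) (z : T) (k : R[i]) :
  nsq ((\1_A z)%:C%C * k) = \1_A z * nsq k.
Proof. by rewrite nsqM nsq_real indicE; case: (z \in A); rewrite ?expr1n ?expr0n. Qed.

Lemma normc_truncation (T : Type) (A : set T) (z : T) (k : R[i]) :
  normc ((\1_A z)%:C%C * k) = \1_A z * normc k.
Proof.
rewrite indicE; case: (z \in A); first by rewrite !mul1r.
by rewrite mulr0n !mul0r (normc_real 0) normr0.
Qed.

Lemma indic_itv (T : Type) (A : set T) (z : T) : 0 <= (\1_A z : R) <= 1.
Proof. by rewrite indicE; case: (z \in A); rewrite ?lexx ?ler01. Qed.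

(** On a set of finite measure |K| <= 1 + |K|^2 makes K integrable. The set does not involve the
    marks, so that the zero mean survives the truncation. *)
Lemma truncated_good_mark K (A : set (config * X)) : cmeasurable K ->
  (csq mN K < +oo)%E -> pmean0 K -> measurable A -> (PN A < +oo)%E ->
  good_mark (fun z => (\1_A z.1)%:C%C * K z).
Proof.
move=> mK K2 K0 mA Aoo; have mA' := cmeasurable_truncation mA measurable_fst mK.
have mi : mfunT (fun z : CXM => \1_A z.1 : R).
  by apply: (mcompT (f := fun w => (\1_A w : R))) => //; exact: measurable_indic.
split => //.
- by apply: pmean0_mean0; exact: pmean0_truncation.
- apply: (@le_lt_trans _ _ (\int[mN]_z (\1_A z.1 + nsq (K z))%:E)%E).
    apply: integral_EFin_le.
    + exact: measurable_normc.
    + by apply: measurable_funD => //; exact: measurable_nsq.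
    + by move=> z; exact: normc_ge0.
    + move=> z; rewrite normc_truncation indicE.
      case: (z.1 \in A); first by rewrite mul1r; exact: normc_le_nsq.
      by rewrite mul0r add0r nsq_ge0.
  rewrite integral_EFinD; [|exact: mi|exact: measurable_nsq|
    by move=> z; have /andP[] := indic_itv A z.1|by move=> z; exact: nsq_ge0].
  apply: lte_add_pinfty => //.
  have mie : mfunT (fun z : CXM => (\1_A z.1 : R)%:E).
    exact/mEFinP.
  rewrite (fubini_tonelli1 _ mie); last by move=> z; rewrite lee_fin; have /andP[] := indic_itv A z.1.
  rewrite /fubini_F (eq_integral (fun z => (\1_A z : R)%:E)); first by rewrite -measure_integral_indic.
  move=> z _; transitivity ((\1_A z : R)%:E * rho setT)%E; first by rewrite -integral_cst.
  by rewrite probability_setT mule1.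
- apply: le_lt_trans K2; apply: integral_EFin_le.
  + exact: measurable_nsq.
  + exact: measurable_nsq.
  + by move=> z; exact: nsq_ge0.
  + move=> z; rewrite nsq_truncation ler_piMl ?nsq_ge0//.
Qed.

(** Truncations along an exhaustion of the Campbell measure converge in L2, and the isometry makes
    their marked sums Cauchy. *)
Lemma mintf_exists K : cmeasurable K -> (csq mN K < +oo)%E -> pmean0 K ->
  exists S, mintf K S.
Proof.
move=> mK K2 K0.
have [A [AT nA hA]] := (sigma_finiteP _ _).1 (sigma_finiteT PN).
pose K_ n (z : CXM) := (\1_(A n) z.1)%:C%C * K z.
have gK n : good_mark (K_ n) by have [mA Aoo] := hA n; exact: truncated_good_mark.
have mKn n : cmeasurable (K_ n) by have [] := gK n.
have hK : to0 (fun n => csq mN (fun z => K_ n z - K z)).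
  apply: (dct_to0 (g := fun z => nsq (K z))) => //.
  - by move=> n; apply: measurable_nsq; exact: cmeasurableB.
  - exact: measurable_nsq.
  - by move=> n z; exact: nsq_ge0.
  - move=> n z; rewrite /K_ indicE; case: (z.1 \in A n).
      by rewrite mul1r subrr nsq0 nsq_ge0.
    by rewrite mul0r sub0r nsqN.
  - apply: aeW => z; have [n0 _ An0] : (\bigcup_i A i) z.1 by rewrite -AT.
    apply: cvg_near_cst; exists n0 => // n /= hn.
    have : A n z.1 by move: An0; apply/subsetPset; exact: nA.
    by move=> An; rewrite /K_ indicE mem_set// mul1r subrr nsq0.
have sK n : cmeasurable (marked_sum (K_ n)) by apply: marked_sum_measurable.
have [|S mS hS] := csq_complete (mu := PP) sK.
  move=> e e0; have [n0 hn] := hK (e / 8) (divr_gt0 e0 (ltr0n _ 8)).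
  exists n0 => m n hm hn'.
  rewrite (_ : csq _ _ = csq mN (fun z => K_ m z - K_ n z)); last first.
    have gB := good_markB (gK m) (gK n).
    rewrite -(marked_csq gB); apply: ae_csq; first exact: cmeasurableB.
      by apply: marked_sum_measurable; exact: cmeasurableB.
    by apply: filterS (marked_sumB (gK m) (gK n)) => z ->.
  apply: (@le_lt_trans _ _ (2%:E * (e / 8)%:E + 2%:E * (e / 8)%:E)%E).
    apply: le_trans (csqB_tri mN (mKn m) (mKn n) mK) _.
    by apply: leeD; apply: lee_wpmul2l => //; apply: ltW; exact: hn.
  rewrite (_ : (2%:E * _ + _)%E = (2 * (e / 8) + 2 * (e / 8))%:E)// lte_fin.
  lra.
exists S; split => //; last by exists K_.
split => //; apply/cnorm2_lty; apply: (csq_lty_lim sK mS) hS => n.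
by rewrite (marked_csq (gK n)); have [] := gK n.
Qed.

(** An indicator that depends on the configuration alone comes out of the sum over its atoms; this
    localizes the isometry. *)
Lemma mintf_restrict K S (C : set config) : measurable C -> mintf K S ->
  mintf (fun z => (\1_C z.1.1)%:C%C * K z) (fun z => (\1_C z.1)%:C%C * S z).
Proof.
move=> mC [mK [mS S2] [K_ [gK hK hS]]]; move/cnorm2_lty in S2.
have mf2 : mfunT (fun z : CXM => z.1.1).
  by apply: mcompT.
have le d' (T : measurableType d') (mu : {measure set T -> \bar R}) (h : T -> config)
    (f : T -> R[i]) : mfunT h -> cmeasurable f ->
    (csq mu (fun z => (\1_C (h z))%:C%C * f z)%R <= csq mu f)%E.
  move=> mh mf; apply: integral_EFin_le.
  - by apply: measurable_nsq; exact: cmeasurable_truncation.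
  - exact: measurable_nsq.
  - by move=> z; exact: nsq_ge0.
  - move=> z; rewrite nsq_truncation ler_piMl ?nsq_ge0//.
split; first exact: cmeasurable_truncation.
  split; first exact: cmeasurable_truncation.
  by apply/cnorm2_lty; apply: le_lt_trans S2; exact: le.
exists (fun n z => (\1_C z.1.1)%:C%C * K_ n z); split.
- move=> n; have [mKn Kn0 Kn1 Kn2] := gK n.
  have mT := cmeasurable_truncation mC mf2 mKn; split => //.
  + apply: filterS Kn0 => w; apply: filterS => x; rewrite /= indicE; case: (w \in C) => /= h.
      by rewrite -[RHS]h; congr cintegral; apply/funext => r; rewrite mul1r.
    by rewrite -[RHS](cintegral0 rho); congr cintegral; apply/funext => r; rewrite mul0r.
  + apply: le_lt_trans Kn1; apply: integral_EFin_le.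
    * exact: measurable_normc.
    * exact: measurable_normc.
    * by move=> z; exact: normc_ge0.
    * move=> z; rewrite normc_truncation ler_piMl ?normc_ge0//.
  + by apply: le_lt_trans Kn2; exact: le.
- apply: to0_le hK => n; under eq_fun do rewrite -mulrBr.
  by apply: le => //; apply: cmeasurableB => //; have [] := gK n.
- apply: to0_le hS => n; have [mKn _ _ _] := gK n.
  rewrite (_ : (fun z => _) = (fun z : config * marks M => (\1_C z.1)%:C%C * (marked_sum (K_ n) z - S z))).
    apply: le => //; apply: cmeasurableB => //; exact: marked_sum_measurable.
  apply/funext => z; rewrite mulrBr; congr (_ - _); rewrite /Defs.marked_sum.
  rewrite indicE; case: (z.1 \in C).
    by rewrite mul1r; congr cintegral; apply/funext => y; rewrite mul1r.
  by rewrite mul0r -[RHS](cintegral0 (marked alive atom z.1 z.2)); congr cintegral;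
    apply/funext => y; rewrite mul0r.
Qed.

(** The isometry holds after restriction to every event [C] of configurations, so the two sides have
    equal integrals over every [C] and coincide almost surely. This covers integrands for which the
    sum over the atoms does not converge absolutely. *)
Lemma mintf_slice K S : mintf K S -> {ae P, forall w : config,
  (\int[Phat]_r (nsq (S (w, r)))%:E = \int[cm w]_x (gsq K (w, x))%:E)%E}.
Proof.
move=> h; have [mK [mS S2] _] := h; move/cnorm2_lty in S2.
have K2 : (csq mN K < +oo)%E by rewrite -(mintf_csq h).
have [mG GE Gtot] := gsq_facts mK K2.
have mGe : mfunT (fun z => (gsq K z)%:E) by exact/mEFinP.
have G0 z : (0 <= (gsq K z)%:E)%E by rewrite lee_fin gsq_ge0.
have [b [mb b0 hb]] := palm_slice mGe G0.
pose a w := (\int[Phat]_r (nsq (S (w, r)))%:E)%E.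
have mn : mfunT (fun z => (nsq (S z))%:E).
  by apply/mEFinP; exact: measurable_nsq.
have n0 z : (0 <= (nsq (S z))%:E)%E by rewrite lee_fin nsq_ge0.
have ma : mfunT a by exact: (measurable_fun_fubini_tonelli_F _ mn n0).
have a0 w : (0 <= a w)%E by exact: integral_ge0.
have ia : P.-integrable setT a.
  apply/integrableP; split => //.
  rewrite (eq_integral a); last by move=> w _; rewrite gee0_abs.
  by rewrite -(fubini_tonelli1 _ mn n0).
suff ab : {ae P, forall w, setT w -> a w = b w}.
  by apply: filterS2 ab hb => w /(_ I) e1 ->; rewrite -e1.
apply: (integral_ae_eq measurableT ia mb) => C _ mC.
have hC := mintf_csq (mintf_restrict mC h).
have mSC := cmeasurable_truncation mC measurable_fst mS.
have mKC := cmeasurable_truncation mC (mcompT measurable_fst measurable_fst) mK.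
rewrite integral_mkcond [RHS]integral_mkcond.
transitivity (csq PP (fun z => (\1_C z.1)%:C%C * S z)).
  have mne : mfunT (fun z => (nsq ((\1_C z.1)%:C%C * S z))%:E).
    by apply/mEFinP; exact: measurable_nsq.
  rewrite /csq (fubini_tonelli1 _ mne); last by move=> z; rewrite lee_fin nsq_ge0.
  apply: eq_integral => w _; rewrite /fubini_F patchE.
  under eq_integral do rewrite nsq_truncation /=.
  rewrite indicE; case: (w \in C).
    by under eq_integral do rewrite mul1r.
  by rewrite integral0_eq// => r _; rewrite mul0r.
rewrite hC.
have mne : mfunT (fun z : CXM => (nsq ((\1_C z.1.1)%:C%C * K z))%:E).
  by apply/mEFinP; exact: measurable_nsq.
have mGC : mfunT (fun z : config * X => (\1_C z.1 : R)%:E * (gsq K z)%:E)%E.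
  apply: emeasurable_funM => //; apply/mEFinP.
  by apply: (mcompT (f := fun w => (\1_C w : R))) => //; exact: measurable_indic.
have GC0 (z : config * X) : (0 <= (\1_C z.1 : R)%:E * (gsq K z)%:E)%E.
  by apply: mule_ge0 => //; rewrite lee_fin; have /andP[] := indic_itv C z.1.
transitivity (\int[PN]_z ((\1_C z.1 : R)%:E * (gsq K z)%:E))%E.
  rewrite /csq (fubini_tonelli1 _ mne); last by move=> z; rewrite lee_fin nsq_ge0.
  apply: ae_ge0_integral_lower => //.
  apply: filterS GE => z ->; rewrite /fubini_F.
  under eq_integral do rewrite nsq_truncation /=.
  rewrite indicE; case: (z.1 \in C).
    by under eq_integral do rewrite mul1r; rewrite mul1e.
  by rewrite mul0e integral0_eq// => r _; rewrite mul0r.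
rewrite (palm.2 _ mGC GC0); apply: ae_ge0_integral_lower.
- by move=> w; rewrite patchE; case: ifP.
- apply/(measurable_restrict _ mC measurableT); rewrite ?setTI//.
  exact: measurable_funS mb.
- apply: filterS hb => w hw; rewrite patchE /= indicE; case: (w \in C).
    by rewrite -hw; apply: eq_integral => x _; rewrite mul1e.
  by rewrite integral0_eq// => x _; rewrite mul0e.
Qed.


Lemma is_marked_integralP K K0 S : versionNM K K0 ->
  is_marked_integral K S <-> mintf K0 S.
Proof.
move=> v0; have mK0 : cmeasurable K0 by case: v0.
have n2 (L1 L2 : CXM -> R[i]) : cmeasurable L1 -> cmeasurable L2 ->
    norm2PN rho P (L1 - L2) = (csq mN (fun z => (L1 z - L2 z)%R) `^ 2^-1)%E.
  by move=> m1 m2; rewrite norm2PNE //; exact: cmeasurableB.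
have lim (K_ : nat -> CXM -> R[i]) L : (forall n, cmeasurable (K_ n)) ->
    cmeasurable L -> norm2PN rho P (K_ n - L) @[n --> \oo] --> 0%E <->
    to0 (fun n => csq mN (fun z => K_ n z - L z)).
  move=> mK mL; under eq_fun do rewrite n2//.
  rewrite -to0_half; last by move=> n; exact: csq_ge0.
  by apply: iff_sym; apply: to0P => n; exact: poweR_ge0.
have good L : good_mark L <-> [/\ cmeasurable L, mean0 rho P L,
    (norm1PN rho P L < +oo)%E & (norm2PN rho P L < +oo)%E].
  split=> [[mL L0 L1 L2]|[mL L0]].
    split => //; first by rewrite norm1PNE.
    by rewrite norm2PNE//; exact: poweR_lty.
  rewrite norm1PNE// norm2PNE// => L1 L2; split => //.
  by apply: poweR_half_lty L2; exact: csq_ge0.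
split.
  move=> [cS [K' [K_ [v hK hK' hS]]]].
  have gK n : good_mark (K_ n) by apply/good.
  have mK' : cmeasurable K' by case: v.
  have mKn n : cmeasurable (K_ n) by have [] := gK n.
  have h : mintf K' S.
    split => //; exists K_; split => //; first exact/lim.
    exact/cnorm2_to0.
  exact: mintf_ae h mK0 (versionNM_unique v v0).
move=> [mK cS [K_ [gK hK hS]]]; split => //; exists K0, K_; split => //.
- by move=> n; apply/good.
- by apply/lim => // n; have [] := gK n.
- exact/cnorm2_to0.
Qed.

End MarkedIntegral.

(** * The gradient sharp and continuity of the factors *)

Section Sharp.

Lemma isK_mintf F K0 : isK F K0 -> exists S, mintf K0 S.
Proof.
move=> h; have [_ mK _] := h; apply: mintf_exists => //; first exact: isK_csq h.
exact: (isK_pmean0 h).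
Qed.

Lemma mintf_to0 (K_ : nat -> CXM -> R[i]) K S_ S :
  (forall n, mintf (K_ n) (S_ n)) -> mintf K S ->
  to0 (fun n => csq mN (fun z => K_ n z - K z)) ->
  to0 (fun n => csq PP (fun z => S_ n z - S z)).
Proof.
move=> h_ h; apply: to0_ext => n.
by rewrite -(mintf_csq (mintfB (h_ n) h)).
Qed.

Lemma is_sharp0_mintf F k S : D0k F k ->
  is_sharp0 nu rho d gam flat P Phat alive atom xi F S <-> mintf k S.
Proof.
move=> Fk; have hk : isK F k by exact: isK_D0k.
have [_ mk _] := hk; split.
  by move=> [_ [K /(is_flatUP _ hk) v]] /(is_marked_integralP _ v).
have v := isK_version mk.
move=> h; split; first exact: D0k_D0 Fk.
by eexists; [exact/(is_flatUP _ hk)/v|exact/(is_marked_integralP _ v)].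
Qed.

(** In a sequence defining sharp the gradients converge to [K0], so that their marked integrals
    converge both to [S] and to the marked integral of [K0]. Conversely the sequence given by [isK]
    works. *)
Lemma is_sharpP F K0 S : isK F K0 -> is_sharp F S <-> mintf K0 S.
Proof.
move=> hK; have [cF mK0 [F_ [k_ [hk hF hk0]]]] := hK; have [T hT] := isK_mintf hK.
split.
  move=> [_ [mS S2] [G_ [S_ [hG /= nG nS]]]].
  have /choice[g_ hg] : forall n, exists k, D0k (G_ n) k.
    by move=> n; apply: D0_D0k; have [] := hG n.
  have hS n : mintf (g_ n) (S_ n) by apply/(is_sharp0_mintf _ (hg n)).
  have [_ hg0] := (normD_to0 (fun n => isK_D0k (hg n)) hK).1 nG.
  have hST := mintf_to0 hS hT hg0; move/cnorm2_to0 in nS.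
  have [_ [mT _] _] := hT.
  have mSn n : cmeasurable (S_ n) by have [_ [] ] := hS n.
  apply: (mintf_aer hT mS).
  have le0 : (csq PP (fun z => T z - S z)%R <= 0)%E.
    apply: (@to0_cst R).
    apply: to0_le (to0D (to0Z _ (ler0n R 2) hST) (to0Z _ (ler0n R 2) nS)) => n; try exact: csq_ge0.
    apply: le_trans (csqB_tri PP mT mS (mSn n)) _.
    by rewrite csqB [X in (_ + 2%:E * X <= _)%E]csqB.
  apply: filterS (csq0_ae (cmeasurableB mT mS) le0) => z /eqP.
  by rewrite subr_eq0 => /eqP.
move=> hS; have [_ cS _] := hS; split => //; first by apply/(domD_isK _); exists K0.
have /choice[S_ hS_] : forall n, exists S, mintf (k_ n) S.
  by move=> n; apply: (isK_mintf (F := F_ n)); exact: isK_D0k.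
exists F_, S_; split.
- by move=> n; apply/(is_sharp0_mintf _ (hk n)).
- by apply/(normD_to0 (fun n => isK_D0k (hk n)) hK).
- by apply/cnorm2_to0; exact: mintf_to0 hS_ hS hk0.
Qed.

(** By [normUE] the norm of a creation is the norm of the gradient plus a [xi]-term, and the latter
    is controlled by the L2 norm through [to0_xiint]. *)
Lemma creation_continuous : continuous_on domD (fun F H => H = creation F) normD normU.
Proof.
move=> u_ u v_ v hu_ hu hv_ hv hn.
have /choice[K_ hK_] : forall n, exists K, isK (u_ n) K by move=> n; exact/(domD_isK _).
have [K hK] := (domD_isK _).1 hu; have [h1 h2] := (normD_to0 hK_ hK).1 hn.
have e n : normU (v_ n - v) = (csq mN (fun z => K_ n z - K z)%R `^ 2^-1 +
    xiint ((u_ n - u)%R \o fst))%E.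
  by rewrite hv_ hv -(normUE (isKB (hK_ n) hK)).
have B n := isKB (hK_ n) hK.
under eq_fun do rewrite e; apply/to0P.
  by move=> n; rewrite adde_ge0 ?poweR_ge0 ?xiint_ge0.
apply: to0D; first by apply/to0_half => // n; exact: csq_ge0.
apply: to0_xiint => //.
by move=> n; have [[]] := B n.
Qed.

Lemma flat_continuous : continuous_on [set H | exists2 F, domD F & H = creation F]
  is_flatU normU normPN.
Proof.
move=> u_ u v_ v hu_ [F hF ->] hv_ hv hn.
have /choice[F_ hF_] : forall n, exists F, domD F /\ u_ n = creation F.
  by move=> n; have [G ? ?] := hu_ n; exists G.
have /choice[K_ hK_] : forall n, exists K, isK (F_ n) K.
  by move=> n; apply/(domD_isK _); have [] := hF_ n.
have [K hK] := (domD_isK _).1 hF.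
have vK := (is_flatUP _ hK).1 hv.
have vK_ n : versionNM (v_ n) (K_ n).
  by apply/(is_flatUP _ (hK_ n)); have [_ <-] := hF_ n; exact: hv_.
apply/(normPN_to0 vK_ vK).
apply/to0_half; first by move=> n; exact: csq_ge0.
have e n : normU (u_ n - creation F) = (csq mN (fun z => K_ n z - K z)%R `^ 2^-1 +
    xiint ((F_ n - F)%R \o fst))%E.
  by have [_ ->] := hF_ n; rewrite -(normUE (isKB (hK_ n) hK)).
have h0 : to0 (fun n => normU (u_ n - creation F)).
  by apply/to0P => // n; rewrite e adde_ge0 ?poweR_ge0 ?xiint_ge0.
by apply: to0_le h0 => n; rewrite e leeDl ?xiint_ge0.
Qed.

Lemma marked_integral_continuous :
  continuous_on [set K | exists2 F, domD F & is_flatU (creation F) K]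
    is_marked_integral normPN (cnorm2 PP).
Proof.
move=> u_ u v_ v hu_ [F /(domD_isK _)[K0 hK0] hF] hv_ hv hn.
have vK := (is_flatUP _ hK0).1 hF.
have /choice[K_ vK_] : forall n, exists K, versionNM (u_ n) K.
  move=> n; have [G /(domD_isK _)[K hK] hG] := hu_ n.
  by exists K; exact/(is_flatUP _ hK).
move/(normPN_to0 vK_ vK) : hn => h0.
apply/cnorm2_to0; apply: mintf_to0 h0.
- by move=> n; apply/(is_marked_integralP _ (vK_ n)).
- exact/(is_marked_integralP _ vK).
Qed.

End Sharp.

(** * Algebraic operations on functionals and their gradients *)

Section UpAlgebra.

Lemma ae_PN_fst (Q : config -> Prop) : {ae P, forall w, Q w} -> {ae PN, forall z, Q z.1}.
Proof.
move=> [N [mN' N0 QN]]; have mA : measurable (N `*` (setT : set X)) by exact: measurableX.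
have : {ae PN, forall z, ~ (N `*` (setT : set X)) z}.
  apply: ae_null_set => //.
  have mi : mfunT (fun z : config * X => (\1_(N `*` setT) z : R)%:E).
    by apply/mEFinP; exact: measurable_indic.
  have i0 (z : config * X) : (0 <= (\1_(N `*` setT) z : R)%:E)%E.
    by rewrite lee_fin; have /andP[] := indic_itv (N `*` setT) z.
  rewrite (palm.2 _ mi i0) -[RHS](integral0 P setT); apply: ae_ge0_integral_lower => //.
  exists N; split => // w /=; apply: contra_notP => nN.
  by rewrite integral0_eq// => x _; rewrite indicE memNset// => -[].
by apply: filterS => z nz; apply: contrapT => nQ; apply: nz; split => //; exact: QN.
Qed.

Lemma ae_mN_config (Q : config -> Prop) : {ae P, forall w, Q w} ->
  {ae mN, forall z, Q z.1.1}.
Proof. by move=> /ae_PN_fst; exact: ae_fst. Qed.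

Lemma ae_mN_mark (Q : X * M -> Prop) : measurable [set z | Q z] ->
  {ae NR, forall z, Q z} -> {ae mN, forall z, Q (z.1.2, z.2)}.
Proof.
move=> mQ hQ.
have mp : mfunT (fun z : CXM => (z.1.2, z.2)).
  by apply: measurable_fun_pair => //; apply: mcompT.
apply: mN_ae_of.
  by have := mp measurableT _ mQ; rewrite setTI.
by apply: aeW => w; apply: filterS hQ => -[].
Qed.

Lemma isK_ae F G K L : isK F K -> cmeasurable G -> cmeasurable L ->
  {ae P, forall w, F w = G w} -> {ae mN, forall z, K z = L z} -> isK G L.
Proof.
move=> [[mF /cnorm2_lty F2] mK [F_ [k_ [hk hF hK]]]] mG mL FG KL.
have m n := D0k_facts (hk n).
split => //; first by split => //; apply/cnorm2_lty; rewrite -(ae_csq mF mG FG).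
exists F_, k_; split => //.
- apply: to0_ext hF => n; have [mFn _ _ _] := m n.
  apply: ae_csq; [exact: cmeasurableB|exact: cmeasurableB|].
  by apply: filterS FG => w ->.
- apply: to0_ext hK => n; have [_ _ mkn _] := m n.
  apply: ae_csq; [exact: cmeasurableB|exact: cmeasurableB|].
  by apply: filterS KL => w ->.
Qed.

Lemma csq_lin_to0 d' (T : measurableType d') (mu : {measure set T -> \bar R}) (a : R[i])
    (f_ g_ : nat -> T -> R[i]) (f g : T -> R[i]) :
  (forall n, cmeasurable (f_ n)) -> cmeasurable f -> (forall n, cmeasurable (g_ n)) ->
  cmeasurable g -> to0 (fun n => csq mu (fun x => f_ n x - f x)%R) ->
  to0 (fun n => csq mu (fun x => g_ n x - g x)%R) ->
  to0 (fun n => csq mu (fun x => (a * f_ n x + g_ n x) - (a * f x + g x))%R).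
Proof.
move=> mf_ mf mg_ mg hf hg.
apply: (to0_le (v := fun n => (2%:E * ((nsq a)%:E * csq mu (fun x => f_ n x - f x)%R) +
    2%:E * csq mu (fun x => g_ n x - g x)%R)%E)).
  move=> n.
  rewrite (_ : (fun x => _) = (fun x => a * (f_ n x - f x) + (g_ n x - g x))); last first.
    by apply/funext => x; rewrite mulrBr opprD addrACA.
  have mB := cmeasurableB (mf_ n) mf.
  rewrite -csqZ//; apply: csqD_le; last exact: cmeasurableB.
  by apply: cmeasurableM => //; exact: cmeasurable_cst.
apply: to0D; apply: to0Z => //.
- by move=> n; rewrite mule_ge0 ?csq_ge0// lee_fin nsq_ge0.
- by apply: to0Z => //; [move=> n; exact: csq_ge0|exact: nsq_ge0].
- by move=> n; exact: csq_ge0.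
Qed.

Lemma isK_lin (a : R[i]) F K G L : isK F K -> isK G L ->
  isK (fun w => a * F w + G w) (fun z => a * K z + L z).
Proof.
move=> [[mF /cnorm2_lty F2] mK [F_ [k_ [hk hF hK]]]] [[mG /cnorm2_lty G2] mL [G_ [l_ [hl hG hL]]]].
have m n := D0k_facts (hk n).
have m' n := D0k_facts (hl n).
have mZ d' (T : measurableType d') (f : T -> R[i]) : cmeasurable f -> cmeasurable (fun x => a * f x).
  by move=> mf; apply: cmeasurableM => //; exact: cmeasurable_cst.
split.
- split; first by apply: cmeasurableD => //; exact: mZ.
  apply/cnorm2_lty; apply: csqD_lty => //; first exact: mZ.
  by rewrite csqZ//; apply: lte_mul_pinfty => //; rewrite lee_fin nsq_ge0.
- by apply: cmeasurableD => //; exact: mZ.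
- exists (fun n w => a * F_ n w + G_ n w), (fun n z => a * k_ n z + l_ n z); split.
  + by move=> n; exact: D0k_lin.
  + by apply: csq_lin_to0 => // n; [have [] := m n|have [] := m' n].
  + by apply: csq_lin_to0 => // n; [have [] := m n|have [] := m' n].
Qed.

(** Diagonal choice: each pair is replaced by an element of D0 and its gradient at squared distance
    below 1/(n+1) for both norms. *)
Lemma isK_closed F_ K_ F K : (forall n, isK (F_ n) (K_ n)) -> cmeasurable F ->
  cmeasurable K -> to0 (fun n => csq P (fun w => F_ n w - F w)) ->
  to0 (fun n => csq mN (fun z => K_ n z - K z)) -> isK F K.
Proof.
move=> h mF mK hF hK.
have mFn n : cmeasurable (F_ n) by have [[]] := h n.
have mKn n : cmeasurable (K_ n) by have [] := h n.
have hn n : exists Gl : (config -> R[i]) * (CXM -> R[i]), [/\ D0k Gl.1 Gl.2,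
    (csq P (fun w => Gl.1 w - F_ n w)%R < (n.+1%:R^-1)%:E)%E &
    (csq mN (fun z => Gl.2 z - K_ n z)%R < (n.+1%:R^-1)%:E)%E].
  have [_ _ [G_ [l_ [hl hG hL]]]] := h n.
  have e0 : (0 : R) < n.+1%:R^-1 by rewrite invr_gt0.
  have [n1 h1] := hG _ e0; have [n2 h2] := hL _ e0.
  exists (G_ (maxn n1 n2), l_ (maxn n1 n2)); split => //=.
    by apply: h1; rewrite leq_maxl.
  by apply: h2; rewrite leq_maxr.
have /choice[g hg] := hn.
have inv0 : to0 (fun n => (n.+1%:R^-1 : R)%:E).
  move=> e e0; have [n0 hn0] := ltr_add_invr e0; rewrite add0r in hn0.
  exists n0 => n le; rewrite lte_fin; apply: le_lt_trans hn0.
  by rewrite lef_pV2 ?posrE ?ltr0n// ler_nat.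
have key d' (T : measurableType d') (mu : {measure set T -> \bar R}) (a b : nat -> T -> R[i])
    (c : T -> R[i]) : (forall n, cmeasurable (a n)) -> (forall n, cmeasurable (b n)) ->
    cmeasurable c -> (forall n, csq mu (fun x => a n x - b n x)%R < (n.+1%:R^-1)%:E)%E ->
    to0 (fun n => csq mu (fun x => b n x - c x)%R) ->
    to0 (fun n => csq mu (fun x => a n x - c x)%R).
  move=> ma mb mc hab hbc.
  apply: (to0_le (v := fun n => (2%:E * csq mu (fun x => a n x - b n x)%R +
    2%:E * csq mu (fun x => b n x - c x)%R)%E)).
    by move=> n; rewrite [X in (_ <= _ + 2%:E * X)%E]csqB; exact: csqB_tri.
  apply: to0D; apply: to0Z => //; try by move=> n; exact: csq_ge0.
  by apply: to0_le inv0 => n; exact/ltW/hab.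
have m n := D0k_facts (let: And3 x _ _ := hg n in x).
have hFg : to0 (fun n => csq P (fun w => (g n).1 w - F w)%R).
  by apply: (key _ _ P _ F_) => // n; [have [] := m n|have [] := hg n].
have hKg : to0 (fun n => csq mN (fun w => (g n).2 w - K w)%R).
  by apply: (key _ _ mN _ K_) => // n; [have [] := m n|have [] := hg n].
split => //; last first.
  by exists (fun n => (g n).1), (fun n => (g n).2); split => // n; have [] := hg n.
split => //; apply/cnorm2_lty; apply: (csq_lty_lim mFn mF) hF => n.
by apply/cnorm2_lty; have [[]] := h n.
Qed.

Lemma test_lin a f g : test_exponent f -> test_exponent g ->
  test_exponent (fun x => a * f x + g x).
Proof.
move=> tf tg; have [df fi _ _] := test_exponent_facts tf.
have [dg gi _ _] := test_exponent_facts tg.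
move: tf tg => [_ [af [_ /Lfun2P[maf af2] fE]]] [_ [ag [_ /Lfun2P[mag ag2] gE]]].
split.
  apply/Lfun1P; have := integrableD measurableT (integrableZl measurableT a fi) gi.
  by apply: eq_integrable.
have df' := dom_form.
exists (fun x => a * af x + ag x); split; first exact: (df_lin df').
  by apply/Lfun2P; apply: (sqint_lin a (conj maf af2) (conj mag ag2)).
move=> v dv; have sv : sqint nu v := dom_L2 dv.
rewrite (df_bilin df')// fE// gE// mulrN -opprD; congr (- _).
by rewrite -/(ip nu af v) -/(ip nu ag v) -ip_lin.
Qed.

Lemma test0 : test_exponent (cst 0).
Proof.
have df' := dom_form; have d0 := dom0.
split.
  by apply/Lfun1P; apply: eq_integrable (integrable0 _ _) => // x _.
exists (cst 0); split => //.
  by have [? ?] := dom_L2 d0; apply/Lfun2P.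
move=> v dv; have -> : \int[nu]_x (cst 0 x * v x) = 0.
  by rewrite /Rintegral integral0_eq// => x _; rewrite mul0r.
rewrite oppr0; have := df_bilin df' (-1) d0 d0 dv.
rewrite (_ : (fun x => _) = cst 0); last by apply/funext => x; rewrite mulr0 addr0.
by rewrite mulN1r addNr.
Qed.

Lemma testN f : test_exponent f -> test_exponent (fun x => - f x).
Proof.
move=> tf; have := test_lin (-1) tf test0; congr test_exponent.
by apply/funext => x; rewrite addr0 mulN1r.
Qed.

Lemma testD f g : test_exponent f -> test_exponent g -> test_exponent (fun x => f x + g x).
Proof.
move=> tf tg; have := test_lin 1 tf tg; congr test_exponent.
by apply/funext => x; rewrite mul1r.
Qed.

Lemma Ntilde1_cst0 : {ae P, forall w : config, Ntilde1 (cst 0) w = 0}.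
Proof.
have [_ i0 _ _] := test_exponent_facts test0.
have := Ntilde1B i0 i0.
by rewrite (_ : (fun x : X => cst (0 : R) x - _) = cst 0);
  [apply: filterS => w ->; rewrite subrr|apply/funext => x; rewrite subr0].
Qed.

Lemma Ntilde1N f : test_exponent f ->
  {ae P, forall w : config, Ntilde1 (fun x => - f x) w = - Ntilde1 f w}.
Proof.
move=> tf; have [_ i0 _ _] := test_exponent_facts test0.
have [_ fi _ _] := test_exponent_facts tf.
have := Ntilde1B i0 fi.
rewrite (_ : (fun x : X => cst (0 : R) x - _) = (fun x => - f x)); last first.
  by apply/funext => x; rewrite sub0r.
by apply: filterS2 Ntilde1_cst0 => w -> ->; rewrite sub0r.
Qed.

Lemma Ntilde1D f g : test_exponent f -> test_exponent g ->
  {ae P, forall w : config, Ntilde1 (fun x => f x + g x) w = Ntilde1 f w + Ntilde1 g w}.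
Proof.
move=> tf tg; have [_ fi _ _] := test_exponent_facts tf.
have [_ gi _ _] := test_exponent_facts (testN tg).
have := Ntilde1B fi gi; apply: filterS2 (Ntilde1N tg) => w ->; rewrite opprK.
by under [in LHS]eq_fun do rewrite opprK.
Qed.

Lemma flat_opp_ae f : d f -> {ae NR, forall z, flat (fun x => - f x) z = - flat f z}.
Proof.
move=> df; have := flatB dom0 df.
rewrite (_ : (fun x : X => cst (0 : R) x - _) = (fun x => - f x)); last first.
  by apply/funext => x; rewrite sub0r.
by apply: filterS2 flat_cst0 => z -> ->; rewrite sub0r.
Qed.

Lemma flatD_ae f g : d f -> d g ->
  {ae NR, forall z, flat (fun x => f x + g x) z = flat f z + flat g z}.
Proof.
move=> df dg; have := gr_lin grad 1 df dg.
rewrite (_ : (fun x : X => _ + _) = (fun x => f x + g x)); last first.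
  by apply/funext => x; rewrite mul1r.
by apply: filterS => z ->; rewrite mul1r.
Qed.

Lemma isK_sum m (F : 'I_m.+1 -> config -> R[i]) (K : 'I_m.+1 -> CXM -> R[i]) :
  (forall p, isK (F p) (K p)) ->
  isK (fun w => \sum_p F p w) (fun z => \sum_p K p z).
Proof.
elim: m F K => [|m IH] F K h.
  under eq_fun do rewrite big_ord1; under [X in isK _ X]eq_fun do rewrite big_ord1.
  exact: h.
have := isK_lin 1 (IH _ _ (fun p => h (widen_ord (leqnSn m.+1) p))) (h ord_max).
congr isK; apply/funext => w; rewrite mul1r [RHS]big_ord_recr /=; congr (_ + _);
  by apply: eq_bigr => i _; congr (_ _ _); exact: val_inj.
Qed.

Lemma isK_scale (a : R[i]) F K : isK F K -> isK (fun w => a * F w) (fun z => a * K z).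
Proof.
move=> h; have := isK_lin (a - 1) h h; congr isK; apply/funext => w;
  by rewrite mulrBl mul1r subrK.
Qed.

Definition kap1 f (z : CXM) : R[i] :=
  expN f z.1.1 * (flat f (z.1.2, z.2))%:C%C.

Lemma kap1_measurable f : test_exponent f -> cmeasurable (kap1 f).
Proof. by move=> tf; have [df _ _ _] := test_exponent_facts tf; exact: (kap_term_measurable df). Qed.

Lemma isK_expN f : test_exponent f -> isK (expN f) (fun z => iC * kap1 f z).
Proof.
move=> tf; apply: isK_D0k.
exists 0%N, (fun=> 1), (fun=> f); split => //; apply/funext => z.
  by rewrite /expsum big_ord1 mul1r.
by rewrite /kap big_ord1 mulr1.
Qed.

Lemma expN_lift f : test_exponent f -> cmeasurable (fun z : CXM => expN f z.1.1).
Proof.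
move=> tf; have [_ _ mf _] := test_exponent_facts tf.
by apply: (cmeasurable_comp (h := fun z : CXM => z.1.1) (expN_measurable mf));
  apply: mcompT.
Qed.

(** The product is the exponential of f + g up to a null set, and the Leibniz rule is additivity of
    flat. *)
Lemma isK_expNM f g : test_exponent f -> test_exponent g ->
  isK (fun w => expN f w * expN g w)
    (fun z => expN f z.1.1 * (iC * kap1 g z) + expN g z.1.1 * (iC * kap1 f z)).
Proof.
move=> tf tg; have tfg := testD tf tg.
have [df _ mf _] := test_exponent_facts tf.
have [dg _ mg _] := test_exponent_facts tg.
have [dfg _ mfg _] := test_exponent_facts tfg.
have mi f' : test_exponent f' -> cmeasurable (fun z => iC * kap1 f' z).
  by move=> t; apply: cmeasurableM; [exact: cmeasurable_cst|exact: kap1_measurable].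
apply: (isK_ae (isK_expN tfg)).
- by apply: cmeasurableM; exact: expN_measurable.
- by apply: cmeasurableD; apply: cmeasurableM; [exact: expN_lift|exact: mi|exact: expN_lift|exact: mi].
- by apply: filterS (Ntilde1D tf tg) => w h; rewrite /expN h expiD.
- have h1 := ae_mN_config (Ntilde1D tf tg).
  have h2 : {ae mN, forall z, flat (fun x => f x + g x) (z.1.2, z.2) =
      flat f (z.1.2, z.2) + flat g (z.1.2, z.2)}.
    apply: (ae_mN_mark (Q := fun y => flat (fun x => f x + g x) y = flat f y + flat g y)).
      apply: measurable_eq_set; first exact: flat_measurable.
      by apply: measurable_funD; exact: flat_measurable.
    exact: flatD_ae.
  apply: filterS2 h1 h2 => z e1 e2; rewrite /kap1 /expN e1 e2 expiD rmorphD /=.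
  ring.
Qed.

Lemma isK_conj_expN f : test_exponent f ->
  isK (fun w => (expN f w)^*%C) (fun z => (iC * kap1 f z)^*%C).
Proof.
move=> tf; have tn := testN tf.
have [df _ mf _] := test_exponent_facts tf.
have [dn _ mn _] := test_exponent_facts tn.
apply: (isK_ae (isK_expN tn)).
- by apply: cmeasurable_conj; exact: expN_measurable.
- apply: cmeasurable_conj; apply: cmeasurableM; [exact: cmeasurable_cst|exact: kap1_measurable].
- by apply: filterS (Ntilde1N tf) => w h; rewrite /expN h expiN.
- have h1 := ae_mN_config (Ntilde1N tf).
  have h2 : {ae mN, forall z, flat (fun x => - f x) (z.1.2, z.2) = - flat f (z.1.2, z.2)}.
    apply: (ae_mN_mark (Q := fun y => flat (fun x => - f x) y = - flat f y)).
      apply: measurable_eq_set; first exact: flat_measurable.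
      by apply: mcompT => //; exact: flat_measurable.
    exact: flat_opp_ae.
  apply: filterS2 h1 h2 => z e1 e2; rewrite /kap1 /expN e1 e2 expiN.
  case: (expi _) => a b.
  by apply/eqP; rewrite eq_complex /=; apply/andP; split; apply/eqP; ring.
Qed.

(** Leibniz rule on D0, required for the products u h and u^2 in the identity that characterizes the
    carre du champ. *)
Lemma D0k_isKM F k G l : D0k F k -> D0k G l ->
  isK (fun w => F w * G w) (fun z => F z.1.1 * l z + G z.1.1 * k z).
Proof.
move=> [m [lam [f [tf -> ->]]]] [n [mu [g [tg -> ->]]]].
have := isK_sum (fun p => isK_sum (fun q => isK_scale (lam p * mu q) (isK_expNM (tf p) (tg q)))).
congr isK; apply/funext => z.
  rewrite /expsum mulr_suml; apply: eq_bigr => p _; rewrite mulr_sumr.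
  by apply: eq_bigr => q _; rewrite mulrACA.
rewrite /expsum /kap -/kap1 2!mulr_suml.
transitivity (\sum_p \sum_q (lam p * expN (f p) z.1.1 * (iC * mu q * kap1 (g q) z)) +
    \sum_q \sum_p (mu q * expN (g q) z.1.1 * (iC * lam p * kap1 (f p) z))).
  rewrite [X in _ = _ + X]exchange_big -big_split; apply: eq_bigr => p _ /=.
  rewrite -big_split; apply: eq_bigr => q _ /=; ring.
by congr (_ + _); apply: eq_bigr => p _; rewrite mulr_sumr.
Qed.

Lemma conjcD (a b : R[i]) : ((a + b)^*)%C = (a^* + b^*)%C.
Proof. by case: a b => [a1 a2] [b1 b2]; rewrite /= opprD. Qed.

Lemma conjc_sum m (F : 'I_m -> R[i]) : ((\sum_p F p)^*)%C = \sum_p (F p)^*%C.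
Proof. by apply: (big_morph (fun z : R[i] => z^*%C) conjcD); rewrite /= oppr0. Qed.

Lemma D0k_isK_conj F k : D0k F k -> isK (fun w => (F w)^*%C) (fun z => (k z)^*%C).
Proof.
move=> [m [lam [f [tf -> ->]]]].
have := isK_sum (fun p => isK_scale (lam p)^*%C (isK_conj_expN (tf p))).
congr isK; apply/funext => z.
  by rewrite /expsum conjc_sum; apply: eq_bigr => p _; rewrite conjcM.
have aux (a b c : R[i]) : a^*%C * (b * c)^*%C = (b * a * c)^*%C.
  case: a b c => [a1 a2] [b1 b2] [c1 c2].
  by apply/eqP; rewrite eq_complex /=; apply/andP; split; apply/eqP; ring.
rewrite /kap conjc_sum; apply: eq_bigr => p _.
rewrite -[RHS]/((iC * lam p * kap1 (f p) z)^*%C) -[X in _ * X = _]/((iC * kap1 (f p) z)^*%C).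
exact: aux.
Qed.

Lemma isK_conj F K : isK F K -> isK (fun w => (F w)^*%C) (fun z => (K z)^*%C).
Proof.
move=> [[mF F2] mK [F_ [k_ [hk hF hK]]]].
apply: (isK_closed (fun n => D0k_isK_conj (hk n))).
- exact: cmeasurable_conj.
- exact: cmeasurable_conj.
- by apply: to0_ext hF => n; rewrite -csq_conj; under [in RHS]eq_fun do rewrite -rmorphB.
- by apply: to0_ext hK => n; rewrite -csq_conj; under [in RHS]eq_fun do rewrite -rmorphB.
Qed.

Lemma Re_half (z : R[i]) : (Re z)%:C%C = (2^-1)%:C%C * z + (2^-1)%:C%C * z^*%C.
Proof.
case: z => a b; apply/eqP; rewrite eq_complex /=; apply/andP; split; apply/eqP; by field.
Qed.

Lemma isK_Re F K : isK F K -> isK (fun w => (Re (F w))%:C%C) (fun z => (Re (K z))%:C%C).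
Proof.
move=> h; have := isK_lin (2^-1)%:C%C h (isK_scale (2^-1)%:C%C (isK_conj h)).
by congr isK; apply/funext => z; rewrite Re_half.
Qed.

Lemma isK_Im F K : isK F K -> isK (fun w => (Im (F w))%:C%C) (fun z => (Im (K z))%:C%C).
Proof.
move=> h; have := isK_Re (isK_scale (- iC) h).
congr isK; apply/funext => z; congr (_%:C)%C.
  by case: (F z) => a b /=; ring.
by case: (K z) => a b /=; ring.
Qed.

End UpAlgebra.

(** * Exponentials separate L1(P) *)

Section Density.
Implicit Types g h : X -> R.

(** The exponents reached from the test exponents by L2 limits. They include the indicators of sets
    of finite measure, which need not lie in [d]. *)
Definition approximable g := [/\ integrableT nu g, sqint nu g &
  exists2 f_ : nat -> X -> R, forall n, test_exponent (f_ n) &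
    to0 (fun n => csq nu (fun x => (f_ n x)%:C%C - (g x)%:C%C))].

Lemma approximable_lin a g h : approximable g -> approximable h ->
  approximable (fun x => a * g x + h x).
Proof.
move=> [gi gs [f_ tf hf]] [hi hs [k_ tk hk]]; split.
- have := integrableD measurableT (integrableZl measurableT a gi) hi.
  by apply: eq_integrable.
- exact: sqint_lin.
- exists (fun n x => a * f_ n x + k_ n x); first by move=> n; exact: test_lin.
  have m n : cmeasurable (fun x => (f_ n x)%:C%C).
    by apply: cmeasurable_real; have [] := test_exponent_facts (tf n).
  have m' n : cmeasurable (fun x => (k_ n x)%:C%C).
    by apply: cmeasurable_real; have [] := test_exponent_facts (tk n).
  have [mg _] := gs; have [mh _] := hs.
  have := csq_lin_to0 a%:C%C m (cmeasurable_real mg) m' (cmeasurable_real mh) hf hk.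
  by apply: to0_ext => n; congr csq; apply/funext => x; rewrite !rmorphD !rmorphM.
Qed.

Lemma approximable_indic (B : set X) : measurable B -> (nu B < +oo)%E ->
  approximable \1_B.
Proof.
move=> mB Boo; have sB := sqint_indic mB Boo; split => //.
  apply/integrableP; split; first by apply/mEFinP; exact: measurable_indic.
  apply: le_lt_trans Boo; rewrite measure_integral_indic//.
  rewrite le_eqVlt; apply/orP; left; apply/eqP/eq_integral => x _ /=.
  by rewrite ger0_norm// indicE.
have /choice[u hu] : forall n : nat, exists u, test_exponent u /\
    (\int[nu]_x ((u x - \1_B x) ^+ 2)%:E < (n.+1%:R^-1)%:E)%E.
  move=> n; have e0 : 0 < n.+1%:R^-1 :> R by rewrite invr_gt0.
  by have [u [? ? ?]] := generator_approx_indic dom_form mB Boo e0; exists u.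
exists u; first by move=> n; have [] := hu n.
move=> e e0; have [n0 hn0] := ltr_add_invr e0; rewrite add0r in hn0.
exists n0 => n le; have [_ h] := hu n.
rewrite (_ : csq _ _ = \int[nu]_x ((u n x - \1_B x) ^+ 2)%:E)%E; last first.
  by rewrite -csq_real; congr csq; apply/funext => x; rewrite rmorphB.
apply: (lt_trans h); rewrite lte_fin; apply: le_lt_trans hn0.
by rewrite lef_pV2 ?posrE ?ltr0n// ler_nat.
Qed.

Lemma Ntilde1_indic (t : R) (B : set X) g : measurable B -> (nu B < +oo)%E ->
  integrableT nu g ->
  {ae P, forall w : config, Ntilde1 (fun x => t * \1_B x + g x) w =
    Ntilde1 g w + t * (fine (w B) - fine (nu B))}.
Proof.
move=> mB Boo gi; have [Bi _ _] := approximable_indic mB Boo.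
have ti : integrableT nu (fun x => - t * \1_B x).
  by have := integrableZl measurableT (- t) Bi; apply: eq_integrable.
have h1 := Ntilde1B gi ti; have h2 := integrable_config Bi.
have ind (m : {measure set X -> \bar R}) : \int[m]_x (\1_B x : R) = fine (m B).
  by rewrite /Rintegral -measure_integral_indic.
apply: filterS2 h1 h2 => w; rewrite (_ : (fun x => g x - _) = (fun x => t * \1_B x + g x)).
  move=> -> h2; congr (_ + _); rewrite {1}/Defs.Ntilde1 /intN !RintegralZl// !ind.
  by ring.
by apply/funext => x; rewrite mulNr opprK addrC.
Qed.

Variable G : config -> R.
Hypothesis Gi : integrableT P G.
Hypothesis Gperp : forall f, test_exponent f ->
  cintegral P (fun w => expN f w * (G w)%:C%C) = 0.

Let mG : mfunT G.
Proof. by apply/mEFinP; exact: measurable_int Gi. Qed.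

Lemma integral_dominated_cvg (f_ : nat -> config -> R) (f : config -> R) :
  (forall n w, `|f_ n w| <= 1) -> (forall w, `|f w| <= 1) ->
  (forall n, mfunT (f_ n)) -> mfunT f ->
  {ae P, forall w, f_ n w @[n --> \oo] --> f w} ->
  (forall n, \int[P]_w (f_ n w * G w) = 0) -> \int[P]_w (f w * G w) = 0.
Proof.
move=> b_ b m_ m ha h0.
have int (h : config -> R) : mfunT h -> (forall w, `|h w| <= 1) ->
    integrableT P (fun w => h w * G w).
  move=> mh h1; apply: (integrable_le _ _ Gi); first exact: measurable_funM.
  by move=> w; rewrite normrM ler_piMl.
have ctr : to0 (fun n => \int[P]_w (`|f_ n w - f w| * `|G w|)%:E)%E.
  apply: (dct_to0 (g := fun w => 2 * `|G w|)).
  - by move=> n; apply: measurable_funM; apply: mcompT => //; exact: measurable_funB.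
  - by apply: measurable_funM => //; exact: mcompT.
  - by move=> n w; rewrite mulr_ge0.
  - move=> n w; rewrite ler_wpM2r//; apply: le_trans (ler_normB _ _) _.
    by have := b_ n w; have := b w; lra.
  - rewrite integral_EFinZ//; last exact: mcompT.
    have /integrableP[_ hG] := Gi; exact: lte_mul_pinfty.
  - apply: filterS ha => w hw.
    have h2 : f_ n w - f w @[n --> \oo] --> 0.
      by rewrite -(subrr (f w)); apply: cvgB => //; exact: cvg_cst.
    have := cvgM (cvg_norm h2) (cvg_cst `|G w|).
    by rewrite normr0 mul0r; apply.
apply/eqP; rewrite -normr_le0; apply/ler_addgt0Pr => e e0; rewrite add0r.
have [n0 hn] := ctr e e0; have := hn n0 (leqnn _).
have -> : \int[P]_w (f w * G w) = - \int[P]_w ((f_ n0 w - f w) * G w).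
  transitivity (- (\int[P]_w (f_ n0 w * G w) - \int[P]_w (f w * G w))).
    by rewrite h0 sub0r opprK.
  rewrite -RintegralB//; [|exact: int|exact: int].
  by congr (- _); apply: eq_Rintegral => w _; rewrite mulrBl.
rewrite normrN => /ltW le.
have iB : integrableT P (fun w => (f_ n0 w - f w) * G w).
  have := integrableB measurableT (int _ (m_ n0) (b_ n0)) (int _ m b).
  by apply: eq_integrable => // w _ /=; rewrite mulrBl.
apply: le_trans (le_normr_Rintegral _ iB) _ => //.
rewrite -lee_fin /Rintegral fineK; last first.
  by apply: integrable_fin_num => //; have := integrable_norm iB; apply.
by apply: le_trans le; apply: le_lower_integral => w; rewrite lee_fin ?normr_ge0// normrM.
Qed.

(** L2 convergence of the exponents gives that of the compensated sums, hence almost sure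
    convergence along a subsequence; cosine and sine are bounded, so dominated convergence by |G|
    applies. *)
Lemma approximable_perp g : approximable g ->
  cintegral P (fun w => expN g w * (G w)%:C%C) = 0.
Proof.
move=> [gi [mg g2] [f_ tf hf]].
have fact n := test_exponent_facts (tf n).
have mN n : mfunT (Ntilde1 (f_ n)).
  by apply: measurable_Ntilde1; have [] := fact n.
have mNg : mfunT (Ntilde1 g) by exact: measurable_Ntilde1.
have mh n : mfunT (fun w => ((Ntilde1 (f_ n) w - Ntilde1 g w) ^+ 2)%:E).
  by apply/mEFinP; apply: measurable_funX; exact: measurable_funB.
have h0 n w : (0 <= ((Ntilde1 (f_ n) w - Ntilde1 g w) ^+ 2)%:E)%E by rewrite lee_fin sqr_ge0.
have lim : to0 (fun n => \int[P]_w ((Ntilde1 (f_ n) w - Ntilde1 g w) ^+ 2)%:E)%E.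
  apply: to0_le (to0Z (fun n => csq_ge0 _ _) (ler0n R 2) hf) => n.
  have [_ fi mf f2] := fact n.
  have fgi : integrableT nu (fun x => f_ n x - g x).
    by have := integrableB measurableT fi gi.
  have E : (csq nu (fun x => (f_ n x)%:C%C - (g x)%:C%C)%R = \int[nu]_x ((f_ n x - g x) ^+ 2)%:E)%E.
    by rewrite -csq_real; congr csq; apply/funext => x; rewrite rmorphB.
  rewrite E; have fg2 : (\int[nu]_x ((f_ n x - g x) ^+ 2)%:E < +oo)%E.
    rewrite -E; apply: csqB_lty; [exact: cmeasurable_real|exact: cmeasurable_real| |];
    by rewrite csq_real.
  apply: le_trans (Ntilde1_sqr_le fgi fg2).
  rewrite le_eqVlt; apply/orP; left; apply/eqP; apply: ae_eq_integral => //.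
    by apply/mEFinP; apply: measurable_funX; apply: measurable_Ntilde1; exact: measurable_funB.
  by apply: filterS (Ntilde1B fi gi) => w -> _.
have [phi_ _ hphi] := to0_ae_subseq mh h0 lim.
have cv : {ae P, forall w, Ntilde1 (f_ (phi_ n)) w @[n --> \oo] --> Ntilde1 g w}.
  apply: filterS hphi => w hw; apply/cvgrPdist_lt => e e0.
  have [n0 hn0] := hw (e ^+ 2) (exprn_gt0 _ e0).
  exists n0 => // n /= hn; have := hn0 n hn.
  rewrite lte_fin -real_normK ?num_real// ltr_pXn2r ?nnegrE// ?normr_ge0 ?(ltW e0)//.
  by rewrite distrC.
have zero n : cintegral P (fun w => expN (f_ (phi_ n)) w * (G w)%:C%C) = 0 by exact: Gperp.
have part (phi : R -> R) (p : R[i] -> R) : continuous phi -> (forall t, `|phi t| <= 1) ->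
    (forall h : config -> R, mfunT h -> mfunT (fun w : config => phi (h w))) ->
    (forall t u, p (expi t * u%:C%C) = phi t * u) ->
    (forall n, \int[P]_w p (expN (f_ (phi_ n)) w * (G w)%:C%C) = 0) ->
    \int[P]_w p (expN g w * (G w)%:C%C) = 0.
  move=> cphi b m pE z.
  have -> : \int[P]_w p (expN g w * (G w)%:C%C) = \int[P]_w (phi (Ntilde1 g w) * G w).
    by apply: eq_Rintegral => w _; rewrite /expN pE.
  apply: (integral_dominated_cvg (f_ := fun n w => phi (Ntilde1 (f_ (phi_ n)) w))) => //.
  - by move=> n; exact: m.
  - exact: m.
  - by apply: filterS cv => w hw; exact: (continuous_cvg _ (cphi _) hw).
  - by move=> n; rewrite -[RHS](z n); apply: eq_Rintegral => w _; rewrite /expN pE.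
have hr := part (@cos R) (fun z => Re z) (@continuous_cos R) (@cos_le1_norm R)
  (fun (b : config -> R) mb => measurable_cos mb) (fun t u => ReM_real (expi t) u)
  (fun n => congr1 (fun z => Re z) (zero n)).
have hi := part (@sin R) (fun z => Im z) (@continuous_sin R) (@sin_le1_norm R)
  (fun (b : config -> R) mb => measurable_sin mb) (fun t u => ImM_real (expi t) u)
  (fun n => congr1 (fun z => Im z) (zero n)).
by rewrite /cintegral hr hi.
Qed.

(** Multipliers that keep G orthogonal to all exponentials. Requiring this for every exponent, and
    not only for 0, is what allows factors to be added one at a time. *)
Definition annihilated (Phi : config -> R) := [/\ mfunT Phi,
  forall w, `|Phi w| <= 1 & forall g, approximable g ->
    cintegral P (fun w => expN g w * (Phi w * G w)%:C%C) = 0].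

Definition count_factor (B : set X) (t : R) (k : nat) (w : config) : R :=
  (1 + cos (t * (fine (w B) - k%:R))) / 2.

Lemma count_factor_measurable B t k : measurable B ->
  mfunT (count_factor B t k).
Proof.
move=> mB; apply: measurable_funM => //; apply: measurable_funD => //.
apply: measurable_cos; apply: measurable_funM => //; apply: measurable_funB => //.
by apply: mcompT => //; exact: measurable_config_eval.
Qed.

Lemma count_factor_itv B t k w : 0 <= count_factor B t k w <= 1.
Proof.
have := cos_le1_norm (t * (fine (w B) - k%:R)); rewrite ler_norml => /andP[? ?].
by rewrite /count_factor; apply/andP; split; lra.
Qed.

Lemma annihilatedM Phi B t k : measurable B -> (nu B < +oo)%E ->
  annihilated Phi -> annihilated (fun w => count_factor B t k w * Phi w).
Proof.
move=> mB Boo [mPhi Phi1 h]; split.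
- by apply: measurable_funM => //; exact: count_factor_measurable.
- move=> w; have /andP[c0 c1] := count_factor_itv B t k w.
  by rewrite normrM mulr_ile1// ger0_norm.
move=> g ag; have [gi [mg _] _] := ag.
have aB := approximable_indic mB Boo.
have ap := approximable_lin t aB ag; have am := approximable_lin (- t) aB ag.
have [pi' [mp _] _] := ap; have [mi' [mm _] _] := am.
have iPG : integrableT P (fun w => Phi w * G w).
  apply: (integrable_le _ _ Gi); first exact: measurable_funM.
  by move=> w; rewrite normrM ler_piMl.
have mPG : mfunT (fun w => Phi w * G w) by exact: measurable_funM.
have ci g' : mfunT g' ->
    cintegrable P (fun w => expN g' w * (Phi w * G w)%:C%C).
  by move=> mg'; apply: cintegrable_expiM => //; exact: measurable_Ntilde1.
(* The phase between the centred count, which the compensated sum produces, and the count minus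
   k. *)
pose c := expi (t * (fine (nu B) - k%:R)).
pose rhs w := (2^-1)%:C%C * (expN g w * (Phi w * G w)%:C%C) +
  ((4^-1)%:C%C * c * (expN (fun x => t * \1_B x + g x) w * (Phi w * G w)%:C%C) +
   (4^-1)%:C%C * c^*%C * (expN (fun x => - t * \1_B x + g x) w * (Phi w * G w)%:C%C)).
have cig := cintegrableZ (2^-1)%:C%C (ci _ mg).
have cip := cintegrableZ ((4^-1)%:C%C * c) (ci _ mp).
have cim := cintegrableZ ((4^-1)%:C%C * c^*%C) (ci _ mm).
have cir := cintegrableD cig (cintegrableD cip cim).
have mc := count_factor_measurable t k mB.
transitivity (cintegral P rhs).
  apply: ae_cintegral.
  - apply: cmeasurableM; first exact: expN_measurable.
    by apply: cmeasurable_real; apply: measurable_funM => //; exact: measurable_funM.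
  - exact: cintegrable_measurable cir.
  - apply: filterS2 (Ntilde1_indic t mB Boo gi) (Ntilde1_indic (- t) mB Boo gi) => w e1 e2.
    rewrite /rhs /expN e1 e2.
    have -> : (count_factor B t k w * Phi w * G w)%:C%C =
        (count_factor B t k w)%:C%C * (Phi w * G w)%:C%C by rewrite -mulrA rmorphM.
    rewrite mulrA expi_half_cos.
    have -> : expi (Ntilde1 g w + t * (fine (w B) - k%:R)) =
        c * expi (Ntilde1 g w + t * (fine (w B) - fine (nu B))).
      by rewrite /c -expiD; congr expi; ring.
    have -> : expi (Ntilde1 g w - t * (fine (w B) - k%:R)) =
        c^*%C * expi (Ntilde1 g w + - t * (fine (w B) - fine (nu B))).
      by rewrite /c -expiN -expiD; congr expi; ring.
    move: (expi _) (expi _) (expi _) (_%:C%C) => x1 x2 x3 x4; ring.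
rewrite /rhs cintegralD//; last exact: cintegrableD.
by rewrite cintegralD// !cintegralZ; [|exact: ci|exact: ci|exact: ci]; rewrite !h// !mulr0 !addr0.
Qed.

Lemma annihilated_prod (I : Type) (s : seq I) (B : I -> set X) (t : I -> R) (k : I -> nat) :
  (forall i, measurable (B i) /\ (nu (B i) < +oo)%E) ->
  annihilated (fun w => \prod_(i <- s) count_factor (B i) (t i) (k i) w).
Proof.
move=> hB; elim: s => [|i s IH].
  split.
  - by under eq_fun do rewrite big_nil; exact: measurable_cst.
  - by move=> w; rewrite big_nil normr1.
  move=> g /approximable_perp <-; congr cintegral; apply/funext => w.
  by rewrite big_nil mul1r.
under eq_fun do rewrite big_cons.
by have [mB Boo] := hB i; exact: annihilatedM.
Qed.

Lemma annihilated_integral Phi : annihilated Phi -> \int[P]_w (Phi w * G w) = 0.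
Proof.
move=> [mPhi Phi1 h]; have t0 := test0.
have [_ i0 m0 q0] := test_exponent_facts t0.
have a0 : approximable (cst 0).
  split => //; exists (fun=> cst 0) => // e e0; exists 0%N => n _.
  by rewrite /csq integral0_eq// => x _; rewrite subrr nsq0.
have mPG : mfunT (fun w => Phi w * G w) by exact: measurable_funM.
have E : cintegral P (fun w => (Phi w * G w)%:C%C) = 0.
  rewrite -(h _ a0); apply: ae_cintegral.
  - exact: cmeasurable_real.
  - by apply: cmeasurableM; [exact: expN_measurable|exact: cmeasurable_real].
  - by apply: filterS Ntilde1_cst0 => w e; rewrite /expN e expi0 mul1r.
by move: E; rewrite cintegral_real => /(congr1 (fun z => Re z)).
Qed.

Lemma count_event_integral C : count_events nu C -> (\int[P]_(w in C) (G w)%:E = 0)%E.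
Proof.
move=> hC; have mC := count_events_measurable hC; move: hC => [n [B [k [hB CE]]]].
pose s L := [seq (i, m) | i <- enum 'I_n, m <- iota 0 L].
(* Equal to 1 on the event for every [L]. Off the event, when the counts are finite,
   [vanishing_factor] makes one factor zero once [L] exceeds its index. *)
pose Phi L w := \prod_(p <- s L) count_factor (B p.1) (pi / 2 ^+ p.2) (k p.1) w.
have aPhi L : annihilated (Phi L).
  apply: (annihilated_prod (s L) (B := fun p => B p.1) (fun p => pi / 2 ^+ p.2) (fun p => k p.1)).
  by move=> p; exact: hB.
have fin : {ae P, forall w : config, forall i, (w (B i) < +oo)%E}.
  apply: filter_forall => i; have [mB Boo] := hB i.
  have [Bi _ _] := approximable_indic mB Boo.
  apply: filterS (integrable_config Bi) => w /integrableP[_].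
  rewrite (eq_integral (fun x => (\1_(B i) x : R)%:E)); last first.
    by move=> x _ /=; rewrite ger0_norm// indicE.
  by rewrite -measure_integral_indic.
have iC : P.-integrable C (EFin \o G) by apply: integrableS Gi.
suff h : \int[P]_w (\1_C w * G w) = 0.
  have iG : integrableT P (fun w => \1_C w * G w).
    apply: (integrable_le _ _ Gi); first by apply: measurable_funM => //; exact: measurable_indic.
    by move=> w; rewrite normrM ler_piMl// indicE ger0_norm// lern1 leq_b1.
  have <- : (\int[P]_w (\1_C w * G w)%:E = \int[P]_(w in C) (G w)%:E)%E.
    rewrite [RHS]integral_mkcond; apply: eq_integral => w _; rewrite patchE indicE.
    by case: (w \in C); rewrite ?mul1r ?mul0r.
  by rewrite -(fineK (integrable_fin_num measurableT iG)) -/(Rintegral _ _ _) h.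
apply: (integral_dominated_cvg (f_ := Phi)).
- by move=> L; have [] := aPhi L.
- by move=> w; rewrite indicE ger0_norm// lern1 leq_b1.
- by move=> L; have [] := aPhi L.
- exact: measurable_indic.
- apply: filterS fin => w wfin.
  have nat_i i : exists p : nat, w (B i) = p%:R%:E.
    have [mB _] := hB i; have [woo|//] := config_nat w mB.
    by have := wfin i; rewrite woo ltxx.
  have [Cw|nCw] := pselect (C w).
    rewrite indicE mem_set// (_ : (fun L => Phi L w) = cst 1); first exact: cvg_cst.
    apply/funext => L; rewrite /Phi big1_seq// => p _; rewrite /count_factor.
    by move: Cw; rewrite CE => /(_ p.1) ->; rewrite /= subrr mulr0 cos0 divff.
  rewrite indicE memNset//.
  have [i hi] : exists i, w (B i) != (k i)%:R%:E.
    apply: contrapT => hn; apply: nCw; rewrite CE => i; apply/eqP.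
    by apply: contraT => hi; exfalso; apply: hn; exists i.
  have [p wp] := nat_i i.
  have pk : p != k i by apply: contra_neq hi => pk; rewrite wp pk.
  have [a ha] := vanishing_factor R pk.
  apply: cvg_near_cst; exists a.+1 => // L /= aL.
  apply/eqP; rewrite /Phi prodf_seq_eq0; apply/hasP; exists (i, a).
    by apply: allpairs_f; [rewrite mem_enum|rewrite mem_iota].
  by rewrite /= /count_factor wp ha subrr mul0r.
- by move=> L; exact: annihilated_integral.
Qed.

Lemma orthogonal_expN_ae0 : {ae P, forall w, G w = 0}.
Proof.
have main S : measurable S -> (\int[P]_(w in S) (G w)%:E = 0)%E.
  have iS (A : set config) : measurable A -> P.-integrable A (EFin \o G).
    by move=> mA; apply: integrableS Gi.
  move=> mS; move: (mS); rewrite (measurable_count_eventsE nu) => gS.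
  apply: (@dynkin_induction _ _ (count_events nu)
    (fun A => \int[P]_(w in A) (G w)%:E = 0)%E _ _ _ _ _ _ _ gS).
  - exact: measurable_count_eventsE.
  - exact: count_events_setI.
  - by apply: count_event_integral; exact: count_eventsT.
  - by move=> A; exact: count_event_integral.
  - move=> A mA A0; have T0 := count_event_integral (count_eventsT nu).
    have mA' := measurableC mA.
    have mU : measurable_fun (A `|` ~` A) (EFin \o G).
      by rewrite setUv; exact: measurable_int Gi.
    have dA : [disjoint A & ~` A] by apply/disj_setPS; rewrite setICr.
    by have := integral_setU P mA mA' mU dA; rewrite setUv /= T0 A0 add0e.
  - move=> F mF tF F0; rewrite integral_bigcup//; last by apply: iS; exact: bigcup_measurable.
    by rewrite eseries0// => i _ _; exact: F0.
have m0 : mfunT (cst 0%E : config -> \bar R) by exact: measurable_cst.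
have E : ae_eq P setT (EFin \o G) (cst 0%E).
  apply: (integral_ae_eq measurableT Gi m0) => A _ mA.
  by rewrite integral0; exact: main.
by apply: filterS E => w /(_ I)[].
Qed.

End Density.

(** * Identification of the carre du champ *)

Section CarreDuChamp.
Implicit Types (u v h : config -> R) (k l : CXM -> R).

Definition rK u k := isK (fun w => (u w)%:C%C) (fun z => (k z)%:C%C).

Lemma rK_DR u k : rK u k -> DR u.
Proof. by move=> h; apply/domD_isK; eexists; exact: h. Qed.

Lemma DR_rK u : DR u -> exists k, rK u k.
Proof. by move=> /domD_isK[K h]; exists (fun z => Re (K z)); exact: isK_Re h. Qed.

Lemma rK_sqint u k : rK u k -> sqint mN k.
Proof.
move=> h; have := isK_csq h; rewrite csq_real => k2; split => //.
by have [_ [m _] _] := h.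
Qed.

Lemma rK_lin a u k v l : rK u k -> rK v l ->
  rK (fun w => a * u w + v w) (fun z => a * k z + l z).
Proof.
move=> hu hv; have := isK_lin a%:C%C hu hv.
by congr isK; apply/funext => w; rewrite rmorphD rmorphM.
Qed.

Lemma rKB u k v l : rK u k -> rK v l ->
  rK (fun w => u w - v w) (fun z => k z - l z).
Proof.
move=> hu hv; have := rK_lin (-1) hv hu.
by congr rK; apply/funext => w; rewrite mulN1r addrC.
Qed.

Lemma rK_energy u k : rK u k ->
  fine (energy (fun w => (u w)%:C%C)) = 2^-1 * ip mN k k.
Proof.
by move=> h; rewrite (energyE h) csq_real -ipE//; exact: rK_sqint h.
Qed.

Lemma formRE u k v l : rK u k -> rK v l -> formR u v = 2^-1 * ip mN k l.
Proof.
move=> hu hv; have sk := rK_sqint hu; have sl := rK_sqint hv.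
have e1 := rK_energy (rK_lin 1 hu hv); have e2 := rK_energy (rK_lin (-1) hv hu).
have E1 : (fun w => (u w + v w)%:C%C) = (fun w => (1 * u w + v w)%:C%C).
  by apply/funext => w; rewrite mul1r.
have E2 : (fun w => (u w - v w)%:C%C) = (fun w => (-1 * v w + u w)%:C%C).
  by apply/funext => w; rewrite mulN1r addrC.
rewrite /Defs.formR E1 E2 e1 e2.
rewrite !ip_sqr// (ipC _ l k).
move: (ip mN k k) (ip mN k l) (ip mN l l) => a b c; by field.
Qed.

(** [b] is a finite measurable version of the integral of gamma against N, the candidate for
    Gamma. *)
Lemma slice_density (K : CXM -> R[i]) : cmeasurable K -> (csq mN K < +oo)%E ->
  exists b : config -> R, [/\ mfunT b, forall w, 0 <= b w,
    {ae P, forall w : config, (cm w).-integrable setT (fun x => (gsq K (w, x))%:E) /\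
      ((b w)%:E = \int[cm w]_x (gsq K (w, x))%:E)%E} &
    (\int[P]_w (b w)%:E = csq mN K)%E].
Proof.
move=> mK K2; have [mG _ Gtot] := gsq_facts mK K2.
have mGe : mfunT (fun z => (gsq K z)%:E) by exact/mEFinP.
have G0 z : (0 <= (gsq K z)%:E)%E by rewrite lee_fin gsq_ge0.
have [B [mB B0 hB]] := palm_slice mGe G0.
have Goo : (\int[PN]_z (gsq K z)%:E < +oo)%E by rewrite Gtot.
have fin := palm_lty mGe G0 Goo.
have bE : {ae P, forall w : config, (cm w).-integrable setT (fun x => (gsq K (w, x))%:E) /\
      ((fine (B w))%:E = \int[cm w]_x (gsq K (w, x))%:E)%E}.
  apply: filterS2 fin hB => w woo E; split.
    apply/integrableP; split.
      exact: (mcompT mGe (measurable_pair1 _)).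
    by rewrite (eq_integral (fun x => (gsq K (w, x))%:E))// => x _; rewrite gee0_abs.
  by rewrite -E fineK// ge0_fin_numE// integral_ge0.
exists (fun w => fine (B w)); split => //.
- exact: mcompT.
- by move=> w; rewrite fine_ge0.
- rewrite -Gtot (palm.2 _ mGe G0); apply/esym; apply: ae_ge0_integral_lower.
  + by move=> w; rewrite lee_fin fine_ge0.
  + by apply/mEFinP; exact: mcompT.
  + by apply: filterS bE => w [_ ->].
Qed.

Lemma weighted_slice (K : CXM -> R[i]) (b h : config -> R) : cmeasurable K ->
  (csq mN K < +oo)%E ->
  mfunT b -> (forall w, 0 <= b w) ->
  {ae P, forall w : config, ((b w)%:E = \int[cm w]_x (gsq K (w, x))%:E)%E} ->
  mfunT h -> (forall w, 0 <= h w) ->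
  (\int[mN]_z (h z.1.1 * nsq (K z))%:E = \int[P]_w (h w * b w)%:E)%E.
Proof.
move=> mK K2 mb b0 bE mh h0; have [mG GE _] := gsq_facts mK K2.
have mGe : mfunT (fun z => (gsq K z)%:E) by exact/mEFinP.
have mh1 : mfunT (fun z : config * X => h z.1) by exact: mcompT.
have mh2 : mfunT (fun z : CXM => h z.1.1).
  by apply: mcompT => //; apply: mcompT.
have mn := measurable_nsq mK.
have mhn : mfunT (fun z => (h z.1.1 * nsq (K z))%:E).
  by apply/mEFinP; exact: measurable_funM.
rewrite (fubini_tonelli1 _ mhn); last by move=> z; rewrite lee_fin mulr_ge0 ?nsq_ge0.
have mhG : mfunT (fun z => (h z.1 * gsq K z)%:E).
  by apply/mEFinP; exact: measurable_funM.
have hG0 z : (0 <= (h z.1 * gsq K z)%:E)%E by rewrite lee_fin mulr_ge0// gsq_ge0.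
transitivity (\int[PN]_z (h z.1 * gsq K z)%:E)%E.
  apply: ae_ge0_integral_lower => //.
  apply: filterS GE => z E; rewrite /fubini_F /= integral_EFinZ//.
  - by rewrite -E.
  - exact: (mcompT mn (measurable_pair1 _)).
  - by move=> r; exact: nsq_ge0.
rewrite (palm.2 _ mhG hG0); apply: ae_ge0_integral_lower.
- by move=> w; rewrite lee_fin mulr_ge0.
- by apply/mEFinP; exact: measurable_funM.
- apply: filterS bE => w E; rewrite EFinM E /= integral_EFinZ//.
  + exact: (mcompT mG (measurable_pair1 _)).
  + by move=> x; exact: gsq_ge0.
Qed.

Lemma D0k_conj F K' : D0k F K' -> exists F' L', D0k F' L' /\
  {ae P, forall w, F' w = (F w)^*%C}.
Proof.
move=> [m [lam [f [tf -> _]]]].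
exists (expsum nu (fun p => (lam p)^*%C) (fun p x => - f p x)),
  (kap (fun p => (lam p)^*%C) (fun p x => - f p x)); split.
  by exists m, (fun p => (lam p)^*%C), (fun p x => - f p x); split => // p; exact: testN.
have h : {ae P, forall w : config, forall p, Ntilde1 (fun x => - f p x) w = - Ntilde1 (f p) w}.
  by apply: filter_forall => p; exact: Ntilde1N.
apply: filterS h => w E; rewrite /expsum conjc_sum; apply: eq_bigr => p _.
by rewrite E expiN conjcM.
Qed.

Lemma D0k_Re F K' : D0k F K' -> exists F' L', [/\ D0k F' L',
  {ae P, forall w, F' w = (Re (F w))%:C%C} & {ae mN, forall z, L' z = (Re (K' z))%:C%C}].
Proof.
move=> hF; have [F1 [k1 [h1 e1]]] := D0k_conj hF.
(* Elements of D0 have at least one term, so zero is produced as F - F; it lets [D0k_lin] act as a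
   scalar multiplication. *)
have [F0 [K0 h0]] : exists F0 K0, D0k F0 K0 /\ F0 = (fun=> 0) /\ K0 = (fun=> 0).
  exists (F - F), (fun z => K' z - K' z); split; first exact: D0kB.
  by split; apply/funext => z; rewrite ?subrr// fctE subrr.
have [h00 [F00 k00]] := h0; subst F0 K0.
have h2 := D0k_lin (2^-1)%:C%C h1 h00; have h3 := D0k_lin (2^-1)%:C%C hF h2.
eexists; eexists; split; first exact: h3.
  by apply: filterS e1 => w E; rewrite E addr0 Re_half.
have mR : cmeasurable (fun w => (Re (F w))%:C%C).
  by have [[m _] _ _ _] := D0k_facts hF; exact: cmeasurable_real.
have [mF3 _ mk3 _] := D0k_facts h3.
have a3 : isK (fun w => (Re (F w))%:C%C) (fun z => (2^-1)%:C%C * K' z + ((2^-1)%:C%C * k1 z + 0)).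
  apply: (isK_ae (isK_D0k h3) mR mk3); last by apply: aeW.
  by apply: filterS e1 => w E; rewrite E addr0 Re_half.
exact: isK_unique a3 (isK_Re (isK_D0k hF)).
Qed.

Lemma D0k_rKM F K' H L' : D0k F K' -> D0k H L' ->
  rK (fun w => Re (F w) * Re (H w))
    (fun z => Re (F z.1.1) * Re (L' z) + Re (H z.1.1) * Re (K' z)).
Proof.
move=> hF hH; have [F1 [k1 [h1 eF ek]]] := D0k_Re hF.
have [H1 [l1 [h2 eH el]]] := D0k_Re hH.
have [[mF _] _ [mk _] _] := D0k_facts hF; have [[mH _] _ [ml _] _] := D0k_facts hH.
have mfst (g : config -> R) : mfunT g ->
    mfunT (fun z : CXM => g z.1.1).
  by move=> mg; apply: (mcompT mg); apply: mcompT.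
apply: (isK_ae (D0k_isKM h1 h2)).
- by apply: cmeasurable_real; exact: measurable_funM.
- by apply: cmeasurable_real; apply: measurable_funD; apply: measurable_funM => //;
    [exact: (mfst _ mF)|exact: (mfst _ mH)].
- by apply: filterS2 eF eH => w -> ->; rewrite rmorphM.
- apply: filterS2 (ae_and (ae_mN_config eF) (ae_mN_config eH)) (ae_and ek el).
  by move=> z [-> ->] [-> ->]; rewrite rmorphD !rmorphM.
Qed.

Variable Gam : (config -> R) -> (config -> R) -> config -> R.
Hypothesis cdc : carre_du_champ P DR formR Gam.

(** The identity 2 form(u h, u) - form(h, u^2) = E[h Gam u u] is written with gradients. By the
    Leibniz rule the terms containing the gradient of h cancel, and the integral of h |k|^2 is
    left. *)
Lemma Gam_D0k_weighted F K' H L' (b : config -> R) : D0k F K' -> D0k H L' ->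
  mfunT b -> (forall w, 0 <= b w) ->
  {ae P, forall w : config, ((b w)%:E = \int[cm w]_x
    (gsq (fun z => (Re (K' z))%:C%C) (w, x))%:E)%E} ->
  integrableT P b ->
  \int[P]_w (Re (H w) * (Gam (fun w => Re (F w)) (fun w => Re (F w)) w - b w)) = 0.
Proof.
move=> hF hH mb b0 bE bi; pose u w := Re (F w); pose h w := Re (H w).
pose k z := Re (K' z); pose l z := Re (L' z).
have ru : rK u k by exact: isK_Re (isK_D0k hF).
have rh : rK h l by exact: isK_Re (isK_D0k hH).
have [[mF _] [cF bF] [mk _] k2] := D0k_facts hF.
have [[mH _] [cH bH] _ _] := D0k_facts hH.
have ub w : `|u w| <= cF by apply: le_trans (Re_normc _) (bF w).
have hb w : `|h w| <= cH by apply: le_trans (Re_normc _) (bH w).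
have ruh := D0k_rKM hF hH; have ruu := D0k_rKM hF hF.
have sk := rK_sqint ru; have sl := rK_sqint rh.
have uL := bounded_Lfun P mF ub; have hL := bounded_Lfun P mH hb.
have mfst (g : config -> R) : mfunT g ->
    mfunT (fun z : CXM => g z.1.1).
  by move=> mg; apply: (mcompT mg); apply: mcompT.
have sul := sqintM (mfst _ mF) (fun z => ub z.1.1) sl.
have shk := sqintM (mfst _ mH) (fun z => hb z.1.1) sk.
have suk := sqintM (mfst _ mF) (fun z => ub z.1.1) sk.
have := cdc_eq cdc (rK_DR ru) (rK_DR ru) (rK_DR rh) uL uL hL.
have ruh' : rK (u \* h) _ := ruh; have ruu' : rK (u \* u) _ := ruu.
rewrite (formRE ruh' ru) (formRE rh ruu').
have E1 : ip mN (fun z => Re (F z.1.1) * Re (L' z) + Re (H z.1.1) * Re (K' z)) k =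
    ip mN (fun z => u z.1.1 * l z) k + ip mN (fun z => h z.1.1 * k z) k.
  rewrite -[X in X + _]mul1r -ip_lin//; congr ip; apply/funext => z; by rewrite mul1r.
have E2 : ip mN l (fun z => Re (F z.1.1) * Re (K' z) + Re (F z.1.1) * Re (K' z)) =
    2 * ip mN (fun z => u z.1.1 * l z) k.
  rewrite mulr_natl mulr2n ipC -[X in X + _]mul1r.
  have -> : ip mN (fun z => u z.1.1 * l z) k = ip mN (fun z => u z.1.1 * k z) l.
    by apply: eq_Rintegral => z _; rewrite mulrAC.
  rewrite -ip_lin//; congr ip; apply/funext => z; by rewrite mul1r.
rewrite E1 E2 => main.
have {}main : \int[P]_w (h w * Gam u u w) = ip mN (fun z => h z.1.1 * k z) k.
  rewrite -main; move: (ip _ _ _) (ip _ _ _) => x y; by field.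
have cK : cmeasurable (fun z => (k z)%:C%C) by exact: cmeasurable_real.
have K2 : (csq mN (fun z => (k z)%:C%C) < +oo)%E by rewrite csq_real; have [] := sk.
have c0 : 0 <= cH by apply: le_trans (hb point); exact: normr_ge0.
have hbi : integrableT P (fun w => h w * b w).
  apply: (integrable_le (h := fun w => cH * b w)); first exact: measurable_funM.
    by move=> w; rewrite !normrM ler_wpM2r// (ger0_norm c0).
  by have := integrableZl measurableT cH bi; apply: eq_integrable.
have cbi : integrableT P (fun w => cH * b w).
  by have := integrableZl measurableT cH bi; apply: eq_integrable.
have hkb : ip mN (fun z => h z.1.1 * k z) k = \int[P]_w (h w * b w).
  have ci : integrableT mN (fun z => cH * (k z * k z)).
    by have := integrableZl measurableT cH (sqint_ip sk sk); apply: eq_integrable.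
  have hi := sqint_ip shk sk.
  (* [weighted_slice] takes nonnegative weights, so h is shifted by its bound [cH], and the constant
     is subtracted afterwards. *)
  have A1 : (\int[mN]_z (h z.1.1 * k z * k z + cH * (k z * k z)) = \int[P]_w (h w * b w + cH * b w)).
    have -> : \int[P]_w (h w * b w + cH * b w) = \int[P]_w ((h w + cH) * b w).
      by apply: eq_Rintegral => w _; rewrite mulrDl.
    rewrite /Rintegral -(weighted_slice cK K2 mb b0 bE) //.
    - congr fine; apply: eq_integral => z _; rewrite nsq_real expr2 mulrDl; congr (_ + _)%:E.
      by rewrite mulrA.
    - exact: measurable_funD.
    - by move=> w; have := hb w; rewrite ler_norml => /andP[hw _]; lra.
  have A2 : (\int[mN]_z (cH * (k z * k z)) = \int[P]_w (cH * b w)).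
    rewrite /Rintegral -(weighted_slice (h := fun=> cH) cK K2 mb b0 bE) //.
    by congr fine; apply: eq_integral => z _; rewrite nsq_real expr2.
  move: A1; rewrite !RintegralD// A2 => /addIr <-.
  by [].
have Gi : integrableT P (Gam u u).
  by apply/Lfun1P; exact: (cdc_L1 cdc (rK_DR ru) (rK_DR ru)).
have hGi : integrableT P (fun w => h w * Gam u u w).
  have mG : mfunT (Gam u u) by apply/mEFinP; exact: measurable_int Gi.
  apply: (integrable_le (h := fun w => cH * Gam u u w)); first exact: measurable_funM.
    by move=> w; rewrite !normrM ler_wpM2r// (ger0_norm c0).
  by have := integrableZl measurableT cH Gi; apply: eq_integrable.
transitivity (\int[P]_w (h w * Gam u u w) - \int[P]_w (h w * b w)).
  rewrite -RintegralB//; apply: eq_Rintegral => w _; by rewrite mulrBr.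
by rewrite main hkb subrr.
Qed.

Lemma Gam_D0k F K' : D0k F K' -> {ae P, forall w : config,
  ((Gam (fun w => Re (F w)) (fun w => Re (F w)) w)%:E =
   \int[cm w]_x (gsq (fun z => (Re (K' z))%:C%C) (w, x))%:E)%E}.
Proof.
move=> hF; have ru : rK (fun w => Re (F w)) (fun z => Re (K' z)) by exact: isK_Re (isK_D0k hF).
have [mk k2] := rK_sqint ru.
have cK : cmeasurable (fun z => (Re (K' z))%:C%C) by exact: cmeasurable_real.
have K2 : (csq mN (fun z => (Re (K' z))%:C%C) < +oo)%E by rewrite csq_real.
have [b [mb b0 bE btot]] := slice_density cK K2.
have bE' : {ae P, forall w : config, ((b w)%:E = \int[cm w]_x
    (gsq (fun z => (Re (K' z))%:C%C) (w, x))%:E)%E} by apply: filterS bE => w [].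
have bi : integrableT P b.
  apply/integrableP; split; first exact/mEFinP.
  rewrite (eq_integral (fun w => (b w)%:E)) ?btot// => w _.
  by rewrite /= ger0_norm.
have Gi : integrableT P (Gam (fun w => Re (F w)) (fun w => Re (F w))).
  by apply/Lfun1P; exact: (cdc_L1 cdc (rK_DR ru) (rK_DR ru)).
have Di : integrableT P (fun w => Gam (fun w => Re (F w)) (fun w => Re (F w)) w - b w).
  by have := integrableB measurableT Gi bi.
have orth f : test_exponent f -> cintegral P (fun w => expN f w *
    (Gam (fun w => Re (F w)) (fun w => Re (F w)) w - b w)%:C%C) = 0.
  move=> tf.
  have D1 : exists L1, D0k (fun w => 1 * expN f w) L1.
    exists (kap (fun=> 1) (fun _ : 'I_1 => f)), 0%N, (fun=> 1), (fun=> f).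
    by split => //; apply/funext => w; rewrite /expsum big_ord1.
  (* Multiplication by -i brings the imaginary part of the exponential into the real part, the one
     that [Gam_D0k_weighted] tests. *)
  have D2 : exists L1, D0k (fun w => (0 -i* 1)%C * expN f w) L1.
    exists (kap (fun=> (0 -i* 1)%C) (fun _ : 'I_1 => f)), 0%N, (fun=> (0 -i* 1)%C), (fun=> f).
    by split => //; apply/funext => w; rewrite /expsum big_ord1.
  have [l1 h1] := D1; have [l2 h2] := D2.
  have e1 := Gam_D0k_weighted hF h1 mb b0 bE' bi.
  have e2 := Gam_D0k_weighted hF h2 mb b0 bE' bi.
  rewrite /cintegral.
  have -> : \int[P]_w Re (expN f w * (Gam (fun w => Re (F w)) (fun w => Re (F w)) w - b w)%:C%C) = 0.
    by rewrite -[RHS]e1; apply: eq_Rintegral => w _; rewrite ReM_real mul1r.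
  have -> : \int[P]_w Im (expN f w * (Gam (fun w => Re (F w)) (fun w => Re (F w)) w - b w)%:C%C) = 0.
    rewrite -[RHS]e2; apply: eq_Rintegral => w _; rewrite ImM_real; congr (_ * _).
    by case: (expN f w) => x y /=; ring.
  by [].
have := orthogonal_expN_ae0 Di orth.
by apply: filterS2 bE' => w <- /eqP; rewrite subr_eq0 => /eqP ->.
Qed.

(** Nonnegativity of Gamma at s u + v and - s u + v bounds the cross term almost surely; [s] is
    fixed beforehand, which keeps the exceptional set null. *)
Lemma Gam_expand (s : R) u v : 0 < s -> DR u -> DR v ->
  {ae P, forall w, `|Gam u u w - Gam (fun y => -1 * v y + u y) (fun y => -1 * v y + u y) w| <=
     s * Gam u u w + (1 + s^-1) * Gam v v w}.
Proof.
move=> s0 hu hv; have si : s^-1 * s = 1 by rewrite mulVf// gt_eqF.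
have lin a x y : DR x -> DR y -> DR (fun w => a * x w + y w).
  by move=> /DR_rK[k hk] /DR_rK[l hl]; exact: rK_DR (rK_lin a hk hl).
have quad a x y : DR x -> DR y -> {ae P, forall w,
    Gam (fun y' => a * x y' + y y') (fun y' => a * x y' + y y') w =
    a ^+ 2 * Gam x x w + 2 * a * Gam x y w + Gam y y w}.
  move=> hx hy; have hz := lin a _ _ hx hy.
  have b1 := cdc_bilin cdc a hx hy hz.
  have b2 := cdc_bilin cdc a hx hy hx; have b3 := cdc_bilin cdc a hx hy hy.
  have c1 := cdc_sym cdc hx hz; have c2 := cdc_sym cdc hy hz; have c3 := cdc_sym cdc hx hy.
  apply: filterS3 (ae_and b1 (ae_and b2 b3)) (ae_and c1 c2) c3 => w [-> [e2 e3]] [-> ->] c.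
  rewrite e2 e3 c; ring.
have q1 := quad (-1) v u hv hu.
have q2 := quad s u v hu hv; have q3 := quad (- s) u v hu hv.
have p2 := cdc_ge0 cdc (lin s _ _ hu hv); have p3 := cdc_ge0 cdc (lin (- s) _ _ hu hv).
have p0 := cdc_ge0 cdc hv; have c := cdc_sym cdc hu hv.
apply: filterS3 (ae_and q1 (ae_and q2 q3)) (ae_and p2 p3) (ae_and p0 c) => w [-> [e2 e3]].
rewrite e2 e3 => -[h2 h3] [h0 cE]; move: h2 h3 h0; rewrite cE.
move: (Gam u u w) (Gam v u w) (Gam v v w) => a b e h2 h3 h0.
have E2 : s * (s * a + 2 * b + s^-1 * e) = s ^+ 2 * a + 2 * s * b + e.
  by field; rewrite gt_eqF.
have E3 : s * (s * a - 2 * b + s^-1 * e) = (- s) ^+ 2 * a + 2 * (- s) * b + e.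
  by field; rewrite gt_eqF.
have h2' : 0 <= s * a + 2 * b + s^-1 * e by rewrite -(pmulr_rge0 _ s0) E2.
have h3' : 0 <= s * a - 2 * b + s^-1 * e by rewrite -(pmulr_rge0 _ s0) E3.
by rewrite ler_norml mulrDl mul1r; apply/andP; split; lra.
Qed.

Lemma slice_dist (K L : CXM -> R[i]) (b c : config -> R) :
  cmeasurable K -> (csq mN K < +oo)%E -> cmeasurable L -> (csq mN L < +oo)%E ->
  mfunT b -> mfunT c ->
  {ae P, forall w : config, (cm w).-integrable setT (fun x => (gsq K (w, x))%:E) /\
      ((b w)%:E = \int[cm w]_x (gsq K (w, x))%:E)%E} ->
  {ae P, forall w : config, (cm w).-integrable setT (fun x => (gsq L (w, x))%:E) /\
      ((c w)%:E = \int[cm w]_x (gsq L (w, x))%:E)%E} ->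
  (\int[P]_w `|b w - c w|%:E <= \int[PN]_z `|gsq K z - gsq L z|%:E)%E.
Proof.
move=> mK K2 mL L2 mb mc bE cE.
have [mGK _ _] := gsq_facts mK K2; have [mGL _ _] := gsq_facts mL L2.
have mD : mfunT (fun z => `|gsq K z - gsq L z|%:E).
  by apply/mEFinP; apply: mcompT => //; exact: measurable_funB.
have D0 z : (0 <= `|gsq K z - gsq L z|%:E)%E by rewrite lee_fin.
have [H [mH H0 HE]] := palm_slice mD D0.
have -> : (\int[PN]_z `|gsq K z - gsq L z|%:E = \int[P]_w H w)%E.
  by rewrite (palm.2 _ mD D0); exact: ae_ge0_integral_lower.
apply: ae_ge0_le_integral => //.
- by apply/mEFinP; apply: mcompT => //; exact: measurable_funB.
- apply: filterS3 bE cE HE => w [iK eK] [iL eL] <- _.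
  have iB : integrableT (cm w) (fun x => gsq K (w, x) - gsq L (w, x)).
    by have := integrableB measurableT iK iL.
  have -> : b w - c w = \int[cm w]_x (gsq K (w, x) - gsq L (w, x)).
    by rewrite RintegralB// /Rintegral -eK -eL.
  apply: (le_trans (_ : _ <= (\int[cm w]_x `|gsq K (w, x) - gsq L (w, x)|)%:E)%E).
    by rewrite lee_fin; exact: le_normr_Rintegral.
  rewrite /Rintegral fineK//; apply: integrable_fin_num => //.
  by have := integrable_norm iB; apply.
Qed.

Lemma Gam_energy v k : rK v k -> (\int[P]_w `|Gam v v w|%:E = (ip mN k k)%:E)%E.
Proof.
move=> rv; have hv := rK_DR rv.
have Gi : integrableT P (Gam v v) by apply/Lfun1P; exact: (cdc_L1 cdc hv hv).
have mG : mfunT (Gam v v) by apply/mEFinP; exact: measurable_int Gi.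
have -> : (\int[P]_w `|Gam v v w|%:E = \int[P]_w (Gam v v w)%:E)%E.
  apply: ae_eq_integral => //.
  - by apply/mEFinP; exact: mcompT.
  - exact/mEFinP.
  - by apply: filterS (cdc_ge0 cdc hv) => w h _; rewrite ger0_norm.
rewrite -(fineK (integrable_fin_num measurableT Gi)); congr EFin.
have := cdc_energy cdc hv; rewrite (formRE rv rv) => /(mulfI _) -> //.
Qed.

(** Approximation by u_n from D0: in L1 the error is at most s times the energy of u, plus a
    multiple depending on s of the energy of u - u_n, plus the distance of the candidates for u_n
    and u. One takes s small, then n large. *)
Lemma Gam_DR u k : rK u k -> {ae P, forall w : config,
  ((Gam u u w)%:E = \int[cm w]_x (gsq (fun z => (k z)%:C%C) (w, x))%:E)%E}.
Proof.
move=> ru; have [_ _ [F_ [K_ [hD _ hK]]]] := ru.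
pose k_ n z := Re (K_ n z); pose u_ n w := Re (F_ n w).
have ru_ n : rK (u_ n) (k_ n) by exact: isK_Re (isK_D0k (hD n)).
have sk := rK_sqint ru; have sk_ n := rK_sqint (ru_ n).
have ck : cmeasurable (fun z => (k z)%:C%C) by apply: cmeasurable_real; have [] := sk.
have ck_ n : cmeasurable (fun z => (k_ n z)%:C%C).
  by apply: cmeasurable_real; have [] := sk_ n.
have k2 : (csq mN (fun z => (k z)%:C%C) < +oo)%E by rewrite csq_real; have [] := sk.
have k2_ n : (csq mN (fun z => (k_ n z)%:C%C) < +oo)%E by rewrite csq_real; have [] := sk_ n.
have mKn n : cmeasurable (K_ n) by have [] := D0k_facts (hD n).
have hk : to0 (fun n => csq mN (fun z => (k_ n z)%:C%C - (k z)%:C%C)).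
  apply: to0_le hK => n; apply: integral_EFin_le.
  - by apply: measurable_nsq; exact: cmeasurableB.
  - by apply: measurable_nsq; exact: cmeasurableB.
  - by move=> z; exact: nsq_ge0.
  - move=> z; rewrite -rmorphB nsq_real.
    by apply: le_trans (Re_nsq _); rewrite ReB.
have hW := gsq_to0 ck_ k2_ ck k2 hk.
have [b [mb b0 bE btot]] := slice_density ck k2.
have hu := rK_DR ru.
have Gi : integrableT P (Gam u u) by apply/Lfun1P; exact: (cdc_L1 cdc hu hu).
have mG : mfunT (Gam u u) by apply/mEFinP; exact: measurable_int Gi.
have mD : mfunT (fun w => `|Gam u u w - b w|).
  by apply: mcompT => //; exact: measurable_funB.
pose A := ip mN k k; have A0 : 0 <= A by exact: ip_ge0.
have bound (s : R) n : 0 < s -> (\int[P]_w `|Gam u u w - b w|%:E <=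
    (s * A)%:E + ((1 + s^-1)%:E * csq mN (fun z => ((k_ n z)%:C%C - (k z)%:C%C)%R) +
    \int[PN]_z `|gsq (fun z => (k_ n z)%:C%C) z - gsq (fun z => (k z)%:C%C) z|%:E))%E.
  move=> s0; pose v w := u w - u_ n w.
  have rv : rK v (fun z => k z - k_ n z) by exact: rKB.
  have hv := rK_DR rv.
  have Gvi : integrableT P (Gam v v) by apply/Lfun1P; exact: (cdc_L1 cdc hv hv).
  have mGv : mfunT (Gam v v) by apply/mEFinP; exact: measurable_int Gvi.
  have [c [mc c0 cE _]] := slice_density (ck_ n) (k2_ n).
  have GE := Gam_D0k (hD n).
  have ex := Gam_expand s0 hu hv.
  have uE : (fun y => -1 * v y + u y) = u_ n.
    by apply/funext => y; rewrite /v mulN1r opprB subrK.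
  have si : 0 <= 1 + s^-1 by rewrite addr_ge0// invr_ge0 ltW.
  have mcb : mfunT (fun w => `|c w - b w|).
    by apply: mcompT => //; exact: measurable_funB.
  have mGa : mfunT (fun w => `|Gam u u w|) by exact: mcompT.
  have mGva : mfunT (fun w => `|Gam v v w|) by exact: mcompT.
  have ip_E : ((ip mN (fun z => k z - k_ n z) (fun z => k z - k_ n z))%:E =
      csq mN (fun z => ((k_ n z)%:C%C - (k z)%:C%C)%R))%E.
    rewrite ipE; last exact: rK_sqint rv.
    rewrite -csq_real csqB; congr csq; apply/funext => z; by rewrite rmorphB.
  apply: (@le_trans _ _ (\int[P]_w (s * `|Gam u u w| +
      ((1 + s^-1) * `|Gam v v w| + `|c w - b w|))%:E)%E).
    apply: ae_ge0_le_integral => //.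
    - exact/mEFinP.
    - by move=> w _; rewrite lee_fin !addr_ge0// mulr_ge0// ltW.
    - apply/mEFinP; apply: measurable_funD; first exact: measurable_funM.
      by apply: measurable_funD => //; exact: measurable_funM.
    - apply: filterS3 ex (ae_and GE cE) (ae_and (cdc_ge0 cdc hu) (cdc_ge0 cdc hv)) => w.
      rewrite uE => e1 [e2 [_ e3]] [g1 g2] _; rewrite lee_fin.
      have e4 : Gam (u_ n) (u_ n) w = c w by apply: EFin_inj; rewrite e2 e3.
      rewrite e4 in e1; rewrite (ger0_norm g1) (ger0_norm g2).
      have := ler_normD (Gam u u w - c w) (c w - b w); rewrite addrA subrK.
      by move: e1; lra.
  rewrite integral_EFinD; [|exact: measurable_funM| | |]; last 3 first.
  - by apply: measurable_funD => //; exact: measurable_funM.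
  - by move=> w; rewrite mulr_ge0// ltW.
  - by move=> w; rewrite addr_ge0// mulr_ge0.
  rewrite integral_EFinD; [|exact: measurable_funM|exact: mcb|by move=> w; rewrite mulr_ge0|by []].
  rewrite !integral_EFinZ//; last exact: ltW.
  rewrite (Gam_energy ru) (Gam_energy rv) ip_E -EFinM leeD2l// leeD2l//.
  exact: (slice_dist (ck_ n) (k2_ n) ck k2 mc mb cE bE).
have Di : integrableT P (fun w => `|Gam u u w - b w|).
  have bi : integrableT P b.
    apply/integrableP; split; first exact/mEFinP.
    rewrite (eq_integral (fun w => (b w)%:E)) ?btot// => w _.
    by rewrite /= ger0_norm.
  have := integrableB measurableT Gi bi => h.
  by have := integrable_norm h; apply.
have le0 : (\int[P]_w `|Gam u u w - b w|%:E <= 0)%E.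
  rewrite -(fineK (integrable_fin_num measurableT Di)) lee_fin.
  apply/ler_addgt0Pr => e e0; rewrite add0r -lee_fin.
  rewrite (fineK (integrable_fin_num measurableT Di)).
  pose s := e / (2 * (A + 1)).
  have A1 : 0 < A + 1 by rewrite ltr_wpDl.
  have s0 : 0 < s by rewrite divr_gt0// mulr_gt0.
  have sA : s * A <= e / 2.
    rewrite /s -mulrA ler_pM2l// mulrC ler_pdivrMr ?mulr_gt0//.
    by move: A1; lra.
  have si : 0 <= 1 + s^-1 by rewrite addr_ge0// invr_ge0 ltW.
  have [n0 hn0] := to0D (to0Z (fun n => csq_ge0 _ _) si hk) hW (divr_gt0 e0 (ltr0n _ 2)).
  apply: le_trans (bound s n0 s0) _.
  apply: (@le_trans _ _ ((e / 2)%:E + (e / 2)%:E)%E).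
    by apply: leeD; [rewrite lee_fin|exact/ltW/hn0].
  by rewrite -EFinD lee_fin; lra.
have mDe : mfunT (fun w => `|Gam u u w - b w|%:E) by exact/mEFinP.
have D0 w : (0 <= `|Gam u u w - b w|%:E)%E by rewrite lee_fin.
apply: filterS2 (integral_eq0_ae mDe D0 le0) bE => w [/eqP].
by rewrite normr_eq0 subr_eq0 => /eqP -> [_ ->].
Qed.

Lemma gsq_ReIm (K : CXM -> R[i]) : cmeasurable K -> (csq mN K < +oo)%E ->
  {ae PN, forall z, gsq K z = gsq (fun z => (Re (K z))%:C%C) z +
    gsq (fun z => (Im (K z))%:C%C) z}.
Proof.
move=> mK K2; have [m1 m2] := mK.
have cR : cmeasurable (fun z => (Re (K z))%:C%C) by exact: cmeasurable_real.
have cI : cmeasurable (fun z => (Im (K z))%:C%C) by exact: cmeasurable_real.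
have le (p : R[i] -> R) : cmeasurable (fun z => (p (K z))%:C%C) ->
    (forall z, p z ^+ 2 <= nsq z) -> (csq mN (fun z => (p (K z))%:C%C) < +oo)%E.
  move=> mp h; apply: le_lt_trans K2; apply: integral_EFin_le.
  - exact: measurable_nsq.
  - exact: measurable_nsq.
  - by move=> z; exact: nsq_ge0.
  - by move=> z; rewrite nsq_real.
have [_ g1 _] := gsq_facts mK K2.
have [_ g2 _] := gsq_facts cR (le _ cR (@Re_nsq R)).
have [_ g3 _] := gsq_facts cI (le _ cI (@Im_nsq R)).
apply: filterS3 g1 g2 g3 => z e1 e2 e3; apply: EFin_inj; rewrite EFinD e1 e2 e3.
have mz (p : CXM -> R) : mfunT p ->
    mfunT (fun r => p (z, r)).
  by move=> mp; exact: (mcompT mp (measurable_pair1 _)).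
rewrite -integral_EFinD.
- by apply: eq_integral => r _; rewrite !nsq_real.
- by apply: (mz (fun y => nsq ((Re (K y))%:C%C))); exact: measurable_nsq.
- by apply: (mz (fun y => nsq ((Im (K y))%:C%C))); exact: measurable_nsq.
- by move=> r; exact: nsq_ge0.
- by move=> r; exact: nsq_ge0.
Qed.

Lemma GammaCE F K : isK F K -> {ae P, forall w : config,
  ((GammaC Gam F w)%:E = \int[cm w]_x (gsq K (w, x))%:E)%E}.
Proof.
move=> h; have rR : rK (fun w => Re (F w)) (fun z => Re (K z)) by exact: isK_Re h.
have rI : rK (fun w => Im (F w)) (fun z => Im (K z)) by exact: (isK_Im h).
have [_ mK _] := h; have K2 := isK_csq h.
have hs := palm_ae_N (gsq_ReIm mK K2).
apply: filterS3 (Gam_DR rR) (Gam_DR rI) hs => w e1 e2 e3.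
rewrite /GammaC EFinD e1 e2.
have [mG _ _] := gsq_facts mK K2.
have facts u k : rK u k -> mfunT (fun x => gsq (fun z => (k z)%:C%C) (w, x)).
  move=> r; have [_ mk _] := r; have [m _ _] := gsq_facts mk (isK_csq r).
  exact: (mcompT m (measurable_pair1 _)).
rewrite -integral_EFinD.
- apply: ae_eq_integral => //.
  + by apply/mEFinP; apply: measurable_funD; [exact: facts rR|exact: facts rI].
  + by apply/mEFinP; exact: (mcompT mG (measurable_pair1 _)).
  + by apply: filterS e3 => x -> _.
- exact: facts rR.
- exact: facts rI.
- by move=> x; exact: gsq_ge0.
- by move=> x; exact: gsq_ge0.
Qed.

End CarreDuChamp.

End UpStructure.

Theorem theorem3p1 (R : realType) (dX dM : measure_display)
    (X : measurableType dX) (M : measurableType dM)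
    (nu : {sigma_finite_measure set X -> \bar R}) (rho : probability M R)
    (d : set (X -> R)) (gam : (X -> R) -> (X -> R) -> X -> R)
    (flat : (X -> R) -> X * M -> R)
    (P : probability (config X R) R) (Phat : probability (marks M) R)
    (alive : nat -> set (config X R)) (atom : nat -> config X R -> X)
    (xi : X -> R)
    (singletons : forall x : X, measurable [set x])
    (diffuse : forall x : X, nu [set x] = 0%E)
    (bottom : local_dirichlet_structure nu d gam)
    (separable : form_separable nu d (bform nu gam))
    (gamma_one : gamma_loc nu d gam (cst 1) (cst 0))
    (flat_gradient : gradient nu rho d gam flat)
    (law_N : poisson_law nu P)
    (atoms_N : atom_enumeration P alive atom)
    (law_marks : product_law rho Phat)
    (xi_measurable : measurable_fun setT xi)
    (xi_gt0 : forall x, 0 < xi x)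
    (xi_L2 : ('N[P]_2%:E[(fun w : config X R => \int[w]_x (xi x)%:E)] < +oo)%E) :
  (forall F, domD nu d gam P F ->
    [/\ underD nu d gam P xi (creation F),
        exists K, is_flatU nu rho d gam flat P xi (creation F) K,
        exists S, is_sharp nu rho d gam flat P Phat alive atom xi F S &
        forall K, is_flatU nu rho d gam flat P xi (creation F) K ->
          L20 nu rho P K /\
          (forall S, is_sharp nu rho d gam flat P Phat alive atom xi F S <->
                     is_marked_integral nu rho P Phat alive atom K S)]) /\
  [/\ continuous_on (domD nu d gam P)
        (fun F H => H = creation F)
        (normD nu d gam P) (normU nu d gam P xi),
      continuous_on [set H | exists2 F, domD nu d gam P F & H = creation F]
        (is_flatU nu rho d gam flat P xi)
        (normU nu d gam P xi) (normPN nu rho P) &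
      continuous_on [set K | exists2 F, domD nu d gam P F &
                               is_flatU nu rho d gam flat P xi (creation F) K]
        (is_marked_integral nu rho P Phat alive atom)
        (normPN nu rho P) (cnorm2 (P \x Phat)%E)] /\
  (forall Gam, carre_du_champ P (DR nu d gam P) (formR nu d gam P) Gam ->
   forall F, domD nu d gam P F ->
     (exists g g', is_gammaU nu d gam P xi (creation F) g /\
                   versionN nu P g g') /\
     (forall S g g',
        is_sharp nu rho d gam flat P Phat alive atom xi F S ->
        is_gammaU nu d gam P xi (creation F) g -> versionN nu P g g' ->
        {ae P, forall w : config X R,
          (GammaC Gam F w)%:E = (\int[Phat]_r ((normc (S (w, r))) ^+ 2)%:E)%E /\
          (GammaC Gam F w)%:E = (\int[w]_x (g' (w, x))%:E)%E})).
Proof.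
have [PN palm] := palm_measure_exists law_N atoms_N.
(* This equivalence supplies the function [K0] on which each clause of the statement is read. *)
have isKP F : domD nu d gam P F <-> exists K', isK nu rho d gam flat P PN F K'.
  exact: (domD_isK bottom flat_gradient palm).
split; [|split; [split|]].
- move=> F /isKP[K0 hK]; have [_ mK0 _] := hK.
  have v := creation_versionM nu rho P mK0.
  have fP K := is_flatUP bottom flat_gradient singletons diffuse atoms_N palm
    xi_measurable xi_gt0 xi_L2 K hK.
  have sP S := is_sharpP bottom flat_gradient singletons diffuse atoms_N law_marks palm
    xi_measurable xi_gt0 xi_L2 S hK.
  split.
  + exact: (isK_underD bottom flat_gradient singletons diffuse atoms_N palm
      xi_measurable xi_gt0 xi_L2 hK).
  + by eexists; apply/fP; exact: v.
  + have [S hS] := isK_mintf bottom flat_gradient singletons diffuse atoms_N law_marks palm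
      xi_measurable xi_gt0 xi_L2 hK.
    by exists S; apply/sP.
  + move=> K /fP vK; split.
      exact: (isK_L20 bottom flat_gradient singletons diffuse atoms_N palm
        xi_measurable xi_gt0 xi_L2 hK vK).
    move=> S; apply: (iff_trans (sP S)); apply: iff_sym.
    exact: (is_marked_integralP Phat singletons diffuse atoms_N palm S vK).
- exact: (creation_continuous bottom flat_gradient singletons diffuse atoms_N palm
    xi_measurable xi_gt0 xi_L2).
- exact: (flat_continuous bottom flat_gradient singletons diffuse atoms_N palm
    xi_measurable xi_gt0 xi_L2).
- exact: (marked_integral_continuous bottom flat_gradient singletons diffuse atoms_N law_marks
    palm xi_measurable xi_gt0 xi_L2).
- move=> Gam cdc F /isKP[K0 hK]; split.
    have [g [hg vg]] := gammaU_exists bottom flat_gradient singletons diffuse atoms_N palm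
      xi_measurable xi_gt0 xi_L2 hK.
    by exists g, (gsq rho K0).
  move=> S g g' hS hg vg.
  have e1 := GammaCE bottom flat_gradient singletons diffuse atoms_N palm
    xi_measurable xi_gt0 xi_L2 cdc hK.
  have hm := (is_sharpP bottom flat_gradient singletons diffuse atoms_N law_marks palm
    xi_measurable xi_gt0 xi_L2 S hK).1 hS.
  have e2 := mintf_slice atoms_N law_marks palm hm.
  have e3 := palm_ae_N atoms_N palm (gammaU_version bottom flat_gradient singletons diffuse
    atoms_N palm xi_measurable xi_gt0 xi_L2 hK hg vg).
  have [mg _] := vg; have [_ mK0 _] := hK.
  have [mG _ _] := gsq_facts mK0 (isK_csq bottom flat_gradient singletons diffuse atoms_N palm
    xi_measurable xi_gt0 xi_L2 hK).
  apply: filterS3 e1 e2 e3 => w E1 E2 E3; split.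
    by rewrite E1 -E2; apply: eq_integral => r _; rewrite nsqE.
  rewrite E1; apply: ae_eq_integral => //.
  + by apply/mEFinP; exact: (mcompT mG (measurable_pair1 _)).
  + by apply/mEFinP; exact: (mcompT mg (measurable_pair1 _)).
  + by apply: filterS E3 => x -> _.
Qed.
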